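(* Let $M$ be a closed connected smooth Riemannian manifold. Then every nontrivial free homotopy class $\alpha$ of loops in $M$ is symplectically essential.
   Context: $S^1=\mathbb{R}/\mathbb{Z}$. $T^*M$ carries the canonical symplectic form $\Omega_{can}=-d\theta$, $\theta$ the Liouville form (locally $\sum y_idx^i$), and $M$ is identified with the zero section. A free homotopy class is nontrivial if it is not the class of constant loops. For a domain $W\subset T^*M$ containing $M$ and $H\in C_0^\infty(S^1\times W)$, the Hamiltonian vector field is given by $dH_t=\iota(X_{H_t})\Omega_{can}$. For a free homotopy class $\beta$ of loops in $W$, $\mathcal{P}(H;\beta)$ denotes the set of $z\in C^\infty(S^1,W)$ with $\dot z(t)=X_{H_t}(z(t))$ for all $t$ that represent $\beta$. The relative Biran-Polterovich-Salamon capacity is (with $\inf\emptyset=\infty$) $$c_{BPS}(W,M;\beta)=\inf\Big\{c>0:\ \mathcal{P}(H;\beta)\ne\emptyset\ \text{ for all } H\in C_0^\infty(S^1\times W)\text{ with }\sup_{S^1\times M}H\le-c\Big\}.$$ A nontrivial free homotopy class $\alpha$ of loops in $M$ is called symplectically essential if there exists a domain $W\subset T^*M$ containing $M$ such that $c_{BPS}(W,M;\iota_\#\alpha)$ is finite, where $\iota_\#$ is the map between free homotopy classes induced by the inclusion $\iota:M\hookrightarrow W$. *)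

(* Defs.v *)
From HB Require Import structures.
From mathcomp Require Import all_boot all_order all_algebra.
From mathcomp Require Import all_classical all_reals all_analysis.

Set Implicit Arguments.
Unset Strict Implicit.
Unset Printing Implicit Defensive.

Import Order.TTheory GRing.Theory Num.Theory.
Import numFieldNormedType.Exports.

Local Open Scope classical_set_scope.
Local Open Scope ring_scope.

(* [derive_along [:: v1; ...; vk] f] is the iterated directional derivative
   D_v1 (... (D_vk f)).  *)
Definition derive_along (R : realType) (V W : normedModType R)
    (vs : seq V) (f : V -> W) : V -> W :=
  foldr (fun v g => fun x => 'D_v g x) f vs.

(* C^oo on an open set [U] of a finite-dimensional space: every iterated
   directional derivative exists and is Frechet differentiable at every point
   of [U].  Only meant for open [U]. *)
Definition smooth_on (R : realType) (V W : normedModType R)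
    (U : set V) (f : V -> W) : Prop :=
  forall (vs : seq V) (x : V), U x -> differentiable (derive_along vs f) x.

(* A smooth n-manifold without boundary, with a (not necessarily maximal)
   smooth atlas indexed by [chart]; [coord c] is a homeomorphism of [cdom c]
   onto an open subset of R^n with inverse [param c]. *)
Record smoothManifold (R : realType) (n : nat) := SmoothManifold {
  carrier :> topologicalType;
  chart : Type;
  cdom : chart -> set carrier;
  coord : chart -> carrier -> 'rV[R]_n;
  param : chart -> 'rV[R]_n -> carrier;
  manifold_hausdorff : hausdorff_space carrier;
  manifold_second_countable : @second_countable carrier;
  cdom_open : forall c, open (cdom c);
  cdom_cover : forall x, exists c, cdom c x;
  coord_open : forall c, open (coord c @` cdom c);
  coordK : forall c x, cdom c x -> param c (coord c x) = x;
  coord_continuous : forall c, {within cdom c, continuous (coord c)};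
  param_continuous :
    forall c, {within coord c @` cdom c, continuous (param c)};
  transition_smooth : forall c c',
    smooth_on (coord c @` (cdom c `&` cdom c')) (coord c' \o param c)
}.

Arguments chart {R n} s : rename.
Arguments cdom {R n s} c _ : rename.
Arguments coord {R n s} c _ : rename.
Arguments param {R n s} c _ : rename.

Section Metric.
Context {R : realType} {n : nat} (M : smoothManifold R n).

(* A Riemannian metric, given by its local expressions: [metric c q] is the
   inner product at the point with coordinates [q] in the chart [c]. *)
Record riemannianMetric := RiemannianMetric {
  metric : chart M -> 'rV[R]_n -> 'rV[R]_n -> 'rV[R]_n -> R;
  metric_linear : forall c x, cdom c x -> forall (a : R) (u v w : 'rV[R]_n),
    metric c (coord c x) (a *: u + v) w =
      a * metric c (coord c x) u w + metric c (coord c x) v w;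
  metric_sym : forall c x, cdom c x -> forall u v : 'rV[R]_n,
    metric c (coord c x) u v = metric c (coord c x) v u;
  metric_pos : forall c x, cdom c x -> forall u : 'rV[R]_n,
    u != 0 -> 0 < metric c (coord c x) u u;
  metric_smooth : forall c (u v : 'rV[R]_n),
    smooth_on (coord c @` cdom c) (fun q => metric c q u v);
  metric_transition : forall c c' x, cdom c x -> cdom c' x ->
    forall u v : 'rV[R]_n,
    metric c (coord c x) u v =
      metric c' (coord c' x)
        ('D_u (coord c' \o param c) (coord c x))
        ('D_v (coord c' \o param c) (coord c x))
}.

End Metric.

Definition pairing (R : realType) (n : nat) (y v : 'rV[R]_n) : R :=
  \sum_(i < n) y 0 i * v 0 i.

Section Cotangent.
Context {R : realType} {n : nat} (M : smoothManifold R n).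

(* A point of T^*M: a base point x together with a covector at x, i.e. a family
   of components, one for each chart around x, related by the transposed
   differentials of the transition maps.  The components in the charts that do
   not contain x are normalized to 0. *)
Record cotangent := Cotangent {
  base : M;
  comp : chart M -> 'rV[R]_n;
  comp_transition : forall c c', cdom c base -> cdom c' base ->
    forall v : 'rV[R]_n,
    pairing (comp c) v =
      pairing (comp c') ('D_v (coord c' \o param c) (coord c base));
  comp_outside : forall c, ~ cdom c base -> comp c = 0
}.

Lemma zero_section_transition (x : M) (c c' : chart M) :
  cdom c x -> cdom c' x -> forall v : 'rV[R]_n,
  pairing 0 v = pairing 0 ('D_v (coord c' \o param c) (coord c x)).
Proof.
by move=> _ _ v; rewrite /pairing; under eq_bigr do rewrite mxE mul0r;
under [RHS]eq_bigr do rewrite mxE mul0r.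
Qed.

Definition zero_section (x : M) : cotangent :=
  @Cotangent x (fun=> 0) (@zero_section_transition x) (fun c _ => erefl).

HB.instance Definition _ := gen_eqMixin cotangent.
HB.instance Definition _ := gen_choiceMixin cotangent.

(* The canonical chart (x, y) = (x_1, ..., x_n, y_1, ..., y_n) of T^*M over the
   chart [c] of M, with domain [[set z | cdom c (base z)]]. *)
Definition cocoord (c : chart M) (z : cotangent) : 'rV[R]_n * 'rV[R]_n :=
  (coord c (base z), comp z c).

Lemma derive_comp (U V W : normedModType R) (f : U -> V) (g : V -> W) (x v : U) :
  differentiable f x -> differentiable g (f x) ->
  'D_v (g \o f) x = 'D_('D_v f x) g (f x).
Proof.
move=> df dg; rewrite deriveE; last exact: differentiable_comp.
by rewrite diff_comp// (deriveE _ df) (deriveE _ dg).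
Qed.

Lemma cocoord_inj (c : chart M) (z z' : cotangent) :
  cdom c (base z) -> cdom c (base z') -> cocoord c z = cocoord c z' -> z = z'.
Proof.
move=> cz cz' /(@pair_equal_spec _ _ _ _ _ _)[exx eyy].
have exb : base z = base z' by rewrite -(coordK cz) -(coordK cz') exx.
case: z z' cz cz' {exx} eyy exb => [x f fT fO] [x' f' fT' fO'] /= cz cz' eyy.
move=> exb; move: exb fT' fO' cz' => <- fT' fO' cz'.
have eff' : f = f'.
  apply/funext => c'; have [c'x|c'x] := pselect (cdom c' x); last first.
    by rewrite fO// fO'.
  apply/rowP => i; pose e : 'rV[R]_n := delta_mx 0 i.
  have pE (y : 'rV[R]_n) : pairing y e = y 0 i.
    rewrite /pairing (bigD1 i)//= mxE !eqxx mulr1 big1 ?addr0// => j ji.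
    by rewrite mxE eqxx (negPf ji) mulr0.
  by rewrite -!pE (fT c' c c'x cz) (fT' c' c c'x cz) eyy.
move: fT fO; rewrite eff' => fT fO.
by congr Cotangent; exact: Prop_irrelevance.
Qed.

Lemma cocoord_onto (c : chart M) :
  cocoord c @` [set z | cdom c (base z)] = (coord c @` cdom c) `*` setT.
Proof.
apply/seteqP; split=> [_ [z cz <-]|[p y] [/= [x cx xp] _]].
  by split=> //=; exists (base z).
rewrite -{}xp {p}.
have dT (c1 c2 : chart M) : cdom c1 x -> cdom c2 x ->
    differentiable (coord c2 \o param c1) (coord c1 x).
  move=> c1x c2x; apply: (@transition_smooth _ _ M c1 c2 [::]).
  by exists x.
pose J c' := jacobian (coord c \o param c') (coord c' x).
have pairingE (u v : 'rV[R]_n) : pairing u v = (u *m v^T) 0 0.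
  by rewrite mxE; apply: eq_bigr => i _; rewrite mxE.
pose f c' : 'rV[R]_n := if pselect (cdom c' x) then y *m (J c')^T else 0.
have fE c' : cdom c' x -> forall v,
    pairing (f c') v = pairing y ('D_v (coord c \o param c') (coord c' x)).
  move=> c'x v; rewrite /f; case: pselect => //= _.
  by rewrite deriveEjacobian; [rewrite !pairingE trmx_mul mulmxA|exact: dT].
have fO c' : ~ cdom c' x -> f c' = 0 by rewrite /f; case: pselect.
clearbody f; clear J.
have nearT (c1 c2 : chart M) : cdom c1 x -> cdom c2 x ->
    \forall q \near coord c1 x,
      (coord c \o param c1) q = ((coord c \o param c2) \o (coord c2 \o param c1)) q.
  move=> c1x c2x.
  have o1 := @coord_open _ _ M c1.
  have i1 : (coord c1 @` cdom c1) (coord c1 x) by exists x.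
  have := @param_continuous _ _ M c1.
  rewrite continuous_open_subspace// => /(_ _ (mem_set i1)).
  move=> /(_ (cdom c2)); rewrite coordK// => pc.
  have {pc} : nbhs (coord c1 x) (param c1 @^-1` cdom c2).
    by apply: pc; apply: open_nbhs_nbhs; split=> //; exact: cdom_open.
  by apply: filterS => q /= c2q; rewrite (coordK c2q).
have fT c1 c2 : cdom c1 x -> cdom c2 x -> forall v,
    pairing (f c1) v = pairing (f c2) ('D_v (coord c2 \o param c1) (coord c1 x)).
  move=> c1x c2x v; apply: (etrans (fE _ c1x v)).
  apply: etrans (esym (fE _ c2x _)); apply: (congr1 (pairing y)).
  have d12 := dT _ _ c1x c2x; have d2 := dT _ _ c2x cx.
  rewrite (near_eq_derive _ (nearT _ _ c1x c2x)).
  have e2 : (coord c2 \o param c1) (coord c1 x) = coord c2 x by rewrite /= coordK.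
  by rewrite derive_comp// e2.
exists (Cotangent fT fO) => //; rewrite /cocoord/=; congr pair.
have nid : \forall q \near coord c x, (coord c \o param c) q = id q.
  have : nbhs (coord c x) (coord c @` cdom c).
    by apply: open_nbhs_nbhs; split; [exact: coord_open|exists x].
  by apply: filterS => _ [x' cx' <-]; rewrite /= coordK.
apply/rowP => i; pose e : 'rV[R]_n := delta_mx 0 i.
have pE (u : 'rV[R]_n) : pairing u e = u 0 i.
  rewrite /pairing (bigD1 i)//= mxE !eqxx mulr1 big1 ?addr0// => j ji.
  by rewrite mxE eqxx (negPf ji) mulr0.
by rewrite -!pE (fE _ cx) (near_eq_derive _ nid) derive_id.
Qed.

(* Inverse of [cocoord c]; unspecified outside the image. *)
Definition coparam (c : chart M) (p : 'rV[R]_n * 'rV[R]_n) : cotangent :=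
  xget (zero_section (param c p.1))
    [set z | cdom c (base z) /\ cocoord c z = p].

(* The manifold topology of T^*M: a set is open iff its image under every
   canonical chart is open in R^n x R^n. *)
Definition cotangent_open (A : set cotangent) : Prop :=
  forall c : chart M, open (cocoord c @` (A `&` [set z | cdom c (base z)])).

Lemma cotangent_openT : cotangent_open setT.
Proof.
move=> c; rewrite setTI cocoord_onto [X in open X](_ : _ =
  fst @^-1` (coord c @` cdom c)); last by apply/seteqP; split=> p // [].
by apply: open_comp (@coord_open _ _ M c) => p _; exact: cvg_fst.
Qed.

Lemma cotangent_openI : setI_closed cotangent_open.
Proof.
move=> A B oA oB c; rewrite [X in open X](_ : _ =
  cocoord c @` (A `&` [set z | cdom c (base z)]) `&`
  cocoord c @` (B `&` [set z | cdom c (base z)])); first exact: openI.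
apply/seteqP; split=> [_ [z [[Az Bz] cz] <-]|_ [[z [Az cz] <-] [z' [Bz' cz']]]].
  by split; exists z.
by move=> /(cocoord_inj cz' cz) zz'; exists z => //; split=> //; split=> //; rewrite -zz'.
Qed.

Lemma cotangent_open_bigU (I : Type) (f : I -> set cotangent) :
  (forall i, cotangent_open (f i)) -> cotangent_open (\bigcup_i f i).
Proof.
move=> of_ c; rewrite setI_bigcupl image_bigcup.
by apply: bigcup_open => i _; exact: of_.
Qed.

HB.instance Definition _ := @isOpenTopological.Build cotangent cotangent_open
  cotangent_openT cotangent_openI cotangent_open_bigU.

End Cotangent.

Section FreeHomotopy.
Context {R : realType} {T : topologicalType}.

(* Maps out of S^1 = R/Z are 1-periodic maps out of R. *)
Definition loop_in (A : set T) (g : R -> T) : Prop :=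
  [/\ continuous g, forall t, g (t + 1) = g t & forall t, A (g t)].

Definition free_homotopic (A : set T) (g0 g1 : R -> T) : Prop :=
  exists F : R * R -> T,
  [/\ {within `[0, 1]%classic `*` setT, continuous F},
      forall s t, s \in `[0, 1] -> F (s, t + 1) = F (s, t),
      forall s t, s \in `[0, 1] -> A (F (s, t)),
      forall t, F (0, t) = g0 t
    & forall t, F (1, t) = g1 t].

Definition free_class (A : set T) (g : R -> T) : set (R -> T) :=
  [set g' | free_homotopic A g g'].

Definition is_free_class (A : set T) (alpha : set (R -> T)) : Prop :=
  exists2 g, loop_in A g & alpha = free_class A g.

Definition nontrivial_class (A : set T) (alpha : set (R -> T)) : Prop :=
  forall x, A x -> alpha <> free_class A (fun=> x).

End FreeHomotopy.

(* Differential forms on R^n x R^n, as functions of the point (first argument)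
   and of tangent vectors. *)
Section CanonicalForm.
Context {R : realType} {n : nat}.
Local Notation V := ('rV[R]_n * 'rV[R]_n)%type.

Definition liouville_form (p v : V) : R := pairing p.2 v.1.

Definition exterior_derivative (theta : V -> V -> R) (p u v : V) : R :=
  'D_u (fun q => theta q v) p - 'D_v (fun q => theta q u) p.

Definition Omega_can (p u v : V) : R :=
  - exterior_derivative liouville_form p u v.

End CanonicalForm.

Section Hamiltonian.
Context {R : realType} {n : nat} {M : smoothManifold R n}.
Local Notation V := ('rV[R]_n * 'rV[R]_n)%type.

Definition domain_containing_zero_section (W : set (cotangent M)) : Prop :=
  [/\ open W, connected W & range (@zero_section R n M) `<=` W].

(* [H \in C_0^oo(S^1 x W)], extended by 0 to the whole of T^*M. *)
Definition compactly_supported_hamiltonian (W : set (cotangent M))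
    (H : R -> cotangent M -> R) : Prop :=
  [/\ forall t z, H (t + 1) z = H t z,
      forall c : chart M,
        smooth_on [set p : R * V |
                    (cocoord c @` (W `&` [set z | cdom c (base z)])) p.2]
                  (fun p : R * V => H p.1 (coparam c p.2))
    & exists K : set (cotangent M),
        [/\ compact K, K `<=` W & forall t z, ~ K z -> H t z = 0]].

(* In the canonical chart over [c], X is the value at z of the Hamiltonian
   vector field of [h], i.e. dh = iota(X) Omega_can at z; such an X is unique
   since Omega_can is nondegenerate. *)
Definition is_hamiltonian_vector (h : cotangent M -> R) (c : chart M)
    (z : cotangent M) (X : V) : Prop :=
  forall v : V,
    'D_v (h \o coparam c) (cocoord c z) = Omega_can (cocoord c z) X v.

Definition smooth_loop (z : R -> cotangent M) : Prop :=
  [/\ continuous z, forall t, z (t + 1) = z t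
    & forall c : chart M,
        smooth_on [set t | cdom c (base (z t))] (fun t => cocoord c (z t))].

(* The set P(H; beta) of 1-periodic orbits of H in W representing beta. *)
Definition periodic_orbits (W : set (cotangent M)) (H : R -> cotangent M -> R)
    (beta : set (R -> cotangent M)) : set (R -> cotangent M) :=
  [set z | [/\ smooth_loop z,
               forall t, W (z t),
               forall (t : R) (c : chart M), cdom c (base (z t)) ->
                 is_hamiltonian_vector (H t) c (z t)
                   ('D_1 (fun s => cocoord c (z s)) t)
             & beta z]].

Definition c_BPS (W : set (cotangent M)) (beta : set (R -> cotangent M)) :
    \bar R :=
  ereal_inf [set c%:E | c in [set c : R | 0 < c /\
    forall H, compactly_supported_hamiltonian W H ->
      (ereal_sup (range (fun p : R * M => (H p.1 (zero_section p.2))%:E))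
         <= (- c)%:E)%E ->
      periodic_orbits W H beta !=set0]].

Definition induced_class (W : set (cotangent M)) (alpha : set (R -> M)) :
    set (R -> cotangent M) :=
  [set z | exists2 g, alpha g & free_homotopic W (@zero_section R n M \o g) z].

Definition symplectically_essential (alpha : set (R -> M)) : Prop :=
  exists W : set (cotangent M), domain_containing_zero_section W /\
    c_BPS W (induced_class W alpha) \is a fin_num.

End Hamiltonian.

(* Main.v *)
Require Import Defs.
From HB Require Import structures.
From mathcomp Require Import all_boot all_order all_algebra all_fingroup.
From mathcomp Require Import all_classical all_reals all_analysis.
From mathcomp Require Import ring lra zify.

Set Implicit Arguments.
Unset Strict Implicit.
Unset Printing Implicit Defensive.

Import Order.TTheory GRing.Theory Num.Theory.
Import numFieldNormedType.Exports.

Local Open Scope classical_set_scope.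
Local Open Scope ring_scope.
Import Defs.

(* The periodic orbit is found by a finite-dimensional minimax. M is embedded in R^D by
   a map e admitting dual vector fields w_j (v = sum_j de_j(v) w_j), so that (x, p) |-> p.de parametrizes the
   covectors redundantly. W is the set of covectors of "height" < 2. A Hamiltonian H supported in W is modified
   outside its support, by functions of the height and of the part of p invisible to e(M), into a function K(t, x, p)
   growing linearly in p with a slope larger than the length of a loop of class alpha.
   For a subdivision of S^1 into N intervals the action is
     A(x, p) = sum_i (p_i.(e(x_(i+1)) - e(x_i)) - K(i/N, x_i, p_i)/N).
   Over a fixed polygon of class alpha, A tends to -oo with |p|, whereas A(x, 0) >= c because H <= -c on M. If a descent
   step frozen below a level close to c had no almost fixed point, its iterates would move the disc {x} x [-r, r]^(ND)
   rel boundary off {p = 0}, contradicting Brouwer. Letting r be huge makes the almost critical points true ones up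
   to 1/N^2, with action at least c - 1; since p.dK/dp - K is less than c - 2 outside the support of H, they meet
   this support.
   An ultralimit N -> oo is Lipschitz and satisfies the Hamilton equations of K; the height is conserved
   outside the support of H, hence the limit stays in W, where K and H have the same flow. *)

(** * Functions of class C^k *)

(** The constant c must serve all H at once, so it may depend only on the class. The slope of K is a
    = D l + 1, where l is a Lipschitz constant of one loop of the class and D comes from pairing sup
    norms. Outside the support of H, p.dK/dp - K is at most 7a: 6a from the function of the height,
    a from the term that confines p. The minimax loses at most 2, one unit because the momenta are
    only almost 0 and one for the almost fixed point; c = 7a + 3 leaves a value above 7a. The
    momenta are clamped to a box, which creates spurious fixed points on its boundary. There p.dA/dp
    is about -r|dA/dp|, while A - p.dA/dp is a sum of terms (p.dK/dp - K)/N bounded above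
    independently of r. As A is at least c - 1, a large r forces dA/dp to be small. Hence the order
    of the choices: N, then r, then the descent step, then the accuracy of the fixed point. The
    redundant part of p has no equation of motion of its own; the confining term makes it O(1/N), so
    that it vanishes in the limit. K is only C^2, so the orbit becomes smooth only as a solution for
    H. *)

Section Ck.
Context {R : realType}.

Definition clinear (V : normedModType R) (l : V -> R) : Prop :=
  (forall a u v, l (a *: u + v) = a * l u + l v) /\ forall v, differentiable l v.

(** Coordinates without a fixed model space, so that R, row vectors and all their products are
    handled alike. *)
Definition findim (V : normedModType R) : Prop :=
  exists d (b : 'I_d -> V) (l : 'I_d -> V -> R),
    (forall i, clinear (l i)) /\ forall v, v = \sum_i l i v *: b i.

(** Finite regularity is unavoidable: the bump functions and the added terms of the Hamiltonian are
    built from powers of a positive part. Scalar values and directional derivatives keep the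
    recursion inside a single type. *)
Fixpoint Ck (V : normedModType R) k (U : set V) (f : V -> R) : Prop :=
  if k is k'.+1 then
    (forall x, U x -> differentiable f x) /\ forall v, Ck k' U ('D_v f)
  else forall x, U x -> {for x, continuous f}.

(** Testing against continuous functionals reduces vector-valued maps to the scalar calculus. *)
Definition vCk (V W : normedModType R) k (U : set V) (f : V -> W) : Prop :=
  forall l : W -> R, clinear l -> Ck k U (l \o f).

Lemma clinear0 (V : normedModType R) (l : V -> R) : clinear l -> l 0 = 0.
Proof. by move=> [h _]; have := h (-1) 0 0; rewrite scaler0 addr0; lra. Qed.

Lemma clinearD (V : normedModType R) (l : V -> R) u v : clinear l -> l (u + v) = l u + l v.
Proof. by move=> [h _]; have := h 1 u v; rewrite scale1r mul1r. Qed.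

Lemma clinearZ (V : normedModType R) (l : V -> R) a v : clinear l -> l (a *: v) = a * l v.
Proof. by move=> h; have := h.1 a v 0; rewrite (clinear0 h) !addr0. Qed.

Lemma clinear_sum (V : normedModType R) (l : V -> R) d (F : 'I_d -> V) :
  clinear l -> l (\sum_i F i) = \sum_i l (F i).
Proof.
move=> h; apply: (big_morph l) => [u v|]; [exact: clinearD|exact: clinear0].
Qed.

Lemma derive_clinear (V : normedModType R) (l : V -> R) x v :
  clinear l -> 'D_v l x = l v.
Proof.
move=> h; rewrite /derive.
have -> : (fun t : R => t^-1 *: ((l \o shift x) (t *: v) - l x)) =
          (fun t : R => if t == 0 then 0 else l v).
  apply/funext => t /=; rewrite (h.1 t v x) addrK /GRing.scale /=.
  case: eqVneq => [->|t0]; first by rewrite invr0 mul0r.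
  by rewrite mulrA mulVf ?mul1r.
apply: cvg_lim => //; apply: cvg_near_cst.
near=> t; suff /negPf -> : t != 0 by [].
by near: t; exact: nbhs_dnbhs_neq.
Unshelve. all: by end_near. Qed.

Lemma Ck_cont (V : normedModType R) k (U : set V) (f : V -> R) x :
  Ck k U f -> U x -> {for x, continuous f}.
Proof.
case: k => [h /h//|k [h _] /h]; exact: differentiable_continuous.
Qed.

Lemma CkW (V : normedModType R) k (U : set V) (f : V -> R) :
  Ck k.+1 U f -> Ck k U f.
Proof.
elim: k f => [|k IH] f h; first by move=> x; exact: (Ck_cont h).
by split=> [x|v]; [exact: h.1|exact/IH/h.2].
Qed.

Lemma Ck_le (V : normedModType R) k k' (U : set V) (f : V -> R) :
  (k <= k')%N -> Ck k' U f -> Ck k U f.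
Proof.
move=> /subnK <-; elim: (k' - k)%N => // d IH; rewrite addSn => /CkW; exact: IH.
Qed.

Lemma Ck_sub (V : normedModType R) k (U U' : set V) (f : V -> R) :
  U' `<=` U -> Ck k U f -> Ck k U' f.
Proof.
elim: k f => [|k IH] f s /= h; first by move=> x /s /h.
by split=> [x /s|v]; [exact: h.1|exact: (IH _ s (h.2 v))].
Qed.

Lemma Ck_local (V : normedModType R) k (U : set V) (f : V -> R) :
  (forall x, U x -> exists2 U', U' x & Ck k U' f) -> Ck k U f.
Proof.
elim: k f => [|k IH] f h /=.
  by move=> x /h[U' U'x]; exact.
split=> [x /h[U' U'x hf]|v]; first exact: hf.1.
by apply: IH => x /h[U' U'x hf]; exists U' => //; exact: hf.2.
Qed.

Lemma near_open (V : normedModType R) (U : set V) (P : V -> Prop) x :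
  open U -> U x -> (forall y, U y -> P y) -> \forall y \near x, P y.
Proof.
by move=> oU Ux h; have : nbhs x U by [exact: open_nbhs_nbhs]; exact: filterS.
Qed.

Lemma differentiable_near (V W : normedModType R) (f g : V -> W) (x : V) :
  (\forall y \near x, f y = g y) -> differentiable f x -> differentiable g x.
Proof.
move=> fg /diff_locallyP[cf /eqaddoP ef].
have fgx := nbhs_singleton fg.
have fg0 : \forall y \near (0:V), f (y + x) = g (y + x).
  by move: fg; rewrite (near_shift 0 x)/= subr0.
have E : g \o shift x = cst (g x) + 'd f x +o_ (0:V) id.
  apply/eqaddoP => e e0; apply: filterS2 fg0 (ef e e0) => y /= fgy.
  by rewrite /= !fctE /= fgy fgx.
by apply/diff_locallyP; rewrite (diff_unique cf E).
Qed.

Lemma Ck_eq (V : normedModType R) k (U : set V) (f g : V -> R) :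
  open U -> (forall x, U x -> f x = g x) -> Ck k U f -> Ck k U g.
Proof.
move=> oU; elim: k f g => [|k IH] f g fg /= h.
  move=> x Ux; have fgx : \forall y \near x, f y = g y by exact: (near_open oU Ux).
  have hx : f @ x --> f x by exact: h.
  rewrite /prop_for /continuous_at -(fg x Ux).
  by apply: cvg_trans hx; apply: near_eq_cvg; apply: filterS fgx => y ->.
split=> [x Ux|v].
  apply: differentiable_near (h.1 _ Ux); exact: (near_open oU Ux).
apply: (IH _ _ _ (h.2 v)) => x Ux; apply: near_eq_derive.
exact: (near_open oU Ux).
Qed.

Lemma Ck_cst (V : normedModType R) k (U : set V) (a : R) : Ck k U (cst a).
Proof.
elim: k a => [|k IH] a /=; first by move=> x _; exact: cst_continuous.
split=> [x _|v]; first exact: differentiable_cst.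
have -> : 'D_v (cst a : V -> R) = cst 0 by apply/funext => x; rewrite derive_cst.
exact: IH.
Qed.

Lemma Ck_lin (V : normedModType R) k (U : set V) (l : V -> R) : clinear l -> Ck k U l.
Proof.
move=> h; case: k => [|k] /=.
  by move=> x _; apply: differentiable_continuous; exact: h.2.
split=> [x _|v]; first exact: h.2.
have -> : 'D_v l = cst (l v) by apply/funext => x; rewrite derive_clinear.
exact: Ck_cst.
Qed.

Lemma CkD (V : normedModType R) k (U : set V) (f g : V -> R) :
  open U -> Ck k U f -> Ck k U g -> Ck k U (fun x => f x + g x).
Proof.
move=> oU; elim: k f g => [|k IH] f g /= hf hg.
  by move=> x Ux; apply: cvgD; [exact: hf|exact: hg].
split=> [x Ux|v]; first by apply: differentiableD; [exact: hf.1|exact: hg.1].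
apply: (Ck_eq oU _ (IH _ _ (hf.2 v) (hg.2 v))) => x Ux.
by rewrite deriveD //; apply: diff_derivable; [exact: hf.1|exact: hg.1].
Qed.

Lemma CkM (V : normedModType R) k (U : set V) (f g : V -> R) :
  open U -> Ck k U f -> Ck k U g -> Ck k U (fun x => f x * g x).
Proof.
move=> oU; elim: k f g => [|k IH] f g /= hf hg.
  by move=> x Ux; apply: cvgM; [exact: hf|exact: hg].
split=> [x Ux|v]; first by apply: differentiableM; [exact: hf.1|exact: hg.1].
have h := CkD oU (IH _ _ (CkW hf) (hg.2 v)) (IH _ _ (CkW hg) (hf.2 v)).
apply: (Ck_eq oU _ h) => x Ux.
by rewrite deriveM //; apply: diff_derivable; [exact: hf.1|exact: hg.1].
Qed.

Lemma CkZ (V : normedModType R) k (U : set V) (a : R) (f : V -> R) :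
  open U -> Ck k U f -> Ck k U (fun x => a * f x).
Proof. by move=> oU; apply: CkM => //; exact: Ck_cst. Qed.

Lemma CkN (V : normedModType R) k (U : set V) (f : V -> R) :
  open U -> Ck k U f -> Ck k U (fun x => - f x).
Proof.
move=> oU /(CkZ (-1) oU); apply: Ck_eq => // x _; by rewrite mulN1r.
Qed.

Lemma CkB (V : normedModType R) k (U : set V) (f g : V -> R) :
  open U -> Ck k U f -> Ck k U g -> Ck k U (fun x => f x - g x).
Proof. by move=> oU hf hg; apply: CkD => //; exact: CkN. Qed.

Lemma CkX (V : normedModType R) k (U : set V) (f : V -> R) d :
  open U -> Ck k U f -> Ck k U (fun x => f x ^+ d).
Proof.
move=> oU hf; elim: d => [|d IH]; first exact: Ck_cst.
under eq_fun do rewrite exprS.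
exact: CkM.
Qed.

Lemma Ck_sum (V : normedModType R) k (U : set V) (I : Type) (r : seq I) (P : pred I)
    (F : I -> V -> R) :
  open U -> (forall i, Ck k U (F i)) -> Ck k U (fun x => \sum_(i <- r | P i) F i x).
Proof.
move=> oU hF; elim: r => [|i r IH].
  by under eq_fun do rewrite big_nil; exact: Ck_cst.
under eq_fun do rewrite big_cons.
by case: (P i) => //; exact: CkD.
Qed.

Lemma derive_coord (V W : normedModType R) (f : V -> W) (l : W -> R) x v :
  clinear l -> differentiable f x -> 'D_v (l \o f) x = l ('D_v f x).
Proof.
by move=> hl df; rewrite derive_comp//; [rewrite derive_clinear|exact: hl.2].
Qed.

Lemma vCk_diff (V W : normedModType R) k (U : set V) (f : V -> W) x :
  findim W -> vCk k.+1 U f -> U x -> differentiable f x.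
Proof.
move=> [d [b [l [hl E]]]] hf Ux.
have -> : f = \sum_i (fun y => (l i \o f) y *: b i).
  by apply/funext => y; rewrite fct_sumE {1}(E (f y)).
apply: differentiable_sum => i; apply: differentiableZl.
exact: (hf _ (hl i)).1.
Qed.

(** Induction on [k] through the chain rule in coordinates: the derivative is a sum of products in
    which one factor is a derivative of a coordinate of [f] and the other one is again a composition
    with [f]. *)
Lemma Ck_comp (V W : normedModType R) k (U : set V) (U' : set W) (f : V -> W) (g : W -> R) :
  findim W -> open U -> open U' -> (forall x, U x -> U' (f x)) ->
  vCk k U f -> Ck k U' g -> Ck k U (g \o f).
Proof.
move=> fW oU oU' fU; have [d [b [l [hl E]]]] := fW.
elim: k g => [|k IH] g hf hg.
  move=> x Ux; apply: (@continuous_comp _ _ _ f g); last exact: (hg _ (fU _ Ux)).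
  have -> : f = fun y => \sum_i (l i \o f) y *: b i.
    by apply/funext => y; rewrite {1}(E (f y)).
  apply: cvg_big => [|i _]; first exact: add_continuous.
  by apply: cvgZr_tmp; exact: (hf _ (hl i)).
split=> [x Ux|v].
  apply: differentiable_comp; first exact: (vCk_diff fW hf).
  exact: hg.1 _ (fU _ Ux).
have hf' : vCk k U f by move=> l' hl'; exact/CkW/hf.
have h : Ck k U (fun x => \sum_(i < d) 'D_v (l i \o f) x * ('D_(b i) g \o f) x).
  apply: Ck_sum => // i; apply: CkM => //; first exact: (hf _ (hl i)).2.
  by apply: IH => //; exact: hg.2.
apply: (Ck_eq oU _ h) => x Ux.
have df : differentiable f x by exact: (vCk_diff fW hf).
have dg : differentiable g (f x) by exact: hg.1 _ (fU _ Ux).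
rewrite derive_comp// (E ('D_v f x)) deriveE// linear_sum; apply: eq_bigr => i _.
by rewrite linearZ /= -deriveE// derive_coord.
Qed.

Lemma vCk_comp (V W X : normedModType R) k (U : set V) (U' : set W) (f : V -> W) (g : W -> X) :
  findim W -> open U -> open U' -> (forall x, U x -> U' (f x)) ->
  vCk k U f -> vCk k U' g -> vCk k U (g \o f).
Proof.
by move=> fW oU oU' fU hf hg l hl; exact: (Ck_comp fW oU oU' fU hf (hg _ hl)).
Qed.

Lemma clinear_id : clinear (id : R -> R).
Proof. by split=> // v; exact: differentiable_id. Qed.

Lemma findim_R : findim R.
Proof.
exists 1%N, (fun=> 1), (fun=> id); split; first by move=> _; exact: clinear_id.
by move=> v; rewrite big_ord1 /GRing.scale /= mulr1.
Qed.

Lemma vCk_R (V : normedModType R) k (U : set V) (f : V -> R) :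
  open U -> Ck k U f -> vCk k U f.
Proof.
move=> oU hf l hl; apply: (Ck_eq oU _ (CkZ (l 1) oU hf)) => x _ /=.
by rewrite mulrC -(clinearZ (f x) (1 : R) hl) /GRing.scale /= mulr1.
Qed.

Lemma clinear_coord n (i : 'I_n) : clinear (fun v : 'rV[R]_n => v 0 i).
Proof.
split=> [a u v|v]; first by rewrite !mxE.
exact: differentiable_coord.
Qed.

Lemma row_sum_delta n (v : 'rV[R]_n) : v = \sum_i v 0 i *: delta_mx 0 i.
Proof. exact: row_sum_delta. Qed.

Lemma findim_rV n : findim 'rV[R]_n.
Proof.
exists n, (fun i => delta_mx 0 i), (fun i (v : 'rV[R]_n) => v 0 i); split.
  by move=> i; exact: clinear_coord.
exact: row_sum_delta.
Qed.

Lemma vCk_rV (V : normedModType R) k (U : set V) n (f : V -> 'rV[R]_n) :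
  open U -> (forall i, Ck k U (fun x => f x 0 i)) -> vCk k U f.
Proof.
move=> oU hf l hl.
have h : Ck k U (fun x => \sum_(i < n) f x 0 i * l (delta_mx 0 i)).
  by apply: Ck_sum => // i; apply: CkM => //; exact: Ck_cst.
apply: (Ck_eq oU _ h) => x _ /=.
rewrite [in RHS](row_sum_delta (f x)) (clinear_sum _ hl); apply: eq_bigr => i _.
by rewrite clinearZ.
Qed.

Lemma clinear_comp (V W : normedModType R) (L : V -> W) (l : W -> R) :
  linear L -> (forall v, differentiable L v) -> clinear l -> clinear (l \o L).
Proof.
move=> hL dL hl; split=> [a u v|v] /=; first by rewrite hL hl.1.
by apply: differentiable_comp => //; exact: hl.2.
Qed.

Lemma vCk_lin (V W : normedModType R) k (U : set V) (L : V -> W) :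
  linear L -> (forall v, differentiable L v) -> vCk k U L.
Proof. by move=> hL dL l hl; apply: Ck_lin; exact: clinear_comp. Qed.

Lemma vCk_id (V : normedModType R) k (U : set V) : vCk k U (@id V).
Proof. by apply: vCk_lin => // v; exact: differentiable_id. Qed.

Lemma vCk_cst (V W : normedModType R) k (U : set V) (w : W) : vCk k U (cst w).
Proof. by move=> l hl; exact: (Ck_cst _ _ (l w)). Qed.

Lemma differentiable_fst (V W : normedModType R) (p : V * W) : differentiable fst p.
Proof.
by apply: linear_differentiable => x; exact: cvg_fst.
Qed.

Lemma differentiable_snd (V W : normedModType R) (p : V * W) : differentiable snd p.
Proof.
by apply: linear_differentiable => x; exact: cvg_snd.
Qed.

Lemma vCk_fst (V W : normedModType R) k (U : set (V * W)) : vCk k U fst.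
Proof. by apply: vCk_lin => // p; exact: differentiable_fst. Qed.

Lemma vCk_snd (V W : normedModType R) k (U : set (V * W)) : vCk k U snd.
Proof. by apply: vCk_lin => // p; exact: differentiable_snd. Qed.

Lemma clinear_pairl (V W : normedModType R) (l : V * W -> R) :
  clinear l -> clinear (fun v => l (v, 0)).
Proof.
move=> hl; apply: (@clinear_comp _ _ (fun v => (v, 0)) l) => //.
by move=> a u v; apply: injective_projections; rewrite /= ?scaler0 ?addr0.
Qed.

Lemma clinear_pairr (V W : normedModType R) (l : V * W -> R) :
  clinear l -> clinear (fun v => l (0, v)).
Proof.
move=> hl; apply: (@clinear_comp _ _ (fun v => (0, v)) l) => //.
by move=> a u v; apply: injective_projections; rewrite /= ?scaler0 ?addr0.
Qed.

Lemma clinear_pair (V W : normedModType R) (l : V * W -> R) v w :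
  clinear l -> l (v, w) = l (v, 0) + l (0, w).
Proof.
by move=> hl; rewrite -clinearD//; congr l; congr pair; rewrite ?addr0 ?add0r.
Qed.

Lemma vCk_pair (V W X : normedModType R) k (U : set V) (f : V -> W) (g : V -> X) :
  open U -> vCk k U f -> vCk k U g -> vCk k U (fun x => (f x, g x)).
Proof.
move=> oU hf hg l hl.
have h := CkD oU (hf _ (clinear_pairl hl)) (hg _ (clinear_pairr hl)).
by apply: (Ck_eq oU _ h) => x _ /=; rewrite [in RHS](clinear_pair _ _ hl).
Qed.

Lemma findim_pair (V W : normedModType R) : findim V -> findim W -> findim (V * W)%type.
Proof.
move=> [d [b [l [hl E]]]] [d' [b' [l' [hl' E']]]].
exists (d + d')%N,
  (fun i => match fintype.split i with inl j => (b j, 0) | inr j => (0, b' j) end),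
  (fun i => match fintype.split i with inl j => l j \o fst | inr j => l' j \o snd end).
split=> [i|[v w]].
  case: (fintype.split i) => j; apply: clinear_comp => //.
  - by move=> p; exact: differentiable_fst.
  - by move=> p; exact: differentiable_snd.
rewrite big_split_ord /=.
under eq_bigr do rewrite -[lshift _ _]/(unsplit (inl _)) unsplitK /=.
under [X in _ + X]eq_bigr do rewrite -[rshift _ _]/(unsplit (inr _)) unsplitK /=.
have -> : \sum_(i < d) l i v *: (b i, (0 : W)) = (v, 0).
  rewrite {2}(E v); apply: injective_projections => /=.
    by rewrite raddf_sum.
  by rewrite raddf_sum big1// => i _ /=; rewrite scaler0.
have -> : \sum_(i < d') l' i w *: ((0 : V), b' i) = (0, w).
  rewrite {2}(E' w); apply: injective_projections => /=.
    by rewrite raddf_sum big1// => i _ /=; rewrite scaler0.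
  by rewrite raddf_sum.
by congr pair; rewrite /= ?addr0 ?add0r.
Qed.

End Ck.

(** * Local Lipschitz and Taylor estimates, symmetry of second derivatives *)

Section LocalCalculus.
Context {R : realType}.

Lemma clinear_bnd (V : normedModType R) (l : V -> R) :
  clinear l -> exists C, 0 <= C /\ forall v, `|l v| <= C * `|v|.
Proof.
move=> hl; have cl : {for 0, continuous l}.
  by apply: differentiable_continuous; exact: hl.2.
have /cvgrPdist_lt/(_ _ ltr01) : l @ (0 : V) --> l 0 by exact: cl.
rewrite (clinear0 hl) => /nbhs_norm0P[/= d d0 hd].
exists (2 / d); split; first by apply: divr_ge0 => //; exact: ltW.
move=> v; have [->|v0] := eqVneq v 0.
  by rewrite (clinear0 hl) !normr0 mulr0.
have nv : 0 < `|v| by rewrite normr_gt0.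
pose a := d / 2 / `|v|; have a0 : 0 < a by rewrite !divr_gt0.
have := hd (a *: v); rewrite /= normrZ gtr0_norm// /a divfK ?gt_eqF//.
have d2 : d / 2 < d by lra.
move=> /(_ d2); rewrite sub0r normrN (clinearZ _ _ hl) normrM gtr0_norm//.
rewrite mulrAC ltr_pdivrMr// mul1r => h.
have : `|l v| < `|v| * (2 / d).
  have -> : `|l v| = d / 2 * `|l v| * (2 / d) by field; rewrite gt_eqF.
  by rewrite ltr_pM2r// divr_gt0.
by move=> /ltW; rewrite mulrC.
Qed.

Lemma is_derive_line (V W : normedModType R) (f : V -> W) (z v : V) (s : R) :
  differentiable f (z + s *: v) ->
  is_derive s 1 (fun t : R => f (z + t *: v)) ('D_v f (z + s *: v)).
Proof.
move=> df; have E : (fun h : R => h^-1 *: (((fun t : R => f (z + t *: v)) \o shift s) (h *: 1) - f (z + s *: v))) =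
   (fun h : R => h^-1 *: ((f \o shift (z + s *: v)) (h *: v) - f (z + s *: v))).
  apply/funext => h /=; congr (_ *: (f _ - _)).
  by rewrite [h *: (1 : R)]mulr1 scalerDl addrCA.
have d := @diff_derivable _ _ _ _ _ v df.
split; first by rewrite /derivable E.
by rewrite /derive E.
Qed.

Lemma derive_dirZ (V : normedModType R) (g : V -> R) (a : R) w y :
  differentiable g y -> 'D_(a *: w) g y = a * 'D_w g y.
Proof. by move=> dg; rewrite !deriveE// linearZ. Qed.

Lemma derive_dirR (g : R -> R) (v : R) y : differentiable g y -> 'D_v g y = v * 'D_1 g y.
Proof. by move=> /(derive_dirZ v (1 : R)) <-; rewrite [v *: (1 : R)]mulr1. Qed.

Lemma MVT01 (f df : R -> R) :
  (forall s : R, 0 <= s <= 1 -> is_derive s 1 f (df s)) ->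
  exists2 c, 0 <= c <= 1 & f 1 - f 0 = df c.
Proof.
move=> h; have [] := @MVT_segment R f df 0 1 ler01.
- by move=> x; rewrite in_itv /= => /andP[x0 x1]; apply: h; rewrite !ltW.
- apply: derivable_within_continuous => x; rewrite in_itv /= => hx.
  by have [] := h x hx.
- by move=> c; rewrite in_itv /= => hc ->; exists c; rewrite // subr0 mulr1.
Qed.

Lemma ball_segment (V : normedModType R) (z0 z z' : V) r (s : R) :
  `|z - z0| < r -> `|z' - z0| < r -> 0 <= s <= 1 -> `|z + s *: (z' - z) - z0| < r.
Proof.
move=> h h' /andP[s0 s1].
have -> : z + s *: (z' - z) - z0 = (1 - s) *: (z - z0) + s *: (z' - z0).
  have -> : z' - z = (z' - z0) - (z - z0) by rewrite opprB addrA subrK.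
  by rewrite scalerBl scale1r scalerBr addrAC addrA addrAC.
apply: le_lt_trans (ler_normD _ _) _; rewrite !normrZ !ger0_norm ?subr_ge0//.
have [->|s0'] := eqVneq s 0; first by rewrite subr0 mul1r mul0r addr0.
have : s * `|z' - z0| < s * r by rewrite ltr_pM2l// lt_def s0' s0.
have : (1 - s) * `|z - z0| <= (1 - s) * r by rewrite ler_wpM2l ?subr_ge0// ltW.
lra.
Qed.

Lemma open_ball_sub (V : normedModType R) (U : set V) z0 : open U -> U z0 ->
  exists2 r, 0 < r & forall z, `|z - z0| < r -> U z.
Proof.
move=> oU Uz; have /nbhs_normP[/= r r0 h] : nbhs z0 U by exact: open_nbhs_nbhs.
by exists r => // z zr; apply: h; rewrite /= distrC.
Qed.

Lemma cont_bnd (V : normedModType R) (f : V -> R) z0 : {for z0, continuous f} ->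
  exists2 r, 0 < r & forall z, `|z - z0| < r -> `|f z| <= `|f z0| + 1.
Proof.
move=> cf; have /cvgrPdist_lt/(_ _ ltr01) : f @ z0 --> f z0 by exact: cf.
move=> /nbhs_normP[/= r r0 h]; exists r => // z zr.
have := h z; rewrite /= distrC => /(_ zr) /ltW h1.
have -> : f z = f z0 - (f z0 - f z) by ring.
by apply: le_trans (ler_normB _ _) _; rewrite lerD2l.
Qed.

Lemma derive_coords (V : normedModType R) d (b : 'I_d -> V) (l : 'I_d -> V -> R) (f : V -> R) x v :
  v = \sum_i l i v *: b i -> differentiable f x -> 'D_v f x = \sum_i l i v * 'D_(b i) f x.
Proof.
move=> E df; rewrite {1}E deriveE// linear_sum; apply: eq_bigr => i _.
by rewrite linearZ /= -deriveE.
Qed.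

Lemma near_fam (V : normedModType R) d (P : 'I_d -> V -> Prop) z0 :
  (forall i, exists2 r : R, 0 < r & forall z, `|z - z0| < r -> P i z) ->
  exists2 r : R, 0 < r & forall z, `|z - z0| < r -> forall i, P i z.
Proof.
elim: d P => [|d IH] P h; first by exists 1 => // z _ [].
have [r r0 hr] := IH (fun i => P (lift ord0 i)) (fun i => h _).
have [r' r'0 hr'] := h ord0.
exists (Num.min r r'); first by rewrite lt_min r0.
move=> z; rewrite lt_min => /andP[zr zr'] i.
by case: (unliftP ord0 i) => [j|] ->; [exact: hr|exact: hr'].
Qed.

Lemma derive_bnd (V : normedModType R) (U : set V) (f : V -> R) z0 :
  findim V -> open U -> Ck 1 U f -> U z0 ->
  exists r C, [/\ 0 < r, 0 <= C & forall z, `|z - z0| < r -> U z /\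
    forall v, `|'D_v f z| <= C * `|v|].
Proof.
move=> [d [b [l [hl E]]]] oU hf Uz.
have [r0 r00 hr0] := open_ball_sub oU Uz.
have h i : exists2 r, 0 < r & forall z, `|z - z0| < r -> `|'D_(b i) f z| <= `|'D_(b i) f z0| + 1.
  by apply: cont_bnd; exact: (hf.2 (b i) z0 Uz).
have [r1 r10 hr1] := near_fam h.
have [B hB] := choice (fun i => clinear_bnd (hl i)).
exists (Num.min r0 r1), (\sum_i B i * (`|'D_(b i) f z0| + 1)); split.
- by rewrite lt_min r00.
- by apply: sumr_ge0 => i _; rewrite mulr_ge0 ?addr_ge0 ?(hB i).1.
move=> z; rewrite lt_min => /andP[/hr0 Uz' /hr1 hz]; split=> // v.
rewrite (derive_coords (E v)); last exact: hf.1.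
apply: le_trans (ler_norm_sum _ _ _) _; rewrite mulr_suml; apply: ler_sum => i _.
rewrite normrM [leRHS]mulrAC; apply: ler_pM => //; exact: (hB i).2.
Qed.

Lemma C1_local (V : normedModType R) (U : set V) (f : V -> R) z0 :
  findim V -> open U -> Ck 1 U f -> U z0 ->
  exists r C, [/\ 0 < r, 0 <= C & forall z z', `|z - z0| < r -> `|z' - z0| < r ->
    `|f z' - f z| <= C * `|z' - z|].
Proof.
move=> fV oU hf Uz; have [r [C [r0 C0 h]]] := derive_bnd fV oU hf Uz.
exists r, C; split=> // z z' hz hz'.
have [s s01|c c01] := @MVT01 (fun s => f (z + s *: (z' - z))) (fun s => 'D_(z' - z) f (z + s *: (z' - z))).
  apply: is_derive_line; apply: hf.1; apply: (h _ _).1; exact: ball_segment.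
rewrite scale1r scale0r addr0 [z + _]addrC subrK => ->.
by apply: (h _ _).2; exact: ball_segment.
Qed.

Lemma derive_lip (V : normedModType R) (U : set V) (f : V -> R) z0 :
  findim V -> open U -> Ck 2 U f -> U z0 ->
  exists r C, [/\ 0 < r, 0 <= C & forall z z' v, `|z - z0| < r -> `|z' - z0| < r ->
    U z /\ `|'D_v f z' - 'D_v f z| <= C * `|v| * `|z' - z|].
Proof.
move=> fV oU hf Uz; have [d [b [l [hl E]]]] := fV.
have [r0 r00 hr0] := open_ball_sub oU Uz.
have h i := C1_local fV oU (hf.2 (b i)) Uz.
have [rr hrr] := choice h.
have [CC hCC] := choice hrr.
have [r1 r10 hr1] : exists2 r : R, 0 < r & forall z, `|z - z0| < r -> forall i, `|z - z0| < rr i.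
  by apply: near_fam => i; exists (rr i) => //; case: (hCC i).
have [B hB] := choice (fun i => clinear_bnd (hl i)).
exists (Num.min r0 r1), (\sum_i B i * CC i); split.
- by rewrite lt_min r00.
- by apply: sumr_ge0 => i _; rewrite mulr_ge0 ?(hB i).1//; case: (hCC i).
move=> z z' v; rewrite !lt_min => /andP[/hr0 Uz1 /hr1 hz] /andP[/hr0 Uz2 /hr1 hz']; split=> //.
rewrite !(derive_coords (E v)); [|exact: hf.1..].
rewrite -sumrB; apply: le_trans (ler_norm_sum _ _ _) _; rewrite !mulr_suml; apply: ler_sum => i _.
rewrite -mulrBr normrM.
have [_ C0 hC] := hCC i; have := hC _ _ (hz i) (hz' i).
have h1 := (hB i).2 v => h2.
(* [ring] only proves equalities, so the last inequality is closed as an equality; the same device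
   recurs below. *)
apply: le_trans (ler_pM _ _ h1 h2) _ => //; rewrite le_eqVlt; apply/orP; left; apply/eqP; ring.
Qed.

Lemma C2_local (V : normedModType R) (U : set V) (f : V -> R) z0 :
  findim V -> open U -> Ck 2 U f -> U z0 ->
  exists r C, [/\ 0 < r, 0 <= C & forall z z', `|z - z0| < r -> `|z' - z0| < r ->
    `|f z' - f z - 'D_(z' - z) f z| <= C * `|z' - z| ^+ 2].
Proof.
move=> fV oU hf Uz; have [r [C [r0 C0 h]]] := derive_lip fV oU hf Uz.
exists r, C; split=> // z z' hz hz'; set v := z' - z.
have hz0 s : 0 <= s <= 1 -> `|z + s *: v - z0| < r by exact: ball_segment.
have [s s01|c c01] := @MVT01 (fun s => f (z + s *: v)) (fun s => 'D_v f (z + s *: v)).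
  by apply: is_derive_line; apply: hf.1; apply: (h _ _ v _ hz).1; exact: hz0.
rewrite scale1r scale0r addr0 {1}/v [z + _]addrC subrK => ->.
apply: le_trans (h _ _ _ hz (hz0 _ c01)).2 _.
case/andP: c01 => c0 c1; rewrite [z + _]addrC addrK normrZ ger0_norm// expr2 mulrA.
have -> : C * `|v| * c * `|v| = C * (`|v| * `|v|) * c by ring.
by rewrite ler_piMr// !mulr_ge0.
Qed.

Lemma smooth_on_Ck (V : normedModType R) (U : set V) (f : V -> R) k :
  smooth_on U f -> Ck k U f.
Proof.
elim: k f => [|k IH] f h.
  by move=> x Ux; apply: differentiable_continuous; exact: (h [::]).
split=> [x|v]; first exact: (h [::]).
apply: IH => vs x Ux; have := h (rcons vs v) x Ux.
by rewrite /derive_along foldr_rcons.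
Qed.

Lemma Ck_smooth_on (V W : normedModType R) (U : set V) (f : V -> W) :
  open U -> findim W -> (forall k, vCk k U f) -> smooth_on U f.
Proof.
move=> oU fW h vs; suff : forall k, vCk k U (derive_along vs f).
  by move=> hk x Ux; apply: (vCk_diff fW (hk 1%N)).
elim/last_ind: vs f h => [//|vs v IH] f h k.
rewrite /derive_along foldr_rcons; apply: IH => {k} k l hl.
have := (h k.+1 l hl).2 v; apply: Ck_eq => // x Ux.
by rewrite derive_coord//; exact: (vCk_diff fW (h 1%N)).
Qed.

(** The mean value theorem is applied in the direction [v] to the difference of [f] along [u], and
    then in the direction [u] to the derivative thus obtained. *)
Lemma second_difference (V : normedModType R) (U : set V) (f : V -> R) x u v (s : R) :
  open U -> Ck 2 U f -> 0 < s ->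
  (forall a b : R, 0 <= a <= s -> 0 <= b <= s -> U (x + a *: u + b *: v)) ->
  exists a b : R, [/\ 0 <= a <= s, 0 <= b <= s &
    f (x + s *: u + s *: v) - f (x + s *: u) - f (x + s *: v) + f x =
      s ^+ 2 * 'D_u ('D_v f) (x + a *: u + b *: v)].
Proof.
move=> oU hf s0 hU; have s00 : 0 <= s <= s by rewrite ltW/=.
have z00 : 0 <= (0 : R) <= s by rewrite lexx ltW.
have sc (c : R) : 0 <= c <= 1 -> 0 <= c * s <= s.
  by move=> /andP[c0 c1]; rewrite mulr_ge0 ?(ltW s0)//=; apply: ler_piMl => //; exact: ltW.
have [t t01|b b01] := @MVT01 (fun t => f (x + s *: u + t *: (s *: v)) - f (x + t *: (s *: v)))
  (fun t => 'D_(s *: v) f (x + s *: u + t *: (s *: v)) - 'D_(s *: v) f (x + t *: (s *: v))).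
  have d1 : is_derive t 1 (fun t : R => f (x + s *: u + t *: (s *: v)))
      ('D_(s *: v) f (x + s *: u + t *: (s *: v))).
    by apply: is_derive_line; apply: hf.1; rewrite scalerA; apply: hU => //; exact: sc.
  have d2 : is_derive t 1 (fun t : R => f (x + t *: (s *: v))) ('D_(s *: v) f (x + t *: (s *: v))).
    apply: is_derive_line; apply: hf.1; rewrite scalerA.
    by rewrite -{1}[x]addr0 -(scale0r u); apply: hU => //; exact: sc.
  exact: (is_deriveB d1 d2).
rewrite !scale1r !scale0r !addr0 scalerA => E.
have [t t01|a a01] := @MVT01 (fun t => 'D_v f (x + (b * s) *: v + t *: (s *: u)))
  (fun t => 'D_(s *: u) ('D_v f) (x + (b * s) *: v + t *: (s *: u))).
  apply: is_derive_line; apply: (hf.2 v).1; rewrite scalerA addrAC; apply: hU; exact: sc.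
rewrite !scale1r !scale0r !addr0 scalerA => E2.
exists (a * s), (b * s); split; [exact: sc|exact: sc|].
have -> : f (x + s *: u + s *: v) - f (x + s *: u) - f (x + s *: v) + f x =
  f (x + s *: u + s *: v) - f (x + s *: v) - (f (x + s *: u) - f x) by ring.
rewrite E !derive_dirZ; last 2 first.
- by apply: hf.1; rewrite -{1}[x]addr0 -(scale0r u); apply: hU => //; exact: sc.
- by apply: hf.1; apply: hU => //; exact: sc.
rewrite -mulrBr [x + s *: u + _]addrAC E2 derive_dirZ; last first.
  by apply: (hf.2 v).1; rewrite addrAC; apply: hU; exact: sc.
by rewrite mulrA -expr2 addrAC.
Qed.

(** The second difference is symmetric in [u] and [v], so the two mixed derivatives agree at two
    points of an arbitrarily small parallelogram, and both are continuous at [x]. *)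
Lemma Schwarz (V : normedModType R) (U : set V) (f : V -> R) x u v :
  open U -> Ck 2 U f -> U x -> 'D_u ('D_v f) x = 'D_v ('D_u f) x.
Proof.
move=> oU hf Ux; apply/eqP; rewrite -subr_eq0 -normr_le0; apply/ler_addgt0Pr => e e0.
rewrite add0r; have e2 : 0 < e / 2 by rewrite divr_gt0.
have c1 : 'D_u ('D_v f) @ x --> 'D_u ('D_v f) x by exact: ((hf.2 v).2 u x Ux).
have c2 : 'D_v ('D_u f) @ x --> 'D_v ('D_u f) x by exact: ((hf.2 u).2 v x Ux).
move: c1 => /cvgrPdist_le/(_ _ e2)/nbhs_normP[/= r1 r10 h1].
move: c2 => /cvgrPdist_le/(_ _ e2)/nbhs_normP[/= r2 r20 h2].
have [r0 r00 h0] := open_ball_sub oU Ux.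
pose r := Num.min r0 (Num.min r1 r2).
have rp : 0 < r by rewrite !lt_min r00 r10 r20.
pose s := r / (1 + `|u| + `|v|).
have den0 : 0 < 1 + `|u| + `|v| by rewrite !ltr_pwDl.
have s0 : 0 < s by rewrite divr_gt0.
have bd (a b : R) : 0 <= a <= s -> 0 <= b <= s -> `|a *: u + b *: v| < r.
  move=> /andP[a0 as_] /andP[b0 bs]; apply: le_lt_trans (ler_normD _ _) _.
  rewrite !normrZ !ger0_norm//; have rE : r = s + s * `|u| + s * `|v|.
    by rewrite /s; field; rewrite gt_eqF.
  have := ler_wpM2r (normr_ge0 u) as_; have := ler_wpM2r (normr_ge0 v) bs; lra.
have hU (w w' : V) (a b : R) : 0 <= a <= s -> 0 <= b <= s -> `|a *: w + b *: w'| < r ->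
   U (x + a *: w + b *: w').
  move=> ha hb; rewrite !lt_min => /and3P[h _ _]; apply: h0.
  by rewrite -[x + _ + _]addrA [x + _]addrC addrK.
have [a [b [ha hb E]]] := second_difference oU hf s0 (fun a b ha hb => hU u v a b ha hb (bd _ _ ha hb)).
have [b' [a' [hb' ha' E']]] := @second_difference _ _ _ x v u _ oU hf s0
  (fun b a hb ha => hU v u b a hb ha ltac:(by rewrite addrC; exact: bd)).
have EE : 'D_u ('D_v f) (x + a *: u + b *: v) = 'D_v ('D_u f) (x + a' *: u + b' *: v).
  apply: (@mulfI _ (s ^+ 2)); first by rewrite expf_neq0 ?gt_eqF.
  rewrite -E [x + a' *: _ + _]addrAC -E' [x + s *: v + _]addrAC; ring.
have n1 : `|'D_u ('D_v f) x - 'D_u ('D_v f) (x + a *: u + b *: v)| <= e / 2.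
  apply: h1; rewrite /= -addrA opprD addrA subrr sub0r normrN.
  by have := bd _ _ ha hb; rewrite !lt_min => /and3P[].
have n2 : `|'D_v ('D_u f) x - 'D_v ('D_u f) (x + a' *: u + b' *: v)| <= e / 2.
  apply: h2; rewrite /= -addrA opprD addrA subrr sub0r normrN.
  by have := bd _ _ ha' hb'; rewrite !lt_min => /and3P[].
move: n1 n2; rewrite EE; set A := 'D_u _ x; set B := 'D_v _ x; set D := 'D_v _ _ => n1 n2.
have -> : A - B = (A - D) - (B - D) by ring.
by apply: le_trans (ler_normB _ _) _; apply: le_trans (lerD n1 n2) _; rewrite -splitr.
Qed.

End LocalCalculus.

(** * Reciprocals, square roots and powers of the positive part *)

Section ScalarFunctions.
Context {R : realType}.

Lemma CkV (V : normedModType R) k (U : set V) (f : V -> R) :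
  open U -> (forall x, U x -> f x != 0) -> Ck k U f -> Ck k U (fun x => (f x)^-1).
Proof.
move=> oU f0; elim: k => [|k IH] hf.
  by move=> x Ux; apply: cvgV; [exact: f0|exact: hf].
split=> [x Ux|v].
  by apply: differentiableV; [exact: hf.1|exact: f0].
have h : Ck k U (fun x => - ((f x)^-1 ^+ 2 * 'D_v f x)).
  by apply: CkN => //; apply: CkM => //; [apply: CkX => //; apply: IH; exact: CkW|exact: hf.2].
apply: (Ck_eq oU _ h) => x Ux; rewrite deriveV ?f0//; last by apply/diff_derivable/hf.1.
by rewrite /GRing.scale /= mulNr exprVn.
Qed.

Lemma Ck_sqrt (V : normedModType R) k (U : set V) (f : V -> R) :
  open U -> (forall x, U x -> 0 < f x) -> Ck k U f -> Ck k U (fun x => Num.sqrt (f x)).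
Proof.
move=> oU f0 hf.
have dsq x : U x -> 0 < f x -> differentiable (@Num.sqrt R) (f x).
  move=> Ux fx; apply/derivable1_diffP; exact: (@ex_derive _ _ _ _ _ _ _ (is_derive1_sqrt fx)).
elim: k hf => [|k IH] hf.
  move=> x Ux; apply: (@continuous_comp _ _ _ f (@Num.sqrt R)); first exact: hf.
  exact: sqrt_continuous.
have hf' : forall x, U x -> differentiable f x by exact: hf.1.
split=> [x Ux|v].
  by apply: (differentiable_comp (hf' _ Ux)); exact: (dsq _ Ux (f0 _ Ux)).
have h : Ck k U (fun x => (2 * Num.sqrt (f x))^-1 * 'D_v f x).
  apply: CkM => //; last exact: hf.2.
  apply: CkV => //; last by apply: CkZ => //; apply: IH; exact: CkW.
  by move=> x Ux; rewrite mulf_neq0// gt_eqF// sqrtr_gt0 f0.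
apply: (Ck_eq oU _ h) => x Ux.
rewrite (derive_comp v (hf' _ Ux) (dsq _ Ux (f0 _ Ux))).
rewrite derive_dirR; last exact: (dsq _ Ux (f0 _ Ux)).
by rewrite (@derive_val _ _ _ _ _ _ _ (is_derive1_sqrt (f0 _ Ux))) mulrC.
Qed.

Definition posp (x : R) : R := Num.max 0 x.

Lemma pospX_diff k (x : R) : is_derive x 1 (fun x => posp x ^+ k.+2) (k.+2%:R * posp x ^+ k.+1).
Proof.
have [x0|x0|->] := ltgtP x 0.
- rewrite /posp max_l ?ltW// expr0n mulr0.
  apply: (@near_eq_is_derive _ _ _ (cst 0)).
  by near=> y; rewrite max_l ?expr0n//; apply: ltW; near: y; exact: lt_nbhsl.
- rewrite /posp max_r ?ltW//.
  have D : is_derive x 1 (fun y : R => y ^+ k.+2) (k.+2%:R * x ^+ k.+1).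
    split; first exact: exprn_derivable.
    by rewrite exp_derive [_ *: 1]mulr1.
  apply: near_eq_is_derive D.
  by near=> y; rewrite max_r//; apply: ltW; near: y; exact: lt_nbhsr.
rewrite /posp maxxx expr0n mulr0.
suff h : (fun h : R => h^-1 *: (((fun x : R => Num.max 0 x ^+ k.+2 : R) \o shift (0 : R)) (h *: (1 : R)) - Num.max 0 0 ^+ k.+2)) @ 0^' --> (0 : R).
  by split; [apply: cvgP h|exact: cvg_lim h].
apply/cvgrPdist_le => e e0; near=> h.
rewrite /= maxxx expr0n subr0 sub0r normrN addr0 [h *: (1 : R)]mulr1.
have h0 : h != 0 by near: h; exact: nbhs_dnbhs_neq.
have m : `|Num.max 0 h| <= `|h|.
  by rewrite ger0_norm ?le_max ?lexx// ge_max normr_ge0 ler_norm.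
rewrite normrM normfV normrX ler_pdivrMl ?normr_gt0// exprS.
apply: ler_pM => //; rewrite ?exprn_ge0// exprS.
have h1 : `|h| <= Num.min e 1.
  near: h; apply: dnbhs0_le; by rewrite lt_min e0 ltr01.
apply: (@le_trans _ _ (`|h| * 1)).
  apply: ler_pM => //; rewrite ?exprn_ge0//; apply: exprn_ile1 => //.
  by apply: le_trans m _; apply: le_trans h1 _; rewrite ge_min lexx orbT.
by rewrite mulr1; apply: le_trans h1 _; rewrite ge_min lexx.
Unshelve. all: by end_near. Qed.

Lemma Ck_pospX k d : Ck k [set: R] (fun x => posp x ^+ (k + d).+1).
Proof.
elim: k => [|k IH] /=.
  move=> x _.
  have cp : continuous (posp : R -> R).
    by move=> y; apply: continuous_max; [exact: cst_continuous|exact: cvg_id].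
  apply: (@continuous_comp _ _ _ posp (fun y => y ^+ d.+1)); first exact: cp.
  exact: exprn_continuous.
split=> [x Ux|v].
  by apply/derivable1_diffP; have [] := pospX_diff (k + d) x.
suff -> : 'D_v (fun x => posp x ^+ (k.+1 + d).+1) = fun x => (v * (k + d).+2%:R) * posp x ^+ (k + d).+1.
  by apply: CkM; [exact: openT| exact: Ck_cst|exact: IH].
apply: funext => x; have [dx Dx] := pospX_diff (k + d) x.
have df : differentiable (fun x => posp x ^+ (k.+1 + d).+1) x by exact/derivable1_diffP.
by rewrite derive_dirR// Dx mulrA.
Qed.

End ScalarFunctions.

(** * Sperner's lemma on a torus and zeros of maps *)

Lemma involution_even (T : finType) (A : {set T}) (f : T -> T) :
  (forall x, x \in A -> f x \in A) -> (forall x, x \in A -> f (f x) = x) ->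
  (forall x, x \in A -> f x != x) -> ~~ odd #|A|.
Proof.
have [k] := ubnP #|A|; elim: k A => // k IH A Ak fA ff fx.
have [->|[x xA]] := set_0Vmem A; first by rewrite cards0.
have fxA : f x \in A :\ x by rewrite !inE fx ?fA.
rewrite (cardsD1 x) xA (cardsD1 (f x)) fxA /= negbK.
set B := (A :\ x) :\ f x.
have BE y : y \in B = [&& y != f x, y != x & y \in A] by rewrite !inE.
apply: IH.
- by move: Ak; rewrite (cardsD1 x) xA (cardsD1 (f x)) fxA -/B; lia.
- move=> y; rewrite !BE => /and3P[y1 y2 yA]; rewrite fA// andbT; apply/andP; split.
    by apply: contra_neq y2 => e; rewrite -(ff y)// e ff.
  by apply: contra_neq y1 => e; rewrite -(ff y)// e.
- by move=> y; rewrite BE => /and3P[_ _ yA]; exact: ff.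
- by move=> y; rewrite BE => /and3P[_ _ yA]; exact: fx.
Qed.

(** An increasing self-map of an initial segment satisfies k <= s k; this applies to [t] and to its
    inverse. *)
Lemma increasing_perm1 l (t : 'S_l) :
  (forall i k : 'I_l, (i < k)%N -> (t i < t k)%N) -> t = 1%g.
Proof.
have geid (s : 'S_l) : (forall i k : 'I_l, (i < k)%N -> (s i < s k)%N) ->
    forall k : 'I_l, (k <= s k)%N.
  move=> h [k]; elim: k => [//|k IH] kl.
  have kl' : (k < l)%N by exact: ltn_trans kl.
  exact: leq_ltn_trans (IH kl') (h (Ordinal kl') (Ordinal kl) (ltnSn _)).
move=> h; apply/permP => k; rewrite perm1; apply/val_inj/eqP.
rewrite eqn_leq (geid _ h) andbT.
have := geid t^-1%g _ (t k); rewrite permK; apply => i j ij.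
rewrite ltnNge leq_eqVlt negb_or; apply/andP; split.
  by apply: contraTneq ij => /val_inj/perm_inj ->; rewrite ltnn.
by apply: contraL ij => /h; rewrite !permKV -leqNgt => /ltnW.
Qed.

Section Sperner.
Local Close Scope classical_set_scope.
Variables (l q : nat).
Let L := l.+1.
Local Notation grid := {ffun 'I_l.+1 -> 'I_q.+2}.
Local Notation cell := (grid * 'S_l.+1)%type.

(** The Kuhn triangulation: from the corner [s.1] the coordinates are raised one after the other, in
    the order given by [s.2]. Addition in ['I_q.+2] is cyclic, so the grid is a torus and has no
    boundary facets. *)
Definition kuhn_vertex (s : cell) (j : nat) : grid :=
  [ffun k => s.1 k + (s.2 k < j)%:R].

Variable lab : grid -> 'I_L.+1.

Definition full_cell (s : cell) : bool :=
  [forall c, exists j : 'I_L.+1, lab (kuhn_vertex s j) == c].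

(** The facet opposite to the vertex [sj.2] carries all the labels other than [ord_max]. *)
Definition door (sj : cell * 'I_L.+1) : bool :=
  [forall c : 'I_L.+1, (c != ord_max) ==>
    [exists i : 'I_L.+1, (i != sj.2) && (lab (kuhn_vertex sj.1 i) == c)]].

Definition swap_vals (j : nat) : 'S_l.+1 := tperm (inord j.-1) (inord j).

(** The passage to the other simplex with the same facet. Without the first vertex, the remaining
    ones are the first vertices of a simplex with a shifted corner; without the last vertex it is
    the reverse; without an inner vertex two consecutive coordinates are exchanged. *)
Definition flip_door (sj : cell * 'I_L.+1) : cell * 'I_L.+1 :=
  let: ((b, t), j) := sj in
  if j == ord0 then
    (([ffun k => b k + (t k < 1)%:R], (t * perm (@ord_pred_inj _))%g), ord_max)
  else if j == ord_max then
    (([ffun k => b k - (l <= t k)%:R], (t * perm (@ordS_inj _))%g), ord0)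
  else ((b, (t * swap_vals j)%g), j).

Lemma ord_predE (k : 'I_l.+1) : ord_pred k = (if k == 0%N :> nat then l else k.-1) :> nat.
Proof.
rewrite /=; case: k => -[|k] kl /=; first by rewrite modn_small.
by rewrite modnDr modn_small// ltnW.
Qed.

Lemma ordSE (k : 'I_l.+1) : ordS k = (if k == l :> nat then 0%N else k.+1) :> nat.
Proof.
rewrite /=; case: k => k kl /=; case: eqP => [->|kl']; first by rewrite modnn.
by rewrite modn_small//; lia.
Qed.

Lemma vertex_swap (b : grid) (t : 'S_l.+1) (j i : nat) : (0 < j < L)%N -> i != j ->
  kuhn_vertex (b, t * swap_vals j)%g i = kuhn_vertex (b, t) i.
Proof.
move=> /andP[j0 jL] ij; apply/ffunP => k; rewrite !ffunE /= permM; congr (_ + _%:R).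
rewrite /swap_vals; congr (nat_of_bool _); case: tpermP => [->|->|//]; rewrite !inordK//; lia.
Qed.

Lemma vertex_pred (b : grid) (t : 'S_l.+1) (i : nat) : (i < L)%N ->
  kuhn_vertex ([ffun k => b k + (t k < 1)%:R], (t * perm (@ord_pred_inj l.+1))%g) i =
  kuhn_vertex (b, t) i.+1.
Proof.
move=> iL; apply/ffunP => k; rewrite !ffunE /= permM permE ord_predE -addrA; congr (_ + _).
case: eqP => [->|tk0] /=; last first.
  have -> : (t k < 1)%N = false by lia.
  by rewrite add0r; congr (_%:R); lia.
have -> : (l < i)%N = false by rewrite /L in iL; lia.
by rewrite addr0.
Qed.

Lemma flip_doorK sj : flip_door (flip_door sj) = sj.
Proof.
case: sj => [[b t] j]; rewrite {2}/flip_door.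
have [->|j0] := eqVneq j ord0.
  rewrite /flip_door (_ : (ord_max == ord0 :> 'I_L.+1) = false)// eqxx; congr (_, _, _).
    apply/ffunP => k; rewrite !ffunE permM permE ord_predE.
    rewrite (_ : (l <= (if t k == 0%N :> nat then l else (t k).-1))%N = (t k < 1)%N) ?addrK//.
    by have := ltn_ord (t k); case: eqP; lia.
  by apply/permP => k; rewrite !permM [X in perm _ X]permE permE ord_predK.
have [->|jm] := eqVneq j ord_max.
  rewrite /flip_door; congr (_, _, _).
    apply/ffunP => k; rewrite !ffunE permM permE ordSE.
    rewrite (_ : ((if t k == l :> nat then 0 else (t k).+1) < 1)%N = (l <= t k)%N) ?subrK//.
    by have := ltn_ord (t k); case: eqP; lia.
  by apply/permP => k; rewrite !permM [X in perm _ X]permE permE ordSK.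
rewrite /flip_door (negPf j0) (negPf jm); congr (_, _, _).
by rewrite -mulgA tperm2 mulg1.
Qed.

Lemma flip_door_neq sj : flip_door sj != sj.
Proof.
case: sj => [[b t] j]; rewrite /flip_door.
have [->|j0] := eqVneq j ord0; first by apply/eqP => -[].
have [->|jm] := eqVneq j ord_max; first by apply/eqP => -[].
have j0' : (0 < j)%N by rewrite lt0n; apply: contra_neq j0 => ?; exact: val_inj.
have jL : (j < L)%N by rewrite ltn_neqAle -ltnS ltn_ord andbT; apply: contra_neq jm => ?; exact: val_inj.
apply/eqP => -[] /permP /(_ (t^-1%g (inord j))); rewrite permM permKV tpermR.
by move=> /(congr1 val); rewrite /= !inordK//; lia.
Qed.

Lemma flip_doorP sj : door sj -> door (flip_door sj).
Proof.
move=> /forallP dsj; apply/forallP => c; apply/implyP => cm.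
have {dsj}/implyP/(_ cm)/existsP[i /andP[]] := dsj c.
case: sj => [[b t] j] /= ij /eqP lc.
have [j0|j0] := eqVneq j ord0.
  have i0 : (0 < i)%N by rewrite lt0n j0 in ij *; apply: contra_neq ij => ?; exact: val_inj.
  have iL : (i.-1 < L.+1)%N by have := ltn_ord i; lia.
  apply/existsP; exists (Ordinal iL); rewrite /= vertex_pred; last by have := ltn_ord i; lia.
  by rewrite /= prednK// lc eqxx andbT -val_eqE /=; have := ltn_ord i; lia.
have [jm|jm] := eqVneq j ord_max.
  have iL : (i < L)%N.
    by rewrite ltn_neqAle -ltnS ltn_ord andbT; apply: contra_neq ij => e; apply: val_inj; rewrite jm.
  apply/existsP; exists (Ordinal (iL : (i.+1 < L.+1)%N)); rewrite /=.
  have := vertex_pred [ffun k => b k - (l <= t k)%:R] (t * perm (@ordS_inj _))%g iL.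
  set s1 := (_, _); set s2 := (_, _); suff -> : s1 = (b, t) by move=> <-; rewrite lc.
  have := flip_doorK ((b, t), j); rewrite {2}/flip_door (negPf j0) jm eqxx.
  by rewrite /flip_door eqxx => -[e1 e2]; rewrite /s1 e1 e2.
have j0' : (0 < j)%N by rewrite lt0n; apply: contra_neq j0 => ?; exact: val_inj.
have jL : (j < L)%N by rewrite ltn_neqAle -ltnS ltn_ord andbT; apply: contra_neq jm => ?; exact: val_inj.
by apply/existsP; exists i; rewrite /= ij vertex_swap ?j0'// lc eqxx.
Qed.

(** In a full cell the labelling is a bijection and the only door is opposite to the label
    [ord_max]. In any other cell with a door exactly one label is repeated, and the two vertices
    that carry it give the two doors. *)
Lemma odd_doors (s : cell) : odd #|[set j | door (s, j)]| = full_cell s.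
Proof.
pose f (i : 'I_L.+1) := lab (kuhn_vertex s i).
have dP j : reflect (forall c, c != ord_max -> exists2 i, i != j & f i = c) (door (s, j)).
  apply: (iffP forallP) => h c; first by move=> cm; have /implyP/(_ cm)/existsP[i /andP[ij /eqP e]] := h c; exists i.
  by apply/implyP => cm; have [i ij e] := h c cm; apply/existsP; exists i; rewrite ij; apply/eqP.
have [fc|nf] := boolP (full_cell s).
  have fs c : exists i, f i = c by have /forallP/(_ c)/existsP[i /eqP] := fc; exists i.
  have fi : injective f.
    apply/injectiveP/card_uniqP; rewrite size_map -cardE cardT size_enum_ord; apply/eqP.
    rewrite eqn_leq; apply/andP; split; first by rewrite -[leqRHS]card_ord max_card.
    have -> : #|codom f| = #|'I_L.+1|; last by rewrite card_ord.
    by apply: eq_card => c; rewrite inE; have [i <-] := fs c; rewrite codom_f.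
  have [j fj] := fs ord_max.
  suff -> : [set j | door (s, j)] = [set j] by rewrite cards1.
  apply/setP => k; rewrite !inE; apply/dP/eqP => [h|-> c cm]; last first.
    by have [i e] := fs c; exists i => //; apply: contra_neq cm => ij; rewrite -e ij fj.
  apply/eqP/negPn/negP => kj; have [|i ik e] := h (f k).
    by rewrite -fj (inj_eq fi).
  by move: ik; rewrite (fi _ _ e) eqxx.
have [->|[j]] := set_0Vmem [set j | door (s, j)]; first by rewrite cards0.
rewrite inE => /dP dj.
have fjm : f j != ord_max.
  apply: contraNneq nf => e; apply/forallP => c; apply/existsP.
  by have [->|/dj[i _ <-]] := eqVneq c ord_max; [exists j; rewrite -e|exists i].
have [i ij fij] := dj _ fjm.
have inj k k' : k != j -> k' != j -> f k = f k' -> k = k'.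
  (* f maps the L indices different from j onto the L labels different from ord_max *)
  have sub : [set c | c != ord_max] \subset f @: [set k | k != j].
    by apply/fintype.subsetP => c; rewrite inE => /dj[u uj <-]; apply: imset_f; rewrite inE.
  have cD (T : finType) (x : T) : #|[set k | k != x]| = #|T|.-1.
    by rewrite -cardsT (cardsD1 x [set: T]%SET) inE /=; apply: eq_card => y; rewrite !inE andbT.
  have : #|f @: [set k | k != j]| = #|[set k | k != j]|.
    apply/eqP; rewrite eqn_leq leq_imset_card.
    by have := subset_leq_card sub; rewrite !cD.
  by move=> /eqP/imset_injP h kj k'j; apply: h; rewrite inE.
suff -> : [set j | door (s, j)] = [set i; j] by rewrite cards2 ij.
apply/setP => k; rewrite !inE; apply/dP/orP => [h|[/eqP->|/eqP->]] //.
- have [|kj] := eqVneq k j; [by right|left].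
  apply/negPn/negP => ki; have [|k' k'k e] := h (f k).
    apply: contraNneq nf => e; apply/forallP => c; apply/existsP.
    by have [->|/dj[i' _ <-]] := eqVneq c ord_max; [exists k; rewrite -e|exists i'].
  have [k'j|k'j] := eqVneq k' j; last by move: k'k; rewrite (inj _ _ k'j kj e) eqxx.
  by move: ki; rewrite (inj k i kj ij) ?eqxx// -e k'j fij.
- move=> c cm; have [u kj e] := dj c cm.
  have [ki|ki] := eqVneq u i; last by exists u.
  by exists j; rewrite 1?eq_sym// -e ki fij.
Qed.

(** [flip_door] pairs the doors of the whole torus, so their number is even; counted cell by cell it
    has the parity of the number of full cells. *)
Lemma sperner_torus : ~~ odd #|[set s | full_cell s]|.
Proof.
have : ~~ odd #|[set sj | door sj]|.
  apply: (@involution_even _ _ flip_door) => sj; rewrite ?inE; [exact: flip_doorP|by rewrite flip_doorK|by rewrite flip_door_neq].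
suff -> : odd #|[set sj | door sj]| = odd #|[set s | full_cell s]| by [].
have -> : #|[set sj | door sj]| = (\sum_(s : cell) #|[set j | door (s, j)]|)%N.
  rewrite -sum1_card (eq_bigl (fun p => true && door (p.1, p.2))); last by case=> s j; rewrite inE.
  rewrite -(pair_big_dep xpredT (fun s j => door (s, j)) (fun=> fun=> 1%N)) /=.
  by apply: eq_bigr => s _; rewrite -sum1_card; apply: eq_bigl => j; rewrite inE.
rewrite -sum1_card !(big_morph odd oddD (erefl : odd 0 = false)).
rewrite [RHS]big_mkcond; apply: eq_bigr => s _.
by rewrite odd_doors inE; case: full_cell.
Qed.

End Sperner.

(** * Approximate zeros of maps that are the identity outside a box *)

Section Brouwer.
Context {R : realType}.

(** The source of most uniform constants below: a property that gets weaker as the constant grows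
    and holds near each point with some constant holds on a compact set with one constant. It is a
    covering argument along the filter at infinity. *)
Lemma compact_bound (X : topologicalType) (K : set X) (P : R -> X -> Prop) :
  compact K -> (forall C C' x, C <= C' -> P C x -> P C' x) ->
  (forall x, K x -> exists C, \forall x' \near x, K x' -> P C x') ->
  exists2 C, 0 < C & forall x, K x -> P C x.
Proof.
move=> cK mP h.
have /compact_near_coveringP/near_covering_withinP cK' := cK.
have [|C [C0 hC]] := cK' _ (@pinfty_nbhs R) P _.
  move=> x Kx; have [C hC] := h x Kx; near=> x' C' => /=.
  move=> Kx'; apply: (mP C); first by near: C'; exact: nbhs_pinfty_ge (num_real _).
  by move: Kx'; near: x'.
have : \forall C \near +oo, 0 < C /\ (K `<=` P C).
  by apply: filterI; [exact: nbhs_pinfty_gt (num_real _)|exists C].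
by case/filter_ex => C' [? ?]; exists C'.
Unshelve. all: by end_near. Qed.

Lemma coord_le_norm m n (v : 'M[R]_(m, n)) i j : `|v i j| <= `|v|.
Proof.
rewrite [leRHS]mx_normrE; exact: (le_bigmax _ (fun ij : 'I_m * 'I_n => `|v ij.1 ij.2|) (i, j)).
Qed.

Lemma mx_norm_le m n (v : 'M[R]_(m, n)) e : 0 <= e -> (forall i j, `|v i j| <= e) -> `|v| <= e.
Proof. by move=> e0 h; rewrite [leLHS]mx_normrE; apply: bigmax_le => // -[i j] _; exact: h. Qed.

Lemma box_compact n (r : R) : compact [set v : 'rV[R]_n | `|v| <= r].
Proof.
have cK := @rV_compact R n (fun=> `[- r, r]%classic) (fun=> segment_compact (a := - r) (b := r)).
apply: subclosed_compact cK _; last first.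
  move=> v /= vr i; rewrite in_itv /= -ler_norml; apply: le_trans vr; exact: coord_le_norm.
apply: (@closed_comp _ _ (fun v : 'rV[R]_n => `|v|) [set x | x <= r]); last exact: closed_le.
by move=> v _; exact: norm_continuous.
Qed.

Section Labels.
Variable L : nat.

(** The index of the first negative coordinate, or [ord_max] if there is none. In a full cell one
    vertex has no negative coordinate while each coordinate is negative at some vertex, so a small
    full cell nearly contains a zero. *)
Definition neg_label (w : 'rV[R]_L) : 'I_L.+1 :=
  if [pick i : 'I_L | (w 0 i < 0) && [forall j : 'I_L, (j < i)%N ==> (0 <= w 0 j)]] is Some i
  then widen_ord (leqnSn L) i else ord_max.

Lemma neg_label_max w : neg_label w = ord_max -> forall i, 0 <= w 0 i.
Proof.
rewrite /neg_label; case: pickP => [i _ /(congr1 val) /= e|h _ i].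
  by have := ltn_ord i; rewrite e ltnn.
rewrite leNgt; apply/negP => wi.
have [k wk kmin] := @arg_minnP _ i (fun i => w 0 i < 0) (fun i => i : nat) wi.
have /negP[] := negbT (h k); rewrite wk; apply/forallP => j; apply/implyP => jk.
by rewrite leNgt; apply/negP => /kmin; rewrite leqNgt jk.
Qed.

Lemma neg_labelP w (i : 'I_L) : neg_label w = widen_ord (leqnSn L) i ->
  w 0 i < 0 /\ forall j : 'I_L, (j < i)%N -> 0 <= w 0 j.
Proof.
rewrite /neg_label; case: pickP => [k /andP[wk /forallP hk] /(congr1 val) /= /val_inj <-|_ /(congr1 val) /= e].
  by split=> // j jk; have /implyP := hk j; exact.
by have := ltn_ord i; rewrite -e ltnn.
Qed.

Lemma neg_labelE (w : 'rV[R]_L) (i : 'I_L) : w 0 i < 0 -> (forall j : 'I_L, (j < i)%N -> 0 <= w 0 j) ->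
  neg_label w = widen_ord (leqnSn L) i.
Proof.
move=> wi hi; rewrite /neg_label; case: pickP => [k /andP[wk /forallP hk]|/(_ i)]; last first.
  by rewrite wi /= => /negbT/negP[]; apply/forallP => j; apply/implyP; exact: hi.
have ki : k = i; last exact: (congr1 (widen_ord (leqnSn L)) ki).
apply: ord_inj; have [ki|ik|//] := ltngtP (k : nat) i.
  by have := hi _ ki; rewrite leNgt wk.
by have /implyP/(_ ik) := hk i; rewrite leNgt wi.
Qed.

End Labels.

Section Grid.
Variables (l h : nat) (r : R).
Hypotheses (h2 : (2 <= h)%N) (r0 : 0 < r).
Let q := h.*2.-2.
Let L := l.+1.
Local Notation grid := {ffun 'I_l.+1 -> 'I_q.+2}.
Let step := 2 * r / h%:R.

(** The 2h residues of each circle run from -2r to 2r - [step]; the circle is cut between its last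
    residue and 0. The sign changes between h - 1 and h. *)
Definition grid_pt (k : grid) : 'rV[R]_L := \row_i (((k i)%:R - h%:R) * step).

Let h0 : 0 < h%:R :> R. Proof. by rewrite ltr0n; lia. Qed.
Let step0 : 0 < step. Proof. by rewrite divr_gt0// mulr_gt0. Qed.
Let step_r : step <= r.
Proof. by rewrite ler_pdivrMr// mulrC ler_pM2l// ler_nat. Qed.
Let qE : q.+2 = h.*2. Proof. by rewrite /q; lia. Qed.

Definition inner_cell (s : grid * 'S_l.+1) := [forall i, (s.1 i < q.+1)%N].

Lemma grid_pt_lt0 k i : (grid_pt k 0 i < 0) = (k i < h)%N.
Proof. by rewrite mxE pmulr_llt0// subr_lt0 ltr_nat. Qed.

Lemma inner_vertex s j i : inner_cell s -> kuhn_vertex s j i = (s.1 i + (s.2 i < j))%N :> nat.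
Proof.
move=> /forallP/(_ i) si; rewrite ffunE /=.
have -> : ((s.2 i < j)%N%:R : 'I_q.+2) = (s.2 i < j)%N :> nat by case: (s.2 i < j)%N.
by rewrite modn_small//; case: (_ < j)%N; lia.
Qed.

(** In a direction that crosses the cut, every vertex has the coordinate 2r - [step] or -2r, and
    [step] is at most r because h is at least 2. *)
Lemma outer_vertex s j : ~~ inner_cell s -> exists i, r <= `|grid_pt (kuhn_vertex s j) 0 i|.
Proof.
move=> /forallPn[i si]; exists i; rewrite mxE.
have {si} si : s.1 i = ord_max by apply: val_inj => /=; have := ltn_ord (s.1 i); lia.
rewrite ffunE si; case: (_ < j)%N.
  have -> : (ord_max + 1%:R : 'I_q.+2) = 0 by apply: val_inj; rewrite /= (@modn_small 1)// addn1 modnn.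
  have -> : (0%:R - h%:R) * step = - (2 * r) by rewrite /step; field; rewrite gt_eqF.
  by rewrite normrN ger0_norm; move: r0; lra.
rewrite addr0 /= (_ : q.+1%:R = 2 * h%:R - 1 :> R); last first.
  by rewrite -natr1 -[1 in LHS]/(1%:R) -natrD /= (_ : (q + 1)%N = (2 * h - 1)%N) ?natrB ?natrM//; lia.
have -> : (2 * h%:R - 1 - h%:R) * step = 2 * r - step by rewrite /step; field; rewrite gt_eqF.
by rewrite ger0_norm; move: step_r r0; lra.
Qed.

(** The vertex without negative coordinates forces every corner coordinate to be at least h - 1, and
    the label i forces the i-th one to be at most h - 1. As the vertex labelled k has no negative
    coordinate before k, the coordinates are raised in increasing order. *)
Lemma inner_cell_id : [set s | full_cell (fun k => neg_label (grid_pt k)) s && inner_cell s]%SET =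
  [set ([ffun=> inord h.-1], 1%g)]%SET.
Proof.
apply/setP => -[b t]; rewrite !inE; apply/andP/eqP => [[/forallP fc ic]|[-> ->]].
  have mx i : (h <= b i + 1)%N.
    have /existsP[j /eqP/neg_label_max/(_ i)] := fc ord_max.
    rewrite leNgt grid_pt_lt0 (inner_vertex _ _ ic) -leqNgt /=.
    by case: (t i < j)%N; lia.
  have lb (i : 'I_L) := fc (widen_ord (leqnSn L) i).
  have bE i : b i = h.-1 :> nat.
    have /existsP[j /eqP/neg_labelP[+ _]] := lb i.
    rewrite grid_pt_lt0 (inner_vertex _ _ ic) /= => m2.
    have b1 : (b i < h)%N := leq_ltn_trans (leq_addr _ _) m2.
    have b2 : (h <= b i + 1)%N := mx i.
    suff H : forall x : nat, (x < h)%N -> (h <= x + 1)%N -> x = h.-1 by exact: H b1 b2.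
    by clear=> x; lia.
  congr pair.
    by apply/ffunP => i; rewrite ffunE; apply: val_inj; rewrite /= inordK ?bE// qE; lia.
  apply: increasing_perm1 => i k ik.
  have /existsP[j /eqP/neg_labelP[wk hk]] := lb k.
  have := hk _ ik; rewrite leNgt grid_pt_lt0 (inner_vertex _ _ ic) -leqNgt /= bE.
  move: wk; rewrite grid_pt_lt0 (inner_vertex _ _ ic) /= bE.
  by case: ltnP; case: ltnP; lia.
have ic : inner_cell ([ffun=> inord h.-1], 1%g).
  by apply/forallP => i; rewrite ffunE inordK ?qE//; lia.
split=> //; apply/forallP => c; apply/existsP; exists c; apply/eqP.
have vE i : (grid_pt (kuhn_vertex ([ffun=> inord h.-1], 1%g) c) 0 i < 0) = (c <= i)%N.
  rewrite grid_pt_lt0 (inner_vertex _ _ ic) /= ffunE inordK ?qE ?perm1; last lia.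
  suff H : forall i c : nat, (h.-1 + (i < c) < h)%N = (c <= i)%N by exact: H.
  by clear -h2 => i c; case: ltnP; lia.
have [cm|cm] := ltnP c L.
  have -> : c = widen_ord (leqnSn L) (Ordinal cm) by exact: val_inj.
  apply: neg_labelE => [|j jc]; first by rewrite vE.
  by rewrite leNgt vE -ltnNge.
rewrite [RHS](_ : c = ord_max); last by apply: val_inj; apply/eqP; rewrite eqn_leq cm -ltnS ltn_ord.
rewrite /neg_label; case: pickP => // i /andP[+ _]; rewrite vE => ci.
by have := leq_trans cm ci; rewrite leqNgt ltn_ord.
Qed.

(* [P] and the identity both have an even number of full Kuhn cells, and the same ones across the cut of the torus
   at infinity; away from the cut the identity has exactly one. *)
Lemma full_inner_cell (P : 'rV[R]_L -> 'rV[R]_L) :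
  (forall v : 'rV[R]_L, (exists i, r <= `|v 0 i|) -> P v = v) ->
  exists2 s, inner_cell s & full_cell (fun k => neg_label (P (grid_pt k))) s.
Proof.
move=> hP; pose I := [set s | inner_cell s]%SET.
pose A := [set s | full_cell (fun k => neg_label (P (grid_pt k))) s]%SET.
pose B := [set s | full_cell (fun k => neg_label (grid_pt k)) s]%SET.
have AB : A :\: I = B :\: I.
  apply/setP => s; rewrite !inE; have [//|si] := boolP (inner_cell s).
  by apply: eq_forallb => c; apply: eq_existsb => j; rewrite hP//; exact: outer_vertex.
have := sperner_torus (fun k => neg_label (P (grid_pt k))); rewrite -/A -(cardsID I A).
have := sperner_torus (fun k => neg_label (grid_pt k)); rewrite -/B -(cardsID I B) AB.
have -> : #|B :&: I| = 1%N.
  rewrite -[RHS](cards1 (([ffun=> inord h.-1], 1%g) : grid * 'S_l.+1)) -inner_cell_id.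
  by apply: eq_card => s; rewrite !inE.
rewrite !oddD /= negbK => ->; rewrite addbT negbK => o.
have /card_gt0P[s] : (0 < #|A :&: I|)%N by case: #|_| o.
by rewrite !inE => /andP[? ?]; exists s.
Qed.

End Grid.

(** Brouwer's theorem in approximate form. The mesh is taken finer than the modulus of continuity of
    [P]: at the vertex [x0] of a full cell labelled [ord_max] the values are nonnegative, and each
    of them is close to a negative one. *)
Lemma approx_zero L (P : 'rV[R]_L -> 'rV[R]_L) (r e : R) : 0 < r -> 0 < e ->
  continuous P -> (forall v : 'rV[R]_L, (exists i, r <= `|v 0 i|) -> P v = v) ->
  exists v, forall i, `|P v 0 i| <= e.
Proof.
case: L P => [|l] P r0 e0 cP hP; first by exists 0 => -[].
pose e' := Num.min e (r / 2); have e'0 : 0 < e' by rewrite lt_min e0 divr_gt0.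
(* [C] is the inverse of a modulus of continuity, so that enlarging it weakens the property, as
   [compact_bound] requires. *)
have mP (C C' : R) (x : 'rV[R]_l.+1) : C <= C' -> (forall y, `|y - x| * C <= 1 -> `|P y - P x| <= e') ->
    forall y, `|y - x| * C' <= 1 -> `|P y - P x| <= e'.
  move=> CC' hx y yx; apply: hx; apply: le_trans yx; exact: ler_wpM2l.
have lP (x : 'rV[R]_l.+1) : `|x| <= 2 * r -> exists C, \forall x' \near x, `|x'| <= 2 * r ->
    (forall y, `|y - x'| * C <= 1 -> `|P y - P x'| <= e').
  move=> _; have e2 : 0 < e' / 2 by rewrite divr_gt0.
  have /cvgrPdist_le/(_ _ e2)/nbhs_normP[/= d d0 hd] : P @ x --> P x by exact: cP.
  exists (4 / d); have d2 : 0 < d / 2 by rewrite divr_gt0.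
  apply/nbhs_normP; exists (d / 2) => //= x' xx' _ y.
  rewrite mulrA ler_pdivrMr// mul1r => yx'.
  have -> : P y - P x' = (P x - P x') - (P x - P y) by rewrite opprB [RHS]addrC addrA subrK.
  apply: le_trans (ler_normB _ _) _; rewrite [leRHS]splitr; apply: lerD; apply: hd => /=.
    by apply: lt_trans xx' _; lra.
  have -> : x - y = (x - x') - (y - x') by rewrite opprB addrA subrK.
  have xx2 : `|x - x'| < d / 2 by exact: xx'.
  by apply: le_lt_trans (ler_normB _ _) _; lra.
have [C C0 hC] := compact_bound (box_compact (n := l.+1) (r := 2 * r)) mP lP.
have rC0 : 0 <= 2 * r * C by rewrite !mulr_ge0 ?(ltW r0) ?(ltW C0).
pose h := (Num.bound (2 * r * C)).+2; have h2 : (2 <= h)%N by [].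
have hgt : 2 * r * C <= h%:R.
  apply: ltW; apply: lt_le_trans (archi_boundP rC0) _; by rewrite ler_nat /h; lia.
have h0 : 0 < h%:R :> R by rewrite ltr0n.
have [s sin /forallP sf] := full_inner_cell h2 r0 hP.
have /existsP[j0 /eqP j0max] := sf ord_max.
have {}j0max := neg_label_max j0max.
set x0 := grid_pt _ _ in j0max.
exists x0 => i; rewrite ger0_norm ?j0max//.
have /existsP[j /eqP/neg_labelP[Pneg _]] := sf (widen_ord (leqnSn _) i).
set x := grid_pt _ _ in Pneg.
have x0K : `|x0| <= 2 * r.
  apply: mx_norm_le => [|a k]; first by rewrite mulr_ge0 ?(ltW r0).
  rewrite mxE normrM [X in _ * X]ger0_norm ?divr_ge0 ?mulr_ge0 ?(ltW r0)//.
  rewrite mulrA ler_pdivrMr// mulrC ler_wpM2l ?mulr_ge0 ?(ltW r0)//.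
  set m := nat_of_ord _; have mh : (m <= h.*2)%N by have := ltn_ord (kuhn_vertex s j0 k); rewrite -/m; lia.
  by rewrite ler_distl subrr ler0n -natrD ler_nat addnn.
have xx0 : `|x - x0| * C <= 1.
  apply: (@le_trans _ _ (2 * r / h%:R * C)).
    apply: ler_wpM2r; first exact: ltW.
    apply: mx_norm_le => [|a k]; first by rewrite divr_ge0 ?mulr_ge0 ?(ltW r0).
    rewrite !mxE -mulrBl normrM [X in _ * X]ger0_norm ?divr_ge0 ?mulr_ge0 ?(ltW r0)//.
    rewrite ler_piMl ?divr_ge0 ?mulr_ge0 ?(ltW r0)//.
    rewrite opprB addrA subrK !(inner_vertex h2 r0 _ _ sin) !natrD opprD addrACA subrr add0r.
    by do 2 case: (_ < _)%N; rewrite ?subrr ?subr0 ?sub0r ?normr0 ?normrN ?normr1.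
  by rewrite mulrAC ler_pdivrMr// mul1r.
have := hC _ x0K _ xx0 => hle.
have : `|(P x - P x0) 0 i| <= e' by apply: le_trans hle; exact: coord_le_norm.
rewrite !mxE ler_norml => /andP[h1 _].
apply: (@le_trans _ _ e'); last by rewrite ge_min lexx.
by move: h1 Pneg; lra.
Qed.

End Brouwer.

(** * Charts, embedding and dual vector fields *)

Section VectorSmooth.
Context {R : realType}.

Lemma smooth_on_vCk (V W : normedModType R) (U : set V) (f : V -> W) k :
  open U -> smooth_on U f -> vCk k U f.
Proof.
move=> oU; elim: k f => [|k IH] f h l hl.
  move=> x Ux; apply: differentiable_continuous.
  by apply: differentiable_comp; [exact: (h [::])|exact: hl.2].
split=> [x Ux|v].
  by apply: differentiable_comp; [exact: (h [::])|exact: hl.2].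
have h' : smooth_on U ('D_v f).
  by move=> vs x Ux; have := h (rcons vs v) x Ux; rewrite /derive_along foldr_rcons.
apply: (Ck_eq oU _ (IH _ h' l hl)) => x Ux.
by rewrite derive_coord//; exact: (h [::]).
Qed.

Lemma derive_rV n (f : 'rV[R]_n -> R) x v :
  differentiable f x -> 'D_v f x = \sum_i v 0 i * 'D_(delta_mx 0 i) f x.
Proof. exact: (derive_coords (l := fun i (v : 'rV[R]_n) => v 0 i) (row_sum_delta v)). Qed.

Lemma near_in_open (T : topologicalType) (U : set T) (P : T -> Prop) x :
  open U -> U x -> (forall y, U y -> P y) -> \forall y \near x, P y.
Proof. by move=> oU Ux h; have : nbhs x U by [exact: open_nbhs_nbhs]; exact: filterS. Qed.

Lemma open_preim_lt (T : topologicalType) (f : T -> R) a : continuous f -> open [set x | f x < a].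
Proof. move=> /continuousP cf; exact: (cf _ (@open_lt R a)). Qed.

Lemma open_preim_gt (T : topologicalType) (f : T -> R) a : continuous f -> open [set x | a < f x].
Proof. move=> /continuousP cf; exact: (cf _ (@open_gt R a)). Qed.

Lemma finite_cover (T : topologicalType) (A : set T) (f : T -> set T) :
  compact A -> (forall x, A x -> open (f x)) -> (forall x, A x -> f x x) ->
  exists s : seq T, forall x, A x -> exists k : 'I_(size s), f (tnth (in_tuple s) k) x.
Proof.
move=> /compact_near_coveringP cA fo ff.
(* The filter of large finite sequences, ordered by inclusion of their elements: the covering form
   of compactness along it yields one sequence good for all points. *)
pose F : set_system (seq T) := [set B | exists s0 : seq T, forall s : seq T, (forall x, x \in s0 -> x \in s) -> B s].
have FF : Filter F.
  split; first by exists [::].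
    move=> B C [s hs] [t ht]; exists (s ++ t) => u hu; split; [apply: hs|apply: ht] => x xs;
      by apply: hu; rewrite mem_cat xs ?orbT.
  by move=> B C BC [s hs]; exists s => t ht; apply: BC; exact: hs.
have [x Ax|s hs] := cA _ F (fun s x => exists2 y, y \in s & f y x) FF.
  exists (f x, [set s : seq T | x \in s]) => [|[x' s] [/= fx xs]]; last by exists x.
  split => /=; first by apply: open_nbhs_nbhs; split; [exact: fo|exact: ff].
  by exists [:: x] => s hs; apply: hs; rewrite inE.
exists s => x Ax; have [y ys fy] := hs s (fun _ h => h) x Ax.
have ys' : y \in in_tuple s by [].
by have /tnthP[k e] := ys'; exists k; rewrite -e.
Qed.

End VectorSmooth.

Section Charts.
Context {R : realType} {n : nat} (M : smoothManifold R n).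
Implicit Types (c : chart M) (x : M).

Definition cimg c : set 'rV[R]_n := coord c @` cdom c.

Lemma cimg_open c : open (cimg c). Proof. exact: coord_open. Qed.

Lemma cimg_coord c x : cdom c x -> cimg c (coord c x). Proof. by exists x. Qed.

Lemma cdom_param c q : cimg c q -> cdom c (param c q).
Proof. by case=> x cx <-; rewrite coordK. Qed.

Lemma paramK c q : cimg c q -> coord c (param c q) = q.
Proof. by case=> x cx <-; rewrite coordK. Qed.

Lemma coord_cts c x : cdom c x -> {for x, continuous (coord c)}.
Proof.
move=> cx; have := @coord_continuous _ _ M c.
by rewrite continuous_open_subspace; [move/(_ _ (mem_set cx))|exact: cdom_open].
Qed.

Lemma param_cts c q : cimg c q -> {for q, continuous (param c)}.
Proof.
move=> cq; have := @param_continuous _ _ M c.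
by rewrite continuous_open_subspace; [move/(_ _ (mem_set cq))|exact: coord_open].
Qed.

Definition cpre c (A : set M) : set 'rV[R]_n := [set q | cimg c q /\ A (param c q)].

Lemma cpre_open c (A : set M) : open A -> open (cpre c A).
Proof.
move=> oA; rewrite openE => q [cq Aq]; apply: filterI.
  by apply: open_nbhs_nbhs; split=> //; exact: cimg_open.
by apply: (param_cts cq); apply: open_nbhs_nbhs.
Qed.

Lemma cpreE c c' : cpre c (cdom c') = coord c @` (cdom c `&` cdom c').
Proof.
apply/seteqP; split=> [q [cq c'q]|_ [x [cx c'x] <-]].
  by exists (param c q); [split=> //; exact: cdom_param|rewrite paramK].
by split; [exact: cimg_coord|rewrite coordK].
Qed.

Definition trans c c' : 'rV[R]_n -> 'rV[R]_n := coord c' \o param c.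

Lemma trans_vCk c c' k : vCk k (cpre c (cdom c')) (trans c c').
Proof.
apply: smooth_on_vCk; first by apply: cpre_open; exact: cdom_open.
by rewrite cpreE; exact: transition_smooth.
Qed.

Lemma trans_diff c c' x : cdom c x -> cdom c' x -> differentiable (trans c c') (coord c x).
Proof.
by move=> cx c'x; apply: (@transition_smooth _ _ M c c' [::]); exists x.
Qed.

Lemma trans_coord c c' x : cdom c x -> trans c c' (coord c x) = coord c' x.
Proof. by move=> cx; rewrite /trans /= coordK. Qed.

Lemma near_cpre c (A : set M) x : open A -> cdom c x -> A x ->
  \forall q \near coord c x, cimg c q /\ A (param c q).
Proof.
move=> oA cx Ax; apply: (near_in_open (U := cpre c A)) => //; first exact: cpre_open.
by split; [exact: cimg_coord|rewrite coordK].
Qed.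

Lemma near_trans (T : Type) (f : M -> T) c c' x : cdom c x -> cdom c' x ->
  \forall q \near coord c x, (f \o param c) q = ((f \o param c') \o trans c c') q.
Proof.
move=> cx c'x; apply: filterS (near_cpre (cdom_open c') cx c'x) => q [cq c'q].
by rewrite /= /trans /= coordK.
Qed.

Lemma derive_trans (W : normedModType R) (f : M -> W) c c' x v :
  cdom c x -> cdom c' x -> differentiable (f \o param c') (coord c' x) ->
  'D_v (f \o param c) (coord c x) = 'D_('D_v (trans c c') (coord c x)) (f \o param c') (coord c' x).
Proof.
move=> cx c'x df; rewrite (near_eq_derive _ (near_trans f cx c'x)).
by rewrite derive_comp ?trans_coord//; exact: trans_diff.
Qed.

Lemma derive_trans_id c c' x v : cdom c x -> cdom c' x ->
  'D_('D_v (trans c c') (coord c x)) (trans c' c) (coord c' x) = v.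
Proof.
move=> cx c'x; have := derive_trans (f := coord c) v cx c'x (trans_diff c'x cx).
move=> <-; transitivity ('D_v id (coord c x)); last by rewrite derive_id.
apply: near_eq_derive; apply: (near_in_open (@cimg_open c)); first exact: cimg_coord.
by move=> q cq /=; rewrite paramK.
Qed.

Definition MCk k (f : M -> R) := forall c, Ck k (cimg c) (f \o param c).

(** Extension by 0 from a chart. The ball that contains the support has a compact image, closed in M
    by the Hausdorff property, and [f] vanishes on its open complement; inside [c0] the change of
    charts applies. *)
Lemma lift_Ck c0 (q0 : 'rV[R]_n) (r : R) (h : 'rV[R]_n -> R) (f : M -> R) c k :
  (forall q, `|q - q0| <= r -> cimg c0 q) ->
  Ck k (cpre c0 (cdom c)) h -> (forall q, r < `|q - q0| -> h q = 0) ->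
  (forall x, cdom c x -> cdom c0 x -> f x = h (coord c0 x)) ->
  (forall x, cdom c x -> ~ cdom c0 x -> f x = 0) ->
  Ck k (cimg c) (f \o param c).
Proof.
move=> Bc0 hh h0 fin fout.
have oc0 := cdom_open c0; have oc := cdom_open c.
pose K := param c0 @` [set q | `|q - q0| <= r].
have cK : compact K.
  apply: continuous_compact.
    apply: continuous_in_subspaceT => q; rewrite inE /= => hq.
    exact: (param_cts (Bc0 _ hq)).
  have -> : [set q | `|q - q0| <= r] = (fun q => q + q0) @` [set q : 'rV[R]_n | `|q| <= r].
    apply/seteqP; split=> [q hq|_ [q /= hq <-]]; last by rewrite /= addrK.
    by exists (q - q0); rewrite // subrK.
  apply: continuous_compact; last exact: box_compact.
  apply: continuous_subspaceT => q; apply: differentiable_continuous.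
  by apply: (@differentiableD _ _ _ id (cst q0)).
have clK : closed K by apply: compact_closed => //; exact: manifold_hausdorff.
apply: Ck_local => q cq; have [c0q|nc0q] := pselect (cdom c0 (param c q)).
  exists (cpre c (cdom c0)); first by [].
  have h1 : Ck k (cpre c (cdom c0)) (h \o trans c c0).
    apply: (Ck_comp (findim_rV _) (cpre_open oc0) (cpre_open oc) _ (trans_vCk _ _ _) hh).
    move=> q' [cq' c0q']; split; first by rewrite /trans /=; exact: cimg_coord.
    by rewrite /trans /= coordK//; exact: cdom_param.
  apply: (Ck_eq (cpre_open oc0) _ h1) => q' [cq' c0q'].
  by rewrite /= fin//; exact: cdom_param.
have onK : open (~` K) by exact: closed_openC.
exists (cpre c (~` K)).
  by split=> //; move=> [p hp pq]; apply: nc0q; rewrite -pq; apply: cdom_param; exact: Bc0.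
apply: (Ck_eq (cpre_open onK) _ (Ck_cst k _ 0)) => q' [cq' nKq'] /=.
have [c0q'|c0q'] := pselect (cdom c0 (param c q')); last by rewrite fout//; exact: cdom_param.
rewrite fin//; last exact: cdom_param.
rewrite h0// ltNge; apply/negP => hq'; apply: nKq'.
by exists (coord c0 (param c q')) => //; rewrite coordK.
Qed.

Lemma sqdist_Ck k (q0 : 'rV[R]_n) (U : set 'rV[R]_n) : Ck k U (fun q => pairing (q - q0) (q - q0)).
Proof.
apply: (@Ck_sub _ _ _ setT) => //; apply: Ck_sum => [|i]; first exact: openT.
have h : Ck k setT (fun q : 'rV[R]_n => (q - q0) 0 i).
  apply: (@Ck_eq _ _ _ _ (fun q : 'rV[R]_n => q 0 i - q0 0 i)); first exact: openT.
    by move=> q _; rewrite !mxE.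
  apply: CkB; first exact: openT.
    by apply: Ck_lin; exact: clinear_coord.
  exact: Ck_cst.
by apply: CkM => //; exact: openT.
Qed.

Lemma cdom_pre_open c (A : set 'rV[R]_n) : open A -> open [set x | cdom c x /\ A (coord c x)].
Proof.
move=> oA; rewrite openE => x [cx Ax]; apply: filterI.
  by apply: open_nbhs_nbhs; split=> //; exact: cdom_open.
by apply: (coord_cts cx); apply: open_nbhs_nbhs.
Qed.

(** The closed balls are those of the sup norm, whereas the covering uses the Euclidean distance,
    whose square is smooth; the Euclidean ball lies in the other one. *)
Lemma finite_atlas : compact [set: M] -> exists (K : nat) (ch : 'I_K -> chart M)
    (ctr : 'I_K -> 'rV[R]_n) (rad : 'I_K -> R),
  [/\ forall k, 0 < rad k,
      forall k q, `|q - ctr k| <= rad k -> cimg (ch k) q &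
      forall x, exists2 k, cdom (ch k) x & pairing (coord (ch k) x - ctr k) (coord (ch k) x - ctr k) < rad k ^+ 2].
Proof.
move=> cM.
have h x : exists cr : chart M * R, [/\ cdom cr.1 x, 0 < cr.2 &
    forall q, `|q - coord cr.1 x| <= cr.2 -> cimg cr.1 q].
  have [c cx] := cdom_cover x.
  have [r r0 hr] := open_ball_sub (@cimg_open c) (cimg_coord cx).
  exists (c, r / 2); split=> //=; first by rewrite divr_gt0.
  by move=> q hq; apply: hr; apply: le_lt_trans hq _; rewrite gtr_pMr// invf_lt1// ltr1n.
have [F hF] := choice h.
pose f x := [set y | cdom (F x).1 y /\ pairing (coord (F x).1 y - coord (F x).1 x) (coord (F x).1 y - coord (F x).1 x) < (F x).2 ^+ 2].
have fo x : [set: M] x -> open (f x).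
  move=> _; apply: (@cdom_pre_open _ ([set q | pairing (q - coord (F x).1 x) (q - coord (F x).1 x) < (F x).2 ^+ 2])).
  have cf : continuous (fun q : 'rV[R]_n => pairing (q - coord (F x).1 x) (q - coord (F x).1 x)).
    by move=> q; apply: (Ck_cont (sqdist_Ck 0 _ setT)).
  exact: open_preim_lt.
have ff x : f x x.
  by have [? r0 ?] := hF x; split=> //; rewrite subrr /pairing big1 ?exprn_gt0// => i _; rewrite mxE mul0r.
have [s hs] := finite_cover cM (fun x _ => fo x I) (fun x _ => ff x).
exists (size s), (fun k => (F (tnth (in_tuple s) k)).1), (fun k => coord (F (tnth (in_tuple s) k)).1 (tnth (in_tuple s) k)), (fun k => (F (tnth (in_tuple s) k)).2).
split=> [k|k|x]; [by case: (hF (tnth (in_tuple s) k))|by case: (hF (tnth (in_tuple s) k))|].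
have [k hk] := hs x I; have [cy hy] := hk.
by exists k.
Qed.

End Charts.

Section Frame.
Context {R : realType} {n : nat} (M : smoothManifold R n).

(* [fld c x j] are the components in the chart [c] of a vector field w_j. The w_j need not be
   orthonormal or independent: [fld_dual] is all that replaces a Riemannian metric below. *)
Record frame := Frame {
  fdim : nat;
  emb : M -> 'rV[R]_fdim;
  fld : chart M -> M -> 'I_fdim -> 'rV[R]_n;
  emb_inj : injective emb;
  emb_C3 : forall j, MCk 3 (fun x => emb x 0 j);
  fld_C2 : forall c j i, Ck 2 (cimg c) (fun q => fld c (param c q) j 0 i);
  fld_trans : forall c c' x j, cdom c x -> cdom c' x ->
    fld c' x j = 'D_(fld c x j) (trans c c') (coord c x);
  fld_dual : forall c x v, cdom c x ->
    \sum_j 'D_v ((fun y => emb y 0 j) \o param c) (coord c x) *: fld c x j = v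
}.

Section Construction.
Variables (K : nat) (ch : 'I_K -> chart M) (ctr : 'I_K -> 'rV[R]_n) (rad : 'I_K -> R).
Hypotheses (rad0 : forall k, 0 < rad k)
  (balls : forall k q, `|q - ctr k| <= rad k -> cimg (ch k) q)
  (covers : forall x, exists2 k, cdom (ch k) x &
     pairing (coord (ch k) x - ctr k) (coord (ch k) x - ctr k) < rad k ^+ 2).

Definition bump k (q : 'rV[R]_n) : R := posp (rad k ^+ 2 - pairing (q - ctr k) (q - ctr k)) ^+ 4.

Lemma bump_C3 k U : Ck 3 U (bump k).
Proof.
apply: (@Ck_sub _ _ _ setT) => //.
have h : Ck 3 setT (fun q => rad k ^+ 2 - pairing (q - ctr k) (q - ctr k)).
  by apply: CkB; [exact: openT|exact: Ck_cst|exact: sqdist_Ck].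
have hv := vCk_R openT h.
exact: (Ck_comp findim_R openT openT (fun _ _ => I) hv (Ck_pospX (R := R) 3 0)).
Qed.

Lemma bump_out k q : rad k < `|q - ctr k| -> bump k q = 0.
Proof.
move=> hq; rewrite /bump /posp max_l ?expr0n// subr_le0.
have [i hi] : exists i, rad k < `|(q - ctr k) 0 i|.
  apply: contrapT => /forallNP h; move: hq; rewrite ltNge => /negP[]; apply: mx_norm_le; first exact: ltW.
  by move=> a j; rewrite ord1 leNgt; apply/negP => hj; apply: (h j).
rewrite /pairing (bigD1 i)//= -[leLHS]addr0 lerD//.
  have h1 := ltW hi; have h0 := ltW (rad0 k).
  by rewrite -expr2 -[leRHS]real_normK ?num_real// lerXn2r// nnegrE.
by apply: sumr_ge0 => j _; rewrite -expr2 sqr_ge0.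
Qed.

Definition lift_fun k (h : 'rV[R]_n -> R) (x : M) : R :=
  if pselect (cdom (ch k) x) then bump k (coord (ch k) x) * h (coord (ch k) x) else 0.

Lemma lift_fun_in k h x : cdom (ch k) x -> lift_fun k h x = bump k (coord (ch k) x) * h (coord (ch k) x).
Proof. by rewrite /lift_fun; case: pselect. Qed.

Lemma lift_fun_out k h x : ~ cdom (ch k) x -> lift_fun k h x = 0.
Proof. by rewrite /lift_fun; case: pselect. Qed.

Lemma lift_fun_C3 k h : Ck 3 setT h -> MCk 3 (lift_fun k h).
Proof.
move=> hh c; apply: (@lift_Ck _ _ _ (ch k) (ctr k) (rad k) (fun q => bump k q * h q)).
- exact: balls.
- apply: CkM; first by apply: cpre_open; exact: cdom_open.
    exact: bump_C3.
  exact: Ck_sub hh.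
- by move=> q hq; rewrite bump_out ?mul0r.
- by move=> x _; exact: lift_fun_in.
- by move=> x _; exact: lift_fun_out.
Qed.

Definition rho k : M -> R := lift_fun k (fun=> 1).
Definition sigma (x : M) : R := \sum_k rho k x ^+ 2.

Lemma rho_in k x : cdom (ch k) x -> rho k x = bump k (coord (ch k) x).
Proof. by move=> h; rewrite /rho lift_fun_in// mulr1. Qed.

Lemma rho_C3 k : MCk 3 (rho k).
Proof. apply: lift_fun_C3; exact: Ck_cst. Qed.

Lemma sigma_C3 : MCk 3 sigma.
Proof.
move=> c; apply: Ck_sum => [|k]; first exact: cimg_open.
by apply: CkX; [exact: cimg_open|exact: rho_C3].
Qed.

Lemma sigma_gt0 x : 0 < sigma x.
Proof.
have [k kx hk] := covers x; rewrite /sigma (bigD1 k)//= ltr_pwDl//.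
  by rewrite exprn_gt0// rho_in// exprn_gt0// lt_max subr_gt0 hk orbT.
by apply: sumr_ge0 => j _; rewrite sqr_ge0.
Qed.

Let J : finType := ('I_K * 'I_n.+1)%type.

(** For each chart k, the functions rho_k (index [ord0]) and rho_k q_i, the usual way to embed a
    compact manifold with finitely many charts. *)
Definition emb_fun (a : J) : M -> R :=
  match unlift ord0 a.2 with
  | None => rho a.1
  | Some i => lift_fun a.1 (fun q => q 0 i)
  end.

(** By the product rule, the sum of the d(rho q_i)(v) times the i-th coordinate vector, minus d
    rho(v) times q, is rho v. Multiplied by rho / [sigma] and summed over the charts, this gives v,
    which is [fld_dual]. *)
Definition fld_loc (a : J) (q : 'rV[R]_n) : 'rV[R]_n :=
  (bump a.1 q / sigma (param (ch a.1) q)) *: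
  match unlift ord0 a.2 with None => - q | Some i => delta_mx 0 i end.

Definition fld_fun (c : chart M) (x : M) (a : J) : 'rV[R]_n :=
  if pselect (cdom (ch a.1) x)
  then 'D_(fld_loc a (coord (ch a.1) x)) (trans (ch a.1) c) (coord (ch a.1) x) else 0.

Lemma fld_fun_in c x a : cdom (ch a.1) x ->
  fld_fun c x a = 'D_(fld_loc a (coord (ch a.1) x)) (trans (ch a.1) c) (coord (ch a.1) x).
Proof. by rewrite /fld_fun; case: pselect. Qed.

Lemma fld_fun_out c x a : ~ cdom (ch a.1) x -> fld_fun c x a = 0.
Proof. by rewrite /fld_fun; case: pselect. Qed.

Lemma emb_fun_C3 a : MCk 3 (emb_fun a).
Proof.
rewrite /emb_fun; case: unliftP => [i _|_]; last exact: rho_C3.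
by apply: lift_fun_C3; apply: Ck_lin; exact: clinear_coord.
Qed.

Lemma fld_loc_C2 a i : Ck 2 (cimg (ch a.1)) (fun q => fld_loc a q 0 i).
Proof.
have oc := @cimg_open _ _ M (ch a.1).
have h1 : Ck 2 (cimg (ch a.1)) (fun q => bump a.1 q / sigma (param (ch a.1) q)).
  apply: CkM => //; first exact/CkW/bump_C3.
  apply: CkV => //; last exact/CkW/sigma_C3.
  by move=> q _; rewrite gt_eqF// sigma_gt0.
have h2 : Ck 2 (cimg (ch a.1)) (fun q : 'rV[R]_n => (match unlift ord0 a.2 with None => - q | Some i => delta_mx 0 i end : 'rV[R]_n) 0 i).
  case: (unlift ord0 a.2) => [j|]; first exact: Ck_cst.
  have hN : Ck 2 (cimg (ch a.1)) (fun q : 'rV[R]_n => - q 0 i).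
    by apply: (CkN oc); apply: Ck_lin; exact: clinear_coord.
  by apply: (Ck_eq oc _ hN) => q _; rewrite mxE.
by apply: (Ck_eq oc _ (CkM oc h1 h2)) => q _; rewrite mxE.
Qed.

Lemma fld_fun_C2 c a i : Ck 2 (cimg c) (fun q => fld_fun c (param c q) a 0 i).
Proof.
set k := a.1; have op : open (cpre (ch k) (cdom c)) by apply: cpre_open; exact: cdom_open.
pose h q := \sum_m fld_loc a q 0 m * 'D_(delta_mx 0 m) (fun q' => trans (ch k) c q' 0 i) q.
have dt q : cpre (ch k) (cdom c) q -> differentiable (trans (ch k) c) q.
  by move=> hq; apply: (vCk_diff (findim_rV _) (trans_vCk (ch k) c 1) hq).
have hE q : cpre (ch k) (cdom c) q -> h q = 'D_(fld_loc a q) (trans (ch k) c) q 0 i.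
  move=> hq; rewrite -(derive_coord _ (clinear_coord i) (dt _ hq)).
  rewrite derive_rV //.
  exact: (trans_vCk (ch k) c 1 (clinear_coord i)).1.
apply: (@lift_Ck _ _ _ (ch k) (ctr k) (rad k) h (fun x => fld_fun c x a 0 i)).
- exact: balls.
- apply: Ck_sum => // m; apply: CkM => //.
    by apply: Ck_sub (fld_loc_C2 a m) => q [].
  exact: (trans_vCk (ch k) c 3 (clinear_coord i)).2.
- move=> q hq; rewrite /h big1// => m _.
  by rewrite mxE bump_out// mul0r mul0r mul0r.
- move=> x cx kx; rewrite fld_fun_in//.
  by rewrite hE//; split; [exact: cimg_coord|rewrite coordK].
- by move=> x cx kx; rewrite fld_fun_out// mxE.
Qed.

Lemma fld_fun_trans c c' x a : cdom c x -> cdom c' x ->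
  fld_fun c' x a = 'D_(fld_fun c x a) (trans c c') (coord c x).
Proof.
move=> cx c'x; rewrite /fld_fun; case: pselect => kx; last by rewrite derive0.
exact: (derive_trans _ kx cx (trans_diff cx c'x)).
Qed.

(** A positive value of rho_k puts both points into the chart k, where the coordinates are quotients
    of the remaining functions by rho_k. *)
Lemma emb_fun_inj x y : (forall a, emb_fun a x = emb_fun a y) -> x = y.
Proof.
move=> h; have [k kx hk] := covers x.
have rx : 0 < rho k x by rewrite rho_in// exprn_gt0// lt_max subr_gt0 hk orbT.
have exy := h (k, ord0); rewrite /emb_fun /= unlift_none in exy.
have ky : cdom (ch k) y.
  by apply: contrapT => ky; move: rx; rewrite exy /rho lift_fun_out// ltxx.
rewrite -(coordK kx) -(coordK ky); congr (param _ _); apply/rowP => i.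
have := h (k, lift ord0 i); rewrite /emb_fun /= liftK !lift_fun_in//.
rewrite -!rho_in// -exy => /mulfI; apply; exact: lt0r_neq0.
Qed.

Lemma derive_emb_loc k (q : 'rV[R]_n) v :
  \sum_(a < n.+1) 'D_v (fun q => bump k q * (match unlift ord0 a with None => 1 | Some i => q 0 i end)) q *: fld_loc (k, a) q
  = (bump k q ^+ 2 / sigma (param (ch k) q)) *: v.
Proof.
have db : differentiable (bump k) q by exact: (bump_C3 k setT).1.
have dc i : differentiable (fun q : 'rV[R]_n => q 0 i) q by exact: differentiable_coord.
rewrite big_ord_recl /= unlift_none /fld_loc /= unlift_none.
under eq_fun do rewrite mulr1.
under eq_bigr => i _.
  rewrite liftK /= (@deriveM _ _ (bump k) (fun q : 'rV[R]_n => q 0 i)); [|exact: diff_derivable..].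
  rewrite (derive_clinear q v (clinear_coord i)).
  over.
apply/rowP => l; rewrite !mxE summxE.
rewrite (bigD1 l)//= big1 ?addr0 => [|i il].
  rewrite !mxE !eqxx /= mulr1 /GRing.scale /=; ring.
by rewrite !mxE [l == i]eq_sym (negPf il) !mulr0.
Qed.

Lemma fld_fun_dual k c x v : cdom c x ->
  \sum_(a < n.+1) 'D_v (emb_fun (k, a) \o param c) (coord c x) *: fld_fun c x (k, a)
  = (rho k x ^+ 2 / sigma x) *: v.
Proof.
move=> cx; have [kx|kx] := pselect (cdom (ch k) x); last first.
  rewrite [rho k x]lift_fun_out// expr0n mul0r scale0r big1// => a _.
  by rewrite fld_fun_out// scaler0.
set q := coord (ch k) x; set v' := 'D_v (trans c (ch k)) (coord c x).
have cq : cimg (ch k) q by exact: cimg_coord.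
pose F (a : 'I_n.+1) (q : 'rV[R]_n) := bump k q * (match unlift ord0 a with None => 1 | Some i => q 0 i end).
have nearF a : \forall q' \near q, (emb_fun (k, a) \o param (ch k)) q' = F a q'.
  apply: (near_in_open (@cimg_open _ _ M (ch k))) => // q' cq'.
  have kq' := cdom_param cq'.
  rewrite /= /emb_fun /F /=; case: (unlift ord0 a) => [i|]; first by rewrite lift_fun_in// paramK.
  by rewrite rho_in// paramK// mulr1.
have dg : differentiable (trans (ch k) c) q by exact: trans_diff.
have dZ b w : b *: 'D_w (trans (ch k) c) q = 'd (trans (ch k) c) q (b *: w).
  by rewrite deriveE// linearZ.
under eq_bigr => a _.
  rewrite (derive_trans v cx kx); last exact: (emb_fun_C3 (k, a) (ch k)).1.
  rewrite -/q -/v' (near_eq_derive _ (nearF a)) fld_fun_in//=.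
  rewrite -/q dZ.
  over.
rewrite /= -linear_sum derive_emb_loc linearZ /= -deriveE// derive_trans_id//.
by rewrite rho_in// /q coordK.
Qed.

Lemma frame_of_atlas : inhabited frame.
Proof.
pose e x := \row_(j < #|J|) emb_fun (enum_val j) x.
pose w c x (j : 'I_#|J|) := fld_fun c x (enum_val j).
have eE j : (fun x => e x 0 j) = emb_fun (enum_val j) by apply/funext => x; rewrite mxE.
split; apply: (@Frame _ e w).
- move=> x y /rowP exy; apply: emb_fun_inj => a.
  by have := exy (enum_rank a); rewrite !mxE enum_rankK.
- by move=> j; rewrite eE; exact: emb_fun_C3.
- by move=> c j i; exact: fld_fun_C2.
- by move=> c c' x j cx c'x; exact: fld_fun_trans.
move=> c x v cx; under eq_bigr do rewrite eE.
rewrite -(big_enum_val (A := predT) (fun a => 'D_v (emb_fun a \o param c) (coord c x) *: fld_fun c x a)) /=.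
rewrite (eq_bigl xpredT)//.
rewrite -(pair_bigA _ (fun k a => 'D_v (emb_fun (k, a) \o param c) (coord c x) *: fld_fun c x (k, a))) /=.
under eq_bigr do rewrite fld_fun_dual//.
by rewrite -scaler_suml -mulr_suml divff ?scale1r// gt_eqF// sigma_gt0.
Qed.

End Construction.

Lemma frame_exists : compact [set: M] -> inhabited frame.
Proof.
move=> /finite_atlas[K [ch [ctr [rad [r0 balls covers]]]]].
exact: (frame_of_atlas r0 balls covers).
Qed.

End Frame.

Arguments fdim {R n M} f.
Arguments emb {R n M} f x.
Arguments fld {R n M} f c x j.
Arguments emb_inj {R n M} f.
Arguments emb_C3 {R n M} f j.
Arguments fld_C2 {R n M} f c j i.
Arguments fld_trans {R n M} f {c c' x} j.
Arguments fld_dual {R n M} f {c x} v.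

(** * Partial derivatives and the Euclidean pairing *)

Section Partial.
Context {R : realType}.

Lemma derive_pair1 (V W : normedModType R) (F : V * W -> R) q p v :
  'D_(v, 0) F (q, p) = 'D_v (fun q => F (q, p)) q.
Proof.
have E : (fun h : R => h^-1 *: ((F \o shift (q, p)) (h *: (v, 0)) - F (q, p))) =
    (fun h : R => h^-1 *: (((fun q => F (q, p)) \o shift q) (h *: v) - F (q, p))).
  apply/funext => h /=; congr (_ *: (F _ - _)).
  by apply: injective_projections; rewrite /= ?scaler0 ?add0r.
by rewrite /derive E.
Qed.

Lemma derive_pair2 (V W : normedModType R) (F : V * W -> R) q p v :
  'D_(0, v) F (q, p) = 'D_v (fun p => F (q, p)) p.
Proof.
have E : (fun h : R => h^-1 *: ((F \o shift (q, p)) (h *: (0, v)) - F (q, p))) =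
    (fun h : R => h^-1 *: (((fun p => F (q, p)) \o shift p) (h *: v) - F (q, p))).
  apply/funext => h /=; congr (_ *: (F _ - _)).
  by apply: injective_projections; rewrite /= ?scaler0 ?add0r.
by rewrite /derive E.
Qed.

Lemma derive_pair (V W : normedModType R) (F : V * W -> R) q p v w : differentiable F (q, p) ->
  'D_(v, w) F (q, p) = 'D_v (fun q => F (q, p)) q + 'D_w (fun p => F (q, p)) p.
Proof.
move=> dF; rewrite -derive_pair1 -derive_pair2 !deriveE// -linearD.
by congr ('d F _ _); apply: injective_projections; rewrite /= ?addr0 ?add0r.
Qed.

Lemma norm_pair_le (V W : normedModType R) (v : V) (w : W) : `|(v, w)| <= `|v| + `|w|.
Proof. by rewrite prod_normE /= ge_max lerDl lerDr !normr_ge0. Qed.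

End Partial.

Section Pairing.
Context {R : realType}.

Lemma pairingDl n (u v w : 'rV[R]_n) : pairing (u + v) w = pairing u w + pairing v w.
Proof. by rewrite -big_split; apply: eq_bigr => i _; rewrite mxE mulrDl. Qed.

Lemma pairingC n (u v : 'rV[R]_n) : pairing u v = pairing v u.
Proof. by apply: eq_bigr => i _; rewrite mulrC. Qed.

Lemma pairingZl n a (u v : 'rV[R]_n) : pairing (a *: u) v = a * pairing u v.
Proof. by rewrite mulr_sumr; apply: eq_bigr => i _; rewrite mxE mulrA. Qed.

Lemma pairingDr n (u v w : 'rV[R]_n) : pairing u (v + w) = pairing u v + pairing u w.
Proof. by rewrite pairingC pairingDl !(pairingC u). Qed.

Lemma pairingZr n a (u v : 'rV[R]_n) : pairing u (a *: v) = a * pairing u v.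
Proof. by rewrite pairingC pairingZl pairingC. Qed.

Lemma pairingNl n (u v : 'rV[R]_n) : pairing (- u) v = - pairing u v.
Proof. by rewrite -scaleN1r pairingZl mulN1r. Qed.

Lemma pairingNr n (u v : 'rV[R]_n) : pairing u (- v) = - pairing u v.
Proof. by rewrite pairingC pairingNl pairingC. Qed.

Lemma pairingBl n (u v w : 'rV[R]_n) : pairing (u - v) w = pairing u w - pairing v w.
Proof. by rewrite pairingDl pairingNl. Qed.

Lemma pairingBr n (u v w : 'rV[R]_n) : pairing u (v - w) = pairing u v - pairing u w.
Proof. by rewrite pairingDr pairingNr. Qed.

Lemma pairing0l n (u : 'rV[R]_n) : pairing 0 u = 0.
Proof. by rewrite /pairing big1// => i _; rewrite mxE mul0r. Qed.

Lemma pairing0r n (u : 'rV[R]_n) : pairing u 0 = 0.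
Proof. by rewrite pairingC pairing0l. Qed.

Lemma pairing_ge0 n (u : 'rV[R]_n) : 0 <= pairing u u.
Proof. by apply: sumr_ge0 => i _; rewrite -expr2 sqr_ge0. Qed.

Lemma pairing_bnd n (u v : 'rV[R]_n) : `|pairing u v| <= n%:R * (`|u| * `|v|).
Proof.
apply: le_trans (ler_norm_sum _ _ _) _.
rewrite mulr_natl -[X in _ *+ X](card_ord n) -sumr_const; apply: ler_sum => i _.
by rewrite normrM ler_pM// coord_le_norm.
Qed.

Lemma norm_le_pairing n (u : 'rV[R]_n) : `|u| ^+ 2 <= pairing u u.
Proof.
have [->|u0] := eqVneq u 0; first by rewrite normr0 expr0n pairing0l.
have [ij uE] := @mx_norm_neq0 _ _ _ u ltac:(by rewrite -[mx_norm _]/(`|u|) normr_eq0).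
rewrite -[`|u|]/(mx_norm u) uE real_normK ?num_real// /pairing (bigD1 ij.2)//= (ord1 ij.1) -expr2 lerDl.
by apply: sumr_ge0 => i _; rewrite -expr2 sqr_ge0.
Qed.

Lemma pairing_le_norm n (u : 'rV[R]_n) : pairing u u <= n%:R * `|u| ^+ 2.
Proof. by have := pairing_bnd u u; rewrite ger0_norm ?pairing_ge0// expr2. Qed.

Lemma pairing_delta n (y : 'rV[R]_n) i : pairing y (delta_mx 0 i) = y 0 i.
Proof.
rewrite /pairing (bigD1 i)//= mxE !eqxx mulr1 big1 ?addr0// => j ji.
by rewrite mxE eqxx (negPf ji) mulr0.
Qed.

Lemma cvg_rV n (T : Type) (G : set_system T) (FG : Filter G) (f : T -> 'rV[R]_n) (a : 'rV[R]_n) :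
  (forall j, f x 0 j @[x --> G] --> a 0 j) -> f @ G --> a.
Proof.
move=> h; have h2 : \sum_j f x 0 j *: (delta_mx 0 j : 'rV[R]_n) @[x --> G] --> \sum_j a 0 j *: (delta_mx 0 j : 'rV[R]_n).
  by apply: cvg_big => [|j _]; [exact: add_continuous|exact: cvgZr_tmp].
rewrite -(row_sum_delta a) in h2.
suff <- : (fun x => \sum_j f x 0 j *: (delta_mx 0 j : 'rV[R]_n)) = f by [].
by apply/funext => x; rewrite -row_sum_delta.
Qed.

Lemma coord_cvg n (a : 'rV[R]_n) i : {for a, continuous (fun v : 'rV[R]_n => v 0 i)}.
Proof. by apply: differentiable_continuous; exact: differentiable_coord. Qed.

Lemma cvg_pairing n (T : Type) (G : set_system T) (FG : Filter G) (f g : T -> 'rV[R]_n) (a b : 'rV[R]_n) :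
  f @ G --> a -> g @ G --> b -> pairing (f x) (g x) @[x --> G] --> pairing a b.
Proof.
move=> hf hg; apply: cvg_big => [|i _]; first exact: add_continuous.
by apply: cvgM; [exact: (cvg_comp f (fun v : 'rV[R]_n => v 0 i) hf (@coord_cvg n a i))|
  exact: (cvg_comp g (fun v : 'rV[R]_n => v 0 i) hg (@coord_cvg n b i))].
Qed.

End Pairing.

(** * Jets on M x V, oblique projection and nearest points *)

Section Jets.
Context {R : realType} {n : nat} {M : smoothManifold R n} (F : frame M).
Notation D := (fdim F).
Notation e := (emb F).

Definition ecoord j : M -> R := fun x => e x 0 j.

Definition chart_at (x : M) : chart M := sval (cid (cdom_cover x)).
Lemma chart_atP x : cdom (chart_at x) x. Proof. exact: (svalP (cid (cdom_cover x))). Qed.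

(** The numbers df(w_j). By [fld_dual] they represent df against de ([gradP]), which gives a
    chart-free gradient in R^D. *)
Definition grad (f : M -> R) (x : M) : 'rV[R]_D :=
  \row_j 'D_(fld F (chart_at x) x j) (f \o param (chart_at x)) (coord (chart_at x) x).

Lemma gradE f c x j : cdom c x -> differentiable (f \o param c) (coord c x) ->
  grad f x 0 j = 'D_(fld F c x j) (f \o param c) (coord c x).
Proof.
move=> cx df; rewrite mxE (derive_trans _ (chart_atP x) cx df).
by rewrite -fld_trans//; exact: chart_atP.
Qed.

Definition dE c x v : 'rV[R]_D := \row_j 'D_v (ecoord j \o param c) (coord c x).

Lemma ecoord_diff j c x : cdom c x -> differentiable (ecoord j \o param c) (coord c x).
Proof. by move=> cx; have [h _] := emb_C3 F j c; exact: h (cimg_coord cx). Qed.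

Lemma gradP f c x v : cdom c x -> differentiable (f \o param c) (coord c x) ->
  pairing (grad f x) (dE c x v) = 'D_v (f \o param c) (coord c x).
Proof.
move=> cx df; rewrite -[in RHS](fld_dual F v cx) deriveE// linear_sum; apply: eq_bigr => j _.
by rewrite (gradE _ cx df) linearZ /= mxE mulrC -deriveE.
Qed.

(** Joint regularity in a point of M and a vector parameter; V will be a space of momenta, of times
    and momenta, or zero-dimensional. *)
Definition JCk (V : normedModType R) k (f : M -> V -> R) : Prop :=
  forall c, Ck k [set z : 'rV[R]_n * V | cimg c z.1] (fun z => f (param c z.1) z.2).

Lemma jdom_open (V : normedModType R) c : open [set z : 'rV[R]_n * V | @cimg _ _ M c z.1].
Proof. by apply: open_comp (@cimg_open _ _ M c) => p _; exact: cvg_fst. Qed.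

Lemma MCk_cts k f : MCk k f -> continuous (f : M -> R).
Proof.
move=> hf x; have cx := chart_atP x; set c := chart_at x in cx.
have h : f \o param c @ coord c x --> f x.
  by have := Ck_cont (hf c) (cimg_coord cx); rewrite /prop_for /continuous_at /= coordK.
apply: cvg_trans (cvg_comp _ _ (coord_cts cx) h).
apply: near_eq_cvg; apply: (near_in_open (cdom_open c)) => // y cy.
by rewrite /= coordK.
Qed.

Lemma JCk_cts (V : normedModType R) k (f : M -> V -> R) :
  JCk k f -> continuous (fun z : M * V => f z.1 z.2).
Proof.
move=> hf [x p]; have cx := chart_atP x; set c := chart_at x in cx.
pose g (z : 'rV[R]_n * V) := f (param c z.1) z.2.
have h : g @ (coord c x, p) --> f x p.
  have := Ck_cont (hf c) (x := (coord c x, p)) (cimg_coord cx).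
  by rewrite /prop_for /continuous_at /g /= coordK.
have h2 : (coord c z.1, z.2) @[z --> (x, p)] --> (coord c x, p).
  have h3 : coord c z.1 @[z --> (x, p)] --> coord c x.
    by apply: (cvg_comp fst (coord c) _ (coord_cts cx)); exact: cvg_fst.
  have h4 : z.2 @[z --> (x, p)] --> p by exact: cvg_snd.
  exact: cvg_pair h3 h4.
apply: cvg_trans (cvg_comp _ _ h2 h).
apply: near_eq_cvg; have o : open [set z : M * V | cdom c z.1].
  by apply: open_comp (cdom_open c) => z _; exact: cvg_fst.
apply: (near_in_open o) => // -[y p'] /= cy.
by rewrite /g /= coordK.
Qed.

Lemma emb_cts : continuous e.
Proof. by move=> x; apply: cvg_rV => j; exact: (MCk_cts (emb_C3 F j)). Qed.

Lemma JCk_slice (V : normedModType R) k (f : M -> V -> R) (p : V) : findim V -> JCk k f -> MCk k (f^~ p).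
Proof.
move=> fV hf c; have oc := @cimg_open _ _ M c.
have hp : vCk k (cimg c) (fun q : 'rV[R]_n => (q, p)).
  by apply: vCk_pair => //; [exact: vCk_id|exact: vCk_cst].
exact: (Ck_comp (findim_pair (findim_rV n) fV) oc (@jdom_open V c) _ hp (hf c)).
Qed.

Lemma JCk_fib (V : normedModType R) k (f : M -> V -> R) x : findim V -> JCk k f -> Ck k setT (f x).
Proof.
move=> fV hf; have cx := chart_atP x; set c := chart_at x in cx.
have hp : vCk k setT (fun p : V => (coord c x, p)).
  by apply: vCk_pair; [exact: openT|exact: vCk_cst|exact: vCk_id].
have h := Ck_comp (f := fun p : V => (coord c x, p)) (findim_pair (findim_rV n) fV) openT (@jdom_open V c) (fun _ _ => cimg_coord cx) hp (hf c).
by apply: (Ck_eq openT _ h) => p _ /=; rewrite coordK.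
Qed.

Lemma JCk_grad (V : normedModType R) k (f : M -> V -> R) j : (k <= 2)%N -> findim V ->
  JCk k.+1 f -> JCk k (fun x p => grad (f^~ p) x 0 j).
Proof.
move=> k2 fV hf c; have od := @jdom_open V c.
pose g (z : 'rV[R]_n * V) := f (param c z.1) z.2.
have h : Ck k [set z : 'rV[R]_n * V | cimg c z.1]
    (fun z => \sum_i fld F c (param c z.1) j 0 i * 'D_(delta_mx 0 i, 0) g z).
  apply: Ck_sum => // i; apply: CkM => //; last exact: (hf c).2.
  exact: (Ck_comp (f := fst) (findim_rV n) od (@cimg_open _ _ M c) (fun _ h => h)
    (@vCk_fst _ _ V k _) (Ck_le k2 (fld_C2 F c j i))).
apply: (Ck_eq od _ h) => -[q p] /= cq.
have cx := cdom_param cq.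
have dg : differentiable (fun q => g (q, p)) q by exact: (JCk_slice p fV hf c).1.
rewrite (gradE j cx) ?paramK//.
rewrite [RHS]derive_rV//; apply: eq_bigr => i _.
by rewrite derive_pair1.
Qed.

(** Since v is the sum of the de_j(v) w_j with w_j locally bounded, |v| is at most a constant times
    |de(v)|, and de(v) is the increment of [e] up to a quadratic error that is absorbed on a small
    ball. *)
Lemma emb_local c x0 : cdom c x0 -> exists r C, [/\ 0 < r, 0 <= C &
  forall q q', `|q - coord c x0| < r -> `|q' - coord c x0| < r ->
  [/\ cimg c q, `|q' - q| <= C * `|e (param c q') - e (param c q)| &
     `|e (param c q') - e (param c q) - dE c (param c q) (q' - q)| <= C * `|q' - q| ^+ 2]].
Proof.
move=> cx0; have oc := @cimg_open _ _ M c; have cq0 := cimg_coord cx0.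
have [r0 r00 hr0] := open_ball_sub oc cq0.
have h1 j := C2_local (findim_rV n) oc (CkW (emb_C3 F j c)) cq0.
have [rr hrr] := choice h1; have [CC hCC] := choice hrr.
have [r1 r10 hr1] : exists2 r : R, 0 < r & forall z, `|z - coord c x0| < r -> forall j, `|z - coord c x0| < rr j.
  by apply: near_fam => j; exists (rr j) => //; case: (hCC j).
pose C := \sum_j CC j.
have C0 : 0 <= C by apply: sumr_ge0 => j _; case: (hCC j).
have CjC j : CC j <= C.
  by rewrite /C (bigD1 j)//= lerDl; apply: sumr_ge0 => k _; case: (hCC k).
have hw (j : 'I_D) : exists2 r : R, 0 < r & forall z, `|z - coord c x0| < r ->
    forall i, `|fld F c (param c z) j 0 i| <= \sum_i (`|fld F c x0 j 0 i| + 1).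
  apply: near_fam => i; have := cont_bnd (Ck_cont (fld_C2 F c j i) cq0).
  rewrite coordK// => -[r' r'0 hr']; exists r' => // z /hr' /le_trans; apply.
  by rewrite (bigD1 i)//= lerDl; apply: sumr_ge0 => k _; rewrite addr_ge0.
have [r2 r20 hr2] := near_fam hw.
pose W := \sum_j \sum_i (`|fld F c x0 j 0 i| + 1).
have W0 : 0 <= W by apply: sumr_ge0 => j _; apply: sumr_ge0 => i _; rewrite addr_ge0.
have hW z j : `|z - coord c x0| < r2 -> `|fld F c (param c z) j| <= W.
  move=> hz; apply: mx_norm_le => // a i; rewrite ord1; apply: le_trans (hr2 _ hz j i) _.
  rewrite /W (bigD1 j)//= lerDl; apply: sumr_ge0 => k _.
  by apply: sumr_ge0 => l _; rewrite addr_ge0.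
pose B := D%:R * W; have B0 : 0 <= B by rewrite mulr_ge0.
(* On this ball the quadratic error, multiplied by [B], is at most half of |v|. *)
pose r3 := (4 * (B * C + 1))^-1; have r30 : 0 < r3 by rewrite invr_gt0 mulr_gt0// ltr_pwDr ?mulr_ge0.
exists (Num.min (Num.min r0 r1) (Num.min r2 r3)), (C + 2 * B); split.
- by rewrite !lt_min r00 r10 r20.
- by rewrite addr_ge0 ?mulr_ge0.
move=> q q'; rewrite !lt_min => /andP[/andP[q0 q1] /andP[q2 q3]] /andP[/andP[q'0 q'1] /andP[q'2 q'3]].
have cq := hr0 _ q0; set x := param c q; set x' := param c q'; set v := q' - q.
have cx : cdom c x by exact: cdom_param.
have tay j : `|(e x' - e x - dE c x v) 0 j| <= CC j * `|v| ^+ 2.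
  have [_ _ h] := hCC j; have := h q q' (hr1 _ q1 j) (hr1 _ q'1 j).
  by rewrite !mxE /x paramK.
have tayC : `|e x' - e x - dE c x v| <= C * `|v| ^+ 2.
  apply: mx_norm_le => [|a j]; first by rewrite mulr_ge0 ?sqr_ge0.
  by rewrite ord1; apply: le_trans (tay j) _; rewrite ler_wpM2r ?sqr_ge0.
split=> //; last by apply: le_trans tayC _; rewrite ler_wpM2r ?sqr_ge0// lerDl mulr_ge0.
have v1 : `|v| <= B * `|dE c x v|.
  rewrite -{1}(fld_dual F v cx); apply: le_trans (ler_norm_sum _ _ _) _.
  rewrite /B -mulrA mulr_natl -[X in _ *+ X](card_ord D) -sumr_const; apply: ler_sum => j _.
  rewrite normrZ mulrC; apply: ler_pM => //; first exact: hW.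
  by have := coord_le_norm (dE c x v) 0 j; rewrite mxE.
have dEn : `|dE c x v| <= `|e x' - e x| + C * `|v| ^+ 2.
  have -> : dE c x v = (e x' - e x) - (e x' - e x - dE c x v) by rewrite opprB addrC subrK.
  by apply: le_trans (ler_normB _ _) _; rewrite lerD2l.
have vr : `|v| <= 2 * r3.
  have -> : v = (q' - coord c x0) - (q - coord c x0) by rewrite opprB addrA subrK.
  by apply: le_trans (ler_normB _ _) _; move: q3 q'3; lra.
have small : B * (C * `|v| ^+ 2) <= `|v| / 2.
  rewrite mulrA expr2 mulrA [leRHS]mulrC; apply: ler_wpM2r => //.
  apply: (@le_trans _ _ (B * C * (2 * r3))); first by rewrite ler_wpM2l ?mulr_ge0.
  have -> : B * C * (2 * r3) = (B * C) / (B * C + 1) / 2 by rewrite /r3; field; rewrite gt_eqF// ltr_pwDr ?mulr_ge0.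
  by rewrite ler_piMl ?invr_ge0// ler_pdivrMr ?mul1r ?lerDl// ltr_pwDr ?mulr_ge0.
have := ler_wpM2l B0 dEn; rewrite mulrDr => h.
have h2 : `|v| <= 2 * B * `|e x' - e x| by lra.
by apply: le_trans h2 _; rewrite ler_wpM2r// lerDr.
Qed.

Lemma grad_cts (V : normedModType R) (f : M -> V -> R) : findim V -> JCk 1 f ->
  continuous (fun z : M * V => grad (f^~ z.2) z.1).
Proof.
move=> fV hf z; apply: cvg_rV => j.
exact: (JCk_cts (f := fun x p => grad (f^~ p) x 0 j) (JCk_grad j (isT : (0 <= 2)%N) fV hf)).
Qed.

Lemma fib_derive_cts (V : normedModType R) (f : M -> V -> R) (v : V) : JCk 1 f ->
  continuous (fun z : M * V => 'D_v (f z.1) z.2).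
Proof.
move=> hf; have h : JCk 0 (fun x p => 'D_v (f x) p).
  move=> c; have h0 : Ck 0 _ ('D_((0 : 'rV[R]_n), v) (fun z : 'rV[R]_n * V => f (param c z.1) z.2)) := (hf c).2 _.
  apply: (@Ck_eq _ _ 0 _ _ (fun z : 'rV[R]_n * V => 'D_v (f (param c z.1)) z.2) (@jdom_open V c) _ h0) => -[q p] /= cq.
  by rewrite derive_pair2.
exact: (JCk_cts h).
Qed.

Lemma fib_derive_dir_cts (V : normedModType R) (f : M -> V -> R) : findim V -> JCk 1 f ->
  continuous (fun z : (M * V) * V => 'D_z.2 (f z.1.1) z.1.2).
Proof.
move=> fV hf; have [d [b [l [hl E]]]] := fV.
have -> : (fun z : (M * V) * V => 'D_z.2 (f z.1.1) z.1.2) =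
    (fun z => \sum_i l i z.2 * 'D_(b i) (f z.1.1) z.1.2).
  apply/funext => -[[x p] v] /=; rewrite (derive_coords (E v))//.
  exact: (JCk_fib x fV hf).1.
move=> [[x p] v]; apply: cvg_big => [|i _]; first exact: add_continuous.
apply: cvgM.
  apply: (cvg_comp snd (l i)); first exact: cvg_snd.
  exact: differentiable_continuous ((hl i).2 v).
apply: (cvg_comp fst (fun z => 'D_(b i) (f z.1) z.2)); first exact: cvg_fst.
exact: fib_derive_cts.
Qed.

(** The remainder of a first-order expansion in which the displacement of the base point is the
    chord in R^D, so that no chart occurs and far points are allowed. *)
Definition jet_err (V : normedModType R) (f : M -> V -> R) x p x' p' : R :=
  f x' p' - f x p - pairing (grad (f^~ p) x) (e x' - e x) - 'D_(p' - p) (f x) p.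

Lemma jet_local (V : normedModType R) (f : M -> V -> R) (x0 : M) (p0 : V) : findim V -> JCk 2 f ->
  exists C, 0 <= C /\ \forall z \near (((x0, p0), (x0, p0)) : (M * V) * (M * V)),
    `|jet_err f z.1.1 z.1.2 z.2.1 z.2.2| <= C * (`|e z.2.1 - e z.1.1| ^+ 2 + `|z.2.2 - z.1.2| ^+ 2).
Proof.
move=> fV hf; have cx0 := chart_atP x0; set c := chart_at x0 in cx0.
have [r1 [C1 [r10 C10 h1]]] := emb_local cx0.
pose g (z : 'rV[R]_n * V) := f (param c z.1) z.2.
have [r2 [C2 [r20 C20 h2]]] := C2_local (z0 := (coord c x0, p0)) (findim_pair (findim_rV n) fV)
  (@jdom_open V c) (hf c) (cimg_coord cx0).
pose G := `|grad (f^~ p0) x0| + 1.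
exists (2 * C2 * C1 ^+ 2 + D%:R * G * C1 ^+ 3 + 2 * C2); split.
  by rewrite !addr_ge0 ?mulr_ge0 ?exprn_ge0 ?addr_ge0.
have nc : \forall z \near ((x0, p0) : M * V), [/\ cdom c z.1, `|coord c z.1 - coord c x0| < r1,
    `|coord c z.1 - coord c x0| < r2, `|z.2 - p0| < r2 & `|grad (f^~ z.2) z.1| <= G].
  have n1 : \forall z \near ((x0, p0) : M * V), cdom c z.1.
    have o : open [set z : M * V | cdom c z.1] by apply: open_comp (cdom_open c) => z _; exact: cvg_fst.
    exact: (near_in_open o).
  have cq : coord c z.1 @[z --> (x0, p0)] --> coord c x0.
    by apply: (cvg_comp fst (coord c) _ (coord_cts cx0)); exact: cvg_fst.
  have n2 r : 0 < r -> \forall z \near ((x0, p0) : M * V), `|coord c z.1 - coord c x0| < r.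
    move=> r0; move/cvgrPdist_lt : cq => /(_ _ r0); apply: filterS => z; by rewrite distrC.
  have n3 : \forall z \near ((x0, p0) : M * V), `|z.2 - p0| < r2.
    have cp : z.2 @[z --> (x0, p0)] --> p0 by exact: cvg_snd.
    move/cvgrPdist_lt : cp => /(_ _ r20); apply: filterS => z; by rewrite distrC.
  have n4 : \forall z \near ((x0, p0) : M * V), `|grad (f^~ z.2) z.1| <= G.
    have := @grad_cts V f fV (fun c => CkW (hf c)) (x0, p0).
    move=> /cvgrPdist_lt/(_ _ ltr01); apply: filterS => z /= hz.
    have -> : grad (f^~ z.2) z.1 = grad (f^~ p0) x0 - (grad (f^~ p0) x0 - grad (f^~ z.2) z.1).
      by rewrite opprB addrC subrK.
    by apply: le_trans (ler_normB _ _) _; rewrite lerD2l ltW.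
  near=> z; split; near: z; [exact: n1|exact: n2|exact: n2|exact: n3|exact: n4].
have nc2 : \forall z \near (((x0, p0), (x0, p0)) : (M * V) * (M * V)), [/\ cdom c z.1.1, `|coord c z.1.1 - coord c x0| < r1,
    `|coord c z.1.1 - coord c x0| < r2, `|z.1.2 - p0| < r2 & `|grad (f^~ z.1.2) z.1.1| <= G] /\
    [/\ cdom c z.2.1, `|coord c z.2.1 - coord c x0| < r1,
    `|coord c z.2.1 - coord c x0| < r2, `|z.2.2 - p0| < r2 & `|grad (f^~ z.2.2) z.2.1| <= G].
  by exists ([set z | [/\ cdom c z.1, `|coord c z.1 - coord c x0| < r1,
    `|coord c z.1 - coord c x0| < r2, `|z.2 - p0| < r2 & `|grad (f^~ z.2) z.1| <= G]],
    [set z | [/\ cdom c z.1, `|coord c z.1 - coord c x0| < r1,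
    `|coord c z.1 - coord c x0| < r2, `|z.2 - p0| < r2 & `|grad (f^~ z.2) z.1| <= G]]) => // -[z z'] [].
apply: filterS nc2 => -[[x p] [x' p']] /= [[cx q1 q2 pp gG] [cx' q1' q2' pp' _]].
set q := coord c x in q1 q2; set q' := coord c x' in q1' q2'.
have cq : cimg c q by exact: cimg_coord.
have px : param c q = x by rewrite /q coordK.
have px' : param c q' = x' by rewrite /q' coordK.
have [_ v1 tay] := h1 _ _ q1 q1'; rewrite px px' in v1 tay.
have sm (a : 'rV[R]_n) (b : V) : `|a| < r2 -> `|b| < r2 -> `|(a, b)| < r2.
  by move=> ha hb; rewrite prod_normE gt_max ha hb.
have := h2 (q, p) (q', p') (sm (q - _) (p - _) q2 pp) (sm (q' - _) (p' - _) q2' pp').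
set v := q' - q in v1 tay *; set w := p' - p.
rewrite [(q', p') - (q, p)](_ : _ = (v, w))// /= px px' => h3.
have dg : differentiable g (q, p) by exact: (hf c).1.
rewrite derive_pair//= px in h3.
have dq : differentiable ((f^~ p) \o param c) q by exact: (JCk_slice p fV hf c).1.
rewrite (_ : 'D_v _ q = pairing (grad (f^~ p) x) (dE c x v)) in h3; last by rewrite (gradP v cx dq).
have -> : jet_err f x p x' p' = (f x' p' - f x p - (pairing (grad (f^~ p) x) (dE c x v) + 'D_w (f x) p))
   - pairing (grad (f^~ p) x) (e x' - e x - dE c x v).
  by rewrite /jet_err -/w [in RHS]pairingBr; ring.
apply: le_trans (ler_normB _ _) _.
have b2 := pairing_bnd (grad (f^~ p) x) (e x' - e x - dE c x v).
set E := `|e x' - e x| in v1 *.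
have v2 : `|v| ^+ 2 <= C1 ^+ 2 * E ^+ 2.
  have E0 : 0 <= E by exact: normr_ge0.
  by rewrite -exprMn lerXn2r ?nnegrE ?mulr_ge0.
have G0 : 0 <= G by rewrite addr_ge0.
have b3 : `|pairing (grad (f^~ p) x) (e x' - e x - dE c x v)| <= D%:R * (G * (C1 * (C1 ^+ 2 * E ^+ 2))).
  apply: le_trans b2 _; apply: ler_wpM2l => //; apply: ler_pM => //.
  by apply: le_trans tay _; exact: ler_wpM2l.
have n2 : `|(v, w)| ^+ 2 <= 2 * `|v| ^+ 2 + 2 * `|w| ^+ 2.
  apply: (@le_trans _ _ ((`|v| + `|w|) ^+ 2)).
    by rewrite lerXn2r ?nnegrE ?addr_ge0 ?norm_pair_le.
  by rewrite -subr_ge0 (_ : _ - _ = (`|v| - `|w|) ^+ 2) ?sqr_ge0//; ring.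
have b1 : C2 * `|(v, w)| ^+ 2 <= C2 * (2 * (C1 ^+ 2 * E ^+ 2) + 2 * `|w| ^+ 2).
  apply: ler_wpM2l => //; apply: le_trans n2 _; rewrite lerD2r; exact: ler_wpM2l.
apply: le_trans (lerD h3 b3) _; apply: le_trans (lerD b1 (lexx _)) _.
have W0 : 0 <= `|w| ^+ 2 by exact: sqr_ge0.
have K0 : 0 <= 2 * C2 * C1 ^+ 2 + D%:R * G * C1 ^+ 3.
  by rewrite !addr_ge0 ?mulr_ge0 ?exprn_ge0.
have E0 : 0 <= E ^+ 2 by exact: sqr_ge0.
have m1 := mulr_ge0 K0 W0; have m2 := mulr_ge0 (mulr_ge0 (ler0n R 2) C20) E0.
rewrite -subr_ge0.
have -> : (2 * C2 * C1 ^+ 2 + D%:R * G * C1 ^+ 3 + 2 * C2) * (E ^+ 2 + `|w| ^+ 2) -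
  (C2 * (2 * (C1 ^+ 2 * E ^+ 2) + 2 * `|w| ^+ 2) + D%:R * (G * (C1 * (C1 ^+ 2 * E ^+ 2)))) =
  (2 * C2 * C1 ^+ 2 + D%:R * G * C1 ^+ 3) * `|w| ^+ 2 + 2 * C2 * E ^+ 2 by ring.
exact: addr_ge0.
Unshelve. all: by end_near. Qed.

(** Near the diagonal this is [jet_local]; away from it the right-hand factor is bounded below
    because [e] is injective. Compactness joins the two cases. *)
Lemma jet_bound (V : normedModType R) (f : M -> V -> R) (B : set V) :
  compact [set: M] -> compact B -> findim V -> JCk 2 f ->
  exists2 C, 0 < C & forall x p x' p', B p -> B p' ->
    `|jet_err f x p x' p'| <= C * (`|e x' - e x| ^+ 2 + `|p' - p| ^+ 2).
Proof.
move=> cM cB fV hf.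
have cK : compact (([set: M] `*` B) `*` ([set: M] `*` B)) by do !apply: compact_setX.
pose N (z : (M * V) * (M * V)) := `|e z.2.1 - e z.1.1| ^+ 2 + `|z.2.2 - z.1.2| ^+ 2.
pose L (z : (M * V) * (M * V)) := jet_err f z.1.1 z.1.2 z.2.1 z.2.2.
have N0 z : 0 <= N z by rewrite addr_ge0 ?sqr_ge0.
have mP (C C' : R) z : C <= C' -> `|L z| <= C * N z -> `|L z| <= C' * N z.
  by move=> CC' /le_trans; apply; exact: ler_wpM2r.
have [|C C0 hC] := compact_bound cK mP.
  move=> [[x0 p0] [x1 p1]] _.
  have [[<- <-]|ne] := pselect (x0 = x1 /\ p0 = p1).
    have [C [_ hC]] := jet_local x0 p0 fV hf.
    by exists C; apply: filterS hC => z hz _.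
  set z0 := ((x0, p0), (x1, p1)).
  have Nz0 : 0 < N z0.
    rewrite lt_def N0 andbT; apply: contra_notN ne; rewrite paddr_eq0 ?sqr_ge0//.
    rewrite !expf_eq0 /= !normr_eq0 !subr_eq0 => /andP[/eqP e1 /eqP e2].
    by split=> //; apply: (emb_inj F).
  have ce2 : e z.2.1 @[z --> z0] --> e x1.
    by apply: (cvg_comp (fun z : (M * V) * (M * V) => z.2.1) e _ (@emb_cts x1)); apply: (cvg_comp snd fst); [exact: cvg_snd|exact: cvg_fst].
  have ce1 : e z.1.1 @[z --> z0] --> e x0.
    by apply: (cvg_comp (fun z : (M * V) * (M * V) => z.1.1) e _ (@emb_cts x0)); apply: (cvg_comp fst fst); [exact: cvg_fst|exact: cvg_fst].
  have ce : e z.2.1 - e z.1.1 @[z --> z0] --> e x1 - e x0 by exact: cvgB.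
  have cp2 : z.2.2 @[z --> z0] --> p1 by apply: (cvg_comp snd snd); [exact: cvg_snd|exact: cvg_snd].
  have cp1 : z.1.2 @[z --> z0] --> p0 by apply: (cvg_comp fst snd); [exact: cvg_fst|exact: cvg_snd].
  have cp : z.2.2 - z.1.2 @[z --> z0] --> p1 - p0 by exact: cvgB.
  have cN : N z @[z --> z0] --> N z0.
    by apply: cvgD; rewrite ?expr2; apply: cvgM; exact: cvg_norm.
  have cL : L z @[z --> z0] --> L z0.
    apply: cvgB; [apply: cvgB; [apply: cvgB|]|].
    - by apply: (cvg_comp snd (fun z => f z.1 z.2)); [exact: cvg_snd|exact: (JCk_cts hf)].
    - by apply: (cvg_comp fst (fun z => f z.1 z.2)); [exact: cvg_fst|exact: (JCk_cts hf)].
    - apply: cvg_pairing => //.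
      apply: (cvg_comp fst (fun z => grad (f^~ z.2) z.1)); first exact: cvg_fst.
      exact: (grad_cts fV (fun c => CkW (hf c))).
    - have cc : (z.1, z.2.2 - z.1.2) @[z --> z0] --> (z0.1, p1 - p0).
        by apply: (cvg_pair (cvg_fst (F := nbhs z0.1) (G := nbhs z0.2)) cp).
      exact: (cvg_comp _ _ cc (@fib_derive_dir_cts V f fV (fun c => CkW (hf c)) (z0.1, p1 - p0))).
  exists ((`|L z0| + 1) / (N z0 / 2)).
  have nN : \forall z \near z0, N z0 / 2 < N z.
    have N2 : 0 < N z0 / 2 by rewrite divr_gt0.
    move/cvgrPdist_lt : cN => /(_ _ N2); apply: filterS => z.
    by rewrite ltr_distl => /andP[]; lra.
  have nL : \forall z \near z0, `|L z| <= `|L z0| + 1.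
    move/cvgrPdist_lt : cL => /(_ _ ltr01); apply: filterS => z hz.
    have -> : L z = L z0 - (L z0 - L z) by ring.
    by apply: le_trans (ler_normB _ _) _; rewrite lerD2l ltW.
  near=> z => _.
  have h1 : N z0 / 2 <= N z by apply: ltW; near: z.
  have h2 : `|L z| <= `|L z0| + 1 by near: z.
  apply: le_trans h2 _; rewrite mulrAC ler_pdivlMr ?divr_gt0//.
  by rewrite ler_wpM2l// addr_ge0.
by exists C => // x p x' p' Bp Bp'; apply: (hC ((x, p), (x', p'))).
Unshelve. all: by end_near. Qed.

End Jets.

Section JClosure.
Context {R : realType} {n : nat} {M : smoothManifold R n}.
Variable V : normedModType R.

Lemma JCk_fst k (f : M -> R) : MCk k f -> JCk k (fun x (_ : V) => f x).
Proof.
move=> hf c; exact: (Ck_comp (f := fst) (findim_rV n) (@jdom_open _ _ M V c) (@cimg_open _ _ M c) (fun _ h => h)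
  (@vCk_fst _ _ V k _) (hf c)).
Qed.

Lemma JCk_snd k (g : V -> R) : findim V -> Ck k setT g -> JCk k (fun (_ : M) p => g p).
Proof.
move=> fV hg c; exact: (Ck_comp (f := snd) fV (@jdom_open _ _ M V c) openT (fun _ h => I)
  (@vCk_snd _ _ V k _) hg).
Qed.

Lemma JCkD k (f g : M -> V -> R) : JCk k f -> JCk k g -> JCk k (fun x p => f x p + g x p).
Proof. by move=> hf hg c; apply: CkD; [exact: jdom_open|exact: hf|exact: hg]. Qed.

Lemma JCkM k (f g : M -> V -> R) : JCk k f -> JCk k g -> JCk k (fun x p => f x p * g x p).
Proof. by move=> hf hg c; apply: CkM; [exact: jdom_open|exact: hf|exact: hg]. Qed.

Lemma JCk_sum k (I : Type) (r : seq I) (P : pred I) (f : I -> M -> V -> R) :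
  (forall i, JCk k (f i)) -> JCk k (fun x p => \sum_(i <- r | P i) f i x p).
Proof. by move=> hf c; apply: Ck_sum => [|i]; [exact: jdom_open|exact: hf]. Qed.

End JClosure.

Section Tube.
Context {R : realType} {n : nat} {M : smoothManifold R n} (F : frame M).
Hypothesis cM : compact [set: M].
Notation D := (fdim F).
Notation e := (emb F).

Lemma cts_bound (f : M -> R) : continuous f -> exists2 C, 0 < C & forall x, `|f x| <= C.
Proof.
move=> cf; have [||C C0 hC] := @compact_bound _ _ _ (fun C x => `|f x| <= C) cM.
- by move=> C C' x CC' /le_trans; exact.
- move=> x _; exists (`|f x| + 1).
  have /cvgrPdist_lt/(_ _ ltr01) : f @ x --> f x by exact: cf.
  apply: filterS => y hy _; have -> : f y = f x - (f x - f y) by ring.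
  by apply: le_trans (ler_normB _ _) _; rewrite lerD2l ltW.
by exists C => // x; exact: hC.
Qed.

Lemma emb_bound : exists2 C, 0 < C & forall x, `|e x| <= C.
Proof.
have [|C C0 h] := @cts_bound (fun x => `|e x| : R); first by move=> x; apply: cvg_norm; exact: emb_cts.
by exists C => // x; have := h x; rewrite normr_id.
Qed.

Lemma MCk_grad k (f : M -> R) j : (k <= 2)%N -> MCk k.+1 f -> MCk k (fun x => grad F f x 0 j).
Proof.
(* A function on M is viewed as one with a zero-dimensional parameter. *)
move=> k2 hf; have hJ : JCk k.+1 (fun x (_ : 'rV[R]_0) => f x) by exact: JCk_fst.
have h := JCk_grad j k2 (findim_rV 0) hJ.
have h2 := JCk_slice (0 : 'rV[R]_0) (findim_rV 0) h.
exact: h2.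
Qed.

Lemma lipM (f : M -> R) : MCk 2 f -> exists2 C, 0 < C & forall x x', `|f x' - f x| <= C * `|e x' - e x|.
Proof.
move=> hf; have hJ : JCk 2 (fun x (_ : 'rV[R]_0) => f x) by exact: JCk_fst.
have c0 : compact [set (0 : 'rV[R]_0)] by exact: compact_set1.
have [C C0 hC] := jet_bound F cM c0 (findim_rV 0) hJ.
have [B B0 hB] := emb_bound.
have cg : continuous (fun x => `|grad F f x| : R).
  move=> x; apply: cvg_norm; apply: cvg_rV => j.
  exact: (MCk_cts (MCk_grad j (isT : (0 <= 2)%N) (fun c => CkW (hf c)))).
have [G G0 hG] := cts_bound cg.
exists (D%:R * G + C * (2 * B)) => [|x x']; first by rewrite ltr_wpDl ?mulr_gt0 ?mulr_ge0// ltW.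
have := hC x 0 x' 0 erefl erefl; rewrite /jet_err subrr derive0 subr0 normr0 expr0n addr0 -[grad _ _ _]/(grad F f x) => h.
have -> : f x' - f x = (f x' - f x - pairing (grad F f x) (e x' - e x)) + pairing (grad F f x) (e x' - e x) by ring.
apply: le_trans (ler_normD _ _) _; rewrite mulrDl addrC; apply: lerD.
  apply: le_trans (pairing_bnd _ _) _; rewrite -mulrA ler_wpM2l// ler_wpM2r//.
  by have := hG x; rewrite normr_id.
have hE : `|e x' - e x| <= 2 * B.
  by apply: le_trans (ler_normB _ _) _; rewrite mulr_natl mulr2n; apply: lerD; exact: hB.
apply: le_trans h _; rewrite expr2 -mulrA; apply: ler_wpM2l; first exact: ltW.
by apply: ler_wpM2r.
Qed.

Definition emb_pair (x : M) (p : 'rV[R]_D) : R := pairing p (e x).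

Lemma JCk_emb_pair : JCk 3 emb_pair.
Proof.
have h j : JCk 3 (fun x (p : 'rV[R]_D) => p 0 j * e x 0 j).
  apply: (JCkM (f := fun _ (p : 'rV[R]_D) => p 0 j) (g := fun x (_ : 'rV[R]_D) => e x 0 j)).
    by apply: JCk_snd; [exact: findim_rV|apply: Ck_lin; exact: clinear_coord].
  by apply: JCk_fst; exact: emb_C3.
exact: (JCk_sum (index_enum 'I_D) predT h).
Qed.

(* The projection of R^D along the normals {p | p.de(v) = 0 for all v}, not orthogonal in general; its
   values are the frame components of the covector v |-> p.de(v). *)
Definition Q (x : M) (p : 'rV[R]_D) : 'rV[R]_D := grad F (emb_pair^~ p) x.

Lemma emb_pair_diff c x p : cdom c x -> differentiable (emb_pair^~ p \o param c) (coord c x).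
Proof.
by move=> cx; apply: (JCk_slice p (findim_rV D) JCk_emb_pair c).1; exact: cimg_coord.
Qed.

Lemma derive_emb_pair c x p v : cdom c x ->
  'D_v (emb_pair^~ p \o param c) (coord c x) = pairing p (dE F c x v).
Proof.
move=> cx; have d j : differentiable (fun q => p 0 j * ecoord j (param c q)) (coord c x).
  by apply: differentiableM => //; exact: ecoord_diff.
rewrite deriveE; last exact: emb_pair_diff.
have -> : emb_pair^~ p \o param c = \sum_j (fun q => p 0 j * ecoord j (param c q)).
  by apply/funext => q; rewrite fct_sumE.
rewrite -deriveE; last exact: differentiable_sum.
rewrite derive_sum => [|j]; last exact: diff_derivable.
apply: eq_bigr => j _; rewrite mxE (@deriveM _ _ (cst (p 0 j)) (ecoord j \o param c)).
- by rewrite derive_cst scaler0 addr0.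
- exact: derivable_cst.
- by apply: diff_derivable; exact: ecoord_diff.
Qed.

Lemma Q_coord c x p j : cdom c x -> Q x p 0 j = pairing p (dE F c x (fld F c x j)).
Proof. by move=> cx; rewrite /Q (gradE j cx) ?derive_emb_pair//; exact: emb_pair_diff. Qed.

Lemma Q_dE c x p v : cdom c x -> pairing (Q x p) (dE F c x v) = pairing p (dE F c x v).
Proof. by move=> cx; rewrite /Q gradP ?derive_emb_pair//; exact: emb_pair_diff. Qed.

Lemma Q_linear x : linear (Q x).
Proof.
move=> a u v; apply/rowP => j; rewrite [RHS]mxE [X in _ = X + _]mxE !(Q_coord _ _ (chart_atP x)).
by rewrite pairingDl pairingZl.
Qed.

Lemma QD x u v : Q x (u + v) = Q x u + Q x v.
Proof. by have := Q_linear x 1 u v; rewrite !scale1r. Qed.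
Lemma Q0 x : Q x 0 = 0.
Proof. by apply: (addrI (Q x 0)); rewrite -QD !addr0. Qed.
Lemma QZ x a u : Q x (a *: u) = a *: Q x u.
Proof. by have := Q_linear x a u 0; rewrite Q0 !addr0. Qed.
Lemma QN x u : Q x (- u) = - Q x u.
Proof. by rewrite -scaleN1r QZ scaleN1r. Qed.
Lemma QB x u v : Q x (u - v) = Q x u - Q x v.
Proof. by rewrite QD QN. Qed.

Lemma Q_normal c x p : cdom c x -> (forall v, pairing p (dE F c x v) = 0) -> Q x p = 0.
Proof. by move=> cx h; apply/rowP => j; rewrite (Q_coord _ _ cx) h mxE. Qed.

Lemma Q_idem x p : Q x (Q x p) = Q x p.
Proof.
apply/rowP => j; rewrite (Q_coord _ _ (chart_atP x)) Q_dE; last exact: chart_atP.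
by rewrite -Q_coord//; exact: chart_atP.
Qed.

(** The Taylor estimate for x |-> p.e(x), whose gradient is [Q x p], scaled to unit p. It expresses
    that M has positive reach: normals pair with chords only to second order. *)
Lemma reach : exists2 C, 0 < C & forall x x' p,
  `|pairing (p - Q x p) (e x' - e x)| <= C * `|p| * `|e x' - e x| ^+ 2.
Proof.
have [C C0 hC] := jet_bound F cM (box_compact (n := D) (r := 1)) (findim_rV D) (fun c => CkW (JCk_emb_pair c)).
exists C => // x x' p; have [->|p0] := eqVneq p 0.
  by rewrite Q0 subr0 pairing0l !normr0 mulr0 mul0r.
have np : 0 < `|p| by rewrite normr_gt0.
pose u := `|p|^-1 *: p; have u1 : `|u| <= 1 by rewrite normrZ ger0_norm ?invr_ge0// mulVf ?gt_eqF.
have := hC x u x' u u1 u1; rewrite /jet_err subrr derive0 subr0 normr0 expr0n addr0.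
rewrite /emb_pair -pairingBr -/emb_pair -/(Q x u) -pairingBl => h.
have -> : p = `|p| *: u by rewrite scalerA divff ?scale1r// gt_eqF.
rewrite QZ -scalerBr pairingZl normrM normr_id normrZ normr_id.
have -> : `|u| = 1 by rewrite normrZ ger0_norm ?invr_ge0// mulVf ?gt_eqF.
by rewrite [leRHS](_ : _ = `|p| * (C * `|e x' - e x| ^+ 2)) ?ler_wpM2l//; ring.
Qed.

Definition Qm (i j : 'I_D) (x : M) : R := grad F (ecoord i) x 0 j.

Lemma Qm_C2 i j : MCk 2 (Qm i j).
Proof.
by apply: (MCk_grad (f := ecoord i) j (isT : (2 <= 2)%N)); exact: emb_C3.
Qed.

Lemma QE x p j : Q x p 0 j = \sum_i p 0 i * Qm i j x.
Proof.
rewrite (Q_coord _ _ (chart_atP x)); apply: eq_bigr => i _.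
rewrite /Qm (gradE j (chart_atP x)); last exact: ecoord_diff (chart_atP x).
by rewrite mxE.
Qed.

Lemma Q_lip : exists2 C, 0 < C & forall x x' p, `|Q x' p - Q x p| <= C * `|p| * `|e x' - e x|.
Proof.
have [C hC] := choice (fun ij : 'I_D * 'I_D => let: ex_intro2 C C0 h := lipM (Qm_C2 ij.1 ij.2) in ex_intro _ C (conj C0 h)).
exists (\sum_i \sum_j C (i, j) + 1) => [|x x' p].
  by rewrite ltr_wpDl//; apply: sumr_ge0 => i _; apply: sumr_ge0 => j _; rewrite ltW ?(hC (i, j)).1.
apply: mx_norm_le => [|a j].
  rewrite !mulr_ge0// addr_ge0//; apply: sumr_ge0 => i _; apply: sumr_ge0 => j _; rewrite ltW ?(hC (i, j)).1//.
rewrite ord1 mxE [X in _ + X]mxE !QE -sumrB.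
apply: le_trans (ler_norm_sum _ _ _) _.
apply: (@le_trans _ _ (\sum_i C (i, j) * `|p| * `|e x' - e x|)).
  apply: ler_sum => i _; rewrite -mulrBr normrM mulrAC mulrC ler_pM ?coord_le_norm//.
  exact: (hC (i, j)).2.
rewrite -!mulr_suml ler_wpM2r// ler_wpM2r//.
apply: (@le_trans _ _ (\sum_i \sum_j C (i, j))); last by rewrite lerDl.
apply: ler_sum => i _; rewrite (bigD1 j)//= lerDl; apply: sumr_ge0 => k _.
by rewrite ltW ?(hC (i, k)).1.
Qed.

Lemma Q_bnd : exists2 C, 0 < C & forall x p, `|Q x p| <= C * `|p|.
Proof.
have [C hC] := choice (fun ij : 'I_D * 'I_D => let: ex_intro2 C C0 h := cts_bound (MCk_cts (Qm_C2 ij.1 ij.2)) in ex_intro _ C (conj C0 h)).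
exists (\sum_i \sum_j C (i, j) + 1) => [|x p].
  by rewrite ltr_wpDl//; apply: sumr_ge0 => i _; apply: sumr_ge0 => j _; rewrite ltW ?(hC (i, j)).1.
apply: mx_norm_le => [|a j].
  rewrite !mulr_ge0// addr_ge0//; apply: sumr_ge0 => i _; apply: sumr_ge0 => j _; rewrite ltW ?(hC (i, j)).1//.
rewrite ord1 QE; apply: le_trans (ler_norm_sum _ _ _) _.
apply: (@le_trans _ _ (\sum_i C (i, j) * `|p|)).
  by apply: ler_sum => i _; rewrite normrM mulrC ler_pM ?coord_le_norm//; exact: (hC (i, j)).2.
rewrite -!mulr_suml ler_wpM2r//.
apply: (@le_trans _ _ (\sum_i \sum_j C (i, j))); last by rewrite lerDl.
apply: ler_sum => i _; rewrite (bigD1 j)//= lerDl; apply: sumr_ge0 => k _.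
by rewrite ltW ?(hC (i, k)).1.
Qed.

End Tube.

(** * Nearest points on the embedded manifold *)

Section NearestPoint.
Context {R : realType} {n : nat} {M : smoothManifold R n} (F : frame M).
Hypothesis cM : compact [set: M].
Variable x0 : M.
Notation D := (fdim F).
Notation e := (emb F).

Lemma small_le0 (a C r : R) : 0 < r -> (forall s, 0 < s -> s < r -> s * a <= C * s ^+ 2) -> a <= 0.
Proof.
move=> r0 h; rewrite leNgt; apply/negP => a0.
pose s := Num.min (r / 2) (a / (2 * (`|C| + 1))).
have C1 : 0 < 2 * (`|C| + 1) by rewrite mulr_gt0// ltr_wpDl.
have s0 : 0 < s by rewrite lt_min !divr_gt0.
have sr : s < r by rewrite gt_min; apply/orP; left; lra.
have := h s s0 sr; rewrite expr2 mulrCA ler_pM2l// => h1.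
have : s * (2 * (`|C| + 1)) <= a by rewrite -ler_pdivlMr// ge_min lexx orbT.
have : C * s <= `|C| * s by rewrite ler_wpM2r ?ler_norm// ltW.
move: (`|C|) h1 => c h1; nra.
Qed.

(** Along a curve in M starting in the direction v, the left side is linear in the time up to second
    order and the right side is quadratic, so the linear coefficient is nonpositive; v and -v
    together give 0. *)
Lemma crit_normal c x G (C : R) : cdom c x ->
  (forall x', pairing G (e x' - e x) <= C * `|e x' - e x| ^+ 2) ->
  forall v, pairing G (dE F c x v) = 0.
Proof.
move=> cx h; suff h1 v : pairing G (dE F c x v) <= 0.
  move=> v; apply/le_anti; rewrite h1 /= -oppr_le0 -pairingNr.
  have -> : - dE F c x v = dE F c x (- v) by apply/rowP => j; rewrite !mxE !deriveE ?linearN//; exact: ecoord_diff.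
  exact: h1.
have [r [C1 [r0 C10 hr]]] := emb_local F cx.
pose w := dE F c x v.
pose C2 := `|w| + C1 * `|v| ^+ 2.
have C20 : 0 <= C2 by rewrite addr_ge0// mulr_ge0// sqr_ge0.
have v1 : 0 < `|v| + 1 by rewrite ltr_wpDl.
apply: (@small_le0 _ (`|C| * C2 ^+ 2 + D%:R * (`|G| * (C1 * `|v| ^+ 2))) (Num.min 1 (r / (`|v| + 1)))).
  by rewrite lt_min ltr01 divr_gt0.
move=> s s0; rewrite lt_min => /andP[s1]; rewrite ltr_pdivlMr// => sr.
have svr : `|s *: v| < r.
  rewrite normrZ gtr0_norm//; apply: le_lt_trans sr; rewrite ler_wpM2l ?ltW//; lra.
have := hr (coord c x) (coord c x + s *: v); rewrite subrr normr0 addrC addKr => /(_ r0 svr).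
rewrite coordK//; set x' := param c _ => -[_ _].
have -> : dE F c x (s *: v) = s *: w.
  by apply/rowP => j; rewrite !mxE !deriveE ?linearZ//; exact: ecoord_diff.
rewrite normrZ gtr0_norm// addrC => hx.
have hx2 : `|e x' - e x| <= s * C2.
  have -> : e x' - e x = s *: w + (- (s *: w) + (e x' - e x)) by rewrite addNKr.
  apply: le_trans (ler_normD _ _) _; rewrite normrZ gtr0_norm// mulrDr lerD2l.
  apply: le_trans hx _; rewrite exprMn mulrCA expr2 -mulrA ler_wpM2l ?(ltW s0)//.
  by rewrite ler_piMl ?(ltW s1)// mulr_ge0// sqr_ge0.
have hG := h x'.
rewrite addrC in hx; have -> : s * pairing G w = pairing G (e x' - e x) - pairing G (e x' - e x - s *: w).
  by rewrite -pairingZr -pairingBr opprB [in RHS]addrC subrK.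
rewrite mulrDl; apply: lerD.
  apply: le_trans hG _; rewrite -mulrA; apply: (@le_trans _ _ (`|C| * `|e x' - e x| ^+ 2)).
    by rewrite ler_wpM2r ?sqr_ge0// ler_norm.
  by rewrite ler_wpM2l// -exprMn mulrC ler_sqr ?nnegrE ?mulr_ge0 ?(ltW s0).
apply: le_trans (ler_norm _) _; rewrite normrN; apply: le_trans (pairing_bnd _ _) _.
rewrite -!mulrA ler_wpM2l// ler_wpM2l//; apply: le_trans hx _.
by rewrite [leRHS](_ : _ = C1 * (s * `|v|) ^+ 2)//; ring.
Qed.

Definition sq (v : 'rV[R]_D) : R := pairing v v.

Lemma sqB u v : sq (u - v) = sq u - 2 * pairing u v + sq v.
Proof. by rewrite /sq pairingBl !pairingBr (pairingC v u); ring. Qed.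

(* [x0] is never reached when M is compact: the minimum exists. *)
Definition near_pt (xi : 'rV[R]_D) : M :=
  xget x0 [set x | forall y, sq (xi - e x) <= sq (xi - e y)].

Lemma near_ptP xi y : sq (xi - e (near_pt xi)) <= sq (xi - e y).
Proof.
have [||x _ hx] := @compact_EVT_min M R (fun x => sq (xi - e x)) setT _ cM.
- by exists x0.
- apply: continuous_subspaceT => x.
  have h : xi - e z @[z --> x] --> xi - e x by apply: cvgB; [exact: cvg_cst|exact: emb_cts].
  exact: cvg_pairing.
rewrite /near_pt; case: xgetP => [z _ hz|/(_ x) []]; first exact: hz.
by move=> z; apply: hx; rewrite inE.
Qed.

Lemma near_pt_emb x : near_pt (e x) = x.
Proof.
apply: (@emb_inj _ _ _ F); apply/eqP; rewrite eq_sym -subr_eq0 -normr_eq0 -sqrf_eq0.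
have := near_ptP (e x) x; rewrite subrr {2}/sq pairing0l => h.
by apply/eqP/le_anti; rewrite sqr_ge0 andbT; apply: le_trans (norm_le_pairing _) h.
Qed.

Lemma near_pt_dist xi y : `|xi - e (near_pt xi)| <= (D%:R + 1) * `|xi - e y|.
Proof.
have D0 : (0 : R) <= D%:R by [].
rewrite -ler_sqr ?nnegrE ?mulr_ge0 ?addr_ge0//.
apply: le_trans (norm_le_pairing _) _; apply: le_trans (near_ptP xi y) _.
apply: le_trans (pairing_le_norm _) _; rewrite exprMn ler_wpM2r ?sqr_ge0//; nra.
Qed.

Lemma near_pt_close xi y : `|e (near_pt xi) - e y| <= (D%:R + 2) * `|xi - e y|.
Proof.
have -> : e (near_pt xi) - e y = (xi - e y) - (xi - e (near_pt xi)) by rewrite opprB [RHS]addrC addrA subrK.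
apply: le_trans (ler_normB _ _) _; have := near_pt_dist xi y; lra.
Qed.

(** Minimality of the distance, compared with the point [y] and expanded. For [xi] equal to [e y]
    minus a multiple of a gradient, this inequality makes a projected gradient step decrease the
    function. *)
Lemma near_pt_desc xi y : let d := e (near_pt xi) - e y in sq d <= 2 * pairing (xi - e y) d.
Proof.
have := near_ptP xi y; set r := near_pt xi => h /=.
move: h; have -> : xi - e r = (xi - e y) - (e r - e y) by rewrite opprB addrA subrK.
rewrite [sq (_ - (_ - _))]sqB; lra.
Qed.

Lemma near_pt_normal xi : Q (near_pt xi) (xi - e (near_pt xi)) = 0.
Proof.
set r := near_pt xi; apply: (Q_normal (chart_atP r)) => v.
apply: (@crit_normal _ _ _ (D%:R / 2) (chart_atP r)) => x'.
have := near_ptP xi x'; rewrite -/r.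
have -> : xi - e x' = (xi - e r) - (e x' - e r) by rewrite opprB addrA subrK.
rewrite [sq (_ - (_ - _))]sqB.
have := pairing_le_norm (e x' - e r); rewrite -/(sq _); lra.
Qed.

(** The square of the chord between the two nearest points is its pairing with [xi' - xi], up to its
    pairings with two normals. By [reach] and the choice of [d], each of these is at most a quarter
    of the squared norm of the chord, so they can be absorbed. *)
Lemma near_pt_lip : exists d C, [/\ 0 < d, 0 < C & forall xi xi' y y',
  `|xi - e y| <= d -> `|xi' - e y'| <= d ->
  `|e (near_pt xi') - e (near_pt xi)| <= C * `|xi' - xi|].
Proof.
have [C C0 hC] := reach F cM.
have D0 : (0 : R) <= D%:R by [].
have D1 : 0 < D%:R + 1 :> R by rewrite ltr_wpDl.
pose d : R := (4 * C * (D%:R + 1))^-1.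
have d0 : 0 < d by rewrite invr_gt0 !mulr_gt0.
exists d, (2 * D%:R + 1); split=> //.
move=> xi xi' y y' hy hy'.
set r := near_pt xi; set r' := near_pt xi'; set Dl := e r' - e r.
have nu (z : 'rV[R]_D) (w : M) : `|z - e w| <= d -> C * `|z - e (near_pt z)| <= 1 / 4.
  move=> h; have := near_pt_dist z w => h2.
  apply: (@le_trans _ _ (C * ((D%:R + 1) * d))).
    by rewrite ler_wpM2l ?(ltW C0)//; apply: le_trans h2 _; rewrite ler_wpM2l// ltW.
  by rewrite le_eqVlt; apply/orP; left; apply/eqP; rewrite /d; field; rewrite !gt_eqF.
have b1 : `|pairing (xi - e r) Dl| <= 1 / 4 * `|Dl| ^+ 2.
  have := hC r r' (xi - e r); rewrite near_pt_normal subr0 => /le_trans; apply.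
  by rewrite ler_wpM2r ?sqr_ge0//; exact: nu hy.
have b2 : `|pairing (xi' - e r') Dl| <= 1 / 4 * `|Dl| ^+ 2.
  have eD : e r - e r' = - Dl by rewrite /Dl opprB.
  have := hC r' r (xi' - e r'); rewrite near_pt_normal subr0 eD pairingNr !normrN => /le_trans; apply.
  by rewrite ler_wpM2r ?sqr_ge0//; exact: nu hy'.
have E : sq Dl = pairing (xi' - xi) Dl - pairing (xi' - e r') Dl + pairing (xi - e r) Dl.
  by rewrite /sq -pairingBl -pairingDl; congr pairing; apply/rowP => j; rewrite !mxE; ring.
have b3 := pairing_bnd (xi' - xi) Dl.
have b4 := norm_le_pairing Dl; rewrite -/(sq Dl) in b4.
have b5 : `|Dl| * `|Dl| <= (2 * D%:R * `|xi' - xi|) * `|Dl|.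
  move: b1 b2 b3; rewrite !ler_norml => /andP[_ b1] /andP[b2 _] /andP[_ b3].
  rewrite expr2 in b1 b2 b4; nra.
have [->|Dl0] := eqVneq Dl 0; first by rewrite normr0 mulr_ge0// addr_ge0// mulr_ge0.
rewrite ler_pM2r ?normr_gt0// in b5; apply: le_trans b5 _.
by apply: ler_wpM2r => //; rewrite lerDl.
Qed.

(** The distance to [e x] is bounded below on the compact complement of an open neighbourhood, hence
    the topology of M can be read off R^D. *)
Lemma emb_separates x U : nbhs x U -> exists2 d : R, 0 < d & forall y, `|e y - e x| < d -> U y.
Proof.
rewrite nbhsE => -[V [oV Vx] VU].
have cV : compact (~` V) by apply: (@subclosed_compact _ (~` V) setT) => //; exact: open_closedC.
have [||C C0 hC] := @compact_bound _ _ _ (fun C y => 1 <= C * `|e y - e x|) cV.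
- by move=> C C' y CC' /le_trans; apply; rewrite ler_wpM2r.
- move=> y Vy; have yx : 0 < `|e y - e x|.
    by rewrite normr_gt0 subr_eq0; apply/eqP => /emb_inj yx; apply: Vy; rewrite yx.
  exists (2 / `|e y - e x|).
  have h : `|e z - e x| @[z --> y] --> `|e y - e x| by apply: cvg_norm; apply: cvgB; [exact: emb_cts|exact: cvg_cst].
  have y2 : 0 < `|e y - e x| / 2 by rewrite divr_gt0.
  move/cvgrPdist_lt : h => /(_ _ y2); apply: filterS => z.
  rewrite ltr_distl => /andP[h1 h2] _; rewrite mulrAC ler_pdivlMr//; lra.
exists C^-1; first by rewrite invr_gt0.
move=> y hy; have h : C * `|e y - e x| < 1 by rewrite mulrC -ltr_pdivlMr// div1r.
apply: VU; apply: contrapT => /hC.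
by rewrite leNgt h.
Qed.

Lemma emb_embed (T : Type) (G : set_system T) (FG : Filter G) (h : T -> M) x :
  e (h t) @[t --> G] --> e x -> h @ G --> x.
Proof.
move=> he U /emb_separates[d d0 hU].
move/cvgrPdist_lt : he => /(_ _ d0); apply: filterS => t ht; apply: hU.
by rewrite distrC.
Qed.

Lemma near_pt_cvg : exists2 d : R, 0 < d & forall (T : Type) (G : set_system T) (FG : Filter G)
  (f : T -> 'rV[R]_D) xi y, `|xi - e y| < d -> f @ G --> xi -> near_pt (f t) @[t --> G] --> near_pt xi.
Proof.
have [d [C [d0 C0 hC]]] := near_pt_lip; exists d => // T G FG f xi y hy hf.
apply: emb_embed; apply/cvgrPdist_lt => eps eps0.
have h1 : `|f t - e y| @[t --> G] --> `|xi - e y| by apply: cvg_norm; apply: cvgB => //; exact: cvg_cst.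
have h2 : \forall t \near G, `|f t - e y| < d.
  have hd : 0 < d - `|xi - e y| by rewrite subr_gt0.
  by move/cvgrPdist_lt : h1 => /(_ _ hd); apply: filterS => t; rewrite ltr_distl => /andP[h2 h3]; move: h2 h3; lra.
have eC : 0 < eps / C by rewrite divr_gt0.
move/cvgrPdist_lt : hf => /(_ _ eC) h3; near=> t.
apply: (@le_lt_trans _ _ (C * `|xi - f t|)).
  by apply: (hC _ _ y y); [apply: ltW; near: t|exact: ltW].
by rewrite mulrC -ltr_pdivlMr//; near: t.
Unshelve. all: by end_near. Qed.

End NearestPoint.

(** * Concatenation of homotopies, and homotopy of nearby loops *)

Section Homotopy.
Context {R : realType}.

Lemma free_homotopic_trans (T : topologicalType) (A : set T) (g0 g1 g2 : R -> T) :
  free_homotopic A g0 g1 -> free_homotopic A g1 g2 -> free_homotopic A g0 g2.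
Proof.
move=> [F1 [c1 p1 a1 s1 e1]] [F2 [c2 p2 a2 s2 e2]].
pose H (z : R * R) := if z.1 <= 2^-1 then F1 (2 * z.1, z.2) else F2 (2 * z.1 - 1, z.2).
have half1 (s : R) : s \in `[0, 1] -> s <= 2^-1 -> 2 * s \in `[0, 1] :> Prop.
  by rewrite !in_itv /= => /andP[? ?] ?; apply/andP; split; lra.
have half2 (s : R) : s \in `[0, 1] -> ~~ (s <= 2^-1) -> 2 * s - 1 \in `[0, 1] :> Prop.
  by rewrite !in_itv -ltNge /= => /andP[? ?] ?; apply/andP; split; lra.
exists H; split.
- pose A1 := [set z : R * R | z.1 \in `[0, 2^-1]]; pose A2 := [set z : R * R | z.1 \in `[2^-1, 1]].
  have cl (a b : R) : closed [set z : R * R | z.1 \in `[a, b]].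
    by apply: (@closed_comp _ _ fst `[a, b]%classic) => [z _|]; [exact: cvg_fst|exact: itv_closed].
  have -> : `[0, 1]%classic `*` setT = A1 `|` A2.
    apply/seteqP; split=> -[s t] /=; rewrite /A1 /A2 /= !in_itv /=.
      by move=> [/andP[-> ->] _]; rewrite andbT; have [?|/ltW ?] := leP s 2^-1; [left|right].
    by move=> [|] /andP[? ?]; split=> //; apply/andP; split; lra.
  have h4 : continuous (fun z : R * R => (2 * z.1, z.2)).
    move=> z; have h1 : 2 * z.1 @[z --> z] --> 2 * z.1 by apply: cvgM; [exact: cvg_cst|exact: cvg_fst].
    have h2 : z.2 @[z --> z] --> z.2 by exact: cvg_snd.
    exact: cvg_pair h1 h2.
  have h5 : continuous (fun z : R * R => (2 * z.1 - 1, z.2)).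
    move=> z; have h1 : 2 * z.1 - 1 @[z --> z] --> 2 * z.1 - 1.
      by apply: cvgB; [apply: cvgM; [exact: cvg_cst|exact: cvg_fst]|exact: cvg_cst].
    have h2 : z.2 @[z --> z] --> z.2 by exact: cvg_snd.
    exact: cvg_pair h1 h2.
  apply: withinU_continuous; [exact: cl|exact: cl| |].
  + apply/subspace_continuousP => z Az.
    have hz : (`[0, 1]%classic `*` setT) (2 * z.1, z.2) by split=> //=; move: Az; rewrite /A1 /= !in_itv /= => /andP[? ?]; apply/andP; split; lra.
    have E w : A1 w -> H w = F1 (2 * w.1, w.2).
      by rewrite /A1 /H /= in_itv /= => /andP[_ ->].
    rewrite [from_subspace A1 H z](E z Az).
    move/subspace_continuousP : c1 => /(_ _ hz) hc U /hc hU.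
    have hU2 : \forall w \near z, (`[0, 1]%classic `*` setT) (2 * w.1, w.2) -> U (F1 (2 * w.1, w.2)) := h4 z _ hU; suff : \forall w \near z, A1 w -> U (H w) by [].
    move: hU2; apply: filterS => w hU2 Aw; rewrite E//.
    have hw : (`[0, 1]%classic `*` setT) (2 * w.1, w.2) by split=> //=; move: Aw; rewrite /A1 /= !in_itv /= => /andP[? ?]; apply/andP; split; lra.
    exact: hU2 hw.
  + apply/subspace_continuousP => z Az.
    have hz : (`[0, 1]%classic `*` setT) (2 * z.1 - 1, z.2) by split=> //=; move: Az; rewrite /A2 /= !in_itv /= => /andP[? ?]; apply/andP; split; lra.
    have E w : A2 w -> H w = F2 (2 * w.1 - 1, w.2).
      rewrite /A2 /H /= in_itv /= => /andP[h _]; case: ifP => // h'.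
      have -> : w.1 = 2^-1 by apply/le_anti; rewrite h h'.
      by rewrite mulfV// subrr e1 s2.
    rewrite [from_subspace A2 H z](E z Az).
    move/subspace_continuousP : c2 => /(_ _ hz) hc U /hc hU.
    have hU2 : \forall w \near z, (`[0, 1]%classic `*` setT) (2 * w.1 - 1, w.2) -> U (F2 (2 * w.1 - 1, w.2)) := h5 z _ hU; suff : \forall w \near z, A2 w -> U (H w) by [].
    move: hU2; apply: filterS => w hU2 Aw; rewrite E//.
    have hw : (`[0, 1]%classic `*` setT) (2 * w.1 - 1, w.2) by split=> //=; move: Aw; rewrite /A2 /= !in_itv /= => /andP[? ?]; apply/andP; split; lra.
    exact: hU2 hw.
- by move=> s t hs; rewrite /H /=; case: ifPn => h; [rewrite p1//; exact: half1|rewrite p2//; exact: half2].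
- by move=> s t hs; rewrite /H /=; case: ifPn => h; [apply: a1; exact: half1|apply: a2; exact: half2].
- by move=> t; rewrite /H /= invr_ge0 ler0n mulr0 s1.
- move=> t; rewrite /H /= leNgt invf_lt1 ?ltr1n//= mulr1.
  by have -> : 2 - 1 = 1 :> R by ring.
Unshelve. all: by end_near. Qed.

Context {n : nat} {M : smoothManifold R n} (F : frame M).
Hypothesis cM : compact [set: M].
Variable x0 : M.
Notation D := (fdim F).
Notation e := (emb F).

(** The straight homotopy in R^D stays in the tube where [near_pt] is continuous, and is projected
    back to M. *)
Lemma close_homotopic : exists2 d : R, 0 < d & forall g0 g1 : R -> M,
  loop_in setT g0 -> loop_in setT g1 -> (forall t, `|e (g1 t) - e (g0 t)| < d) ->
  free_homotopic setT g0 g1.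
Proof.
have [d d0 hd] := near_pt_cvg F cM x0; exists d => // g0 g1 [c0 p0 _] [c1 p1 _] h.
exists (fun z => near_pt x0 (e (g0 z.2) + z.1 *: (e (g1 z.2) - e (g0 z.2)))); split=> //=.
- apply: continuous_in_subspaceT => -[s t]; rewrite inE /= => -[]; rewrite in_itv /= => /andP[s0 s1] _.
  apply: (hd _ _ _ _ _ (g0 t)).
    rewrite addrC addKr normrZ ger0_norm//; apply: le_lt_trans (h t).
    by rewrite -{2}[`|_|]mul1r ler_wpM2r.
  have ct (g : R -> M) : continuous g -> e (g z.2) @[z --> (s, t)] --> e (g t).
    move=> cg; apply: (cvg_comp (fun z : R * R => z.2) (e \o g)); first exact: cvg_snd.
    by apply: (cvg_comp g e (cg t)); exact: emb_cts.
  apply: cvgD; first exact: ct.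
  by apply: cvgZ; [exact: cvg_fst|apply: cvgB; exact: ct].
- by move=> s t _; rewrite p0 p1.
- by move=> t; rewrite scale0r addr0 near_pt_emb.
- by move=> t; rewrite scale1r addrC subrK near_pt_emb.
Qed.

End Homotopy.

(** * Polygons *)

Section Periodic.
Context {R : realType}.

Lemma periodic_int (T : Type) (h : R -> T) (k : int) t : (forall t, h (t + 1) = h t) -> h (t + k%:~R) = h t.
Proof.
move=> hp; have hn (m : nat) s : h (s + m%:R) = h s.
  by elim: m s => [|m IH] s; rewrite ?addr0// -addn1 natrD addrA hp.
case: k => m; first exact: hn.
by rewrite NegzE mulrNz -(hn m.+1 (t - _)) subrK.
Qed.

Lemma periodic_seq (T : Type) (X : int -> T) (N : nat) (k l : int) :
  (forall k, X (k + N%:Z) = X k) -> X (k + l * N%:Z) = X k.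
Proof.
move=> hp; have hn (m : nat) s : X (s + m%:Z * N%:Z) = X s.
  elim: m s => [|m IH] s; first by rewrite mul0r addr0.
  by rewrite -addn1 PoszD mulrDl mul1r addrA hp.
case: l => m; first exact: hn.
by rewrite NegzE mulNr -(hn m.+1 (k - _)) subrK.
Qed.

Lemma periodic_unif (n : nat) (h : R -> 'rV[R]_n) (eps : R) : continuous h -> (forall t, h (t + 1) = h t) -> 0 < eps ->
  exists2 C, 0 < C & forall t t', C * `|t' - t| < 1 -> `|h t' - h t| < eps.
Proof.
move=> ch hp eps0.
have cK : compact `[(0 : R), 1]%classic by exact: segment_compact.
have [||C C0 hC] := @compact_bound _ _ _ (fun C t => forall t', C * `|t' - t| < 1 -> `|h t' - h t| < eps) cK.
- by move=> C C' t CC' hC t' /(le_lt_trans _) h1; apply: hC; apply: h1; rewrite ler_wpM2r.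
- move=> t0 _; have eps2 : 0 < eps / 2 by rewrite divr_gt0.
  have /cvgrPdist_lt/(_ _ eps2) : h @ t0 --> h t0 by exact: ch.
  rewrite -nbhs_ballE => -[r /= r0 hr]; exists (2 / r).
  have r2 : 0 < r / 2 by rewrite divr_gt0.
  near=> t => _ t' htt.
  have tt : `|t0 - t| < r / 2 by near: t; exact: (nbhsx_ballx t0 _ r2).
  have tt' : `|t' - t| < r / 2 by move: htt; rewrite mulrAC ltr_pdivrMr// mul1r mulrC => htt; rewrite ltr_pdivlMr.
  have h1 := hr t; have h2 := hr t'.
  have -> : h t' - h t = (h t0 - h t) - (h t0 - h t') by rewrite opprB [RHS]addrC addrA subrK.
  apply: le_lt_trans (ler_normB _ _) _; rewrite [ltRHS]splitr; apply: ltrD; [apply: h1|apply: h2].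
    by rewrite /ball /=; lra.
  rewrite /ball /=; have -> : t0 - t' = (t0 - t) - (t' - t) by ring.
  by apply: le_lt_trans (ler_normB _ _) _; lra.
exists C => // t t' htt.
rewrite -(periodic_int (- Num.floor t) t hp) -(periodic_int (- Num.floor t) t' hp).
apply: hC; first by rewrite /= in_itv /= mulrNz subr_ge0 floor_le /= lerBlDr addrC -intrD1 ltW// floorD1_gt.
by rewrite opprD addrACA subrr addr0.
Unshelve. all: by end_near. Qed.

End Periodic.

Section PiecewiseLinear.
Context {R : realType} {D : nat}.
Implicit Type a : int -> 'rV[R]_D.

Definition pl a (s : R) : 'rV[R]_D :=
  a (Num.floor s) + (s - (Num.floor s)%:~R) *: (a (Num.floor s + 1) - a (Num.floor s)).

Lemma pl_close a B s : 0 <= B -> (forall k, `|a (k + 1) - a k| <= B) -> `|pl a s - a (Num.floor s)| <= B.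
Proof.
move=> B0 h; rewrite /pl addrC addKr normrZ ger0_norm ?subr_ge0 ?floor_le//.
rewrite -[leRHS]mul1r; apply: ler_pM => //; rewrite ?subr_ge0 ?floor_le// lerBlDr addrC.
by rewrite ltW// -intrD1 floorD1_gt.
Qed.

(** The restriction to times less than 1 apart leaves at most one vertex between them. *)
Lemma pl_lip a B s s' : 0 <= B -> (forall k, `|a (k + 1) - a k| <= B) -> s <= s' -> s' < s + 1 ->
  `|pl a s' - pl a s| <= B * (s' - s).
Proof.
move=> B0 h ss' s1; set k := Num.floor s.
have ks : k%:~R <= s by exact: floor_le.
have sk : s < k%:~R + 1 by rewrite -intrD1 floorD1_gt.
have [h1|h1] := ltP s' (k%:~R + 1).
  have E : Num.floor s' = k by apply: floor_def; rewrite intrD h1 andbT (le_trans ks).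
  rewrite /pl E -/k.
  have -> : a k + (s' - k%:~R) *: (a (k + 1) - a k) - (a k + (s - k%:~R) *: (a (k + 1) - a k)) =
     (s' - s) *: (a (k + 1) - a k) by apply/rowP => j; rewrite !mxE; ring.
  by rewrite normrZ ger0_norm ?subr_ge0// mulrC ler_wpM2r ?subr_ge0.
have E : Num.floor s' = k + 1.
  by apply: floor_def; rewrite !intrD h1 /=; move: s1 sk; lra.
rewrite /pl E -/k.
set d0 := a (k + 1) - a k; set d1 := a (k + 1 + 1) - a (k + 1).
have -> : a (k + 1) + (s' - (k + 1)%:~R) *: d1 - (a k + (s - k%:~R) *: d0) =
   (k%:~R + 1 - s) *: d0 + (s' - (k%:~R + 1)) *: d1.
  by rewrite /d0 /d1 intrD; apply/rowP => j; rewrite !mxE; ring.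
apply: le_trans (ler_normD _ _) _; rewrite !normrZ !ger0_norm ?subr_ge0// ?(ltW sk)//.
have -> : B * (s' - s) = (k%:~R + 1 - s) * B + (s' - (k%:~R + 1)) * B by ring.
by apply: lerD; apply: ler_wpM2l; rewrite ?subr_ge0 ?(ltW sk)//; exact: h.
Qed.

Lemma pl_lip2 a B s s' : 0 <= B -> (forall k, `|a (k + 1) - a k| <= B) -> `|s' - s| < 1 ->
  `|pl a s' - pl a s| <= B * `|s' - s|.
Proof.
move=> B0 h hs; have [ss|/ltW ss] := leP s s'.
  by move: hs; rewrite ger0_norm ?subr_ge0// => hs; apply: pl_lip => //; lra.
move: hs; rewrite !(distrC s') (distrC _ (pl a s)) ger0_norm ?subr_ge0// => hs.
by apply: pl_lip => //; lra.
Qed.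

Lemma pl_cts a B : 0 <= B -> (forall k, `|a (k + 1) - a k| <= B) -> continuous (pl a).
Proof.
move=> B0 h s; apply/cvgrPdist_lt => eps eps0.
have d0 : 0 < Num.min 1 (eps / (B + 1)) by rewrite lt_min ltr01 divr_gt0// ltr_wpDl.
have : \forall s' \near s, `|s - s'| < Num.min 1 (eps / (B + 1)) by exact: (nbhsx_ballx s _ d0).
apply: filterS => s'; rewrite lt_min => /andP[h1 h2]; rewrite distrC in h1 *.
rewrite distrC; apply: le_lt_trans (pl_lip2 B0 h h1) _.
move: h2; rewrite ltr_pdivlMr ?ltr_wpDl// distrC => h2.
by apply: le_lt_trans h2; rewrite mulrC ler_wpM2l// lerDl.
Qed.

Lemma floor_shift (s : R) (N : nat) : Num.floor (s + N%:R) = Num.floor s + N%:Z.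
Proof. by rewrite floorDrz ?(@intrKfloor R N%:Z)// rpred_nat. Qed.

Lemma pl_per a (N : nat) s : (forall k, a (k + N%:Z) = a k) -> pl a (s + N%:R) = pl a s.
Proof.
move=> h; rewrite /pl floor_shift.
rewrite [_ + 1]addrAC !h; congr (_ + _ *: _).
by rewrite intrD /=; ring.
Qed.

End PiecewiseLinear.

Section Polygon.
Context {R : realType} {n : nat} {M : smoothManifold R n} (F : frame M).
Hypothesis cM : compact [set: M].
Variable x0 : M.
Notation D := (fdim F).
Notation e := (emb F).

Definition polygon (N : nat) (X : int -> M) (t : R) : M := near_pt x0 (pl (e \o X) (N%:R * t)).

Lemma polygon_loop : exists2 d : R, 0 < d & forall N (X : int -> M), (forall k, X (k + N%:Z) = X k) ->
  (forall k, `|e (X (k + 1)) - e (X k)| <= d) ->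
  loop_in setT (polygon N X) /\ (forall t, `|e (polygon N X t) - e (X (Num.floor (N%:R * t)))| <= (D%:R + 2) * d).
Proof.
have [d d0 hd] := near_pt_cvg F cM x0; exists (d / 2); first by rewrite divr_gt0.
move=> N X hp hX; have d20 : 0 <= d / 2 by rewrite divr_ge0// ltW.
split; last first.
  move=> t; apply: le_trans (near_pt_close cM x0 _ _) _; rewrite ler_wpM2l ?addr_ge0//.
  exact: (pl_close (a := e \o X)).
split=> // [t|t].
  apply: (hd _ _ _ (fun t => pl (e \o X) (N%:R * t)) _ (X (Num.floor (N%:R * t)))).
    by apply: le_lt_trans (pl_close (a := e \o X) _ d20 hX) _; lra.
  apply: (cvg_comp (fun t : R => N%:R * t) (pl (e \o X))); last exact: (pl_cts d20 hX).
  by apply: cvgM; [exact: cvg_cst|exact: cvg_id].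
by rewrite /polygon mulrDr mulr1 pl_per// => k; rewrite /= hp.
Qed.

Lemma polygon_homotopic : exists2 d : R, 0 < d &
  (forall N (X X' : int -> M), (forall k, X (k + N%:Z) = X k) -> (forall k, X' (k + N%:Z) = X' k) ->
  (forall k, `|e (X (k + 1)) - e (X k)| <= d) -> (forall k, `|e (X' (k + 1)) - e (X' k)| <= d) ->
  (forall k, `|e (X' k) - e (X k)| <= d) -> free_homotopic setT (polygon N X) (polygon N X')) /\
  (forall N (X : int -> M) g, (forall k, X (k + N%:Z) = X k) ->
  (forall k, `|e (X (k + 1)) - e (X k)| <= d) -> loop_in setT g ->
  (forall t, `|e (g t) - e (X (Num.floor (N%:R * t)))| <= d) ->
  free_homotopic setT (polygon N X) g /\ free_homotopic setT g (polygon N X)).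
Proof.
have [d1 d10 h1] := polygon_loop; have [d2 d20 h2] := close_homotopic F cM x0.
have D0 : (0 : R) <= D%:R by [].
have D3 : 0 < 2 * (D%:R + 3) :> R by rewrite mulr_gt0// ltr_wpDl.
(* Each polygon is within (D + 2) d of its vertices, so two polygons with d-close vertices are at
   most (2 (D + 2) + 1) d apart. *)
pose d := Num.min d1 (d2 / (2 * (D%:R + 3))).
have d0 : 0 < d by rewrite lt_min d10 divr_gt0.
have dd1 : d <= d1 by rewrite ge_min lexx.
have dd2 : 2 * (D%:R + 3) * d <= d2 by rewrite mulrC -ler_pdivlMr// ge_min lexx orbT.
have h1' N (X : int -> M) : (forall k, X (k + N%:Z) = X k) -> (forall k, `|e (X (k + 1)) - e (X k)| <= d) ->
    loop_in setT (polygon N X) /\ forall t, `|e (polygon N X t) - e (X (Num.floor (N%:R * t)))| <= (D%:R + 2) * d.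
  move=> hp hX; have [l _] : loop_in setT (polygon N X) /\ _ := h1 N X hp (fun k => le_trans (hX k) dd1).
  split=> // t; apply: le_trans (near_pt_close cM x0 _ _) _; rewrite ler_wpM2l ?addr_ge0//.
  by apply: (pl_close (a := e \o X)) => //; exact: ltW.
exists d => //; split.
  move=> N X X' hp hp' hX hX' hXX; have [l c] := h1' N X hp hX; have [l' c'] := h1' N X' hp' hX'.
  apply: h2 => // t; have := c t; have := c' t; have := hXX (Num.floor (N%:R * t)).
  move: (e (polygon N X t)) (e (polygon N X' t)) (e (X _)) (e (X' _)) => a a' b b' g1 g2 g3.
  have -> : a' - a = (a' - b') + (b' - b) - (a - b) by apply/rowP => j; rewrite !mxE; ring.
  apply: le_lt_trans (ler_normB _ _) _; apply: le_lt_trans (lerD (ler_normD _ _) (lexx _)) _.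
  move: g1 g2 g3 dd2; nra.
move=> N X g hp hX lg hg; have [l c] := h1' N X hp hX.
have B t : `|e (g t) - e (polygon N X t)| < d2.
  have := c t; have := hg t; move: (e (polygon N X t)) (e (g t)) (e (X _)) => a b x g1 g2.
  have -> : b - a = (b - x) - (a - x) by apply/rowP => j; rewrite !mxE; ring.
  apply: le_lt_trans (ler_normB _ _) _; move: g1 g2 dd2; nra.
by split; apply: h2 => // t; rewrite distrC.
Qed.

Lemma floor_frac (N : nat) (t : R) : (0 < N)%N -> `|t - (Num.floor (N%:R * t))%:~R / N%:R| <= 1 / N%:R.
Proof.
move=> N0; have N0' : 0 < N%:R :> R by rewrite ltr0n.
have -> : t - (Num.floor (N%:R * t))%:~R / N%:R = (N%:R * t - (Num.floor (N%:R * t))%:~R) / N%:R.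
  by field; rewrite gt_eqF.
rewrite ger0_norm ?divr_ge0 ?subr_ge0 ?floor_le// ler_pM2r ?invr_gt0// lerBlDr addrC ltW//.
by rewrite -intrD1 floorD1_gt.
Qed.

(** The loop is merely continuous, so its own samples give no bound of order 1/N. It is first
    replaced by a homotopic polygon [g1], which is Lipschitz because [near_pt] is, and [g1] is
    sampled. The bound [l] depends on [g1] only and later fixes the slope of the modified
    Hamiltonian. *)
Lemma lipschitz_polygons g : loop_in setT g -> exists l, 0 < l /\ exists N0 : nat, forall N : nat, (N0 <= N)%N ->
  exists X : int -> M, [/\ forall k, X (k + N%:Z) = X k,
    forall k, `|e (X (k + 1)) - e (X k)| <= l / N%:R & free_homotopic setT g (polygon N X)].
Proof.
move=> lg; have [cg pg _] := lg.
have [d d0 [hd1 hd2]] := polygon_homotopic.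
have [d' d'0 hd'] := polygon_loop.
have [dl [L [dl0 L0 hL]]] := near_pt_lip F cM x0.
pose r := Num.min (Num.min d d') dl; have r0 : 0 < r by rewrite !lt_min d0 d'0.
have rd : r <= d by rewrite !ge_min lexx.
have rd' : r <= d' by rewrite !ge_min lexx orbT.
have rdl : r <= dl by rewrite !ge_min lexx !orbT.
clearbody r.
have ch : continuous (e \o g).
  by move=> t; apply: (cvg_comp g e (cg t)); exact: emb_cts.
have [|C C0 hC] := periodic_unif ch _ r0; first by move=> t; rewrite /= pg.
pose N1 := (Num.trunc C).+1.
have N1C : C < N1%:R by rewrite truncnS_gt.
have N10 : 0 < N1%:R :> R by rewrite ltr0n.
pose X1 (k : int) := g (k%:~R / N1%:R).
have X1p k : X1 (k + N1%:Z) = X1 k.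
  by rewrite /X1 intrD mulrDl divff ?gt_eqF// pg.
have hC1 t t' : `|t' - t| <= 1 / N1%:R -> `|e (g t') - e (g t)| <= r.
  move=> h; apply/ltW/hC; apply: le_lt_trans (ler_wpM2l (ltW C0) h) _.
  by rewrite mulrA mulr1 ltr_pdivrMr// mul1r.
have X1s k : `|e (X1 (k + 1)) - e (X1 k)| <= r.
  by apply: hC1; rewrite -mulrBl intrD addrC addKr ger0_norm ?divr_ge0.
pose g1 := polygon N1 X1.
have [lg1 _] : loop_in setT g1 /\ _ := hd' N1 X1 X1p (fun k => le_trans (X1s k) rd').
have gg1 : free_homotopic setT g g1.
  apply: (hd2 N1 X1 g X1p _ lg _).2 => [k|t]; first exact: le_trans (X1s k) rd.
  by apply: le_trans rd; apply: hC1; exact: floor_frac.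
have g1lip s s' : `|s' - s| < 1 / N1%:R -> `|e (g1 s') - e (g1 s)| <= L * r * N1%:R * `|s' - s|.
  move=> hs; have pc u : `|pl (e \o X1) u - e (X1 (Num.floor u))| <= dl.
    by apply: le_trans rdl; apply: (pl_close (a := e \o X1) _ (ltW r0)).
  apply: le_trans (hL _ _ _ _ (pc _) (pc _)) _; rewrite -!mulrA ler_wpM2l ?(ltW L0)//.
  have E : `|N1%:R * s' - N1%:R * s| = N1%:R * `|s' - s| by rewrite -mulrBr normrM ger0_norm.
  rewrite -E; apply: (pl_lip2 (ltW r0)) => //.
  by rewrite E mulrC -ltr_pdivlMr.
pose l := L * r * N1%:R + 1.
have l0 : 0 < l by rewrite /l ltr_wpDl// !mulr_ge0 ?(ltW L0) ?(ltW r0).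
exists l; split=> //; exists (Num.trunc (N1%:R + l / d)).+1 => N hN.
have NN : N1%:R + l / d < N%:R.
  by apply: lt_le_trans (truncnS_gt _) _; rewrite ler_nat.
have ld : 0 < l / d by rewrite divr_gt0.
have N0 : 0 < N%:R :> R by apply: lt_trans NN; rewrite addr_gt0.
have Nn0 : (0 < N)%N by rewrite -(ltr0n R).
have lN : l / N%:R <= d by rewrite ler_pdivrMr// mulrC -ler_pdivrMr//; move: NN N10; lra.
have N1N : 1 / N%:R < 1 / N1%:R :> R by rewrite ltr_pM2l// ltf_pV2 ?posrE//; move: NN ld; lra.
pose X (k : int) := g1 (k%:~R / N%:R).
have Xp k : X (k + N%:Z) = X k.
  by have [_ p1 _] := lg1; rewrite /X intrD mulrDl divff ?gt_eqF// p1.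
have lE (u : R) : `|u| <= 1 / N%:R -> L * r * N1%:R * `|u| <= l / N%:R.
  move=> hu; apply: (@le_trans _ _ (l * `|u|)); first by rewrite ler_wpM2r// /l lerDl.
  by apply: le_trans (ler_wpM2l (ltW l0) hu) _; rewrite mulrA mulr1.
have Xs k : `|e (X (k + 1)) - e (X k)| <= l / N%:R.
  have E : `|(k + 1)%:~R / N%:R - k%:~R / N%:R| = 1 / N%:R :> R.
    by rewrite -mulrBl intrD addrC addKr ger0_norm ?divr_ge0.
  by apply: le_trans (g1lip _ _ _) _; [rewrite E|apply: lE; rewrite E].
exists X; split=> //.
apply: free_homotopic_trans gg1 _; apply: (hd2 N X g1 Xp _ lg1 _).2 => [k|t]; first exact: le_trans (Xs k) lN.
have hf := floor_frac t Nn0.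
by apply: le_trans lN; apply: le_trans (g1lip _ _ (le_lt_trans hf N1N)) _; exact: lE.
Qed.

End Polygon.

(** * Discrete action and its minimax critical points *)

Section Cutoffs.
Context {R : realType}.

Definition sat (u : R) : R := posp u / (1 + posp u).

Lemma posp_ge0 (u : R) : 0 <= posp u. Proof. by rewrite /posp le_max lexx. Qed.

Lemma sat_ge0 u : 0 <= sat u.
Proof. by rewrite divr_ge0 ?addr_ge0 ?posp_ge0. Qed.

Lemma sat_le1 u : sat u <= 1.
Proof. by rewrite ler_pdivrMr ?mul1r ?lerDr// ltr_wpDr ?posp_ge0. Qed.

Lemma sat_eq0 u : u <= 0 -> sat u = 0.
Proof. by move=> u0; rewrite /sat /posp max_l// mul0r. Qed.

Lemma sat_ge a u : 0 < a -> a <= u -> a / (1 + a) <= sat u.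
Proof.
move=> a0 au; have u0 := lt_le_trans a0 au.
rewrite /sat /posp max_r ?(ltW u0)// ler_pdivrMr ?ltr_wpDr ?(ltW a0)// mulrAC ler_pdivlMr; nra.
Qed.

Lemma sat_cvg (T : Type) (G : set_system T) (FG : Filter G) (f : T -> R) a :
  f @ G --> a -> sat (f t) @[t --> G] --> sat a.
Proof.
move=> hf; have hp : posp (f t) @[t --> G] --> posp a.
  have E (u : R) : posp u = (u + `|u|) / 2.
    by rewrite /posp; have [u0|u0] := leP 0 u; [rewrite ger0_norm//|rewrite ltr0_norm//]; field.
  rewrite (_ : (fun t => posp (f t)) = fun t => (f t + `|f t|) / 2); last by apply/funext => t.
  by rewrite E; apply: cvgM; [apply: cvgD => //; exact: cvg_norm|exact: cvg_cst].
apply: cvgM => //; apply: cvgV; first by rewrite gt_eqF// ltr_wpDr ?posp_ge0.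
by apply: cvgD => //; exact: cvg_cst.
Qed.

(** The projection onto the interval [-r, r], in a form whose continuity is immediate. *)
Definition clamp1 (r u : R) : R := (`|u + r| - `|u - r|) / 2.

Lemma clamp1P (r u : R) : 0 < r ->
  [\/ `|u| <= r /\ clamp1 r u = u, r < u /\ clamp1 r u = r | u < - r /\ clamp1 r u = - r].
Proof.
move=> r0; rewrite /clamp1; have [h|h] := leP u r; last first.
  by constructor 2; split=> //; rewrite !ger0_norm; [field|lra|lra].
have [h2|h2] := leP (- r) u.
  constructor 1; split; first by rewrite ler_norml h2.
  by rewrite ger0_norm ?ler0_norm; [field|lra|lra].
by constructor 3; split=> //; rewrite !ler0_norm; [field|lra|lra].
Qed.

Lemma clamp1_norm r u : 0 < r -> `|clamp1 r u| <= r.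
Proof.
move=> r0; case: (clamp1P u r0) => -[h ->] //; first by rewrite gtr0_norm.
by rewrite normrN gtr0_norm.
Qed.

Lemma clamp1_id r u : 0 < r -> `|u| <= r -> clamp1 r u = u.
Proof.
move=> r0 ur; case: (clamp1P u r0) => -[h ->] //; move: ur; rewrite ler_norml => /andP[]; lra.
Qed.

Lemma clamp1_big r u : 0 < r -> r <= `|u| -> `|clamp1 r u| = r.
Proof.
move=> r0 ur; case: (clamp1P u r0) => -[h ->]; last by rewrite normrN gtr0_norm.
  by apply/le_anti; rewrite h.
by rewrite gtr0_norm.
Qed.

(** The variational inequality of the projection onto an interval, the counterpart of [near_pt_desc]
    for momenta. *)
Lemma clamp1_desc (r p g : R) : 0 < r -> `|p| <= r ->
  (clamp1 r (p - g) - p) ^+ 2 <= - (g * (clamp1 r (p - g) - p)).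
Proof.
move=> r0; rewrite ler_norml => /andP[p1 p2].
case: (clamp1P (p - g) r0) => -[h ->]; nra.
Qed.

Lemma clamp1_crit (r p g t d B : R) : 0 < r -> `|p| <= r -> 0 < t -> `|clamp1 r (p - t * g) - p| <= d -> `|g| <= B ->
  p * g <= - r * `|g| + (2 * r / t + B) * d.
Proof.
move=> r0 pr t0; have p12 := pr; rewrite ler_norml in p12; move/andP: p12 => [p1 p2].
have rt : 0 < r / t by rewrite divr_gt0.
case: (clamp1P (p - t * g) r0) => -[h ->] hd hB.
- have : t * `|g| <= d.
    have E : p - t * g - p = - (t * g) by ring.
    by rewrite E normrN normrM (gtr0_norm t0) in hd.
  move=> tg; have pg : p * g <= r * `|g|.
    by apply: le_trans (ler_norm _) _; rewrite normrM ler_wpM2r.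
  have B0 : 0 <= B by apply: le_trans hB.
  have d0 : 0 <= d by apply: le_trans hd.
  have : 2 * (r / t) * (t * `|g|) <= 2 * (r / t) * d by rewrite ler_wpM2l// mulr_ge0// ltW.
  have -> : 2 * (r / t) * (t * `|g|) = 2 * r * `|g| by field; rewrite gt_eqF.
  have : 0 <= B * d by rewrite mulr_ge0.
  have -> : 2 * r / t = 2 * (r / t) by rewrite mulrA.
  move: (`|g|) (r / t) pg => gg rr pg; lra.
- have g0 : g < 0 by nra.
  rewrite ltr0_norm// in hB *; rewrite ger0_norm ?subr_ge0// in hd.
  have d0 : 0 <= d by lra.
  have : (r - p) * - g <= d * B by apply: ler_pM; lra.
  have : 0 <= 2 * r / t * d by rewrite mulr_ge0// -mulrA mulr_ge0// ltW.
  lra.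
- have g0 : 0 < g by nra.
  rewrite gtr0_norm// in hB *; rewrite ler0_norm in hd; last by lra.
  have d0 : 0 <= d by lra.
  have : (r + p) * g <= d * B by apply: ler_pM; lra.
  have : 0 <= 2 * r / t * d by rewrite mulr_ge0// -mulrA mulr_ge0// ltW.
  lra.
Qed.

Lemma clamp1_cvg (T : Type) (G : set_system T) (FG : Filter G) (f : T -> R) a r :
  f @ G --> a -> clamp1 r (f t) @[t --> G] --> clamp1 r a.
Proof.
move=> hf; apply: cvgM; last exact: cvg_cst.
by apply: cvgB; apply: cvg_norm; [apply: cvgD|apply: cvgB] => //; exact: cvg_cst.
Qed.

Definition clamp n (r : R) (v : 'rV[R]_n) : 'rV[R]_n := \row_j clamp1 r (v 0 j).

Lemma clamp_cvg n (T : Type) (G : set_system T) (FG : Filter G) (f : T -> 'rV[R]_n) a r :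
  f @ G --> a -> clamp r (f t) @[t --> G] --> clamp r a.
Proof.
move=> hf; apply: cvg_rV => j.
rewrite mxE (_ : (fun t => clamp r (f t) 0 j) = fun t => clamp1 r (f t 0 j)); last by apply/funext => t; rewrite mxE.
apply: clamp1_cvg; exact: (cvg_comp f (fun v : 'rV[R]_n => v 0 j) hf (@coord_cvg _ n a j)).
Qed.

Lemma clamp_norm n r (v : 'rV[R]_n) : 0 < r -> `|clamp r v| <= r.
Proof. by move=> r0; apply: mx_norm_le => [|a j]; rewrite ?(ltW r0)// mxE clamp1_norm. Qed.

Lemma clamp_id n r (v : 'rV[R]_n) : 0 < r -> `|v| <= r -> clamp r v = v.
Proof.
move=> r0 vr; apply/rowP => j; rewrite mxE clamp1_id//; apply: le_trans vr; exact: coord_le_norm.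
Qed.

Lemma clamp_desc n (r : R) (p g : 'rV[R]_n) : 0 < r -> `|p| <= r ->
  pairing (clamp r (p - g) - p) (clamp r (p - g) - p) <= - pairing g (clamp r (p - g) - p).
Proof.
move=> r0 pr; set d := clamp _ _ - _; rewrite -pairingNl; apply: ler_sum => j _; rewrite -expr2 [(- g) 0 j]mxE mulNr.
have := clamp1_desc (p := p 0 j) (g 0 j) r0 (le_trans (coord_le_norm _ _ _) pr).
by rewrite /d !mxE.
Qed.

End Cutoffs.

Section FibreGradient.
Context {R : realType} {D : nat}.

Definition dgrad (f : 'rV[R]_D -> R) p : 'rV[R]_D := \row_j 'D_(delta_mx 0 j) f p.

Lemma dgradP f p v : differentiable f p -> 'D_v f p = pairing (dgrad f p) v.
Proof. by move=> df; rewrite derive_rV//; apply: eq_bigr => j _; rewrite mxE mulrC. Qed.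

Lemma dgrad_lip f p (L : R) : 0 <= L -> differentiable f p -> (forall p', `|f p' - f p| <= L * `|p' - p|) ->
  `|dgrad f p| <= L.
Proof.
move=> L0 df h; apply: mx_norm_le => // a j; rewrite ord1 mxE.
set v := delta_mx 0 j; have v1 : `|v : 'rV[R]_D| <= 1.
  by apply: mx_norm_le => // a' k; rewrite mxE; case: (_ && _); rewrite ?normr1 ?normr0.
have hd : derivable f p v by exact: diff_derivable.
suff : `|'D_v f p| <= L by [].
have hc : h^-1 *: ((f \o shift p) (h *: v) - f p) @[h --> 0^'] --> 'D_v f p by exact: hd.
have hn : `|h^-1 *: ((f \o shift p) (h *: v) - f p)| @[h --> 0^'] --> `|'D_v f p| by exact: cvg_norm.
rewrite -(cvg_lim _ hn)//; apply: limr_le; first by apply/cvg_ex; eexists; exact: hn.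
near=> s; have s0 : s != 0 by near: s; exact: nbhs_dnbhs_neq.
rewrite normrZ normfV ler_pdivrMl ?normr_gt0// mulrC /=; apply: le_trans (h _) _.
by rewrite addrK normrZ ler_wpM2l// ler_piMr.
Unshelve. all: by end_near. Qed.

End FibreGradient.

Section DiscreteAction.
Context {R : realType} {n : nat} {M : smoothManifold R n} (F : frame M).
Hypothesis cM : compact [set: M].
Variables (m : nat).
Notation D := (fdim F).
Notation e := (emb F).
Notation N := m.+1.
Variable k : 'I_N -> M -> 'rV[R]_D -> R.
Hypothesis hk : forall i, JCk 2 (k i).

Definition state : Type := (('I_N -> M) * ('I_N -> 'rV[R]_D))%type.
Implicit Type z : state.

Definition dstep z i : 'rV[R]_D := e (z.1 (ordS i)) - e (z.1 i).
Definition Gp z i : 'rV[R]_D := dstep z i - dgrad (k i (z.1 i)) (z.2 i).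
(** With [Gp], the gradient of [daction]: the point x_i ends the step i - 1 and begins the step i,
    hence the difference of two momenta. *)
Definition Gx z i : 'rV[R]_D := z.2 (ord_pred i) - z.2 i - grad F (fun x => k i x (z.2 i)) (z.1 i).
Definition daction z : R := \sum_i (pairing (z.2 i) (dstep z i) - k i (z.1 i) (z.2 i)).
Definition movement z z' : R := \sum_i (`|e (z'.1 i) - e (z.1 i)| ^+ 2 + `|z'.2 i - z.2 i| ^+ 2).
Definition boxed (r : R) z := forall i, `|z.2 i| <= r.

Let kdiff i x p : differentiable (k i x) p.
Proof. exact: (JCk_fib x (findim_rV D) (hk i)).1. Qed.

Lemma sum_ordS (f : 'I_N -> R) : \sum_i f (ordS i) = \sum_i f i.
Proof. by rewrite [RHS](reindex_inj (@ordS_inj N)). Qed.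

Lemma daction_expand r : exists2 C, 0 < C & forall z z', boxed r z -> boxed r z' ->
  daction z' - daction z <= \sum_i (pairing (Gp z i) (z'.2 i - z.2 i) + pairing (Gx z i) (e (z'.1 i) - e (z.1 i))) + C * movement z z'.
Proof.
have [Ck hC] := choice (fun i => let: ex_intro2 C C0 h := jet_bound F cM (box_compact (n := D) (r := r)) (findim_rV D) (hk i) in ex_intro _ C (conj C0 h)).
pose C' := \sum_i Ck i.
have CkC i : Ck i <= C'.
  by rewrite /C' (bigD1 i)//= lerDl; apply: sumr_ge0 => j _; rewrite ltW ?(hC j).1.
have C'0 : 0 <= C' by apply: sumr_ge0 => i _; rewrite ltW ?(hC i).1.
exists (C' + D%:R + 1) => [|z z' bz bz']; first by rewrite ltr_wpDl// addr_ge0.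
pose dx i : 'rV[R]_D := e (z'.1 i) - e (z.1 i); pose dp i : 'rV[R]_D := z'.2 i - z.2 i.
(* [U] and [V] have the same sum by a cyclic shift. Adding their difference performs the summation
   by parts and moves the squares of [dx (ordS i)] to the index i, after which the inequality holds
   term by term. *)
pose U i : R := pairing (z.2 i) (dx (ordS i)) + D%:R / 2 * `|dx (ordS i)| ^+ 2.
pose V i : R := pairing (z.2 (ord_pred i)) (dx i) + D%:R / 2 * `|dx i| ^+ 2.
have UV : \sum_i U i = \sum_i V i.
  by rewrite -[RHS]sum_ordS; apply: eq_bigr => i _; rewrite /V ordSK.
rewrite /daction /movement -sumrB mulr_sumr; apply: le_trans (_ : _ <= _ + (\sum_i U i - \sum_i V i)) _; last first.
  by rewrite UV subrr addr0.
rewrite -(sumrB _ _ U) -!big_split /=.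
apply: ler_sum => i _; rewrite -/(dx i) -/(dp i).
have hj := (hC i).2 (z.1 i) (z.2 i) (z'.1 i) (z'.2 i) (bz i) (bz' i).
rewrite /jet_err -/(dx i) -/(dp i) dgradP// in hj.
have E1 : pairing (z'.2 i) (dstep z' i) - pairing (z.2 i) (dstep z i) =
   pairing (dp i) (dstep z i) + pairing (z.2 i) (dx (ordS i) - dx i) + pairing (dp i) (dx (ordS i) - dx i).
  have -> : dx (ordS i) - dx i = dstep z' i - dstep z i.
    by rewrite /dx /dstep; apply/rowP => j; rewrite !mxE; ring.
  by rewrite /dp !pairingBl !pairingBr; ring.
have b1 : pairing (dp i) (dx (ordS i) - dx i) <=
    D%:R * `|dp i| ^+ 2 + D%:R / 2 * `|dx (ordS i)| ^+ 2 + D%:R / 2 * `|dx i| ^+ 2.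
  apply: le_trans (ler_norm _) _; apply: le_trans (pairing_bnd _ _) _.
  have h : `|dp i| * `|dx (ordS i) - dx i| <= `|dp i| ^+ 2 + `|dx (ordS i)| ^+ 2 / 2 + `|dx i| ^+ 2 / 2.
    apply: (@le_trans _ _ (`|dp i| * (`|dx (ordS i)| + `|dx i|))); first by rewrite ler_wpM2l// ler_normB.
    have s1 := sqr_ge0 (`|dp i| - `|dx (ordS i)|); have s2 := sqr_ge0 (`|dp i| - `|dx i|).
    move: (`|dp i|) (`|dx _|) (`|dx i|) s1 s2 => a b c; rewrite !expr2; lra.
  apply: le_trans (ler_wpM2l (ler0n _ D) h) _.
  by rewrite le_eqVlt; apply/orP; left; apply/eqP; ring.
have b2 : k i (z.1 i) (z.2 i) - k i (z'.1 i) (z'.2 i) <=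
    - pairing (grad F (fun x => k i x (z.2 i)) (z.1 i)) (dx i) - pairing (dgrad (k i (z.1 i)) (z.2 i)) (dp i) +
    C' * (`|dx i| ^+ 2 + `|dp i| ^+ 2).
  have : Ck i * (`|dx i| ^+ 2 + `|dp i| ^+ 2) <= C' * (`|dx i| ^+ 2 + `|dp i| ^+ 2).
    by rewrite ler_wpM2r// addr_ge0 ?sqr_ge0.
  move: hj; rewrite ler_norml => /andP[hj _]; move: hj.
  by move: (pairing (grad _ _ _) _) => a; lra.
have b3 : 0 <= `|dx i| ^+ 2 by exact: sqr_ge0.
have b4 : 0 <= `|dp i| ^+ 2 by exact: sqr_ge0.
have b5 : 0 <= D%:R * `|dx i| ^+ 2 by rewrite mulr_ge0.
have b6 : 0 <= D%:R * `|dp i| ^+ 2 by rewrite mulr_ge0.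
have -> : pairing (Gp z i) (dp i) = pairing (dp i) (dstep z i) - pairing (dgrad (k i (z.1 i)) (z.2 i)) (dp i).
  by rewrite /Gp pairingBl (pairingC (dstep z i)).
have -> : pairing (Gx z i) (dx i) = pairing (z.2 (ord_pred i)) (dx i) - pairing (z.2 i) (dx i) -
     pairing (grad F (fun x => k i x (z.2 i)) (z.1 i)) (dx i).
  by rewrite /Gx !pairingBl.
rewrite pairingBr in E1; rewrite /U /V.
move: b1 b2 E1 b3 b4 b5 b6.
move: (`|dx i| ^+ 2) (`|dp i| ^+ 2) (`|dx (ordS i)| ^+ 2) => a b c.
move: (pairing (grad _ _ _) _) (pairing (dgrad _ _) _) => g1 g2.
move: (k i _ _) (k i _ _) (pairing (z'.2 i) _) (pairing (z.2 i) (dstep z i)) => k1 k2 t1 t2.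
have -> : (C' + D%:R + 1) * (a + b) = C' * (a + b) + D%:R * a + D%:R * b + a + b by ring.
have -> : D%:R / 2 * a = D%:R * a / 2 by rewrite mulrAC.
have -> : D%:R / 2 * c = D%:R * c / 2 by rewrite mulrAC.
move: (C' * _) (D%:R * a) (D%:R * b) (D%:R * c) => u1 u2 u3 u4; lra.
Qed.

End DiscreteAction.

Section Descent.
Context {R : realType} {n : nat} {M : smoothManifold R n} (F : frame M).
Hypothesis cM : compact [set: M].
Variables (x0 : M) (m : nat).
Notation D := (fdim F).
Notation e := (emb F).
Notation N := m.+1.
Variable k : 'I_N -> M -> 'rV[R]_D -> R.
Hypothesis hk : forall i, JCk 2 (k i).
Implicit Type z : state F m.

Let kdiff i x p : differentiable (k i x) p.
Proof. exact: (JCk_fib x (findim_rV D) (hk i)).1. Qed.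

Variables (r tau a0 del : R).
Hypotheses (r0 : 0 < r) (tau0 : 0 < tau).

(* [zeta] stops the descent below the level [a0]; [chi] stops the base points of a state that is about
   to leave the class of loops, while its momenta go on moving. *)
Definition zeta z : R := sat (daction k z - a0).
Definition chi z : R := \prod_i sat (del - `|dstep z i|).

(** A gradient step downwards in all the variables, followed by the projection onto M for the base
    points and onto the box for the momenta. *)
Definition step z : state F m :=
  ((fun i => near_pt x0 (e (z.1 i) - (tau * zeta z * chi z) *: Gx k z i)),
   (fun i => clamp r (z.2 i - (tau * zeta z) *: Gp k z i))).

Lemma chi01 z : 0 <= chi z <= 1.
Proof.
apply/andP; split; first by apply: prodr_ge0 => i _; exact: sat_ge0.
by apply: prodr_ile1 => i _; rewrite sat_ge0 sat_le1.
Qed.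

Lemma step_size z : 0 <= tau * zeta z * chi z <= tau.
Proof.
have [c0 c1] := andP (chi01 z); have z0 : 0 <= zeta z := sat_ge0 _; have z1 : zeta z <= 1 := sat_le1 _.
have t0 := ltW tau0; apply/andP; split; first by do 2 apply: mulr_ge0 => //.
by rewrite -mulrA ler_piMr//; exact: mulr_ile1.
Qed.

Lemma chi_eq0 z i : del <= `|dstep z i| -> chi z = 0.
Proof. by move=> h; rewrite /chi (bigD1 i)//= sat_eq0 ?mul0r// subr_le0. Qed.

Lemma step_boxed z : boxed r (step z).
Proof. by move=> i; exact: clamp_norm. Qed.

Lemma step_frozen z : boxed r z -> daction k z <= a0 -> step z = z.
Proof.
move=> bz az; have z0 : zeta z = 0 by rewrite /zeta sat_eq0// subr_le0.
case: z bz z0 {az} => x p bz z0; congr pair; apply/funext => i; rewrite /= z0 mulr0 ?mul0r scale0r subr0.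
  exact: near_pt_emb.
by rewrite clamp_id//; exact: bz.
Qed.

(** The cutoffs may make the actual step size [s] arbitrarily small or 0; the decrease is expressed
    by the upper bound [t] alone. *)
Lemma scalar_desc (s t X Y : R) : 0 <= s -> s <= t -> 0 < t -> 0 <= X -> X <= - (s * Y) -> (X = 0 -> Y = 0) -> Y <= - (X / t).
Proof.
move=> s0 st t0 X0 h h0; have [X00|Xn] := eqVneq X 0; first by rewrite h0// X00 mul0r oppr0.
have Xp : 0 < X by rewrite lt0r Xn.
have Y0 : Y < 0 by nra.
rewrite lerNr ler_pdivrMr//; nra.
Qed.

(** The first-order decrease is at least the squared displacement over tau for the momenta, and over
    2 tau for the base points because of the factor 2 in [near_pt_desc]. For small tau this pays for
    the quadratic error and still leaves [movement]. *)
Lemma step_desc C z : boxed r z ->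
  (forall z', boxed r z' -> daction k z' - daction k z <=
    \sum_i (pairing (Gp k z i) (z'.2 i - z.2 i) + pairing (Gx k z i) (e (z'.1 i) - e (z.1 i))) + C * movement z z') ->
  2 * tau * (C + 1) <= 1 -> daction k (step z) + movement z (step z) <= daction k z.
Proof.
move=> bz hC ht; have h := hC (step z) (step_boxed z).
suff h2 : \sum_i (pairing (Gp k z i) ((step z).2 i - z.2 i) + pairing (Gx k z i) (e ((step z).1 i) - e (z.1 i))) <=
   - (C + 1) * movement z (step z) by rewrite -lerBrDr; lra.
rewrite mulr_sumr; apply: ler_sum => i _.
have z01 : 0 <= zeta z <= 1 by rewrite /zeta sat_ge0 sat_le1.
have c01 := chi01 z.
have tinv : C + 1 <= (2 * tau)^-1 by rewrite -[leRHS]div1r ler_pdivlMr ?mulr_gt0// mulrC.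
have sq0 (v : 'rV[R]_D) w : sq v = 0 -> pairing w v = 0.
  move=> v0; have : `|v| ^+ 2 <= 0 by rewrite -v0; exact: norm_le_pairing.
  move=> v1; have /eqP : `|v| ^+ 2 = 0 by apply/le_anti; rewrite v1 sqr_ge0.
  by rewrite sqrf_eq0 normr_eq0 => /eqP ->; rewrite pairing0r.
set dp := _ - z.2 i; set dx := _ - e (z.1 i).
have h1 : pairing (Gp k z i) dp <= - (sq dp / tau).
  apply: (@scalar_desc (tau * zeta z)) => //; first by rewrite mulr_ge0 ?(ltW tau0)//; case/andP: z01.
  - by rewrite ler_piMr ?(ltW tau0)//; case/andP: z01.
  - exact: pairing_ge0.
  - by rewrite -pairingZl; apply: clamp_desc.
  - exact: sq0.
have h2 : pairing (Gx k z i) dx <= - (sq dx / (2 * tau)).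
  apply: (@scalar_desc (2 * (tau * zeta z * chi z))) => //.
  - by rewrite mulr_ge0//; case/andP: (step_size z).
  - by rewrite ler_wpM2l//; case/andP: (step_size z).
  - by rewrite mulr_gt0.
  - exact: pairing_ge0.
  - apply: le_trans (near_pt_desc cM x0 _ _) _; rewrite addrAC subrr add0r pairingNl pairingZl.
    by rewrite -/dx; lra.
  - exact: sq0.
have n1 := norm_le_pairing dp; have n2 := norm_le_pairing dx.
rewrite -/(sq dp) in n1; rewrite -/(sq dx) in n2.
have s1 : 0 <= `|dp| ^+ 2 by exact: sqr_ge0.
have s2 : 0 <= `|dx| ^+ 2 by exact: sqr_ge0.
have t2 : tau^-1 = 2 * (2 * tau)^-1 by field; rewrite gt_eqF.
move: h1 h2; rewrite t2; have ti0 : 0 < (2 * tau)^-1 by rewrite invr_gt0 mulr_gt0.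
move: (2 * tau)^-1 tinv ti0 => T tinv ti0 h1 h2.
have m1 : (C + 1) * `|dp| ^+ 2 <= T * sq dp by nra.
have m2 : (C + 1) * `|dx| ^+ 2 <= T * sq dx by nra.
have m3 : 0 <= T * sq dp by rewrite mulr_ge0 ?(ltW ti0)// pairing_ge0.
move: h1 h2; rewrite mulrDr !mulNr; lra.
Qed.

Lemma step_cvg d G0 : (forall (T : Type) (G : set_system T) (FG : Filter G)
  (f : T -> 'rV[R]_D) xi y, `|xi - e y| < d -> f @ G --> xi -> near_pt x0 (f t) @[t --> G] --> near_pt x0 xi) ->
  (forall z i, boxed r z -> `|Gx k z i| <= G0) -> tau * G0 < d ->
  forall (T : Type) (G : set_system T) (FG : Filter G) (f : T -> state F m) z, boxed r z ->
  (forall i, (f t).1 i @[t --> G] --> z.1 i) -> (forall i, (f t).2 i @[t --> G] --> z.2 i) ->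
  (forall i, (step (f t)).1 i @[t --> G] --> (step z).1 i) /\
  (forall i, (step (f t)).2 i @[t --> G] --> (step z).2 i).
Proof.
move=> hd hG0 tG T G FG f z bz f1 f2.
have ce i : e ((f t).1 i) @[t --> G] --> e (z.1 i).
  by apply: (cvg_comp (fun t => (f t).1 i) e (f1 i)); exact: emb_cts.
have cd i : dstep (f t) i @[t --> G] --> dstep z i by apply: cvgB; exact: ce.
have cpair i : ((f t).1 i, (f t).2 i) @[t --> G] --> (z.1 i, z.2 i) by exact: cvg_pair (f1 i) (f2 i).
have ck i : k i ((f t).1 i) ((f t).2 i) @[t --> G] --> k i (z.1 i) (z.2 i).
  exact: (cvg_comp _ (fun q : M * 'rV[R]_D => k i q.1 q.2) (cpair i) (JCk_cts (hk i) (x := (z.1 i, z.2 i)))).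
have ca : daction k (f t) @[t --> G] --> daction k z.
  apply: cvg_big => [|i _]; first exact: add_continuous.
  by apply: cvgB => //; apply: cvg_pairing => //; exact: cd.
have cz : zeta (f t) @[t --> G] --> zeta z.
  by apply: sat_cvg; apply: cvgB => //; exact: cvg_cst.
have cc : chi (f t) @[t --> G] --> chi z.
  apply: cvg_big => [|i _]; first exact: mul_continuous.
  by apply: sat_cvg; apply: cvgB; [exact: cvg_cst|apply: cvg_norm; exact: cd].
have hk1 i : JCk 1 (k i) by move=> c; exact: CkW (hk i c).
have cGp i : Gp k (f t) i @[t --> G] --> Gp k z i.
  apply: cvgB; first exact: cd.
  apply: cvg_rV => j; rewrite mxE.
  rewrite (_ : (fun t => dgrad (k i ((f t).1 i)) ((f t).2 i) 0 j) =
     (fun t => 'D_(delta_mx 0 j) (k i ((f t).1 i)) ((f t).2 i))); last by apply/funext => t; rewrite mxE.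
  exact: (cvg_comp _ (fun q : M * 'rV[R]_D => 'D_(delta_mx 0 j) (k i q.1) q.2) (cpair i) (fib_derive_cts (hk1 i) (x := (z.1 i, z.2 i)))).
have cGx i : Gx k (f t) i @[t --> G] --> Gx k z i.
  apply: cvgB; first by apply: cvgB; exact: f2.
  exact: (cvg_comp _ (fun q : M * 'rV[R]_D => grad F ((k i)^~ q.2) q.1) (cpair i) (grad_cts (F := F) (findim_rV D) (hk1 i) (x := (z.1 i, z.2 i)))).
have ct : tau * zeta (f t) @[t --> G] --> tau * zeta z by apply: cvgM => //; exact: cvg_cst.
split=> i /=.
  apply: (hd _ _ _ _ _ (z.1 i)); last first.
    by apply: cvgB => //; apply: cvgZ => //; apply: cvgM.
  rewrite addrAC subrr add0r normrN normrZ; apply: le_lt_trans tG.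
  by have [s0 s1] := andP (step_size z); rewrite ger0_norm// ler_pM// hG0.
by apply: clamp_cvg; apply: cvgB => //; exact: cvgZ.
Qed.

Lemma Gx_bound : exists2 G0, 0 < G0 & forall z i, boxed r z -> `|Gx k z i| <= G0.
Proof.
have cB := compact_setX cM (box_compact (n := D) (r := r)).
have hb i : exists C, 0 < C /\ forall x p, `|p| <= r -> `|grad F (fun x => k i x p) x| <= C.
  have [||C C0 hC] := @compact_bound _ (M * 'rV[R]_D)%type _ (fun C q => `|grad F ((k i)^~ q.2) q.1| <= C) cB.
  - by move=> C C' x CC' /le_trans; exact.
  - move=> q _; exists (`|grad F ((k i)^~ q.2) q.1| + 1).
    have := grad_cts (F := F) (findim_rV D) (fun c => CkW (hk i c)) (x := q).
    move=> /cvgrPdist_lt/(_ _ ltr01); apply: filterS => q' hq' _.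
    have -> : grad F ((k i)^~ q'.2) q'.1 = grad F ((k i)^~ q.2) q.1 - (grad F ((k i)^~ q.2) q.1 - grad F ((k i)^~ q'.2) q'.1).
      by rewrite opprB addrC subrK.
    by apply: le_trans (ler_normB _ _) _; rewrite lerD2l ltW.
  by exists C; split=> // x p hp; exact: (hC (x, p)).
have [C hC] := choice hb.
exists (2 * r + \sum_i C i) => [|z i bz].
  by rewrite ltr_wpDr ?mulr_gt0//; apply: sumr_ge0 => i _; rewrite ltW ?(hC i).1.
apply: le_trans (ler_normB _ _) _; apply: lerD.
  by apply: le_trans (ler_normB _ _) _; have := bz i; have := bz (ord_pred i); lra.
apply: le_trans ((hC i).2 _ _ (bz i)) _.
by rewrite (bigD1 i)//= lerDl; apply: sumr_ge0 => j _; rewrite ltW ?(hC j).1.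
Qed.

End Descent.

Lemma add3_le (R : realType) (a b c d : R) : 2 * b <= d - a -> c <= a -> c + b + b <= d.
Proof. lra. Qed.

(** * The minimax argument for a fixed number of intervals *)

Section Minimax.
Context {R : realType} {n : nat} {M : smoothManifold R n} (F : frame M).
Hypothesis cM : compact [set: M].
Variables (x0 : M) (m : nat).
Notation D := (fdim F).
Notation e := (emb F).
Notation N := m.+1.
Variable k : 'I_N -> M -> 'rV[R]_D -> R.
Hypothesis hk : forall i, JCk 2 (k i).
Implicit Type z : state F m.
Variables (Lk w b0 B0 l0 c0 c1 del del' mu : R) (xs : 'I_N -> M) (Cl : ('I_N -> M) -> Prop).
Hypotheses (Lk0 : 0 <= Lk) (w0 : 0 < w) (del0 : 0 < del) (deldel : del < del') (mu0 : 0 < mu) (l00 : 0 <= l0).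
Hypothesis hLk : forall i x p p', `|k i x p' - k i x p| <= Lk * `|p' - p|.
Hypothesis hk0 : forall i x, k i x 0 <= - c0.
Hypothesis hc1 : c1 + 1 <= N%:R * c0.
Hypothesis hgrow : forall i x p, (D%:R * l0 + w) * `|p| - b0 <= k i x p.
Hypothesis hL : forall i x p, pairing p (dgrad (k i x) p) - k i x p <= B0.
Hypothesis hxs : forall i, `|e (xs (ordS i)) - e (xs i)| <= l0.
Hypothesis hl0 : l0 <= del.
Hypothesis Cl_xs : Cl xs.
Hypothesis Cl_stable : forall x x' : 'I_N -> M, (forall i, `|e (x (ordS i)) - e (x i)| <= del') ->
  (forall i, `|e (x' (ordS i)) - e (x' i)| <= del') -> (forall i, `|e (x' i) - e (x i)| <= del') -> Cl x -> Cl x'.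
Hypothesis hmu : Lk + mu <= del / 2.

Let kdiff i x p : differentiable (k i x) p.
Proof. exact: (JCk_fib x (findim_rV D) (hk i)).1. Qed.

(** The box has to be large for two reasons: the initial disc must have action at most c1 - 1 on its
    boundary ([rw]), and almost fixed points must have a [Gp] below [mu] ([rmu]). *)
Let r : R := Num.max 1 (Num.max ((N%:R * b0 - c1 + 1) / w) ((N%:R * B0 - c1 + 1) / mu)).
Let r0 : 0 < r. Proof. by rewrite lt_max ltr01. Qed.
Let rw : N%:R * b0 - w * r <= c1 - 1.
Proof.
have : (N%:R * b0 - c1 + 1) / w <= r by rewrite !le_max lexx orbT.
by rewrite ler_pdivrMr//; lra.
Qed.
Let rmu : N%:R * B0 - c1 + 1 <= r * mu.
Proof. by rewrite -ler_pdivrMr// !le_max lexx !orbT. Qed.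

Lemma sum_le_nat (f : 'I_N -> R) b : (forall i, f i <= b) -> \sum_i f i <= N%:R * b.
Proof.
move=> h; rewrite mulr_natl -[X in _ *+ X](card_ord N) -sumr_const; exact: ler_sum.
Qed.

Section Fixed.
Variables (tau eta G0 : R).
Hypotheses (tau0 : 0 < tau) (tG : (D%:R + 2) * (tau * G0) <= eta) (eta1 : 2 * eta <= del' - del) (eta2 : eta <= del').
Hypothesis hG0 : forall z i, boxed r z -> `|Gx k z i| <= G0.
Hypothesis hdesc : forall z, boxed r z ->
  daction k (step x0 k r tau (c1 - 1) del z) + movement z (step x0 k r tau (c1 - 1) del z) <= daction k z.
Hypothesis hcvg : forall (T : Type) (G : set_system T) (FG : Filter G) (f : T -> state F m) z, boxed r z ->
  (forall i, (f t).1 i @[t --> G] --> z.1 i) -> (forall i, (f t).2 i @[t --> G] --> z.2 i) ->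
  (forall i, (step x0 k r tau (c1 - 1) del (f t)).1 i @[t --> G] --> (step x0 k r tau (c1 - 1) del z).1 i) /\
  (forall i, (step x0 k r tau (c1 - 1) del (f t)).2 i @[t --> G] --> (step x0 k r tau (c1 - 1) del z).2 i).

Let stp := step x0 k r tau (c1 - 1) del.

Definition admissible z := [/\ boxed r z, Cl z.1 & forall i, `|dstep z i| <= del'].

(** If some chord has length at least [del], all base points are frozen. Otherwise one step changes
    each chord by at most 2 eta, which is at most del' - del, and [Cl_stable] applies. *)
Lemma inv_step z : admissible z -> admissible (stp z).
Proof.
move=> [bz cz dz]; have bz' : boxed r (stp z) by exact: step_boxed.
have [c01 c11] := andP (step_size k (c1 - 1) del tau0 z).
have hx i : `|e ((stp z).1 i) - e (z.1 i)| <= eta.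
  apply: le_trans tG; apply: le_trans (near_pt_close cM x0 _ (z.1 i)) _.
  rewrite ler_wpM2l ?addr_ge0// addrAC subrr add0r normrN normrZ ger0_norm//.
  by apply: ler_pM => //; exact: hG0.
have [[i hi]|hn] := pselect (exists i, del <= `|dstep z i|).
  have E : (stp z).1 = z.1.
    by apply/funext => j; rewrite /= (chi_eq0 hi) mulr0 scale0r subr0 near_pt_emb.
  by split; rewrite ?E// => j; rewrite /dstep E; exact: dz.
have dz' i : `|dstep (stp z) i| <= del'.
  have h1 : `|dstep z i| <= del by rewrite leNgt; apply/negP => h; apply: hn; exists i; exact: ltW.
  have -> : dstep (stp z) i = dstep z i + (e ((stp z).1 (ordS i)) - e (z.1 (ordS i))) - (e ((stp z).1 i) - e (z.1 i)).
    by rewrite /dstep [X in _ = X - _]addrC addrA subrK opprB addrA subrK.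
  apply: le_trans (ler_normB _ _) _; apply: le_trans (lerD (ler_normD _ _) (lexx _)) _.
  apply: le_trans (lerD (lerD (lexx _) (hx (ordS i))) (hx i)) _; exact: add3_le eta1 h1.
split=> //; apply: Cl_stable cz => // i; exact: le_trans (hx i) eta2.
Qed.

Lemma inv_iter J z : admissible z -> admissible (iter J stp z).
Proof. by move=> iz; elim: J => // J IH; exact: inv_step. Qed.

Definition start (v : 'rV[R]_(N * D)) : state F m := (xs, fun i => clamp r (row i (vec_mx v))).

Lemma inv_start v : admissible (start v).
Proof.
split=> // i; first exact: clamp_norm.
by apply: le_trans (hxs i) _; apply: le_trans hl0 (ltW deldel).
Qed.

Lemma start_term v i : pairing ((start v).2 i) (dstep (start v) i) - k i ((start v).1 i) ((start v).2 i) <=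
   b0 - w * `|(start v).2 i|.
Proof.
have h1 : pairing ((start v).2 i) (dstep (start v) i) <= D%:R * (`|(start v).2 i| * l0).
  apply: le_trans (ler_norm _) _; apply: le_trans (pairing_bnd _ _) _.
  by rewrite ler_wpM2l// ler_wpM2l//; exact: hxs.
have := hgrow i ((start v).1 i) ((start v).2 i).
move: (k _ _ _) h1 => kk; move: (pairing _ _) (`|(start v).2 i|) => a b h1 h2; lra.
Qed.

(** Over the short polygon [xs] the chosen slope beats the pairing with the chords, so one
    coordinate of size r already brings the action below the freezing level. *)
Lemma start_frozen (v : 'rV[R]_(N * D)) J : (exists q, r <= `|v 0 q|) -> iter J stp (start v) = start v.
Proof.
move=> [q]; case: (mxvec_indexP q) => i j hq.
have az : daction k (start v) <= c1 - 1.
  apply: le_trans rw; apply: (@le_trans _ _ (\sum_(i < N) (b0 - w * `|(start v).2 i|))).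
    by apply: ler_sum => i' _; exact: start_term.
  rewrite sumrB; apply: lerB; first exact: sum_le_nat.
  rewrite (bigD1 i)//= -[leLHS]addr0; apply: lerD; last by apply: sumr_ge0 => i' _; rewrite mulr_ge0// ltW.
  rewrite ler_wpM2l ?(ltW w0)//; apply: le_trans (coord_le_norm _ 0 j).
  by rewrite mxE mxE mxE clamp1_big.
have bz : boxed r (start v) by case: (inv_start v).
by elim: J => //= J ->; exact: step_frozen.
Qed.

Lemma iter_cvg J (v : 'rV[R]_(N * D)) : (forall i, (iter J stp (start u)).1 i @[u --> v] --> (iter J stp (start v)).1 i) /\
  (forall i, (iter J stp (start u)).2 i @[u --> v] --> (iter J stp (start v)).2 i).
Proof.
elim: J => [|J [IH1 IH2]]; last first.
  have [bz _ _] := inv_iter J (inv_start v).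
  exact: (@hcvg _ _ _ (fun u => iter J stp (start u)) _ bz IH1 IH2).
have FF : Filter (nbhs v) by exact: nbhs_filter.
split=> i /=; first exact: (@cvg_cst _ (xs i) _ (nbhs v) FF).
apply: (@clamp_cvg _ _ _ (nbhs v) FF); apply: (@cvg_rV _ _ _ (nbhs v) FF) => j; rewrite mxE mxE.
rewrite (_ : (fun u : 'rV[R]_(N * D) => row i (vec_mx u) 0 j) = fun u => u 0 (mxvec_index i j)).
  exact: coord_cvg.
by apply/funext => u; rewrite mxE mxE.
Qed.

Lemma reach_zero J eps : 0 < eps -> exists v, forall i, `|(iter J stp (start v)).2 i| <= eps.
Proof.
(* The bound r / 2 keeps the approximate zero out of the region where P v = v has a coordinate of
   size at least r. *)
move=> eps0; pose e2 := Num.min eps (r / 2).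
have e20 : 0 < e2 by rewrite lt_min eps0 divr_gt0.
pose fl (p : 'I_N -> 'rV[R]_D) : 'rV[R]_(N * D) := mxvec (\matrix_(i, j) p i 0 j).
(* Inside the box the last two terms cancel and P gives the momenta of the iterate; where the start
   is frozen the outer two cancel and P is the identity. *)
pose P (v : 'rV[R]_(N * D)) := fl (iter J stp (start v)).2 + v - fl (start v).2.
have flE p i j : fl p 0 (mxvec_index i j) = p i 0 j by rewrite mxvecE mxE.
have cP : continuous P.
  move=> v; have FF : Filter (nbhs v) by exact: nbhs_filter.
  apply: (@cvg_rV _ _ _ (nbhs v) FF) => q; have [i j] := mxvec_indexP q.
  have E u : P u 0 (mxvec_index i j) = (iter J stp (start u)).2 i 0 j + u 0 (mxvec_index i j) - (start u).2 i 0 j.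
    by rewrite /P [LHS]mxE [X in X + _]mxE [X in _ + X]mxE !flE.
  rewrite E (_ : (fun u => P u 0 (mxvec_index i j)) = fun u => (iter J stp (start u)).2 i 0 j + u 0 (mxvec_index i j) - (start u).2 i 0 j); last by apply/funext => u.
  have cc K : (iter K stp (start u)).2 i 0 j @[u --> v] --> (iter K stp (start v)).2 i 0 j.
    exact: (cvg_comp _ (fun w : 'rV[R]_D => w 0 j) ((iter_cvg K v).2 i) (@coord_cvg _ _ _ j)).
  by apply: cvgB; [apply: cvgD; [exact: cc|exact: coord_cvg]|exact: (cc 0%N)].
have hfix (v : 'rV[R]_(N * D)) : (exists q, r <= `|v 0 q|) -> P v = v.
  by move=> hq; rewrite /P start_frozen// addrAC subrr add0r.
have [v hv] := approx_zero r0 e20 cP hfix.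
have hq q : `|v 0 q| < r.
  rewrite ltNge; apply/negP => h.
  have := hv q; rewrite /P start_frozen; last by exists q.
  rewrite addrAC subrr add0r => h2; move: (le_trans h h2); rewrite /e2 le_min => /andP[_]; move: r0; lra.
exists v => i; apply: mx_norm_le => [|a j]; first exact: ltW.
have := hv (mxvec_index i j); rewrite /P.
have -> : fl (start v).2 = v.
  apply/rowP => q; have [i' j'] := mxvec_indexP q; rewrite flE /= clamp_id// ?mxE ?mxE//.
  by apply: mx_norm_le => [|a' j'']; rewrite ?(ltW r0)// mxE mxE ltW// hq.
rewrite addrK flE ord1 => /le_trans; apply; by rewrite ge_min lexx.
Qed.

Lemma small_action z eps : admissible z -> 0 < eps -> N%:R * (eps * (D%:R * del' + Lk)) <= 1 -> (forall i, `|z.2 i| <= eps) ->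
  c1 <= daction k z.
Proof.
move=> [_ _ dz] eps0 he hz; have dd0 : 0 <= del' by apply: le_trans (dz ord0).
rewrite -lerN2 /daction -sumrN.
apply: (@le_trans _ _ (N%:R * (eps * (D%:R * del' + Lk) - c0))); last by move: hc1; lra.
apply: sum_le_nat => i.
have h1 : - pairing (z.2 i) (dstep z i) <= eps * (D%:R * del').
  apply: le_trans (ler_norm _) _; rewrite normrN; apply: le_trans (pairing_bnd _ _) _.
  by rewrite [leRHS]mulrCA; apply: ler_wpM2l => //; apply: ler_pM.
have h2 := hLk i (z.1 i) 0 (z.2 i); rewrite subr0 in h2.
have h3 : Lk * `|z.2 i| <= Lk * eps by rewrite ler_wpM2l.
move: h2; rewrite ler_norml => /andP[_ h2]; have := hk0 i (z.1 i).
move: (k _ _ _) (k _ _ _) h2 => k1 k2 h2 h4; move: (pairing _ _) h1 => a h1; lra.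
Qed.

(** Some orbit of the descent is almost on {p = 0} at time J, where the action is at least c1; by
    monotonicity it is so at all earlier times. The action starts at most at N b0, so for J eps > N
    b0 - c1 the first J movements cannot all exceed eps. *)
Lemma small_move eps : 0 < eps -> exists z, [/\ admissible z, c1 <= daction k z & movement z (stp z) <= eps].
Proof.
move=> eps0; pose Am := N%:R * b0.
pose J := (Num.trunc (`|Am - c1| / eps)).+1.
have hJ : Am - c1 < J%:R * eps.
  by rewrite -ltr_pdivrMr//; apply: le_lt_trans (truncnS_gt _); rewrite ler_pM2r ?invr_gt0// ler_norm.
have dd0 : 0 < del' by apply: lt_trans deldel.
have K0 : 0 < N%:R * (D%:R * del' + Lk) + 1 by rewrite ltr_wpDl// mulr_ge0// addr_ge0// mulr_ge0// ltW.
pose e1 := (N%:R * (D%:R * del' + Lk) + 1)^-1.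
have e10 : 0 < e1 by rewrite invr_gt0.
have [v hv] := reach_zero J e10.
pose z j := iter j stp (start v).
have iz j : admissible (z j) by exact: inv_iter (inv_start v).
have zJ : c1 <= daction k (z J).
  apply: (@small_action _ e1) => //; rewrite mulrCA /e1 mulrC ler_pdivrMr// mul1r lerDl//.
have mono j : daction k (z j.+1) + movement (z j) (z j.+1) <= daction k (z j).
  by apply: hdesc; case: (iz j).
have mv0 (y y' : state F m) : 0 <= movement y y' by apply: sumr_ge0 => i _; rewrite addr_ge0// sqr_ge0.
have decr j l : daction k (z (j + l)%N) <= daction k (z j).
  elim: l => [|l IH]; rewrite ?addn0// addnS; apply: le_trans IH.
  by apply: le_trans (mono _); rewrite lerDl.
have z0 : daction k (z 0%N) <= Am.
  apply: sum_le_nat => i; apply: le_trans (start_term v i) _.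
  by rewrite gerBl mulr_ge0// ltW.
apply: contrapT => hno.
have big j : (j < J)%N -> eps < movement (z j) (z j.+1).
  move=> jJ; rewrite ltNge; apply/negP => hle; apply: hno; exists (z j); split=> //.
  by apply: le_trans zJ _; rewrite -(subnKC (ltnW jJ)); exact: decr.
have : forall j, (j <= J)%N -> daction k (z j) <= Am - j%:R * eps.
  elim=> [|j IH] jJ; first by rewrite mul0r subr0.
  have h1 := le_trans (lerD (lexx _) (ltW (big j jJ))) (mono j).
  have h2 := IH (ltnW jJ); rewrite -addn1 natrD mulrDl mul1r opprD addrA addn1 lerBrDr.
  exact: le_trans h1 h2.
move/(_ J (leqnn J)) => h; move: (le_trans zJ h); rewrite leNgt => /negP; apply.
by rewrite ltrBlDr -ltrBlDl.
Qed.

Lemma near_critical : exists z, [/\ Cl z.1, forall i, `|dstep z i| <= del',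
  forall i, `|Gp k z i| <= mu, forall i, `|Q (z.1 i) (Gx k z i)| <= mu &
  exists i, (c1 - 1) / N%:R <= pairing (z.2 i) (dgrad (k i (z.1 i)) (z.2 i)) - k i (z.1 i) (z.2 i)].
Proof.
have [CQ CQ0 hCQ] := Q_bnd F cM; have [CL CL0 hCL] := Q_lip F cM.
have N0 : 0 < N%:R :> R by [].
have dd0 : 0 < del' by apply: lt_trans deldel.
have G00 : 0 <= G0.
  have b0' : boxed r (start 0) by case: (inv_start 0).
  exact: le_trans (normr_ge0 _) (hG0 ord0 b0').
pose G1 := del' + Lk; have G10 : 0 <= G1 by rewrite addr_ge0// ltW.
pose K1 := 2 * r / (tau / 2) + G1.
have K10 : 0 <= K1 by rewrite addr_ge0// divr_ge0// ?mulr_ge0// ltW.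
pose ka := (del / 2) / (1 + del / 2).
have ka0 : 0 < ka by rewrite !divr_gt0// ltr_wpDr// divr_ge0// ltW.
pose s0 := tau / 2 * ka ^+ N; have s00 : 0 < s0 by rewrite mulr_gt0 ?divr_gt0// exprn_gt0.
pose e1 := (2 * (N%:R * (D%:R * K1)) + 1)^-1.
have K2 : 0 <= 2 * (N%:R * (D%:R * K1)) by rewrite !mulr_ge0.
have e10 : 0 < e1 by rewrite invr_gt0 ltr_wpDl.
pose e2 := mu / (CQ / s0 + CL * G0 + 1).
have K3 : 0 <= CQ / s0 + CL * G0.
  by apply: addr_ge0; [apply: divr_ge0|apply: mulr_ge0] => //; exact: ltW.
have e20 : 0 < e2 by rewrite divr_gt0// ltr_wpDl.
pose eps := Num.min e1 e2; have eps0 : 0 < eps by rewrite lt_min e10.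
have eK1 : N%:R * (D%:R * (K1 * eps)) <= 1 / 2.
  have : (2 * (N%:R * (D%:R * K1)) + 1) * eps <= 1.
    by rewrite mulrC -ler_pdivlMr ?ltr_wpDl// div1r ge_min lexx.
  have -> : (2 * (N%:R * (D%:R * K1)) + 1) * eps = 2 * (N%:R * (D%:R * (K1 * eps))) + eps by ring.
  by move: eps0; move: (N%:R * _) => a; lra.
have eK2 : (CQ / s0 + CL * G0) * eps <= mu.
  apply: (@le_trans _ _ ((CQ / s0 + CL * G0 + 1) * eps)); first by rewrite ler_wpM2r ?(ltW eps0)// lerDl.
  by rewrite mulrC -ler_pdivlMr ?ltr_wpDl// ge_min lexx orbT.
have [z [[bz cz dz] az mz]] := small_move (exprn_gt0 2 eps0).
have mzi i : `|e ((stp z).1 i) - e (z.1 i)| ^+ 2 + `|(stp z).2 i - z.2 i| ^+ 2 <= eps ^+ 2.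
  apply: le_trans mz; rewrite /movement (bigD1 i)//= lerDl; apply: sumr_ge0 => j _.
  by rewrite addr_ge0// sqr_ge0.
have dxe i : `|e ((stp z).1 i) - e (z.1 i)| <= eps.
  rewrite -ler_sqr ?nnegrE ?(ltW eps0)//; apply: le_trans (mzi i); rewrite lerDl; exact: sqr_ge0.
have dpe i : `|(stp z).2 i - z.2 i| <= eps.
  rewrite -ler_sqr ?nnegrE ?(ltW eps0)//; apply: le_trans (mzi i); rewrite lerDr; exact: sqr_ge0.
(* The action is at least one unit above the freezing level, so the cutoff does not hide the
   gradient. *)
have z12 : 1 / 2 <= zeta k (c1 - 1) z.
  have h : 1 <= daction k z - (c1 - 1) by move: az; lra.
  exact: sat_ge ltr01 h.
set t := tau * zeta k (c1 - 1) z.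
have tt : tau / 2 <= t by rewrite /t ler_wpM2l ?(ltW tau0)//; move: z12; rewrite div1r.
have t2 : 0 < tau / 2 by rewrite divr_gt0.
have t0 : 0 < t by apply: lt_le_trans tt.
have dgL i : `|dgrad (k i (z.1 i)) (z.2 i)| <= Lk by apply: dgrad_lip.
have GpG i : `|Gp k z i| <= G1 by apply: le_trans (ler_normB _ _) _; exact: lerD.
have pG i : pairing (z.2 i) (Gp k z i) <= - r * (\sum_j `|Gp k z i 0 j|) + D%:R * (K1 * eps).
  have -> : D%:R * (K1 * eps) = \sum_(j < D) (K1 * eps) by rewrite sumr_const card_ord mulr_natl.
  rewrite mulr_sumr -big_split; apply: ler_sum => j _ /=.
  have hpe : `|clamp1 r (z.2 i 0 j - t * Gp k z i 0 j) - z.2 i 0 j| <= eps.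
    by apply: le_trans (dpe i); apply: le_trans (coord_le_norm _ 0 j); rewrite /= !mxE.
  apply: le_trans (clamp1_crit r0 (le_trans (coord_le_norm _ _ _) (bz i)) t0 hpe (le_trans (coord_le_norm _ _ _) (GpG i))) _.
  rewrite lerD2l ler_wpM2r ?(ltW eps0)// lerD2r ler_wpM2l ?mulr_ge0 ?(ltW r0)// lef_pV2 ?posrE//.
pose L i := pairing (z.2 i) (dgrad (k i (z.1 i)) (z.2 i)) - k i (z.1 i) (z.2 i).
(* The action is the sum of the p.Gp and of the Legendre terms [L]. The former are bounded by
   [clamp1_crit]; the latter are at most N B0, so both a lower bound for their sum and the smallness
   of [Gp] follow. *)
have main : c1 <= - r * (\sum_i \sum_j `|Gp k z i 0 j|) + 1 / 2 + \sum_i L i.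
  apply: le_trans az _.
  have -> : daction k z = \sum_i (pairing (z.2 i) (Gp k z i) + L i).
    by apply: eq_bigr => i _; rewrite /L /Gp pairingBr; ring.
  rewrite big_split lerD2r /= mulr_sumr.
  apply: le_trans (ler_sum _ (fun i _ => pG i)) _; rewrite big_split lerD2l /=.
  by apply: le_trans eK1; apply: sum_le_nat.
have sumG0 : 0 <= \sum_i \sum_j `|Gp k z i 0 j| by apply: sumr_ge0 => i _; apply: sumr_ge0.
have sumL : c1 - 1 / 2 <= \sum_i L i.
  have : 0 <= r * (\sum_i \sum_j `|Gp k z i 0 j|) by rewrite mulr_ge0 ?(ltW r0).
  by move: main; rewrite mulNr; move: (r * _) (\sum_i L i) => a b; lra.
have Gpmu i : `|Gp k z i| <= mu.
  apply: mx_norm_le => [|a j]; rewrite ?(ltW mu0)// ord1 -(ler_pM2l r0); apply: le_trans rmu.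
  have h1 : `|Gp k z i 0 j| <= \sum_i \sum_j `|Gp k z i 0 j|.
    rewrite (bigD1 i)//= (bigD1 j)//= -addrA lerDl addr_ge0//; first exact: sumr_ge0.
    by apply: sumr_ge0 => i' _; apply: sumr_ge0.
  have h2 : r * `|Gp k z i 0 j| <= r * (\sum_i \sum_j `|Gp k z i 0 j|) by rewrite ler_wpM2l ?(ltW r0).
  have h3 : \sum_i L i <= N%:R * B0 by apply: sum_le_nat => i'; exact: hL.
  move: main h2 h3; rewrite mulNr; move: (r * _) (r * `|_|) (\sum_i L i) (N%:R * B0) => a1 a2 a3 a4; lra.
exists z; split=> //.
  (* Small [Gp] makes all chords shorter than [del] by a definite amount. Thus [chi] is bounded
     below, the base points were not frozen, and their small displacement gives information on
     [Gx]. *)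
  move=> i; have ds j : `|dstep z j| <= del / 2.
    have -> : dstep z j = Gp k z j + dgrad (k j (z.1 j)) (z.2 j) by rewrite /Gp subrK.
    by apply: le_trans (ler_normD _ _) _; apply: le_trans hmu; rewrite addrC lerD.
  have chi1 : ka ^+ N <= chi del z.
    rewrite /chi -[X in ka ^+ X](card_ord N) -prodr_const; apply: ler_prod => j _; rewrite (ltW ka0)/=.
    by apply: sat_ge; rewrite ?divr_gt0//; have := ds j; lra.
  set s := t * chi del z.
  have ss : s0 <= s by apply: ler_pM => //; rewrite ?(ltW t2)// exprn_ge0// ltW.
  have sp : 0 < s by apply: lt_le_trans ss.
  have Qn := near_pt_normal cM x0 (e (z.1 i) - s *: Gx k z i).
  have E : near_pt x0 (e (z.1 i) - s *: Gx k z i) = (stp z).1 i by [].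
  rewrite E in Qn; set x' := (stp z).1 i in Qn E.
  (* What was projected away is normal at x', so only the tangential part of [Gx] is bounded by the
     displacement. *)
  have Qs : s *: Q x' (Gx k z i) = Q x' (e (z.1 i) - e x').
    apply/eqP; rewrite -subr_eq0 -oppr_eq0 opprB -QZ -QB -[X in _ == X]Qn; apply/eqP; congr (Q _ _).
    by rewrite addrAC.
  have h1 : `|Q x' (Gx k z i)| <= CQ / s0 * eps.
    have h : s * `|Q x' (Gx k z i)| <= CQ * eps.
      rewrite -[X in X * _](gtr0_norm sp) -normrZ Qs; apply: le_trans (hCQ _ _) _.
      by rewrite ler_wpM2l ?(ltW CQ0)// distrC; exact: dxe.
    rewrite mulrAC ler_pdivlMr// mulrC; apply: le_trans h.
    by rewrite ler_wpM2r.
  have h2 : `|Q (z.1 i) (Gx k z i) - Q x' (Gx k z i)| <= CL * G0 * eps.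
    apply: le_trans (hCL _ _ _) _; apply: ler_pM => //; first by rewrite mulr_ge0// ltW.
      by rewrite ler_wpM2l ?(ltW CL0)//; exact: hG0.
    by rewrite distrC; exact: dxe.
  have -> : Q (z.1 i) (Gx k z i) = (Q (z.1 i) (Gx k z i) - Q x' (Gx k z i)) + Q x' (Gx k z i) by rewrite subrK.
  apply: le_trans (ler_normD _ _) _; apply: le_trans eK2; rewrite mulrDl addrC.
  exact: lerD.
apply: contrapT => hno.
have : \sum_i L i <= N%:R * ((c1 - 1) / N%:R).
  by apply: sum_le_nat => i; rewrite leNgt; apply/negP => h; apply: hno; exists i; exact: ltW.
rewrite mulrCA mulfV ?gt_eqF// mulr1; move: sumL; move: (\sum_i L i) => a; lra.
Qed.

End Fixed.

Lemma minimax_critical : exists z : state F m, [/\ Cl z.1, forall i, `|dstep z i| <= del',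
  forall i, `|Gp k z i| <= mu, forall i, `|Q (z.1 i) (Gx k z i)| <= mu &
  exists i, (c1 - 1) / N%:R <= pairing (z.2 i) (dgrad (k i (z.1 i)) (z.2 i)) - k i (z.1 i) (z.2 i)].
Proof.
have dd0 : 0 < del' by apply: lt_trans deldel.
have [C C0 hC] := daction_expand cM hk r.
have [G0 G00 hG0] := Gx_bound cM hk r0.
have [d d0 hd] := near_pt_cvg F cM x0.
have D2 : 0 < D%:R + 2 :> R by rewrite ltr_wpDl.
pose eta := Num.min (Num.min ((del' - del) / 2) del') (d / 2).
have eta0 : 0 < eta by rewrite !lt_min dd0 !divr_gt0// subr_gt0.
pose tau := Num.min (2 * (C + 1))^-1 (eta / ((D%:R + 2) * G0)).
have tau0 : 0 < tau by rewrite lt_min invr_gt0 divr_gt0 ?mulr_gt0// addr_gt0.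
have tG : (D%:R + 2) * (tau * G0) <= eta.
  by rewrite mulrCA -ler_pdivlMr ?mulr_gt0// ge_min lexx orbT.
have e1 : 2 * eta <= del' - del by rewrite mulrC -ler_pdivlMr// !ge_min lexx.
have e2 : eta <= del' by rewrite !ge_min lexx !orbT.
have tGd : tau * G0 < d.
  have h : eta <= d / 2 by rewrite !ge_min lexx !orbT.
  have h2 : tau * G0 <= (D%:R + 2) * (tau * G0).
    by rewrite ler_peMl ?mulr_ge0 ?(ltW tau0) ?(ltW G00)//; have := ler0n R D; lra.
  by apply: le_lt_trans h2 _; apply: le_lt_trans tG _; apply: le_lt_trans h _; lra.
apply: (@near_critical tau eta G0) => //.
- move=> z bz; apply: step_desc => //; first by move=> z' bz'; exact: hC.
  have : tau <= (2 * (C + 1))^-1 by rewrite ge_min lexx.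
  by rewrite -[leRHS]div1r ler_pdivlMr ?mulr_gt0 ?addr_gt0// mulrCA mulrA.
- by move=> T G FG f z bz; apply: (step_cvg hk _ _ tau0 hd hG0 tGd).
Qed.

End Minimax.

(** * Cyclic indices and periodic sequences *)

Section CyclicIndex.
Variable m : nat.
Notation N := m.+1.

Definition cyc (k : int) : 'I_N := inord (absz (k %% N%:Z)%Z).

Lemma cyc_val k : nat_of_ord (cyc k) = absz (k %% N%:Z)%Z.
Proof.
rewrite inordK//; have h1 : (0 <= k %% N%:Z)%Z by rewrite modz_ge0.
have h2 : (k %% N%:Z < N%:Z)%Z by rewrite ltz_pmod.
by rewrite -ltz_nat gez0_abs.
Qed.

Lemma cyc_div k : k = (k %/ N%:Z)%Z * N%:Z + (cyc k : nat)%:Z.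
Proof. by rewrite cyc_val gez0_abs ?modz_ge0// -divz_eq. Qed.

Lemma cyc_ord (i : 'I_N) (q : int) : cyc (q * N%:Z + (i : nat)%:Z) = i.
Proof.
apply: val_inj; rewrite /= cyc_val modzMDl modz_small//.
by rewrite lez_nat /= ltz_nat.
Qed.

Lemma cycS k : cyc (k + 1) = ordS (cyc k).
Proof.
rewrite {1}(cyc_div k) -addrA; set i := cyc k; set q := (k %/ _)%Z.
have [iN|iN] := eqVneq (i : nat) m.
  have -> : q * N%:Z + ((i : nat)%:Z + 1) = (q + 1) * N%:Z + ((@ord0 m : 'I_N) : nat)%:Z.
    by rewrite iN mulrDl mul1r addr0 -addn1 PoszD addrA.
  by rewrite cyc_ord; apply: val_inj; rewrite /= iN modnn.
have iS : (i.+1 < N)%N by rewrite ltnS ltn_neqAle iN -ltnS ltn_ord.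
have -> : (i : nat)%:Z + 1 = (Ordinal iS : nat)%:Z by rewrite /= addrC -intS.
by rewrite cyc_ord; apply: val_inj; rewrite /= modn_small.
Qed.

Lemma cycP k : cyc (k - 1) = ord_pred (cyc k).
Proof. by rewrite -[in RHS](subrK 1 k) cycS ordSK. Qed.

Lemma cyc_per k : cyc (k + N%:Z) = cyc k.
Proof. by apply: val_inj; rewrite /= !cyc_val modzDr. Qed.

End CyclicIndex.

Lemma arith_half (R : realType) (a b h d : R) : 2 * a + 4 * b + 4 * h <= d -> 0 <= a -> 0 <= b -> 0 <= h -> a <= d / 2.
Proof. lra. Qed.

Lemma arith_quarter (R : realType) (a b h h2 d : R) : 2 * a + 4 * b + 4 * h <= d -> 0 <= a -> 0 <= b -> h2 <= h ->
  b + h2 <= d / 2 / 2.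
Proof. lra. Qed.

Section Discretization.
Context {R : realType} {n : nat} {M : smoothManifold R n} (F : frame M).
Hypothesis cM : compact [set: M].
Variable x0 : M.
Notation D := (fdim F).
Notation e := (emb F).
Variables (K : R -> M -> 'rV[R]_D -> R) (S : M -> 'rV[R]_D -> Prop) (Lp b0 B0 l c0 : R) (g : R -> M).
Hypothesis Kper : forall t, K (t + 1) = K t.
Hypothesis KC2 : forall t, JCk 2 (K t).
Hypotheses (Lp0 : 0 <= Lp) (l0 : 0 < l).
Hypothesis Klip : forall t x p p', `|K t x p' - K t x p| <= Lp * `|p' - p|.
Hypothesis Kzero : forall t x, K t x 0 <= - c0.
Hypothesis Kgrow : forall t x p, (D%:R * l + 1) * `|p| - b0 <= K t x p.
Hypothesis KL : forall t x p, pairing p (dgrad (K t x) p) - K t x p <= B0.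
Hypothesis KS : forall t x p, c0 - 2 <= pairing p (dgrad (K t x) p) - K t x p -> S x p.
Hypothesis hg : exists N0 : nat, forall N : nat, (N0 <= N)%N ->
  exists X : int -> M, [/\ forall k, X (k + N%:Z) = X k,
    forall k, `|e (X (k + 1)) - e (X k)| <= l / N%:R & free_homotopic setT g (polygon F x0 N X)].

Lemma dgradZ a (f : 'rV[R]_D -> R) p : differentiable f p -> dgrad (fun p => a * f p) p = a *: dgrad f p.
Proof.
move=> df; apply/rowP => j; rewrite !mxE; apply: (deriveZ (f := f)).
exact: diff_derivable.
Qed.

Lemma JCkZ (V : normedModType R) j a (f : M -> V -> R) : JCk j f -> JCk j (fun x p => a * f x p).
Proof.
by move=> hf; apply: (JCkM (f := fun _ _ => a) (g := f)) => // c; exact: Ck_cst.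
Qed.

Lemma gradZ a (f : M -> R) x : MCk 1 f -> grad F (fun y => a * f y) x = a *: grad F f x.
Proof.
move=> hf; have cx := chart_atP x; set c := chart_at x in cx.
have df : differentiable (f \o param c) (coord c x) by apply: (hf c).1; exact: cimg_coord.
have daf : differentiable ((fun y => a * f y) \o param c) (coord c x) by exact: (differentiableZ a df).
apply/rowP => j; rewrite [RHS]mxE !(gradE j cx)//; apply: (deriveZ (f := f \o param c)).
exact: diff_derivable.
Qed.

(** [minimax_critical] with h = 1/N, k_i = h K(ih), chords of length at most l h and the margin w =
    h in the slope. The tolerance h^2 per step makes the scheme consistent as N grows. The level is
    c1 = c0 - 1, hence the c0 - 2 in [KS]. *)
Lemma discrete_orbits (d : R) : 0 < d ->
  (forall N (X X' : int -> M), (forall k, X (k + N%:Z) = X k) -> (forall k, X' (k + N%:Z) = X' k) ->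
   (forall k, `|e (X (k + 1)) - e (X k)| <= d) -> (forall k, `|e (X' (k + 1)) - e (X' k)| <= d) ->
   (forall k, `|e (X' k) - e (X k)| <= d) -> free_homotopic setT (polygon F x0 N X) (polygon F x0 N X')) ->
  exists N0 : nat, forall N, (N0 <= N)%N -> exists (X : int -> M) (P : int -> 'rV[R]_D),
  let h : R := N%:R^-1 in
  [/\ (forall k, X (k + N%:Z) = X k) /\ (forall k, P (k + N%:Z) = P k),
      forall k, `|e (X (k + 1)) - e (X k) - h *: dgrad (K (k%:~R * h) (X k)) (P k)| <= h ^+ 2,
      forall k, `|Q (X k) (P (k - 1) - P k - h *: grad F (fun x => K (k%:~R * h) x (P k)) (X k))| <= h ^+ 2,
      exists k, S (X k) (P k) &
      (forall k, `|e (X (k + 1)) - e (X k)| <= d) /\ free_homotopic setT g (polygon F x0 N X)].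
Proof.
move=> d0 hd; have [N0 hN0] := hg.
pose N1 := maxn N0.+1 (Num.trunc ((2 * l + 4 * (Lp + 1)) / d)).+1.
exists N1 => -[|m]; first by rewrite geq_max.
set N := m.+1; rewrite geq_max => /andP[NN0 hN].
have [Y [Yp Ys Yg]] := hN0 N (ltnW NN0).
have N00 : 0 < N%:R :> R by [].
pose h : R := N%:R^-1; have h0 : 0 < h by rewrite invr_gt0.
have h1 : h <= 1 by rewrite invf_le1// ler1n.
have Nh : N%:R * h = 1 by rewrite mulfV// gt_eqF.
have hh : (2 * l + 4 * (Lp + 1)) * h <= d.
  have hA : (2 * l + 4 * (Lp + 1)) / d <= N%:R.
    by apply: ltW; apply: lt_le_trans (truncnS_gt _) _; rewrite ler_nat.
  rewrite ler_pdivrMr// in hA; apply: le_trans (ler_wpM2r (ltW h0) hA) _.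
  by rewrite mulrAC Nh mul1r.
have hhE : (2 * l + 4 * (Lp + 1)) * h = 2 * (l * h) + 4 * (Lp * h) + 4 * h by ring.
pose k (i : 'I_N) x p := h * K ((i : nat)%:R * h) x p.
have hk i : JCk 2 (k i) by exact: (JCkZ (f := K ((i : nat)%:R * h)) h (KC2 _)).
have dK t x p : differentiable (K t x) p by exact: (JCk_fib x (findim_rV D) (KC2 t)).1.
have Yc k' : Y (cyc m k' : nat)%:Z = Y k'.
  by rewrite [in RHS](cyc_div m k') addrC (periodic_seq _ _ Yp).
have YS (i : 'I_N) : Y (ordS i : nat)%:Z = Y ((i : nat)%:Z + 1).
  have E := cyc_ord i 0; rewrite mul0r add0r in E.
  by rewrite -(Yc (_ + 1)) cycS E.
have Ycyc : (fun k' => Y (cyc m k' : nat)%:Z) = Y by apply/funext => k'; exact: Yc.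
have [|||||||||||||||z [z1 z2 z3 z4 [i0 z5]]] := @minimax_critical _ _ _ F cM x0 m k hk (Lp * h) h (b0 * h) (B0 * h) (l * h) (c0 * h) (c0 - 1) (d / 2) d (h ^+ 2)
   (fun i => Y (i : nat)%:Z) (fun x => free_homotopic setT g (polygon F x0 N (fun k => x (cyc m k)))).
- by rewrite mulr_ge0// ltW.
- exact: h0.
- by rewrite divr_gt0.
- by move: d0; lra.
- by rewrite exprn_gt0.
- move=> i x p p'; rewrite /k -mulrBr normrM gtr0_norm// [leRHS]mulrAC [leRHS]mulrC ler_wpM2l ?(ltW h0)//.
- by move=> i x; rewrite /k [leLHS]mulrC -mulNr ler_wpM2r ?(ltW h0).
- by rewrite subrK mulrCA Nh mulr1.
- move=> i x p; rewrite /k; have := ler_wpM2l (ltW h0) (Kgrow ((i : nat)%:R * h) x p).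
  by apply: le_trans; rewrite le_eqVlt; apply/orP; left; apply/eqP; ring.
- move=> i x p; rewrite /k dgradZ// pairingZr -mulrBr [leRHS]mulrC ler_wpM2l ?(ltW h0)//.
- by move=> i; rewrite -/h YS; exact: Ys.
- rewrite hhE in hh; exact: (arith_half hh (mulr_ge0 (ltW l0) (ltW h0)) (mulr_ge0 Lp0 (ltW h0)) (ltW h0)).
- by rewrite Ycyc.
- move=> x x' sx sx' xx' hx; apply: free_homotopic_trans hx _.
  by apply: hd => [k'|k'|k'|k'|k']; rewrite ?cyc_per ?cycS.
- have h2 : h ^+ 2 <= h by rewrite expr2 ler_piMl// ltW.
  rewrite hhE in hh; exact: (arith_quarter hh (mulr_ge0 (ltW l0) (ltW h0)) (mulr_ge0 Lp0 (ltW h0)) h2).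
have Kt k' : K (k'%:~R * h) = K ((cyc m k' : nat)%:R * h).
  rewrite {1}(cyc_div m k') intrD intrM mulrDl -mulrA Nh mulr1 addrC.
  exact: periodic_int.
have dgk i x p : dgrad (k i x) p = h *: dgrad (K ((i : nat)%:R * h) x) p by exact: dgradZ.
exists (fun k' => z.1 (cyc m k')), (fun k' => z.2 (cyc m k')); rewrite -/h /=; split.
- by split=> k'; rewrite cyc_per.
- by move=> k'; rewrite Kt -dgk cycS; exact: z3.
- move=> k'; rewrite Kt cycP -gradZ; first exact: z4.
  exact: (JCk_slice (z.2 (cyc m k')) (findim_rV D) (fun c => CkW (KC2 _ c))).
- exists (i0 : nat)%:Z; have E := cyc_ord i0 0; rewrite mul0r add0r in E; rewrite E.
  apply: (KS (t := (i0 : nat)%:R * h)); rewrite -(ler_pM2l h0) [leRHS]mulrBr -pairingZr -dgk.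
  by apply: le_trans z5; rewrite mulrC ler_pM2r//; lra.
- by split=> // k'; rewrite cycS; exact: z2.
Qed.

End Discretization.

Lemma pos4 (R : realType) (a b c : R) : 0 <= a -> 0 <= b -> 0 <= c -> 0 < a + 1 + 2 * b + c.
Proof. lra. Qed.

Lemma max4 (R : realType) (a b c d : R) : 0 < a -> 0 <= b -> 0 <= c -> 0 <= d ->
  exists C, [/\ 0 < C, a <= C, b <= C, c <= C & d <= C].
Proof. by move=> *; exists (a + b + c + d); split; lra. Qed.

Lemma arith_start (R : realType) (a b c d f : R) : a <= b + c -> b <= 2 -> c <= d -> d <= f -> 1 + a <= 3 + f.
Proof. lra. Qed.

Lemma arith_end (R : realType) (a b c : R) : 1 + a <= c -> 1 + b <= c -> 1 + a + (1 + b) <= 1 + 2 * c.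
Proof. lra. Qed.

Lemma arith_dp (R : realType) (h a b c p q : R) : 0 <= h -> 0 <= a -> 0 <= b -> 0 <= c -> 0 <= p -> 0 <= q ->
  h * (a * (1 + p)) + h + (b * h + c * h * q) + b * h <= (a + 1 + 2 * b + c) * h * (1 + p + (1 + q)).
Proof.
move=> h0 a0 b0 c0 p0 q0; rewrite -subr_ge0.
have -> : (a + 1 + 2 * b + c) * h * (1 + p + (1 + q)) - (h * (a * (1 + p)) + h + (b * h + c * h * q) + b * h) =
  h * (a * (1 + q) + (1 + p + q) + 2 * b * (1 + p + q) + c * (2 + p)) by ring.
by rewrite mulr_ge0// !addr_ge0// !mulr_ge0// ?addr_ge0// mulr_ge0.
Qed.

(** * Bounds on the discrete orbits uniform in N *)

Section Estimates.
Context {R : realType} {n : nat} {M : smoothManifold R n} (F : frame M).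
Hypothesis cM : compact [set: M].
Notation D := (fdim F).
Notation e := (emb F).

Lemma derive_lip_emb (f : M -> R) (L : R) c x v : cdom c x -> differentiable (f \o param c) (coord c x) ->
  (forall x', `|f x' - f x| <= L * `|e x' - e x|) -> `|'D_v (f \o param c) (coord c x)| <= L * `|dE F c x v|.
Proof.
move=> cx df hL; set q := coord c x.
have F0 : Filter (0 : R)^' by exact: _.
have hf : s^-1 *: ((f \o param c \o shift q) (s *: v) - (f \o param c) q) @[s --> (0 : R)^'] --> 'D_v (f \o param c) q.
  by apply: diff_derivable.
have he : s^-1 *: (e (param c (s *: v + q)) - e x) @[s --> (0 : R)^'] --> dE F c x v.
  apply: cvg_rV => j; rewrite mxE.
  have hj : s^-1 *: ((ecoord j \o param c \o shift q) (s *: v) - (ecoord j \o param c) q) @[s --> (0 : R)^'] --> 'D_v (ecoord j \o param c) q.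
    by apply: diff_derivable; exact: ecoord_diff.
  rewrite (_ : (fun s => _) = fun s : R => s^-1 *: ((ecoord j \o param c \o shift q) (s *: v) - (ecoord j \o param c) q))//.
  by apply/funext => s; rewrite !mxE /= /q coordK.
have hf' : `|s^-1 *: ((f \o param c \o shift q) (s *: v) - (f \o param c) q)| @[s --> (0 : R)^'] --> `|'D_v (f \o param c) q|.
  by exact: cvg_norm.
have he' : L * `|s^-1 *: (e (param c (s *: v + q)) - e x)| @[s --> (0 : R)^'] --> L * `|dE F c x v|.
  by apply: cvgM; [exact: cvg_cst|exact: cvg_norm].
rewrite -(cvg_lim _ hf')// -(cvg_lim _ he')//; apply: ler_lim.
- by apply/cvg_ex; eexists; exact: hf'.
- by apply/cvg_ex; eexists; exact: he'.
near=> s; rewrite !normrZ mulrCA ler_wpM2l//= /q coordK//; exact: hL.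
Unshelve. all: by end_near. Qed.

Lemma grad_lip : exists2 Cw, 0 < Cw & forall (f : M -> R) (L : R) x, MCk 1 f -> 0 <= L ->
  (forall x', `|f x' - f x| <= L * `|e x' - e x|) -> `|grad F f x| <= Cw * L.
Proof.
have [C hC] := choice (fun ij : 'I_D * 'I_D => let: ex_intro2 C C0 h := cts_bound cM (MCk_cts (@Qm_C2 _ _ _ F ij.1 ij.2)) in ex_intro _ C (conj C0 h)).
exists (\sum_ij C ij + 1) => [|f L x hf L0 hL].
  by rewrite ltr_wpDl//; apply: sumr_ge0 => ij _; rewrite ltW ?(hC ij).1.
have cx := chart_atP x; set c := chart_at x in cx.
have CC ij : C ij <= \sum_ij C ij + 1.
  by rewrite (bigD1 ij)//= -addrA lerDl addr_ge0//; apply: sumr_ge0 => k _; rewrite ltW ?(hC k).1.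
have df : differentiable (f \o param c) (coord c x) by apply: (hf c).1; exact: cimg_coord.
have S0 : 0 <= \sum_ij C ij + 1 by rewrite addr_ge0//; apply: sumr_ge0 => ij _; rewrite ltW ?(hC ij).1.
apply: mx_norm_le => [|a j]; first by rewrite mulr_ge0.
rewrite ord1 (gradE j cx df); apply: le_trans (derive_lip_emb _ cx df hL) _.
rewrite mulrC ler_wpM2r//; apply: mx_norm_le => // a' i; rewrite ord1 mxE.
apply: le_trans (CC (i, j)).
have := (hC (i, j)).2 x; rewrite /Qm (gradE j cx)//; exact: ecoord_diff.
Qed.

Variables (K : R -> M -> 'rV[R]_D -> R) (S : M -> 'rV[R]_D -> Prop) (Lp Lx an : R).
Hypothesis KC2 : forall t, JCk 2 (K t).
Hypotheses (Lp0 : 0 <= Lp) (Lx0 : 0 <= Lx) (an0 : 0 < an).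
Hypothesis Klip : forall t x p p', `|K t x p' - K t x p| <= Lp * `|p' - p|.
Hypothesis Klipx : forall t x x' p, `|K t x' p - K t x p| <= Lx * (1 + `|p|) * `|e x' - e x|.
Hypothesis Knormal : forall t x p, an * `|p - Q x p| ^+ 2 <=
  (1 + D%:R * `|p - Q x p|) * pairing (p - Q x p) (dgrad (K t x) p).
Hypothesis SQ : forall x p, S x p -> `|Q x p| <= 2.

(** The bound on one increment of the momentum involves both of its ends, so the unknown occurs on
    both sides. *)
Lemma gronwall_step (a b u : R) : 0 <= a -> 0 <= b -> 0 <= u -> u <= 1 / 2 -> a <= b + u * (b + a) -> a <= (1 + 4 * u) * b.
Proof.
move=> a0 b0 u0 u2 h; have h1 : a * (1 - u) <= (1 + u) * b by lra.
have h2 : (1 + u) * b <= (1 + 4 * u) * (1 - u) * b.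
  by rewrite ler_wpM2r//; nra.
have u1 : 0 < 1 - u by lra.
by rewrite -(ler_pM2r u1); apply: le_trans h1 _; apply: le_trans h2 _; rewrite mulrAC.
Qed.

Lemma quad_small (x b a u : R) : 0 <= x -> 0 < a -> 0 <= u -> 0 <= b -> b * u <= a / 2 ->
  a * x ^+ 2 <= (1 + b * x) * (x * u) -> x <= 2 / a * u.
Proof.
move=> x0 a0 u0 b0 bu h; have [->|xn] := eqVneq x 0; first by rewrite !mulr_ge0// invr_ge0 ltW.
have xp : 0 < x by rewrite lt0r xn.
have h1 : a * x <= (1 + b * x) * u by rewrite -(ler_pM2l xp); move: h; rewrite expr2; nra.
by rewrite mulrAC ler_pdivlMr//; nra.
Qed.

(** The box of the minimax depends on N, so its size is of no use here. The orbit has a point in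
    [S], where the momentum is bounded; a discrete Gronwall inequality carries this bound over a
    whole period. *)
Lemma orbit_estimates : exists2 C : R, 0 < C & exists N1 : nat, forall N, (N1 <= N)%N ->
  forall (X : int -> M) (P : int -> 'rV[R]_D), let h : R := N%:R^-1 in
  (forall k, X (k + N%:Z) = X k) -> (forall k, P (k + N%:Z) = P k) ->
  (forall k, `|e (X (k + 1)) - e (X k) - h *: dgrad (K (k%:~R * h) (X k)) (P k)| <= h ^+ 2) ->
  (forall k, `|Q (X k) (P (k - 1) - P k - h *: grad F (fun x => K (k%:~R * h) x (P k)) (X k))| <= h ^+ 2) ->
  (exists k, S (X k) (P k)) ->
  forall k, [/\ `|e (X (k + 1)) - e (X k)| <= C * h, `|P k| <= C, `|P (k + 1) - P k| <= C * h &
    `|P k - Q (X k) (P k)| <= C * h].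
Proof.
have [CQ CQ0 hCQ] := Q_bnd F cM; have [CL CL0 hCL] := Q_lip F cM.
have [Cr Cr0 hCr] := reach F cM; have [Cw Cw0 hCw] := grad_lip.
pose C1 := Lp + 1; have C10 : 0 < C1 by rewrite ltr_wpDl.
pose C2 := Cr * C1 ^+ 2 + D%:R; have C20 : 0 <= C2 by rewrite addr_ge0// mulr_ge0 ?(ltW Cr0)// sqr_ge0.
pose C3 := 2 / an * C2; have C30 : 0 <= C3 by rewrite mulr_ge0// divr_ge0// ltW.
pose C4 := CQ * (Cw * Lx) + 1 + 2 * C3 + CL * C1.
have C40 : 0 < C4.
  by apply: pos4 => //; [rewrite mulr_ge0 ?(ltW CQ0)// mulr_ge0// ltW|rewrite mulr_ge0 ?(ltW CL0)// ltW].
pose C5 := expR (4 * C4) * (3 + C3); have C50 : 0 < C5 by rewrite mulr_gt0 ?expR_gt0// ltr_wpDr.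
have C450 : 0 <= C4 * (1 + 2 * C5) by rewrite mulr_ge0 ?(ltW C40)// addr_ge0// mulr_ge0// ltW.
have [C [C0 CC1 CC3 CC5 CC4]] := max4 C10 C30 (ltW C50) C450.
exists C => //.
exists (Num.trunc (2 * D%:R * C2 / an + 2 * C4)).+1 => N hN X P h Xp Pp E1 E2 [k0 hS].
have hN1 : 2 * D%:R * C2 / an + 2 * C4 <= N%:R.
  by apply: ltW; apply: lt_le_trans (truncnS_gt _) _; rewrite ler_nat.
have NN : (0 < N)%N by exact: leq_trans hN.
have N0 : 0 < N%:R :> R by rewrite ltr0n.
have h0 : 0 < h by rewrite invr_gt0.
have h1 : h <= 1 by rewrite invf_le1// ler1n.
have Nh : N%:R * h = 1 by rewrite mulfV// gt_eqF.
have Dan : 0 <= 2 * D%:R * C2 / an by rewrite divr_ge0 ?mulr_ge0// ltW.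
have hC4 : C4 * h <= 1 / 2.
  have hh : 2 * C4 <= N%:R by apply: le_trans hN1; rewrite lerDr.
  by have := ler_wpM2r (ltW h0) hh; rewrite Nh; clear -hh; lra.
have hDC : D%:R * (C2 * h) <= an / 2.
  have hh : 2 * D%:R * C2 / an <= N%:R by apply: le_trans hN1; rewrite lerDl mulr_ge0 ?(ltW C40).
  rewrite ler_pdivrMr// in hh; have := ler_wpM2r (ltW h0) hh.
  rewrite [N%:R * an * h]mulrAC Nh mul1r; have -> : 2 * D%:R * C2 * h = 2 * (D%:R * (C2 * h)) by ring.
  by rewrite ler_pdivlMr// mulrC.
clear hN hN1; clearbody h.
have dX k : `|e (X (k + 1)) - e (X k)| <= C1 * h.
  have -> : e (X (k + 1)) - e (X k) = (e (X (k + 1)) - e (X k) - h *: dgrad (K (k%:~R * h) (X k)) (P k)) + h *: dgrad (K (k%:~R * h) (X k)) (P k).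
    by rewrite subrK.
  apply: le_trans (ler_normD _ _) _; rewrite /C1 mulrDl mul1r addrC; apply: lerD.
    rewrite normrZ gtr0_norm// mulrC ler_wpM2r ?(ltW h0)//; apply: dgrad_lip => //.
    exact: (JCk_fib _ (findim_rV D) (KC2 _)).1.
  by apply: le_trans (E1 k) _; rewrite expr2 ler_piMl// ltW.
pose nn k := P k - Q (X k) (P k).
(* The normal part is paired with the first discrete equation. Its pairing with the chord is of
   second order by [reach], while [Knormal] bounds its pairing with dK/dp below, so it must be
   O(h). *)
have hn k : `|nn k| <= C3 * h.
  have Qn : Q (X k) (nn k) = 0 by rewrite /nn QB Q_idem subrr.
  have b1 : pairing (nn k) (e (X (k + 1)) - e (X k)) <= Cr * `|nn k| * (C1 * h) ^+ 2.
    apply: le_trans (ler_norm _) _; have := hCr (X k) (X (k + 1)) (nn k); rewrite Qn subr0 => /le_trans; apply.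
    apply: ler_wpM2l; first by rewrite mulr_ge0// ltW.
    by apply: lerXn2r (dX k); rewrite nnegrE// mulr_ge0// ltW.
  set dg := dgrad (K (k%:~R * h) (X k)) (P k).
  have b2 : - pairing (nn k) (e (X (k + 1)) - e (X k) - h *: dg) <= D%:R * (`|nn k| * h ^+ 2).
    apply: le_trans (ler_norm _) _; rewrite normrN; apply: le_trans (pairing_bnd _ _) _.
    by rewrite ler_wpM2l// ler_wpM2l//; exact: E1.
  have b3 : h * pairing (nn k) dg <= h * (`|nn k| * (C2 * h)).
    rewrite -pairingZr.
    have -> : h *: dg = (e (X (k + 1)) - e (X k)) - (e (X (k + 1)) - e (X k) - h *: dg) by rewrite opprB addrC subrK.
    rewrite pairingBr; apply: le_trans (lerD b1 b2) _.
    by rewrite le_eqVlt; apply/orP; left; apply/eqP; rewrite /C2; ring.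
  rewrite ler_pM2l// in b3.
  have b4 := Knormal (k%:~R * h) (X k) (P k); rewrite -/(nn k) -/dg in b4.
  rewrite /C3 -mulrA; apply: (@quad_small _ D%:R) => //; first by rewrite mulr_ge0// ltW.
  apply: le_trans b4 _; rewrite ler_wpM2l// addr_ge0// mulr_ge0//.
(* The second equation controls only the tangential part of the increment. The rest consists of two
   normal parts and of the change of [Q] between neighbouring points. *)
have dP k : `|P (k - 1) - P k| <= C4 * h * ((1 + `|P k|) + (1 + `|P (k - 1)|)).
  set G := grad F (fun x => K (k%:~R * h) x (P k)) (X k).
  have hG : `|G| <= Cw * (Lx * (1 + `|P k|)).
    apply: hCw; first exact: (JCk_slice (P k) (findim_rV D) (fun c => CkW (KC2 _ c))).
    - by rewrite mulr_ge0// addr_ge0.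
    - by move=> x'; exact: Klipx.
  have b1 : `|Q (X k) (P (k - 1) - P k)| <= h * (CQ * (Cw * (Lx * (1 + `|P k|)))) + h.
    have -> : Q (X k) (P (k - 1) - P k) = Q (X k) (P (k - 1) - P k - h *: G) + h *: Q (X k) G.
      by rewrite [Q _ (_ - h *: G)]QB QZ subrK.
    apply: le_trans (ler_normD _ _) _; rewrite addrC; apply: lerD.
      rewrite normrZ gtr0_norm// ler_wpM2l ?(ltW h0)//; apply: le_trans (hCQ _ _) _.
      by rewrite ler_wpM2l ?(ltW CQ0).
    by apply: le_trans (E2 k) _; rewrite expr2 ler_piMl// ltW.
  have b2 : `|Q (X (k - 1)) (P (k - 1)) - Q (X k) (P (k - 1))| <= CL * C1 * h * `|P (k - 1)|.
    rewrite distrC; apply: le_trans (hCL _ _ _) _; have := dX (k - 1); rewrite subrK => hx.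
    apply: le_trans (ler_wpM2l _ hx) _; first by rewrite mulr_ge0// ltW.
    by rewrite le_eqVlt; apply/orP; left; apply/eqP; ring.
  have -> : P (k - 1) - P k = Q (X k) (P (k - 1) - P k) + (nn (k - 1) + (Q (X (k - 1)) (P (k - 1)) - Q (X k) (P (k - 1)))) - nn k.
    by rewrite /nn QB; move: (Q _ _) (Q _ _) (Q _ _) => a b c; apply/rowP => j; rewrite !mxE; ring.
  apply: le_trans (ler_normB _ _) _; apply: le_trans (lerD (ler_normD _ _) (lexx _)) _.
  apply: le_trans (lerD (lerD b1 (ler_normD _ _)) (hn k)) _.
  apply: le_trans (lerD (lerD (lexx _) (lerD (hn (k - 1)) b2)) (lexx _)) _.
  have -> : h * (CQ * (Cw * (Lx * (1 + `|P k|)))) = h * (CQ * (Cw * Lx) * (1 + `|P k|)) by rewrite !mulrA.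
  apply: arith_dp => //; first exact: ltW.
    by rewrite mulr_ge0 ?(ltW CQ0)// mulr_ge0// ltW.
  by rewrite mulr_ge0 ?(ltW CL0)// ltW.
have hk0 : 1 + `|P k0| <= 3 + C3.
  have -> : P k0 = Q (X k0) (P k0) + nn k0 by rewrite /nn addrC subrK.
  have h3 : C3 * h <= C3 by rewrite ler_piMr.
  exact: arith_start (ler_normD _ _) (SQ hS) (hn k0) h3.
have gr (j : nat) : 1 + `|P (k0 - j%:Z)| <= (1 + 4 * (C4 * h)) ^+ j * (3 + C3).
  elim: j => [|j IH]; first by rewrite subr0 expr0 mul1r.
  have -> : k0 - j.+1%:Z = k0 - j%:Z - 1 by rewrite -addn1 PoszD opprD addrA.
  have h4 : 0 <= C4 * h by rewrite mulr_ge0 ?(ltW C40) ?(ltW h0).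
  rewrite exprS -mulrA; apply: le_trans (_ : _ <= (1 + 4 * (C4 * h)) * (1 + `|P (k0 - j%:Z)|)) _; last first.
    by rewrite ler_wpM2l// addr_ge0// mulr_ge0.
  apply: gronwall_step => //; rewrite ?addr_ge0//.
  have hd := dP (k0 - j%:Z).
  have ht : `|P (k0 - j%:Z - 1)| <= `|P (k0 - j%:Z)| + `|P (k0 - j%:Z - 1) - P (k0 - j%:Z)|.
    by rewrite -{1}[P (k0 - j%:Z - 1)](subrK (P (k0 - j%:Z))) addrC ler_normD.
  by apply: le_trans (lerD (lexx _) ht) _; rewrite addrA lerD2l.
(* Going backwards from [k0] by fewer than N steps reaches every index up to periodicity, and N
   factors 1 + 4 C4 h are at most exp(4 C4). *)
have PC k : 1 + `|P k| <= C5.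
  pose j := absz ((k0 - k) %% N%:Z)%Z.
  have N00 : N%:Z != 0 by rewrite eqz_nat -lt0n.
  have jE : j%:Z = ((k0 - k) %% N%:Z)%Z by rewrite /j gez0_abs// modz_ge0.
  have jN : (j <= N)%N by rewrite -lez_nat jE ltW// ltz_pmod.
  have -> : P k = P (k0 - j%:Z).
    rewrite jE -(periodic_seq k ((k0 - k) %/ N%:Z)%Z Pp); congr P.
    by apply/eqP; rewrite eq_sym subr_eq -addrA -divz_eq addrC subrK.
  apply: le_trans (gr j) _; rewrite /C5 ler_wpM2r ?addr_ge0//.
  have h4 : 0 <= 4 * (C4 * h) by rewrite !mulr_ge0 ?(ltW C40) ?(ltW h0).
  apply: (@le_trans _ _ ((1 + 4 * (C4 * h)) ^+ N)); first by rewrite ler_weXn2l// lerDl.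
  have E : N%:R * (4 * (C4 * h)) = 4 * C4.
    have -> : N%:R * (4 * (C4 * h)) = 4 * C4 * (N%:R * h) by ring.
    by rewrite Nh mulr1.
  rewrite -E expRM_natl; apply: lerXn2r; rewrite ?nnegrE ?expR_ge0 ?addr_ge0//; exact: expR_ge1Dx.
move=> k; split.
- by apply: le_trans (dX k) _; rewrite ler_wpM2r ?(ltW h0).
- by apply: le_trans CC5; apply: le_trans (PC k); rewrite lerDr.
- have := dP (k + 1); rewrite addrK distrC => /le_trans; apply.
  apply: le_trans (_ : _ <= C4 * (1 + 2 * C5) * h) _; last by rewrite ler_wpM2r ?(ltW h0).
  rewrite mulrAC ler_wpM2r ?(ltW h0)// ler_wpM2l ?(ltW C40)//.
  exact: arith_end (PC _) (PC _).
- by apply: le_trans (hn k) _; rewrite ler_wpM2r ?(ltW h0).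
Qed.

End Estimates.

(** * The continuous limit *)

Section UltraLimit.
Context {R : realType}.

(** A single ultrafilter yields limits at all times simultaneously; no subsequence is extracted. *)
Lemma ultra_cvg (T : Type) (X : topologicalType) (U : set_system T) (f : T -> X) (A : set X) :
  UltraFilter U -> compact A -> (\forall t \near U, A (f t)) -> exists2 p, A p & f @ U --> p.
Proof.
move=> uU cA fA; have pU : ProperFilter U by exact: ultra_proper.
have [p [Ap cp]] := cA (f @ U) _ fA; exists p => // V Vp.
have [//|h] := in_ultra_setVsetC (f @^-1` V) uU.
have [t []] := cp (~` V) V h Vp; by [].
Qed.

Section Averaging.
Variable U : set_system nat.
Hypothesis pU : ProperFilter U.
Hypothesis hU : forall N0, \forall N \near U, (N0 <= N)%N.

Lemma small_inv (eps : R) : 0 < eps -> \forall N \near U, 0 < N%:R^-1 :> R /\ N%:R^-1 < eps :> R.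
Proof.
move=> eps0; apply: filterS (hU (Num.trunc eps^-1).+1) => N hN.
have N0 : 0 < N%:R :> R by rewrite ltr0n; exact: leq_trans hN.
split; first by rewrite invr_gt0.
rewrite -[eps]invrK ltf_pV2 ?posrE ?invr_gt0//; apply: lt_le_trans (truncnS_gt _) _.
by rewrite ler_nat.
Qed.

Lemma inv_cvg0 : N%:R^-1 @[N --> U] --> (0 : R).
Proof.
apply/cvgrPdist_lt => eps eps0; apply: filterS (small_inv eps0) => N [h1 h2].
by rewrite sub0r normrN gtr0_norm.
Qed.

Lemma sum_steps (a : int -> R) (k1 : int) (j : nat) (f e : R) :
  (forall i : nat, (i < j)%N -> `|a (k1 + i%:Z + 1) - a (k1 + i%:Z) - f| <= e) ->
  `|a (k1 + j%:Z) - a k1 - j%:R * f| <= j%:R * e.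
Proof.
elim: j => [|j IH] h; first by rewrite addr0 subrr mul0r subrr normr0 mul0r.
have E : k1 + j.+1%:Z = k1 + j%:Z + 1 by rewrite -addn1 PoszD addrA.
rewrite E -addn1 natrD !mulrDl !mul1r.
have -> : a (k1 + j%:Z + 1) - a k1 - (j%:R * f + f) =
  (a (k1 + j%:Z) - a k1 - j%:R * f) + (a (k1 + j%:Z + 1) - a (k1 + j%:Z) - f) by ring.
apply: le_trans (ler_normD _ _) _; apply: lerD; last exact: h.
by apply: IH => i ij; apply: h; exact: ltnW.
Qed.

(** The number of grid steps between the two times differs from N (t - s) by at most 1, which
    accounts for the terms with the inverse of N. *)
Lemma avg_le (a : int -> R) (N : nat) (s t t0 f eps rho : R) : (0 < N)%N -> 0 <= eps -> s <= t ->
  `|s - t0| < rho -> `|t - t0| < rho ->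
  (forall k : int, `|k%:~R / N%:R - t0| < rho + N%:R^-1 -> `|a (k + 1) - a k - f / N%:R| <= eps / N%:R) ->
  `|a (Num.floor (N%:R * t)) - a (Num.floor (N%:R * s)) - (t - s) * f| <= eps * (t - s + N%:R^-1) + N%:R^-1 * `|f|.
Proof.
move=> N0 eps0 st hs ht ha; set k1 := Num.floor (N%:R * s); set k2 := Num.floor (N%:R * t).
have N00 : 0 < N%:R :> R by rewrite ltr0n.
have k12 : k1 <= k2 by rewrite /k1 /k2; apply: le_floor; rewrite ler_pM2l.
have [j k2E] : exists j : nat, k2 = k1 + j%:Z.
  by exists (absz (k2 - k1)); rewrite gez0_abs ?subr_ge0// subrKC.
have f1 := floor_itv (N%:R * s); rewrite -/k1 in f1; case/andP: f1 => f1 f2.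
have f3 := floor_itv (N%:R * t); rewrite -/k2 in f3; case/andP: f3 => f3 f4.
rewrite intrD in f2; rewrite intrD in f4.
set h := N%:R^-1; have h0 : 0 < h by rewrite invr_gt0.
have Nh : N%:R * h = 1 by rewrite mulfV// gt_eqF.
have jE : j%:R = k2%:~R - k1%:~R :> R by rewrite k2E intrD [_ + j%:~R]addrC addrK.
have s1 : `|a k2 - a k1 - j%:R * (f / N%:R)| <= j%:R * (eps / N%:R).
  rewrite k2E; apply: sum_steps => i ij; apply: ha.
  have i0 : (0 : R) <= i%:R by [].
  have ij' : i%:R + 1 <= j%:R :> R by rewrite natr1 ler_nat.
  rewrite intrD mulrDl; move: hs ht; rewrite !ltr_distl => /andP[a1 a2] /andP[a3 a4].
  have e1 : k1%:~R * h <= s by rewrite -(ler_pM2l N00) mulrCA Nh mulr1.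
  have e2 : s < k1%:~R * h + h by rewrite -(ltr_pM2l N00) mulrDr mulrCA Nh mulr1.
  have e3 : (k1%:~R + i%:R) * h <= t.
    rewrite -(ler_pM2l N00) mulrCA Nh mulr1; apply: le_trans f3; rewrite -lerBrDl -jE; lra.
  have e4 : 0 <= i%:R * h by rewrite mulr_ge0// ltW.
  rewrite mulrDl -/h in e3; rewrite -/h [i%:~R]/(i%:R); apply/andP; split; move: a1 a2 a3 a4 e1 e2 e3 e4.
    by move: (k1%:~R * h) (i%:R * h) => u v; lra.
  by move: (k1%:~R * h) (i%:R * h) => u v; lra.
have j1 : j%:R * h <= t - s + h.
  rewrite jE -(ler_pM2l N00) mulrCA Nh mulr1 mulrDr Nh mulrBr; move: f1 f2 f3 f4; lra.
have j2 : t - s - h <= j%:R * h.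
  rewrite jE -(ler_pM2l N00) mulrCA Nh mulr1 mulrBr Nh mulrBr; move: f1 f2 f3 f4; lra.
have -> : a k2 - a k1 - (t - s) * f = (a k2 - a k1 - j%:R * (f / N%:R)) + (j%:R * h - (t - s)) * f.
  by rewrite -/h; ring.
apply: le_trans (ler_normD _ _) _; apply: lerD.
  apply: le_trans s1 _; rewrite -/h mulrCA ler_wpM2l//.
by rewrite normrM ler_wpM2r// ler_norml; apply/andP; split; lra.
Qed.

(** The limit is differentiated directly at t0, without an integral equation: the increments near t0
    are almost f / N, and their sums control the difference quotients of the limit. *)
Lemma avg_derive (a : nat -> int -> R) (b : R -> R) (t0 f r0 : R) : 0 < r0 ->
  (forall t, `|t - t0| < r0 -> a N (Num.floor (N%:R * t)) @[N --> U] --> b t) ->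
  (forall eps, 0 < eps -> exists2 rho, 0 < rho & \forall N \near U, forall k : int,
    `|k%:~R / N%:R - t0| < rho -> `|a N (k + 1) - a N k - f / N%:R| <= eps / N%:R) ->
  is_derive t0 (1 : R) b f.
Proof.
move=> r00 hb ha.
have key eps : 0 < eps -> exists2 rho, 0 < rho & forall t, `|t - t0| < rho -> `|b t - b t0 - (t - t0) * f| <= eps * `|t - t0|.
  move=> eps0; have [rho rho0 hrho] := ha eps eps0.
  have r2 : 0 < Num.min (rho / 2) r0 by rewrite lt_min divr_gt0.
  exists (Num.min (rho / 2) r0) => // t; rewrite lt_min => /andP[t1 t2].
  have t00 : `|t0 - t0| < r0 by rewrite subrr normr0.
  have c1 : `|a N (Num.floor (N%:R * t)) - a N (Num.floor (N%:R * t0)) - (t - t0) * f| @[N --> U] --> `|b t - b t0 - (t - t0) * f|.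
    by apply: cvg_norm; apply: cvgB; [apply: cvgB; exact: hb|exact: cvg_cst].
  have c2 : eps * (`|t - t0| + N%:R^-1) + N%:R^-1 * `|f| @[N --> U] --> eps * (`|t - t0| + 0) + 0 * `|f|.
    apply: cvgD; first by apply: cvgM; [exact: cvg_cst|apply: cvgD; [exact: cvg_cst|exact: inv_cvg0]].
    by apply: cvgM; [exact: inv_cvg0|exact: cvg_cst].
  rewrite mul0r !addr0 in c2; apply: (ler_cvg_to c1 c2).
  have rho2 : 0 < rho / 2 by rewrite divr_gt0.
  near=> N.
  have N0 : (0 < N)%N by near: N; exact: hU.
  have hN : N%:R^-1 < rho / 2.
    have [] : 0 < N%:R^-1 :> R /\ N%:R^-1 < rho / 2 by near: N; exact: small_inv.
    by [].
  have hk : forall k : int, `|k%:~R / N%:R - t0| < rho / 2 + N%:R^-1 -> `|a N (k + 1) - a N k - f / N%:R| <= eps / N%:R.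
    have h : forall k : int, `|k%:~R / N%:R - t0| < rho -> `|a N (k + 1) - a N k - f / N%:R| <= eps / N%:R by near: N.
    by move=> k hk; apply: h; apply: lt_trans hk _; rewrite [ltRHS](splitr rho) ltrD2l.
  have t000 : `|t0 - t0| < rho / 2 by rewrite subrr normr0.
  have [tt|/ltW tt] := leP t0 t.
    by rewrite [in leRHS]ger0_norm ?subr_ge0//; exact: (avg_le N0 (ltW eps0) tt t000 t1 hk).
  rewrite -normrN [X in _ <= _ * (X + _) + _]distrC [X in _ <= _ * (X + _) + _]ger0_norm ?subr_ge0//.
  have := avg_le N0 (ltW eps0) tt t1 t000 hk.
  by congr (`|_| <= _); ring.
apply/is_derive1_caratheodory.
exists (fun z => if z == t0 then f else (b z - b t0) / (z - t0)); split.
- by move=> z; case: eqP => [->|/eqP zt]; [rewrite !subrr mulr0|rewrite divfK// subr_eq0].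
- apply/cvgrPdist_le => eps eps0; rewrite eqxx.
  have [rho rho0 h] := key eps eps0.
  have : \forall z \near t0, `|t0 - z| < rho by exact: (nbhsx_ballx t0 _ rho0).
  apply: filterS => z; rewrite distrC => hz; case: eqP => [_|/eqP zt]; first by rewrite subrr normr0 ltW.
  have zt0 : 0 < `|z - t0| by rewrite normr_gt0 subr_eq0.
  have -> : f - (b z - b t0) / (z - t0) = - ((b z - b t0 - (z - t0) * f) / (z - t0)) by field; rewrite subr_eq0.
  by rewrite normrN normrM normfV ler_pdivrMr//; exact: h.
- by rewrite eqxx.
Unshelve. all: by end_near. Qed.

End Averaging.
End UltraLimit.

Section LimitLoop.
Context {R : realType} {n : nat} {M : smoothManifold R n} (F : frame M).
Hypothesis cM : compact [set: M].
Variable x0 : M.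
Notation D := (fdim F).
Notation e := (emb F).

Lemma Q_cvg (T : Type) (G : set_system T) (FG : Filter G) (X : T -> M) (P : T -> 'rV[R]_D) x p :
  X @ G --> x -> P @ G --> p -> Q (X t) (P t) @[t --> G] --> Q x p.
Proof.
move=> hX hP; apply: cvg_rV => j; rewrite QE (_ : (fun t => Q (X t) (P t) 0 j) = fun t => \sum_i P t 0 i * Qm i j (X t)); last first.
  by apply/funext => t; rewrite QE.
apply: cvg_big => [|i _]; first exact: add_continuous.
apply: cvgM; first exact: (cvg_comp P (fun v : 'rV[R]_D => v 0 i) hP (@coord_cvg _ _ _ i)).
exact: (cvg_comp X (Qm i j) hX (MCk_cts (@Qm_C2 _ _ _ F i j) (x := x))).
Qed.

Lemma disc_lip d (a : int -> 'rV[R]_d) (N : nat) C s t : (0 < N)%N -> 0 <= C -> (forall k, `|a (k + 1) - a k| <= C / N%:R) ->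
  `|a (Num.floor (N%:R * t)) - a (Num.floor (N%:R * s))| <= C * (`|t - s| + N%:R^-1).
Proof.
move=> N0 C0; wlog st : s t / s <= t => [hw ha|ha].
  have [st|/ltW st] := leP s t; first exact: hw.
  by rewrite distrC (distrC t); exact: hw.
apply: mx_norm_le => [|i j]; first by rewrite mulr_ge0// addr_ge0// invr_ge0.
rewrite ord1 !mxE.
have := @avg_le R (fun k => a k 0 j) N s t 0 0 C (`|s| + `|t| + 1) N0 C0 st.
rewrite !subr0 mulr0 subr0 normr0 mulr0 addr0 [`|t - s|]ger0_norm ?subr_ge0//; apply.
- by rewrite -addrA ltrDl ltr_wpDl.
- by rewrite addrAC ltrDr ltr_wpDl.
- move=> k _; rewrite mul0r subr0; apply: le_trans (ha k).
  by apply: le_trans (coord_le_norm _ 0 j); rewrite !mxE.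
Qed.

Variable U : set_system nat.
Hypothesis uU : UltraFilter U.
Hypothesis hU : forall N0, \forall N \near U, (N0 <= N)%N.
Variables (X : nat -> int -> M) (P : nat -> int -> 'rV[R]_D) (C : R).
Hypothesis C0 : 0 < C.
Hypothesis hper : \forall N \near U, (forall k, X N (k + N%:Z) = X N k) /\ (forall k, P N (k + N%:Z) = P N k).
Hypothesis hest : \forall N \near U, forall k, [/\ `|e (X N (k + 1)) - e (X N k)| <= C / N%:R, `|P N k| <= C,
  `|P N (k + 1) - P N k| <= C / N%:R & `|P N k - Q (X N k) (P N k)| <= C / N%:R].

Let pU : ProperFilter U. Proof. exact: ultra_proper. Qed.

Lemma limit_exists : exists (x : R -> M) (p : R -> 'rV[R]_D), forall t,
  X N (Num.floor (N%:R * t)) @[N --> U] --> x t /\ P N (Num.floor (N%:R * t)) @[N --> U] --> p t.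
Proof.
have hx (t : R) : exists x : M, X N (Num.floor (N%:R * t)) @[N --> U] --> x.
  have hT : \forall N \near U, [set: M] (X N (Num.floor (N%:R * t))) by exact: nearW.
  by have [x _ hx] := ultra_cvg uU cM hT; exists x.
have hp (t : R) : exists p : 'rV[R]_D, P N (Num.floor (N%:R * t)) @[N --> U] --> p.
  have hT : \forall N \near U, [set v : 'rV[R]_D | `|v| <= C] (P N (Num.floor (N%:R * t))).
    by apply: filterS hest => N h; case: (h (Num.floor (N%:R * t))).
  by have [p _ hp] := ultra_cvg uU (@box_compact R D C) hT; exists p.
have [x hx'] := choice hx; have [p hp'] := choice hp.
by exists x, p => t; split.
Qed.

Variables (x : R -> M) (p : R -> 'rV[R]_D).
Hypothesis hx : forall t, X N (Num.floor (N%:R * t)) @[N --> U] --> x t.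
Hypothesis hp : forall t, P N (Num.floor (N%:R * t)) @[N --> U] --> p t.

Lemma emb_sample_cvg (t : R) : e (X N (Num.floor (N%:R * t))) @[N --> U] --> e (x t).
Proof.
have h := @hx t; have h2 : e y @[y --> x t] --> e (x t) by exact: emb_cts.
exact: (cvg_comp _ _ h h2).
Qed.

Lemma limit_periodic (t : R) : x (t + 1) = x t /\ p (t + 1) = p t.
Proof.
have h N : Num.floor (N%:R * (t + 1)) = Num.floor (N%:R * t) + N%:Z.
  by rewrite mulrDr mulr1 floor_shift.
have h1 : X N (Num.floor (N%:R * t)) @[N --> U] --> x (t + 1).
  have h' := @hx (t + 1); apply: (cvg_trans _ h'); apply: near_eq_cvg; apply: filterS hper => N [h1 _].
  by rewrite h h1.
have h2 : P N (Num.floor (N%:R * t)) @[N --> U] --> p (t + 1).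
  have h' := @hp (t + 1); apply: (cvg_trans _ h'); apply: near_eq_cvg; apply: filterS hper => N [_ h2].
  by rewrite h h2.
split; last exact: (norm_cvg_unique h2 (@hp t)).
exact: (cvg_unique (manifold_hausdorff (s := M)) h1 (@hx t)).
Qed.

Lemma limit_lip (s t : R) : `|e (x t) - e (x s)| <= C * `|t - s| /\ `|p t - p s| <= C * `|t - s|.
Proof.
have c2 : C * (`|t - s| + N%:R^-1) @[N --> U] --> C * (`|t - s| + 0).
  by apply: cvgM; [exact: cvg_cst|apply: cvgD; [exact: cvg_cst|exact: inv_cvg0]].
rewrite addr0 in c2.
split.
  have c1 : `|e (X N (Num.floor (N%:R * t))) - e (X N (Num.floor (N%:R * s)))| @[N --> U] --> `|e (x t) - e (x s)|.
    by apply: cvg_norm; apply: cvgB; exact: emb_sample_cvg.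
  apply: (ler_cvg_to c1 c2); near=> N; apply: (@disc_lip D (fun k => e (X N k))).
  - by near: N; exact: hU.
  - exact: ltW.
  - have h : forall k, [/\ `|e (X N (k + 1)) - e (X N k)| <= C / N%:R, `|P N k| <= C,
      `|P N (k + 1) - P N k| <= C / N%:R & `|P N k - Q (X N k) (P N k)| <= C / N%:R] by near: N.
    by move=> k; case: (h k).
have c1 : `|P N (Num.floor (N%:R * t)) - P N (Num.floor (N%:R * s))| @[N --> U] --> `|p t - p s|.
  by apply: cvg_norm; apply: cvgB; exact: hp.
apply: (ler_cvg_to c1 c2); near=> N; apply: (@disc_lip D (P N)).
- by near: N; exact: hU.
- exact: ltW.
- have h : forall k, [/\ `|e (X N (k + 1)) - e (X N k)| <= C / N%:R, `|P N k| <= C,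
    `|P N (k + 1) - P N k| <= C / N%:R & `|P N k - Q (X N k) (P N k)| <= C / N%:R] by near: N.
  by move=> k; case: (h k).
Unshelve. all: by end_near. Qed.

Lemma lip_cts d (f : R -> 'rV[R]_d) : (forall s t, `|f t - f s| <= C * `|t - s|) -> continuous f.
Proof.
move=> hf s; apply/cvgrPdist_lt => eps eps0.
have d0 : 0 < eps / C by rewrite divr_gt0.
have : \forall t \near s, `|s - t| < eps / C by exact: (nbhsx_ballx s _ d0).
by apply: filterS => t ht; apply: le_lt_trans (hf _ _) _; rewrite mulrC -ltr_pdivlMr.
Qed.

Lemma limit_cts : continuous x /\ continuous p.
Proof.
split; last by apply: lip_cts => s t; case: (limit_lip s t).
move=> s; apply: (@emb_embed _ _ _ F cM _ (nbhs s)); apply: (@lip_cts _ (fun t => e (x t))).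
by move=> s' t; case: (limit_lip s' t).
Qed.

Lemma limit_normal (t : R) : Q (x t) (p t) = p t.
Proof.
have cQ := Q_cvg (@filter_filter _ _ pU) (@hx t) (@hp t).
have c0 : P N (Num.floor (N%:R * t)) - Q (X N (Num.floor (N%:R * t))) (P N (Num.floor (N%:R * t))) @[N --> U] --> p t - Q (x t) (p t).
  by apply: cvgB => //; exact: cQ.
have c1 : C * N%:R^-1 @[N --> U] --> C * 0 by apply: cvgM; [exact: cvg_cst|exact: inv_cvg0].
apply/esym/eqP; rewrite -subr_eq0 -normr_le0; rewrite mulr0 in c1.
have c2 := cvg_norm c0; apply: (ler_cvg_to (c2 _) c1).
by apply: filterS hest => N h; case: (h (Num.floor (N%:R * t))).
Qed.

(** Convergence at t0 and the common Lipschitz bound control all samples at times near t0, uniformly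
    in the index. *)
Lemma sample_close (t0 d : R) : 0 < d -> exists2 rho, 0 < rho & \forall N \near U, forall k : int,
  `|k%:~R / N%:R - t0| < rho -> `|e (X N k) - e (x t0)| < d /\ `|P N k - p t0| < d.
Proof.
move=> d0; have r0 : 0 < d / 3 / C by rewrite !divr_gt0.
exists (d / 3 / C) => //.
have d3 : 0 < d / 3 by rewrite divr_gt0.
have h1 : \forall N \near U, `|e (x t0) - e (X N (Num.floor (N%:R * t0)))| < d / 3.
  by have /cvgrPdist_lt := @emb_sample_cvg t0; apply.
have h2 : \forall N \near U, `|p t0 - P N (Num.floor (N%:R * t0))| < d / 3.
  by have /cvgrPdist_lt := @hp t0; apply.
near=> N => k hk.
have N0 : (0 < N)%N by near: N; exact: hU.
have N00 : N%:R != 0 :> R by rewrite pnatr_eq0 -lt0n.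
have [_ hN] : 0 < N%:R^-1 :> R /\ N%:R^-1 < d / 3 / C by near: N; exact: small_inv.
have h : forall k, [/\ `|e (X N (k + 1)) - e (X N k)| <= C / N%:R, `|P N k| <= C,
      `|P N (k + 1) - P N k| <= C / N%:R & `|P N k - Q (X N k) (P N k)| <= C / N%:R] by near: N.
have fl : Num.floor (N%:R * (k%:~R / N%:R) : R) = k by rewrite mulrCA divff// mulr1 intrKfloor.
have b : C * (`|k%:~R / N%:R - t0| + N%:R^-1) < d / 3 + d / 3.
  by rewrite mulrDr; apply: ltrD; rewrite mulrC -ltr_pdivlMr.
have e1 : `|e (X N k) - e (X N (Num.floor (N%:R * t0)))| < d / 3 + d / 3.
  rewrite -{1}fl; apply: le_lt_trans b; apply: (@disc_lip D (fun k => e (X N k))) => //; first exact: ltW.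
  by move=> k'; case: (h k').
have e2 : `|P N k - P N (Num.floor (N%:R * t0))| < d / 3 + d / 3.
  rewrite -{1}fl; apply: le_lt_trans b; apply: (@disc_lip D (P N)) => //; first exact: ltW.
  by move=> k'; case: (h k').
have e3 : `|e (x t0) - e (X N (Num.floor (N%:R * t0)))| < d / 3 by near: N.
have e4 : `|p t0 - P N (Num.floor (N%:R * t0))| < d / 3 by near: N.
have d3E : d = d / 3 + d / 3 + d / 3 by field.
have tri (u v w : 'rV[R]_D) : `|u - v| < d / 3 + d / 3 -> `|w - v| < d / 3 -> `|u - w| < d.
  move=> uv wv; have -> : u - w = (u - v) - (w - v) by rewrite opprB addrA subrK.
  by apply: le_lt_trans (ler_normB _ _) _; rewrite [ltRHS]d3E ltrD.
by split; [exact: tri e1 e3|exact: tri e2 e4].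
Unshelve. all: by end_near. Qed.

Lemma sample_near (t0 : R) (A : set (R * (M * 'rV[R]_D))) : nbhs (t0, (x t0, p t0)) A ->
  exists2 rho, 0 < rho & \forall N \near U, forall k : int, `|k%:~R / N%:R - t0| < rho -> A (k%:~R / N%:R, (X N k, P N k)).
Proof.
move=> [[B1 B2] /= [hB1 [[B3 B4] /= [hB3 hB4] B34]] hA].
have [d1 d10 hd1] := emb_separates F cM hB3.
have [d2 /= d20 hd2] := (nbhs_ballP _ _).1 hB4.
have [d3 /= d30 hd3] := (nbhs_ballP _ _).1 hB1.
have d120 : 0 < Num.min d1 d2 by rewrite lt_min d10.
have [rho rho0 h] := sample_close t0 d120.
exists (Num.min rho d3); first by rewrite lt_min rho0.
apply: filterS h => N h k; rewrite lt_min => /andP[k1 k2].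
have [h1 h2] := h k k1; move: h1 h2; rewrite !lt_min => /andP[h1 _] /andP[_ h2].
apply: hA; split; first by apply: hd3; rewrite /ball /= distrC.
apply: B34; split; first exact: hd1.
by apply: hd2; rewrite -ball_normE /ball_ /= distrC.
Qed.

Lemma sample_pair (t0 : R) (A : set (R * (M * 'rV[R]_D))) : nbhs (t0, (x t0, p t0)) A ->
  exists2 rho, 0 < rho & \forall N \near U, forall k : int, `|k%:~R / N%:R - t0| < rho ->
    A (k%:~R / N%:R, (X N k, P N k)) /\ A ((k + 1)%:~R / N%:R, (X N (k + 1), P N (k + 1))).
Proof.
move=> /sample_near [rho rho0 h]; have r2 : 0 < rho / 2 by rewrite divr_gt0.
exists (rho / 2) => //; near=> N => k hk.
have hN : forall k : int, `|k%:~R / N%:R - t0| < rho -> A (k%:~R / N%:R, (X N k, P N k)) by near: N.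
have [s1 s2] : 0 < N%:R^-1 :> R /\ N%:R^-1 < rho / 2 by near: N; exact: small_inv.
split; apply: hN; first by apply: lt_trans hk _; lra.
have -> : (k + 1)%:~R / N%:R - t0 = (k%:~R / N%:R - t0) + N%:R^-1 by rewrite intrD; ring.
apply: le_lt_trans (ler_normD _ _) _; rewrite [ltRHS]splitr; apply: ltrD => //.
by rewrite gtr0_norm.
Unshelve. all: by end_near. Qed.

(** The pointwise limits are uniform, by the common Lipschitz bound and compactness of a period;
    only then can the limit loop be compared with a polygon. *)
Lemma limit_class (d : R) : 0 < d -> \forall N \near U, forall t, `|e (x t) - e (X N (Num.floor (N%:R * t)))| <= d.
Proof.
move=> d0; have cK : compact `[(0 : R), 1]%classic by exact: segment_compact.
have /compact_near_coveringP/near_covering_withinP cK' := cK.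
have h : \forall N \near U, `[0, 1]%classic `<=` (fun t => `|e (x t) - e (X N (Num.floor (N%:R * t)))| <= d).
  apply: (cK' _ U (fun N t => `|e (x t) - e (X N (Num.floor (N%:R * t)))| <= d)) => t _.
  have d2 : 0 < d / 2 by rewrite divr_gt0.
  have [rho rho0 hr] := sample_close t d2.
  have r2 : 0 < rho / 2 by rewrite divr_gt0.
  have c1 : \forall s \near t, `|e (x t) - e (x s)| < d / 2.
    have cx : e (x s) @[s --> t] --> e (x t).
      by apply: (@lip_cts _ (fun t => e (x t))) => s' t'; case: (limit_lip s' t').
    by move/cvgrPdist_lt : cx => /(_ _ d2).
  have c2 : \forall s \near t, `|t - s| < rho / 2 by exact: (nbhsx_ballx t _ r2).
  have c3 : \forall N \near U, 0 < N%:R^-1 :> R /\ N%:R^-1 < rho / 2 by exact: small_inv.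
  have c4 := hU 1%N.
  near=> s N => _.
  have e1 : `|e (x t) - e (x s)| < d / 2 by near: s.
  have e2 : `|t - s| < rho / 2 by near: s.
  have [e3 e4] : 0 < N%:R^-1 :> R /\ N%:R^-1 < rho / 2 by near: N.
  have N0 : (0 < N)%N by near: N.
  have hN : forall k : int, `|k%:~R / N%:R - t| < rho -> `|e (X N k) - e (x t)| < d / 2 /\ `|P N k - p t| < d / 2 by near: N.
  have [h1 _] : `|e (X N (Num.floor (N%:R * s))) - e (x t)| < d / 2 /\ `|P N (Num.floor (N%:R * s)) - p t| < d / 2.
    apply: hN; have ff := floor_frac s N0.
    have -> : (Num.floor (N%:R * s))%:~R / N%:R - t = - (s - (Num.floor (N%:R * s))%:~R / N%:R) - (t - s) by ring.
    apply: le_lt_trans (ler_normB _ _) _; rewrite normrN [ltRHS]splitr; apply: ltrD => //.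
    by apply: le_lt_trans ff _; rewrite div1r.
  have -> : e (x s) - e (X N (Num.floor (N%:R * s))) = - (e (X N (Num.floor (N%:R * s))) - e (x t)) - (e (x t) - e (x s)).
    by rewrite !opprB [RHS]addrC addrA subrK.
  by apply: ltW; apply: le_lt_trans (ler_normB _ _) _; rewrite normrN [ltRHS]splitr ltrD.
near=> N => t; have hN : `[0, 1]%classic `<=` (fun t => `|e (x t) - e (X N (Num.floor (N%:R * t)))| <= d) by near: N.
have [hX _] : (forall k, X N (k + N%:Z) = X N k) /\ (forall k, P N (k + N%:Z) = P N k) by near: N.
pose s := t - (Num.floor t)%:~R.
have s01 : `[(0 : R), 1]%classic s.
  by rewrite /= in_itv /= subr_ge0 floor_le /= lerBlDr addrC -intrD1 ltW// floorD1_gt.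
have -> : x t = x s.
  have hp' s' : x (s' + 1) = x s' by case: (limit_periodic s').
  by rewrite -(periodic_int (Num.floor t) s hp') subrK.
have -> : X N (Num.floor (N%:R * t)) = X N (Num.floor (N%:R * s)).
  rewrite -[RHS](periodic_seq _ (Num.floor t) hX); congr (X N _).
  have -> : N%:R * t = N%:R * s + (Num.floor t * N%:Z)%:~R by rewrite /s intrM mulrBr [_ * N%:~R]mulrC subrK.
  by rewrite floorDrz ?intrKfloor// rpred_int.
exact: hN.
Unshelve. all: by end_near. Qed.

(** The sample times that satisfy the inequality can be taken in [0, 1] and converge along [U]. If f
    exceeded b at their limit, it would do so at all nearby samples. *)
Lemma limit_small (f : M -> 'rV[R]_D -> R) (b : R) : continuous (fun z : M * 'rV[R]_D => f z.1 z.2) ->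
  (\forall N \near U, exists k, f (X N k) (P N k) <= b) -> exists t, f (x t) (p t) <= b.
Proof.
move=> cf hf.
have h1 : \forall N \near U, exists t : R, `[0, 1]%classic t /\ exists k : int, t = k%:~R / N%:R /\ f (X N k) (P N k) <= b.
  near=> N; have [k hk] : exists k, f (X N k) (P N k) <= b by near: N.
  have [hX hP] : (forall k, X N (k + N%:Z) = X N k) /\ (forall k, P N (k + N%:Z) = P N k) by near: N.
  have N0 : (0 < N)%N by near: N; exact: hU.
  have N00 : 0 < N%:R :> R by rewrite ltr0n.
  have Nz : N%:Z != 0 by rewrite eqz_nat -lt0n.
  pose k' := (k %% N%:Z)%Z.
  have E : k = k' + (k %/ N%:Z)%Z * N%:Z by rewrite addrC -divz_eq.
  exists (k'%:~R / N%:R); split; last first.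
    exists k'; split=> //; move: hk; rewrite {1 2}E (periodic_seq _ _ hX) (periodic_seq _ _ hP)//.
  rewrite /= in_itv /= divr_ge0 ?ler0z ?modz_ge0//= ler_pdivrMr// mul1r.
  by rewrite -[N%:R]/((N%:Z)%:~R) ler_int ltW// ltz_pmod.
have [tN htN] : exists tN : nat -> R, \forall N \near U, `[0, 1]%classic (tN N) /\ exists k : int, tN N = k%:~R / N%:R /\ f (X N k) (P N k) <= b.
  pose A N t := `[(0 : R), 1]%classic t /\ exists k : int, t = k%:~R / N%:R /\ f (X N k) (P N k) <= b.
  have hch (N : nat) : exists t, (exists t, A N t) -> A N t.
    by have [[t ht]|hn] := pselect (exists t, A N t); [exists t|exists 0 => /hn].
  have [tN htN] := choice hch.
  by exists tN; apply: filterS h1 => N h; exact: htN.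
have ht1 : \forall N \near U, `[0, 1]%classic (tN N) by apply: filterS htN => N [].
have [t _ ht] := ultra_cvg uU (@segment_compact R 0 1) ht1.
exists t; rewrite leNgt; apply/negP => hlt.
have op : open [set z : R * (M * 'rV[R]_D) | b < f z.2.1 z.2.2].
  apply: (@open_comp _ _ snd [set z : M * 'rV[R]_D | b < f z.1 z.2]); first by move=> z _; exact: cvg_snd.
  exact: open_preim_gt.
have [rho rho0 hr] := sample_near (open_nbhs_nbhs (conj op hlt : open_nbhs (t, (x t, p t)) _)).
have [N [[hN1 hN2] hN3]] : exists N, (`[0, 1]%classic (tN N) /\ exists k : int, tN N = k%:~R / N%:R /\ f (X N k) (P N k) <= b) /\
   `|t - tN N| < rho /\ (forall k : int, `|k%:~R / N%:R - t| < rho -> b < f (X N k) (P N k)).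
  have := filter_ex (filterI htN (filterI ((cvgrPdist_lt _ _).1 ht rho rho0) hr)).
  by move=> [N [a1 [a2 a3]]]; exists N.
case: hN2 => k [kE hk]; case: hN3 => h2 h3.
by have := h3 k; rewrite -kE distrC => /(_ h2); rewrite ltNge hk.
Unshelve. all: by end_near. Qed.

End LimitLoop.

(** * The equations of the limit in local coordinates *)

Section ChartODE.
Context {R : realType} {n : nat} {M : smoothManifold R n} (F : frame M).
Hypothesis cM : compact [set: M].
Notation D := (fdim F).
Notation e := (emb F).
Variable U : set_system nat.
Hypothesis uU : UltraFilter U.
Hypothesis hU : forall N0, \forall N \near U, (N0 <= N)%N.
Variables (X : nat -> int -> M) (P : nat -> int -> 'rV[R]_D) (C : R).
Hypothesis C0 : 0 < C.
Hypothesis hest : \forall N \near U, forall k, [/\ `|e (X N (k + 1)) - e (X N k)| <= C / N%:R, `|P N k| <= C,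
  `|P N (k + 1) - P N k| <= C / N%:R & `|P N k - Q (X N k) (P N k)| <= C / N%:R].
Variables (x : R -> M) (p : R -> 'rV[R]_D).
Hypothesis hx : forall t, X N (Num.floor (N%:R * t)) @[N --> U] --> x t.
Hypothesis hp : forall t, P N (Num.floor (N%:R * t)) @[N --> U] --> p t.
Let pU : ProperFilter U. Proof. exact: ultra_proper. Qed.

Definition sample N (k : int) : R * (M * 'rV[R]_D) := (k%:~R / N%:R, (X N k, P N k)).

(** The two parts of the increment are evaluated at different ends because the discrete scheme is
    explicit in the position and uses the new point in the equation of the momentum. *)
Lemma sample_derive (t0 : R) (a : nat -> int -> R) (b : R -> R) (f1 f2 : R * (M * 'rV[R]_D) -> R) (r0 : R) :
  0 < r0 -> (forall t, `|t - t0| < r0 -> a N (Num.floor (N%:R * t)) @[N --> U] --> b t) ->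
  {for (t0, (x t0, p t0)), continuous f1} -> {for (t0, (x t0, p t0)), continuous f2} ->
  (exists B rho, [/\ 0 <= B, 0 < rho & \forall N \near U, forall k : int, `|k%:~R / N%:R - t0| < rho ->
    `|a N (k + 1) - a N k - (f1 (sample N (k + 1)) + f2 (sample N k)) / N%:R| <= B * N%:R^-1 ^+ 2]) ->
  is_derive t0 (1 : R) b (f1 (t0, (x t0, p t0)) + f2 (t0, (x t0, p t0))).
Proof.
move=> r00 hb c1 c2 [B [rho [B0 rho0 hB]]].
apply: (avg_derive pU hU r00 hb) => eps eps0.
set z0 := (t0, (x t0, p t0)).
have e3 : 0 < eps / 3 by rewrite divr_gt0.
have n1 : \forall z \near z0, `|f1 z0 - f1 z| < eps / 3 by have /cvgrPdist_lt := c1; apply.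
have n2 : \forall z \near z0, `|f2 z0 - f2 z| < eps / 3 by have /cvgrPdist_lt := c2; apply.
have [rho' rho'0 hr] := sample_pair cM uU hU C0 hest hx hp (filterI n1 n2).
exists (Num.min rho rho'); first by rewrite lt_min rho0.
have B3 : 0 < eps / 3 / (B + 1) by rewrite divr_gt0// ltr_wpDl.
near=> N => k; rewrite lt_min => /andP[k1 k2].
have [h0 hN] : 0 < N%:R^-1 :> R /\ N%:R^-1 < eps / 3 / (B + 1) by near: N; exact: small_inv.
have hB' : forall k : int, `|k%:~R / N%:R - t0| < rho ->
    `|a N (k + 1) - a N k - (f1 (sample N (k + 1)) + f2 (sample N k)) / N%:R| <= B * N%:R^-1 ^+ 2 by near: N.
have hr' : forall k : int, `|k%:~R / N%:R - t0| < rho' ->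
  (`|f1 z0 - f1 (sample N k)| < eps / 3 /\ `|f2 z0 - f2 (sample N k)| < eps / 3) /\
  (`|f1 z0 - f1 (sample N (k + 1))| < eps / 3 /\ `|f2 z0 - f2 (sample N (k + 1))| < eps / 3) by near: N.
have [[_ g2] [g1 _]] := hr' k k2.
have g3 := hB' k k1.
set h := N%:R^-1 in h0 hN g3 *.
have Bh : B * h <= eps / 3.
  move: hN; rewrite ltr_pdivlMr ?ltr_wpDl// => hN; apply: le_trans (ltW hN).
  by rewrite mulrC ler_wpM2l ?(ltW h0)// lerDl.
have -> : a N (k + 1) - a N k - (f1 z0 + f2 z0) * h =
  (a N (k + 1) - a N k - (f1 (sample N (k + 1)) + f2 (sample N k)) * h) - ((f1 z0 - f1 (sample N (k + 1))) * h + (f2 z0 - f2 (sample N k)) * h) by ring.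
apply: le_trans (ler_normB _ _) _; apply: le_trans (lerD g3 (ler_normD _ _)) _.
rewrite !normrM (gtr0_norm h0).
have -> : eps * h = eps / 3 * h + (eps / 3 * h + eps / 3 * h) by field.
apply: lerD; first by rewrite expr2 mulrA ler_wpM2r// ltW.
by apply: lerD; rewrite ler_wpM2r ?(ltW h0)// ltW.
Unshelve. all: by end_near. Qed.

Variable K : R -> M -> 'rV[R]_D -> R.
Hypothesis KJ : JCk 2 (fun x (s : R * 'rV[R]_D) => K s.1 x s.2).
Hypothesis hE1 : \forall N \near U, forall k,
  `|e (X N (k + 1)) - e (X N k) - N%:R^-1 *: dgrad (K (k%:~R / N%:R) (X N k)) (P N k)| <= N%:R^-1 ^+ 2.
Hypothesis hE2 : \forall N \near U, forall k,
  `|Q (X N k) (P N (k - 1) - P N k - N%:R^-1 *: grad F (fun x => K (k%:~R / N%:R) x (P N k)) (X N k))| <= N%:R^-1 ^+ 2.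

Variables (t0 : R) (c : chart M).
Hypothesis ct0 : cdom c (x t0).
Let z0 : R * (M * 'rV[R]_D) := (t0, (x t0, p t0)).
Let q0 := coord c (x t0).

Let swap (z : R * (M * 'rV[R]_D)) : M * (R * 'rV[R]_D) := (z.2.1, (z.1, z.2.2)).

Let swap_cvg : swap z @[z --> z0] --> swap z0.
Proof.
have h1 : z.2.1 @[z --> z0] --> x t0 by apply: (cvg_comp snd fst); [exact: cvg_snd|exact: cvg_fst].
have h2 : z.1 @[z --> z0] --> t0 by exact: cvg_fst.
have h3 : z.2.2 @[z --> z0] --> p t0 by apply: (cvg_comp snd snd); [exact: cvg_snd|exact: cvg_snd].
exact: cvg_pair h1 (cvg_pair h2 h3).
Qed.

Let fV : findim (R * 'rV[R]_D)%type := findim_pair findim_R (findim_rV D).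
Let KJ1 : JCk 1 (fun x (s : R * 'rV[R]_D) => K s.1 x s.2).
Proof. by move=> c'; exact: CkW (KJ c'). Qed.

Lemma dgradK_cts j : {for z0, continuous (fun z => dgrad (K z.1 z.2.1) z.2.2 0 j)}.
Proof.
have E (z : R * (M * 'rV[R]_D)) : dgrad (K z.1 z.2.1) z.2.2 0 j =
    'D_((0 : R), (delta_mx 0 j : 'rV[R]_D)) (fun s : R * 'rV[R]_D => K s.1 (swap z).1 s.2) (swap z).2.
  by rewrite mxE derive_pair2.
have h : 'D_((0 : R), (delta_mx 0 j : 'rV[R]_D)) (fun s : R * 'rV[R]_D => K s.1 y.1 s.2) y.2 @[y --> swap z0] -->
   'D_((0 : R), (delta_mx 0 j : 'rV[R]_D)) (fun s : R * 'rV[R]_D => K s.1 (swap z0).1 s.2) (swap z0).2.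
  exact: (fib_derive_cts KJ1).
rewrite /prop_for /continuous_at E (_ : (fun z => dgrad (K z.1 z.2.1) z.2.2 0 j) =
   fun z => 'D_((0 : R), (delta_mx 0 j : 'rV[R]_D)) (fun s : R * 'rV[R]_D => K s.1 (swap z).1 s.2) (swap z).2); last by apply/funext => z.
exact: (cvg_comp _ _ swap_cvg h).
Qed.

Lemma gradK_cts : {for z0, continuous (fun z => grad F (fun y => K z.1 y z.2.2) z.2.1)}.
Proof.
have h : grad F (fun y' => K y.2.1 y' y.2.2) y.1 @[y --> swap z0] --> grad F (fun y' => K t0 y' (p t0)) (x t0).
  exact: (grad_cts fV KJ1 (x := swap z0)).
exact: (cvg_comp _ _ swap_cvg h).
Qed.

Lemma chart_cts (g : 'rV[R]_n -> R) : {for q0, continuous g} -> {for z0, continuous (fun z => g (coord c z.2.1))}.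
Proof.
move=> cg; have h1 : z.2.1 @[z --> z0] --> x t0 by apply: (cvg_comp snd fst); [exact: cvg_snd|exact: cvg_fst].
exact: (cvg_comp _ _ (cvg_comp _ _ h1 (coord_cts ct0)) cg).
Qed.

Lemma fld_cts j i : {for z0, continuous (fun z => fld F c z.2.1 j 0 i)}.
Proof.
have cf : {for q0, continuous (fun q => fld F c (param c q) j 0 i)} by exact: Ck_cont (fld_C2 F c j i) (cimg_coord ct0).
have h := chart_cts cf; rewrite /prop_for /continuous_at in h *.
have E : fld F c (param c (coord c (x t0))) j 0 i = fld F c (x t0) j 0 i by rewrite coordK.
rewrite /z0 /= E in h; apply: (cvg_trans _ h); apply: near_eq_cvg.
have o : open [set z : R * (M * 'rV[R]_D) | cdom c z.2.1].
  apply: (@open_comp _ _ (fun z : R * (M * 'rV[R]_D) => z.2.1) (cdom c)); last exact: cdom_open.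
  by move=> z _; apply: (cvg_comp snd fst); [exact: cvg_snd|exact: cvg_fst].
by apply: (near_in_open o) => // z cz; rewrite coordK.
Qed.

Definition Vf (z : R * (M * 'rV[R]_D)) : 'rV[R]_n := \sum_j dgrad (K z.1 z.2.1) z.2.2 0 j *: fld F c z.2.1 j.

Lemma VfE z i : Vf z 0 i = \sum_j dgrad (K z.1 z.2.1) z.2.2 0 j * fld F c z.2.1 j 0 i.
Proof. by rewrite summxE; apply: eq_bigr => j _; rewrite mxE. Qed.

Lemma Vf_cts i : {for z0, continuous (fun z => Vf z 0 i)}.
Proof.
rewrite /prop_for /continuous_at VfE (_ : (fun z => Vf z 0 i) = fun z => \sum_j dgrad (K z.1 z.2.1) z.2.2 0 j * fld F c z.2.1 j 0 i); last first.
  by apply/funext => z; rewrite VfE.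
apply: cvg_big => [|j _]; first exact: add_continuous.
by apply: cvgM; [exact: dgradK_cts|exact: fld_cts].
Qed.

Lemma cdom_near (r : R) : 0 < r -> \forall z \near z0, cdom c z.2.1 /\ `|coord c z.2.1 - q0| < r.
Proof.
move=> r0.
have h1 : z.2.1 @[z --> z0] --> x t0 by apply: (cvg_comp snd fst); [exact: cvg_snd|exact: cvg_fst].
have h2 : \forall y \near x t0, cdom c y by exact: (near_in_open (cdom_open c)).
have h3 : \forall y \near x t0, `|q0 - coord c y| < r.
  by have /cvgrPdist_lt := coord_cts ct0; apply.
have h23 : \forall y \near x t0, cdom c y /\ `|q0 - coord c y| < r by exact: filterI.
have H : \forall z \near z0, cdom c z.2.1 /\ `|q0 - coord c z.2.1| < r := h1 _ h23.
move: H; apply: filterS => z /= [a b].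
by split=> //; rewrite distrC.
Qed.

(** By [fld_dual] the coordinate increment is the sum of its de_j times w_j; de of the increment is
    the chord up to second order, and the chord is h dK/dp up to h^2. *)
Lemma q_step : exists B rho, [/\ 0 <= B, 0 < rho & \forall N \near U, forall k : int, `|k%:~R / N%:R - t0| < rho ->
  `|coord c (X N (k + 1)) - coord c (X N k)| <= B * N%:R^-1 /\
  `|coord c (X N (k + 1)) - coord c (X N k) - N%:R^-1 *: Vf (sample N k)| <= B * N%:R^-1 ^+ 2].
Proof.
have [r1 [C1 [r10 C10 h1]]] := emb_local F ct0.
have hW j : \forall z \near z0, forall i, `|fld F c z.2.1 j 0 i| <= \sum_i (`|fld F c (x t0) j 0 i| + 1).
  apply: (@filter_forall _ _ _ (nbhs z0) (nbhs_filter z0)) => i; have /cvgrPdist_lt/(_ _ ltr01) := @fld_cts j i.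
  apply: filterS => z hz; apply: (@le_trans _ _ (`|fld F c (x t0) j 0 i| + 1)).
    have -> : fld F c z.2.1 j 0 i = fld F c (x t0) j 0 i - (fld F c (x t0) j 0 i - fld F c z.2.1 j 0 i) by ring.
    by apply: le_trans (ler_normB _ _) _; rewrite lerD2l ltW.
  by rewrite (bigD1 i)//= lerDl; apply: sumr_ge0 => k _; rewrite addr_ge0.
pose W := \sum_j \sum_i (`|fld F c (x t0) j 0 i| + 1).
have W0 : 0 <= W by apply: sumr_ge0 => j _; apply: sumr_ge0 => i _; rewrite addr_ge0.
have hW2 : \forall z \near z0, forall j, `|fld F c z.2.1 j| <= W.
  apply: (@filter_forall _ _ _ (nbhs z0) (nbhs_filter z0)) => j; apply: filterS (hW j) => z hz; apply: mx_norm_le => // a i; rewrite ord1.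
  apply: le_trans (hz i) _; rewrite /W (bigD1 j)//= lerDl; apply: sumr_ge0 => k _.
  by apply: sumr_ge0 => l _; rewrite addr_ge0.
have [rho rho0 hr] := sample_pair cM uU hU C0 hest hx hp (filterI (cdom_near r10) hW2).
pose B2 := D%:R * ((C1 * (C1 * C) ^+ 2 + 1) * W).
have B20 : 0 <= B2 by rewrite !mulr_ge0// addr_ge0// mulr_ge0// sqr_ge0.
have B10 : 0 <= C1 * C by rewrite mulr_ge0// ltW.
exists (C1 * C + B2), rho; split=> //; first by rewrite addr_ge0.
near=> N => k hk; set h := N%:R^-1.
have h0 : 0 <= h by rewrite invr_ge0.
have hr' : forall k : int, `|k%:~R / N%:R - t0| < rho ->
   ((cdom c (X N k) /\ `|coord c (X N k) - q0| < r1) /\ forall j, `|fld F c (X N k) j| <= W) /\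
   ((cdom c (X N (k + 1)) /\ `|coord c (X N (k + 1)) - q0| < r1) /\ forall j, `|fld F c (X N (k + 1)) j| <= W) by near: N.
have [[[d1 d2] d3] [[d4 d5] _]] := hr' k hk.
have he : forall k, [/\ `|e (X N (k + 1)) - e (X N k)| <= C / N%:R, `|P N k| <= C,
  `|P N (k + 1) - P N k| <= C / N%:R & `|P N k - Q (X N k) (P N k)| <= C / N%:R] by near: N.
have [e1 _ _ _] := he k; rewrite -/h in e1.
have hE : forall k, `|e (X N (k + 1)) - e (X N k) - N%:R^-1 *: dgrad (K (k%:~R / N%:R) (X N k)) (P N k)| <= N%:R^-1 ^+ 2 by near: N.
have e2 := hE k; rewrite -/h in e2.
have [_ s1 s2] := h1 _ _ d2 d5; rewrite !coordK// in s1 s2.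
set dq := coord c (X N (k + 1)) - coord c (X N k) in s1 s2 *.
have s3 : `|dq| <= C1 * C * h by apply: le_trans s1 _; rewrite -mulrA ler_wpM2l.
split; first by apply: le_trans s3 _; rewrite ler_wpM2r// lerDl.
have E : dq - h *: Vf (sample N k) = \sum_j (dE F c (X N k) dq - h *: dgrad (K (k%:~R / N%:R) (X N k)) (P N k)) 0 j *: fld F c (X N k) j.
  rewrite /Vf -{1}(fld_dual F dq d1) scaler_sumr -sumrB; apply: eq_bigr => j _.
  by rewrite scalerA -scalerBl; congr (_ *: _); rewrite !mxE.
rewrite E; apply: le_trans (ler_norm_sum _ _ _) _.
apply: (@le_trans _ _ (\sum_(j < D) ((C1 * (C1 * C) ^+ 2 + 1) * h ^+ 2 * W))).
  apply: ler_sum => j _; rewrite normrZ; apply: ler_pM => //.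
  apply: le_trans (coord_le_norm _ _ _) _.
  have -> : dE F c (X N k) dq - h *: dgrad (K (k%:~R / N%:R) (X N k)) (P N k) =
    (e (X N (k + 1)) - e (X N k) - h *: dgrad (K (k%:~R / N%:R) (X N k)) (P N k)) - (e (X N (k + 1)) - e (X N k) - dE F c (X N k) dq).
    by move: (e _ - e _) (h *: _) (dE _ _ _ _) => a b d; rewrite opprB [RHS]addrC addrA subrK.
  apply: le_trans (ler_normB _ _) _; rewrite addrC mulrDl mul1r; apply: lerD => //.
  apply: le_trans s2 _; rewrite -mulrA ler_wpM2l// -exprMn ler_sqr ?nnegrE//.
  by rewrite mulr_ge0.
rewrite sumr_const card_ord -[leLHS]mulr_natl; apply: (@le_trans _ _ (B2 * h ^+ 2)).
  by rewrite le_eqVlt; apply/orP; left; apply/eqP; rewrite /B2; ring.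
by apply: ler_wpM2r; [exact: sqr_ge0|rewrite lerDr].
Unshelve. all: by end_near. Qed.

Lemma stay_in_chart : exists2 r0 : R, 0 < r0 & forall t, `|t - t0| < r0 -> cdom c (x t).
Proof.
have [cx _] := limit_cts cM uU hU C0 hest hx hp.
have : \forall t \near t0, cdom c (x t) by apply: (cx t0); exact: (near_in_open (cdom_open c)).
move=> /nbhs_ballP[r0 /= r00 hr]; exists r0 => // t ht; apply: hr.
by rewrite /ball /= distrC.
Qed.

Lemma q_derive i : is_derive t0 (1 : R) (fun t => coord c (x t) 0 i) (Vf z0 0 i).
Proof.
have [r0 r00 hr0] := stay_in_chart.
have [B [rho [B0 rho0 hB]]] := q_step.
rewrite -[Vf z0 0 i]add0r.
apply: (@sample_derive t0 (fun N k => coord c (X N k) 0 i) _ (fun=> 0) (fun z => Vf z 0 i) r0 r00).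
- move=> t ht; have h := cvg_comp _ _ (@hx t) (coord_cts (hr0 t ht)).
  exact: (cvg_comp _ _ h (@coord_cvg _ _ _ i)).
- by move=> ?; exact: cvg_cst.
- exact: Vf_cts.
exists B, rho; split=> //; apply: filterS hB => N hB k hk.
have [_ hh] := hB k hk; apply: le_trans hh; apply: le_trans (coord_le_norm _ 0 i).
by rewrite add0r !mxE mulrC.
Qed.

Definition dbase (i : 'I_n) (j : 'I_D) (q : 'rV[R]_n) : R := 'D_(delta_mx 0 i) (ecoord j \o param c) q.

Lemma dbase_C2 i j : Ck 2 (cimg c) (dbase i j).
Proof. exact: (emb_C3 F j c).2. Qed.

Lemma dbase_D_cts i j l y : cdom c y -> {for coord c y, continuous ('D_(delta_mx 0 l : 'rV[R]_n) (dbase i j))}.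
Proof.
move=> cy; have h : Ck 1 (cimg c) ('D_(delta_mx 0 l : 'rV[R]_n) (dbase i j)) := (dbase_C2 i j).2 _.
exact: (Ck_cont h (cimg_coord cy)).
Qed.

Lemma dE_dbase y i j : dE F c y (delta_mx 0 i) 0 j = dbase i j (coord c y).
Proof. by rewrite mxE. Qed.

Lemma dE_cts i : {for z0, continuous (fun z => dE F c z.2.1 (delta_mx 0 i))}.
Proof.
apply: (@cvg_rV _ _ _ (nbhs z0) (nbhs_filter z0)) => j.
rewrite dE_dbase (_ : (fun z => dE F c z.2.1 (delta_mx 0 i) 0 j) = fun z => dbase i j (coord c z.2.1)); last first.
  by apply/funext => z; rewrite dE_dbase.
exact: (chart_cts (Ck_cont (dbase_C2 i j) (cimg_coord ct0))).
Qed.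

(** With [Psi2], the two terms of the product rule for y_i = p.(d_i e): [Psi1] comes from the motion
    of p, [Psi2] from that of the vector d_i e along [Vf]. *)
Definition Psi1 i (z : R * (M * 'rV[R]_D)) : R :=
  - pairing (grad F (fun y => K z.1 y z.2.2) z.2.1) (dE F c z.2.1 (delta_mx 0 i)).
Definition Psi2 i (z : R * (M * 'rV[R]_D)) : R :=
  \sum_j z.2.2 0 j * \sum_l Vf z 0 l * 'D_(delta_mx 0 l) (dbase i j) (coord c z.2.1).

Lemma Psi1_cts i : {for z0, continuous (Psi1 i)}.
Proof. by apply: cvgN; apply: cvg_pairing; [exact: gradK_cts|exact: dE_cts]. Qed.

Lemma Psi2_cts i : {for z0, continuous (Psi2 i)}.
Proof.
apply: cvg_big => [|j _]; first exact: add_continuous.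
apply: cvgM.
  have h : z.2.2 @[z --> z0] --> p t0 by apply: (cvg_comp snd snd); [exact: cvg_snd|exact: cvg_snd].
  exact: (cvg_comp _ _ h (@coord_cvg _ _ _ j)).
apply: cvg_big => [|l _]; first exact: add_continuous.
apply: cvgM; first exact: Vf_cts.
exact: (chart_cts (g := 'D_(delta_mx 0 l) (dbase i j)) (@dbase_D_cts i j l _ ct0)).
Qed.

Lemma y_step i : exists B rho, [/\ 0 <= B, 0 < rho & \forall N \near U, forall k : int, `|k%:~R / N%:R - t0| < rho ->
  `|pairing (P N (k + 1)) (dE F c (X N (k + 1)) (delta_mx 0 i)) - pairing (P N k) (dE F c (X N k) (delta_mx 0 i)) -
    (Psi1 i (sample N (k + 1)) + Psi2 i (sample N k)) / N%:R| <= B * N%:R^-1 ^+ 2].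
Proof.
have [Bq [rq [Bq0 rq0 hq]]] := q_step.
have h1 j := C2_local (findim_rV n) (@cimg_open _ _ M c) (dbase_C2 i j) (cimg_coord ct0).
have [rr hrr] := choice h1; have [CC hCC] := choice hrr.
have h2 (jl : 'I_D * 'I_n) := cont_bnd (@dbase_D_cts i jl.1 jl.2 _ ct0).
have [r1 r10 hr1] : exists2 r : R, 0 < r & forall q, `|q - q0| < r -> forall j, `|q - q0| < rr j.
  by apply: near_fam => j; exists (rr j) => //; case: (hCC j).
have [r2 r20 hr2] : exists2 r : R, 0 < r & forall q, `|q - q0| < r -> forall j,
    forall l, `|'D_(delta_mx 0 l) (dbase i j) q| <= `|'D_(delta_mx 0 l) (dbase i j) q0| + 1.
  by apply: near_fam => j; apply: near_fam => l; exact: (h2 (j, l)).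
have hw : \forall z \near z0, `|dE F c z.2.1 (delta_mx 0 i)| <= `|dE F c (x t0) (delta_mx 0 i)| + 1.
  have /cvgrPdist_lt/(_ _ ltr01) := @dE_cts i; apply: filterS => z hz.
  have -> : dE F c z.2.1 (delta_mx 0 i) = dE F c (x t0) (delta_mx 0 i) - (dE F c (x t0) (delta_mx 0 i) - dE F c z.2.1 (delta_mx 0 i)).
    by rewrite opprB addrC subrK.
  by apply: le_trans (ler_normB _ _) _; rewrite lerD2l ltW.
have r120 : 0 < Num.min r1 r2 by rewrite lt_min r10.
have [rho rho0 hr] := sample_pair cM uU hU C0 hest hx hp (filterI (cdom_near r120) hw).
pose W := `|dE F c (x t0) (delta_mx 0 i)| + 1.
pose B2 j := \sum_l (`|'D_(delta_mx 0 l) (dbase i j) q0| + 1).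
have B20 j : 0 <= B2 j by apply: sumr_ge0 => l _; rewrite addr_ge0.
have CC0 j : 0 <= CC j by case: (hCC j).
pose B3 := \sum_j (C * (CC j * Bq ^+ 2 + Bq * B2 j)).
have B30 : 0 <= B3.
  by apply: sumr_ge0 => j _; rewrite mulr_ge0 ?(ltW C0)// addr_ge0// mulr_ge0// sqr_ge0.
have W0 : 0 <= W by rewrite addr_ge0.
exists (D%:R * W + B3), (Num.min rq rho); split; first by rewrite addr_ge0// mulr_ge0.
  by rewrite lt_min rq0.
near=> N => k; rewrite lt_min => /andP[k1 k2].
have hr' : forall k : int, `|k%:~R / N%:R - t0| < rho ->
   ((cdom c (X N k) /\ `|coord c (X N k) - q0| < Num.min r1 r2) /\ `|dE F c (X N k) (delta_mx 0 i)| <= W) /\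
   ((cdom c (X N (k + 1)) /\ `|coord c (X N (k + 1)) - q0| < Num.min r1 r2) /\ `|dE F c (X N (k + 1)) (delta_mx 0 i)| <= W) by near: N.
have [[[d1 d2] _] [[d4 d5] d6]] := hr' k k2.
move: d2 d5; rewrite !lt_min => /andP[d2 d2'] /andP[d5 _].
have he : forall k, [/\ `|e (X N (k + 1)) - e (X N k)| <= C / N%:R, `|P N k| <= C,
  `|P N (k + 1) - P N k| <= C / N%:R & `|P N k - Q (X N k) (P N k)| <= C / N%:R] by near: N.
have [_ pC _ _] := he k.
have hE : forall k, `|Q (X N k) (P N (k - 1) - P N k - N%:R^-1 *: grad F (fun x => K (k%:~R / N%:R) x (P N k)) (X N k))| <= N%:R^-1 ^+ 2 by near: N.
have e2 := hE (k + 1); rewrite addrK in e2.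
have hqq : forall k : int, `|k%:~R / N%:R - t0| < rq ->
  `|coord c (X N (k + 1)) - coord c (X N k)| <= Bq * N%:R^-1 /\
  `|coord c (X N (k + 1)) - coord c (X N k) - N%:R^-1 *: Vf (sample N k)| <= Bq * N%:R^-1 ^+ 2 by near: N.
have [q1 q2] := hqq k k1.
set h := N%:R^-1 in e2 q1 q2 *.
have h0 : 0 <= h by rewrite invr_ge0.
set w' := dE F c (X N (k + 1)) (delta_mx 0 i) in d6 *; set w := dE F c (X N k) (delta_mx 0 i).
set G := grad F _ _ in e2.
(* The vector [w'] is tangent at the new point, so by [Q_dE] only the tangential part of the
   increment of p matters, which is the part that the discrete equation controls. *)
have I1 : `|pairing (P N (k + 1) - P N k) w' - h * Psi1 i (sample N (k + 1))| <= D%:R * W * h ^+ 2.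
  have -> : pairing (P N (k + 1) - P N k) w' - h * Psi1 i (sample N (k + 1)) = - pairing (Q (X N (k + 1)) (P N k - P N (k + 1) - h *: G)) w'.
    by rewrite /w' Q_dE// /Psi1 /sample /= -/G -/w' !pairingBl pairingZl; ring.
  rewrite normrN; apply: le_trans (pairing_bnd _ _) _; rewrite -mulrA ler_wpM2l// [W * _]mulrC.
  exact: ler_pM.
have I2 : `|pairing (P N k) (w' - w) - h * Psi2 i (sample N k)| <= B3 * h ^+ 2.
  rewrite /pairing /Psi2 mulr_sumr -sumrB /B3 mulr_suml; apply: le_trans (ler_norm_sum _ _ _) _.
  apply: ler_sum => j _; rewrite mulrCA -mulrBr normrM -mulrA.
  apply: ler_pM => //; first exact: le_trans (coord_le_norm _ _ _) pC.
  rewrite mxE [(- w) 0 j]mxE /w' /w !dE_dbase.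
  set q := coord c (X N k) in q1 q2 d2 d2' *; set q' := coord c (X N (k + 1)) in q1 q2 d5 *.
  have [_ _ t1] := hCC j; have {}t1 := t1 q q' (hr1 _ d2 j) (hr1 _ d5 j).
  have dq : differentiable (dbase i j) q by apply: (dbase_C2 i j).1; exact: cimg_coord.
  rewrite derive_rV// in t1.
  have -> : dbase i j q' - dbase i j q - h * \sum_l Vf (sample N k) 0 l * 'D_(delta_mx 0 l) (dbase i j) q =
    (dbase i j q' - dbase i j q - \sum_l (q' - q) 0 l * 'D_(delta_mx 0 l) (dbase i j) q) +
    \sum_l (q' - q - h *: Vf (sample N k)) 0 l * 'D_(delta_mx 0 l) (dbase i j) q.
    have -> : \sum_l (q' - q - h *: Vf (sample N k)) 0 l * 'D_(delta_mx 0 l) (dbase i j) q =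
      \sum_l (q' - q) 0 l * 'D_(delta_mx 0 l) (dbase i j) q - h * \sum_l Vf (sample N k) 0 l * 'D_(delta_mx 0 l) (dbase i j) q.
      rewrite mulr_sumr -sumrB; apply: eq_bigr => l _.
      have EE (a b : 'rV[R]_n) (s : R) : (a - s *: b) 0 l = a 0 l - s * b 0 l by rewrite !mxE.
      by rewrite EE; ring.
    by ring.
  apply: le_trans (ler_normD _ _) _; rewrite mulrDl; apply: lerD.
    apply: le_trans t1 _; rewrite -mulrA ler_wpM2l// -exprMn ler_sqr ?nnegrE// mulr_ge0//.
  apply: le_trans (ler_norm_sum _ _ _) _; rewrite mulrAC /B2 mulr_sumr; apply: ler_sum => l _.
  rewrite normrM; apply: ler_pM => //; first exact: le_trans (coord_le_norm _ _ _) q2.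
  exact: hr2.
have -> : pairing (P N (k + 1)) w' - pairing (P N k) w - (Psi1 i (sample N (k + 1)) + Psi2 i (sample N k)) * h =
  (pairing (P N (k + 1) - P N k) w' - h * Psi1 i (sample N (k + 1))) + (pairing (P N k) (w' - w) - h * Psi2 i (sample N k)).
  by rewrite pairingBl pairingBr; ring.
by apply: le_trans (ler_normD _ _) _; rewrite mulrDl lerD.
Unshelve. all: by end_near. Qed.

Lemma y_derive i : is_derive t0 (1 : R) (fun t => pairing (p t) (dE F c (x t) (delta_mx 0 i))) (Psi1 i z0 + Psi2 i z0).
Proof.
have [r0 r00 hr0] := stay_in_chart.
apply: (@sample_derive t0 (fun N k => pairing (P N k) (dE F c (X N k) (delta_mx 0 i))) _ (Psi1 i) (Psi2 i) r0 r00).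
- move=> t ht; apply: cvg_pairing; first exact: (@hp t).
  apply: cvg_rV => j; rewrite dE_dbase (_ : (fun N => _) = fun N => dbase i j (coord c (X N (Num.floor (N%:R * t))))); last first.
    by apply/funext => N; rewrite dE_dbase.
  have h := cvg_comp _ _ (@hx t) (coord_cts (hr0 t ht)).
  exact: (cvg_comp _ _ h (Ck_cont (dbase_C2 i j) (cimg_coord (hr0 t ht)))).
- exact: Psi1_cts.
- exact: Psi2_cts.
- exact: y_step.
Qed.

End ChartODE.

(** * The cotangent bundle and the modified Hamiltonian *)

Section Covectors.
Context {R : realType} {n : nat} {M : smoothManifold R n} (F : frame M).
Notation D := (fdim F).
Notation e := (emb F).
Local Notation V := ('rV[R]_n * 'rV[R]_n)%type.

Lemma pairing_sumr d (I : Type) (r : seq I) (u : 'rV[R]_d) (f : I -> 'rV[R]_d) :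
  pairing u (\sum_(i <- r) f i) = \sum_(i <- r) pairing u (f i).
Proof.
apply: (big_ind2 (fun (a : 'rV[R]_d) b => pairing u a = b)) => //; first exact: pairing0r.
by move=> a b a' b' ha hb; rewrite pairingDr ha hb.
Qed.

Lemma pairing_ext d (u v : 'rV[R]_d) : (forall w, pairing u w = pairing v w) -> u = v.
Proof. by move=> h; apply/rowP => i; rewrite -!pairing_delta. Qed.

Lemma dE_coords c x v : cdom c x -> dE F c x v = \sum_i v 0 i *: dE F c x (delta_mx 0 i).
Proof.
move=> cx; apply/rowP => j; rewrite summxE mxE derive_rV; last exact: ecoord_diff.
by apply: eq_bigr => i _; rewrite !mxE.
Qed.

Lemma dE_trans c c' x v : cdom c x -> cdom c' x ->
  dE F c x v = dE F c' x ('D_v (trans c c') (coord c x)).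
Proof.
by move=> cx c'x; apply/rowP => j; rewrite !mxE; apply: derive_trans => //; exact: ecoord_diff.
Qed.

Definition pull c x (p : 'rV[R]_D) : 'rV[R]_n := \row_i pairing p (dE F c x (delta_mx 0 i)).

Lemma pull_pairing c x p v : cdom c x -> pairing (pull c x p) v = pairing p (dE F c x v).
Proof.
move=> cx; rewrite (dE_coords v cx) pairing_sumr; apply: eq_bigr => i _.
by rewrite mxE pairingZr mulrC.
Qed.

Definition covec_comp x p c : 'rV[R]_n := if pselect (cdom c x) then pull c x p else 0.

Lemma covec_compE x p c : cdom c x -> covec_comp x p c = pull c x p.
Proof. by rewrite /covec_comp; case: pselect. Qed.

Lemma covec_transition x p (c c' : chart M) : cdom c x -> cdom c' x -> forall v : 'rV[R]_n,
  pairing (covec_comp x p c) v = pairing (covec_comp x p c') ('D_v (coord c' \o param c) (coord c x)).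
Proof.
move=> cx c'x v; rewrite !covec_compE// !pull_pairing//; congr pairing.
exact: dE_trans.
Qed.

Lemma covec_outside x p (c : chart M) : ~ cdom c x -> covec_comp x p c = 0.
Proof. by rewrite /covec_comp; case: pselect. Qed.

(** The covector v |-> p.de(v); the vectors p with the same image under [Q x] give the same one. *)
Definition covec x p : cotangent M := Cotangent (@covec_transition x p) (@covec_outside x p).

(** The values of the covector on the fields w_j. This is a section of [covec] with values in the
    range of [Q]. *)
Definition frame_comp (z : cotangent M) : 'rV[R]_D :=
  \row_j pairing (comp z (chart_at (base z))) (fld F (chart_at (base z)) (base z) j).

Lemma frame_compE z c j : cdom c (base z) -> frame_comp z 0 j = pairing (comp z c) (fld F c (base z) j).
Proof.
move=> cz; rewrite mxE (fld_trans F j cz (chart_atP (base z))).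
by rewrite -(comp_transition cz (chart_atP (base z))).
Qed.

Lemma frame_comp_covec x p : frame_comp (covec x p) = Q x p.
Proof.
apply/rowP => j; have cx := chart_atP x.
by rewrite (@frame_compE (covec x p) _ _ cx) (Q_coord p j cx) /= covec_compE// pull_pairing.
Qed.

Lemma covec_frame_comp z : covec (base z) (frame_comp z) = z.
Proof.
have cz := chart_atP (base z).
apply: (@cocoord_inj _ _ _ (chart_at (base z))) => //; rewrite /cocoord /=; congr pair.
rewrite covec_compE//; apply: pairing_ext => v; rewrite pull_pairing//.
rewrite -{2}(fld_dual F v cz) pairing_sumr; apply: eq_bigr => j _.
by rewrite (@frame_compE z _ _ cz) pairingZr mxE mulrC.
Qed.

Lemma covec_Q x p : covec x (Q x p) = covec x p.
Proof. by rewrite -frame_comp_covec; exact: (covec_frame_comp (covec x p)). Qed.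

Lemma covec0 x : covec x 0 = zero_section x.
Proof.
have cx := chart_atP x.
apply: (@cocoord_inj _ _ _ (chart_at x)) => //; rewrite /cocoord /=; congr pair.
by rewrite covec_compE//; apply: pairing_ext => v; rewrite pull_pairing// !pairing0l.
Qed.

Lemma coparamP (c : chart M) (w : V) : cimg c w.1 -> cdom c (base (coparam c w)) /\ cocoord c (coparam c w) = w.
Proof.
move=> cw; have : (cocoord c @` [set z | cdom c (base z)]) w by rewrite cocoord_onto; split.
move=> [z cz zw]; rewrite /coparam.
have := @xgetPex _ (zero_section (param c w.1)) [set z | cdom c (base z) /\ cocoord c z = w].
by apply; exists z.
Qed.

Lemma base_coparam (c : chart M) (w : V) : cimg c w.1 -> base (coparam c w) = param c w.1.
Proof. by move=> cw; have [h1 h2] := coparamP cw; rewrite -[in RHS]h2 /= coordK. Qed.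

Lemma coparamK (c : chart M) z : cdom c (base z) -> coparam c (cocoord c z) = z.
Proof.
move=> cz; have [h1 h2] := coparamP (w := cocoord c z) (cimg_coord cz).
exact: (cocoord_inj h1 cz h2).
Qed.

Lemma covec_coparam c x p : cdom c x -> covec x p = coparam c (coord c x, pull c x p).
Proof.
by move=> cx; rewrite -[LHS](@coparamK c)// /cocoord /= covec_compE.
Qed.

Definition frame_loc c (w : V) : 'rV[R]_D := \row_j pairing w.2 (fld F c (param c w.1) j).

Lemma frame_comp_coparam c w : cimg c w.1 -> frame_comp (coparam c w) = frame_loc c w.
Proof.
move=> cw; apply/rowP => j; have [h1 h2] := coparamP cw.
by rewrite (frame_compE j h1) mxE base_coparam//; congr pairing; rewrite -[in RHS]h2.
Qed.

Lemma frame_loc_C2 c j : Ck 2 [set w : V | cimg c w.1] (fun w => frame_loc c w 0 j).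
Proof.
have o : open [set w : V | cimg c w.1].
  by apply: (@open_comp _ _ fst (cimg c)); [move=> w _; exact: cvg_fst|exact: cimg_open].
apply: (Ck_eq o (f := fun w : V => \sum_i w.2 0 i * fld F c (param c w.1) j 0 i)).
  by move=> w _; rewrite mxE.
apply: Ck_sum => // i; apply: CkM => //.
  exact: (@vCk_snd R 'rV[R]_n 'rV[R]_n 2 [set w : V | cimg c w.1] _ (clinear_coord i)).
exact: (Ck_comp (findim_rV n) o (@cimg_open _ _ M c) (fun _ h => h) (@vCk_fst R 'rV[R]_n 'rV[R]_n 2 _) (fld_C2 F c j i)).
Qed.

Lemma cvg_cot (T : Type) (G : set_system T) (FG : Filter G) (f : T -> cotangent M) z c : cdom c (base z) ->
  (\forall t \near G, cdom c (base (f t))) -> cocoord c (f t) @[t --> G] --> cocoord c z -> f @ G --> z.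
Proof.
move=> cz hn hc A; rewrite nbhsE => -[B [oB Bz] BA].
have oB' : open (cocoord c @` (B `&` [set z | cdom c (base z)])) by exact: (oB : cotangent_open B).
have h : \forall t \near G, (cocoord c @` (B `&` [set z | cdom c (base z)])) (cocoord c (f t)).
  by apply: hc; apply: open_nbhs_nbhs; split=> //; exists z.
apply: filterS2 hn h => t ct [z' [Bz' cz'] zt]; apply: BA.
by rewrite -(cocoord_inj cz' ct zt).
Qed.

Lemma cot_fun_cts (T : topologicalType) (f : cotangent M -> T) :
  (forall c w, cimg c w.1 -> {for w, continuous (f \o coparam c)}) -> continuous f.
Proof.
move=> h; apply/continuousP => A oA.
suff : cotangent_open (f @^-1` A) by [].
move=> c; have -> : cocoord c @` (f @^-1` A `&` [set z | cdom c (base z)]) =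
    [set w : V | cimg c w.1 /\ A (f (coparam c w))].
  apply/seteqP; split=> [_ [z [/= Az cz] <-]|w [cw Aw]] /=.
    by split; [exact: cimg_coord|rewrite coparamK].
  by have [h1 h2] := coparamP cw; exists (coparam c w).
rewrite openE => w [cw Aw]; rewrite /interior.
have o : open [set w : V | cimg c w.1].
  by apply: (@open_comp _ _ fst (cimg c)); [move=> w' _; exact: cvg_fst|exact: cimg_open].
have h1 : \forall w' \near w, cimg c w'.1 by exact: (near_in_open o).
have h2 : \forall w' \near w, A (f (coparam c w')) by apply: (h c w cw); apply: open_nbhs_nbhs.
exact: filterS2 h1 h2.
Qed.

Lemma frame_comp_cts : continuous frame_comp.
Proof.
apply: cot_fun_cts => c w cw.
have o : open [set w : V | cimg c w.1].
  by apply: (@open_comp _ _ fst (cimg c)); [move=> w' _; exact: cvg_fst|exact: cimg_open].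
rewrite /prop_for /continuous_at /= frame_comp_coparam//.
have h : frame_loc c w' @[w' --> w] --> frame_loc c w.
  by apply: cvg_rV => j; exact: (Ck_cont (frame_loc_C2 c j) cw).
apply: cvg_trans h; apply: near_eq_cvg; apply: (near_in_open o) => // w' cw'.
by rewrite /= frame_comp_coparam.
Qed.

Lemma pull_C2 c i j : Ck 2 (cimg c) (fun q => dE F c (param c q) (delta_mx 0 i) 0 j).
Proof.
have h : Ck 2 (cimg c) ('D_(delta_mx 0 i : 'rV[R]_n) (ecoord (F := F) j \o param c)) := (emb_C3 F j c).2 _.
by apply: (Ck_eq (@cimg_open _ _ M c) _ h) => q cq; rewrite mxE paramK.
Qed.

Lemma covec_cvg (T : Type) (G : set_system T) (FG : Filter G) (X : T -> M) (P : T -> 'rV[R]_D) x p :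
  X @ G --> x -> P @ G --> p -> covec (X t) (P t) @[t --> G] --> covec x p.
Proof.
move=> hX hP; pose c := chart_at x; have cx : cdom c x := chart_atP x.
have n0 : \forall t \near G, cdom c (X t) by apply: hX; exact: (near_in_open (cdom_open c)).
apply: (@cvg_cot _ _ _ _ (covec x p) c cx n0).
have h1 : coord c (X t) @[t --> G] --> coord c x := cvg_comp _ _ hX (coord_cts cx).
suff h2 : covec_comp (X t) (P t) c @[t --> G] --> covec_comp x p c by exact: cvg_pair h1 h2.
rewrite covec_compE//.
have h : pull c (X t) (P t) @[t --> G] --> pull c x p.
  apply: cvg_rV => i; rewrite mxE (_ : (fun t => _) = fun t => pairing (P t) (dE F c (X t) (delta_mx 0 i))); last first.
    by apply/funext => t; rewrite mxE.
  apply: cvg_pairing => //; apply: cvg_rV => j.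
  have h := cvg_comp _ _ h1 (Ck_cont (pull_C2 c i j) (cimg_coord cx)).
  rewrite /= coordK// in h; apply: cvg_trans h; apply: near_eq_cvg; apply: filterS n0 => t ct.
  by rewrite /= coordK.
by apply: cvg_trans h; apply: near_eq_cvg; apply: filterS n0 => t ct; rewrite covec_compE.
Qed.

Lemma zero_section_cts : continuous (@zero_section R n M).
Proof.
have -> : @zero_section R n M = fun y => covec y 0 by apply/funext => y; rewrite covec0.
by move=> x; apply: covec_cvg; [exact: cvg_id|exact: cvg_cst].
Qed.

End Covectors.

(** The function x^3 / (x + 2)^2 is the profile of [gcut], with x the excess of the length over
    2. *)
Lemma psi_mono (R : realType) (x y : R) : 0 <= y -> y <= x -> y ^+ 3 / (y + 2) ^+ 2 <= x ^+ 3 / (x + 2) ^+ 2.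
Proof.
move=> y0 yx; have x2 : 0 < x + 2 by lra. have y2 : 0 < y + 2 by lra.
rewrite ler_pdivrMr ?exprn_gt0// mulrAC ler_pdivlMr ?exprn_gt0//.
have h1 : y * (x + 2) <= x * (y + 2) by lra.
have h2 : (y * (x + 2)) ^+ 2 <= (x * (y + 2)) ^+ 2 by rewrite ler_sqr ?nnegrE//; apply: mulr_ge0; lra.
have -> : y ^+ 3 * (x + 2) ^+ 2 = y * (y * (x + 2)) ^+ 2 by ring.
have -> : x ^+ 3 * (y + 2) ^+ 2 = x * (x * (y + 2)) ^+ 2 by ring.
by apply: ler_pM => //; exact: sqr_ge0.
Qed.

(** The difference between x and the profile is 4 x (x + 1) / (x + 2)^2, which is nondecreasing. *)
Lemma psi_lip_le (R : realType) (x y : R) : 0 <= y -> y <= x ->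
  x ^+ 3 / (x + 2) ^+ 2 - y ^+ 3 / (y + 2) ^+ 2 <= x - y.
Proof.
move=> y0 yx; have x2 : 0 < x + 2 by lra. have y2 : 0 < y + 2 by lra.
suff : y * (y + 1) / (y + 2) ^+ 2 <= x * (x + 1) / (x + 2) ^+ 2.
  have -> : x ^+ 3 / (x + 2) ^+ 2 = x - 4 * (x * (x + 1) / (x + 2) ^+ 2) by field; lra.
  have -> : y ^+ 3 / (y + 2) ^+ 2 = y - 4 * (y * (y + 1) / (y + 2) ^+ 2) by field; lra.
  by move: (_ / _) (_ / _) => a b; lra.
rewrite ler_pdivrMr ?exprn_gt0// mulrAC ler_pdivlMr ?exprn_gt0// -subr_ge0.
have -> : x * (x + 1) * (y + 2) ^+ 2 - y * (y + 1) * (x + 2) ^+ 2 = (x - y) * (3 * (x * y) + 4 * (x + y) + 4) by ring.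
apply: mulr_ge0; first by lra.
by have := mulr_ge0 (le_trans y0 yx) y0; lra.
Qed.

Lemma psi_ge (R : realType) (x : R) : 0 <= x -> x - 4 <= x ^+ 3 / (x + 2) ^+ 2.
Proof.
move=> x0; have x2 : 0 < x + 2 by lra.
rewrite ler_pdivlMr ?exprn_gt0// -subr_ge0.
have -> : x ^+ 3 - (x - 4) * (x + 2) ^+ 2 = 12 * x + 16 by ring.
by lra.
Qed.

(** Here T is the length and p its excess over 2; the first factor is the derivative of the profile,
    the second one the radial derivative of the length. The expression is 6 p^2 / T^2 minus a
    nonnegative term. *)
Lemma psi_legendre (R : realType) (p T : R) : 0 <= p -> 1 <= T -> (p = 0 \/ T = p + 2) ->
  (3 * p ^+ 2 / T ^+ 2 - 2 * p ^+ 3 / T ^+ 3) * ((T ^+ 2 - 1) / T) - p ^+ 3 / T ^+ 2 <= 6.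
Proof.
move=> p0 T1 [->|Tp]; first by rewrite !expr0n /= !mulr0 !mul0r !subr0 mul0r.
have T0 : 0 < T by lra.
have p2 : p = T - 2 by lra.
have -> : (3 * p ^+ 2 / T ^+ 2 - 2 * p ^+ 3 / T ^+ 3) * ((T ^+ 2 - 1) / T) - p ^+ 3 / T ^+ 2 =
  6 * (p ^+ 2 / T ^+ 2) - p ^+ 2 * (T + 4) / T ^+ 4.
  by rewrite p2; field; lra.
have h1 : p ^+ 2 / T ^+ 2 <= 1.
  by rewrite ler_pdivrMr ?exprn_gt0// mul1r ler_sqr ?nnegrE; lra.
have h2 : 0 <= p ^+ 2 * (T + 4) / T ^+ 4.
  by rewrite divr_ge0 ?exprn_ge0 ?mulr_ge0 ?exprn_ge0//; lra.
by move: h1 h2; move: (_ / _) (_ / _) => a b; lra.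
Qed.

Lemma posp_lip (R : realType) (a b : R) : `|posp a - posp b| <= `|a - b|.
Proof.
have h1 := ler_norm (a - b); have h2 := ler_norm (- (a - b)); rewrite normrN in h2.
move: (`|a - b|) h1 h2 => c h1 h2.
by rewrite ler_norml /posp; case: (lerP 0 a) => ha; case: (lerP 0 b) => hb; lra.
Qed.

Lemma posp_eq0 (R : realType) (a : R) : a <= 0 -> posp a = 0.
Proof. by move=> ha; rewrite /posp; apply/max_idPl. Qed.

Lemma posp_id (R : realType) (a : R) : 0 <= a -> posp a = a.
Proof. by move=> ha; rewrite /posp; apply/max_idPr. Qed.

Lemma is_derive_sq (R : realType) (f : R -> R) (s df : R) :
  is_derive s 1 f df -> is_derive s 1 (fun t => f t ^+ 2) (2 * f s * df).
Proof.
move=> h; have := is_deriveM h h; rewrite (_ : f * f = fun t => f t ^+ 2); last first.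
  by apply/funext => t; rewrite expr2.
by move=> h'; apply: (is_derive_eq h'); rewrite /GRing.scale /=; ring.
Qed.

(** * Length of momenta and the function that replaces the kinetic energy *)

Section Kinetic.
Context {R : realType} {D : nat}.
Implicit Types v w : 'rV[R]_D.

(** A smooth substitute for the Euclidean norm, critical at 0. It has linear growth, and its
    Legendre term stays bounded ([len_legendre]). *)
Definition len v : R := Num.sqrt (1 + pairing v v).

Let pos v : 0 < 1 + pairing v v.
Proof. by rewrite ltr_pwDl// pairing_ge0. Qed.

Lemma len_sq v : len v ^+ 2 = 1 + pairing v v.
Proof. by rewrite /len sqr_sqrtr// ltW. Qed.

Lemma len_ge0 v : 0 <= len v. Proof. exact: sqrtr_ge0. Qed.

Lemma len_ge1 v : 1 <= len v.
Proof. by rewrite -ler_sqr ?nnegrE ?len_ge0// len_sq expr1n lerDl pairing_ge0. Qed.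

Lemma len_gt0 v : 0 < len v. Proof. exact: lt_le_trans ltr01 (len_ge1 v). Qed.

Lemma len0 : len 0 = 1. Proof. by rewrite /len pairing0l addr0 sqrtr1. Qed.

Lemma norm_le_len v : `|v| <= len v.
Proof.
rewrite -ler_sqr ?nnegrE ?len_ge0// len_sq; apply: le_trans (norm_le_pairing v) _.
by rewrite lerDr.
Qed.

Lemma len_le v : len v <= 1 + D%:R * `|v|.
Proof.
have h0 : 0 <= 1 + D%:R * `|v| by rewrite addr_ge0// mulr_ge0.
rewrite -ler_sqr ?nnegrE ?len_ge0// len_sq; apply: le_trans (_ : 1 + (D%:R * `|v|) ^+ 2 <= _); last first.
  have h : 0 <= D%:R * `|v| by rewrite mulr_ge0.
  by move: h; move: (D%:R * _) => a h; rewrite sqrrD expr1n mul1r -addrA lerD2l lerDr mulrn_wge0.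
rewrite lerD2l; apply: le_trans (pairing_le_norm v) _; rewrite exprMn ler_wpM2r ?sqr_ge0//.
by rewrite -natrX ler_nat; case: (D) => // k; rewrite expnS expn1 leq_pmulr.
Qed.

Lemma len_Ck k : Ck k setT len.
Proof.
have o : open [set: 'rV[R]_D] by exact: openT.
apply: (Ck_sqrt o) => // ; apply: CkD => //; first exact: (Ck_cst k setT (1 : R)).
by apply: Ck_sum => // i; apply: CkM => //; apply: Ck_lin; exact: clinear_coord.
Qed.

Lemma len_lip v w : `|len v - len w| <= D%:R * `|v - w|.
Proof.
have s0 : 0 < len v + len w by rewrite addr_gt0// len_gt0.
have -> : len v - len w = pairing (v - w) (v + w) / (len v + len w).
  have -> : pairing (v - w) (v + w) = len v ^+ 2 - len w ^+ 2.
    by rewrite !len_sq pairingBl !pairingDr (pairingC w v); ring.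
  by rewrite subr_sqr mulfK// gt_eqF.
rewrite normrM normfV (gtr0_norm s0) ler_pdivrMr//; apply: le_trans (pairing_bnd _ _) _.
rewrite -mulrA ler_wpM2l// ler_wpM2l//; apply: le_trans (ler_normD _ _) _.
by apply: lerD; exact: norm_le_len.
Qed.

Lemma len_diff v : differentiable len v. Proof. exact: (len_Ck 1).1. Qed.

Lemma derive_len v : 'D_v len v = (len v ^+ 2 - 1) / len v.
Proof.
have h0 : is_derive (0 : R) 1 (fun t : R => len (v + t *: v)) ('D_v len v).
  by have := is_derive_line (f := len) (z := v) (v := v) (s := 0); rewrite scale0r addr0; apply; exact: len_diff.
have h1 : is_derive (0 : R) 1 (fun t : R => len (v + t *: v) ^+ 2) (2 * len v * 'D_v len v).
  by have := is_derive_sq h0; rewrite scale0r addr0.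
have h2 : is_derive (0 : R) 1 (fun t : R => len (v + t *: v) ^+ 2) (2 * pairing v v).
  rewrite (_ : (fun t : R => _) = fun t : R => 1 + (1 + t) ^+ 2 * pairing v v); last first.
    by apply/funext => t; rewrite len_sq !(pairingDl, pairingDr, pairingZl, pairingZr); ring.
  by apply: is_derive_eq; rewrite /GRing.scale /=; ring.
have E : 2 * len v * 'D_v len v = 2 * pairing v v by rewrite -(@derive_val _ _ _ _ _ _ _ h1) -(@derive_val _ _ _ _ _ _ _ h2).
have l0 := len_gt0 v; rewrite len_sq addrAC subrr add0r.
have l0' : len v != 0 by rewrite gt_eqF.
by apply: (@mulfI _ (2 * len v)); [rewrite mulf_neq0// pnatr_eq0|rewrite E; field].
Qed.

(* Any C^2 function of [len v] vanishing up to 2, of slope 1 at infinity and with v.dg(v) - g(v) bounded would do. *)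
Definition gcut v : R := posp (len v - 2) ^+ 3 / len v ^+ 2.

Lemma gcutE v : gcut v = posp (len v - 2) ^+ 3 / (posp (len v - 2) + 2) ^+ 2.
Proof.
rewrite /gcut; case: (leP (len v) 2) => h.
  by rewrite posp_eq0 ?expr0n/= ?mul0r// subr_le0.
by rewrite posp_id ?subr_ge0 ?ltW// subrK.
Qed.

Lemma gcut_eq0 v : len v <= 2 -> gcut v = 0.
Proof. by move=> h; rewrite /gcut posp_eq0 ?subr_le0// expr0n mul0r. Qed.

Lemma gcut_ge v : len v - 6 <= gcut v.
Proof.
rewrite gcutE; apply: le_trans (psi_ge (posp_ge0 _)).
by have : len v - 2 <= posp (len v - 2) by [rewrite /posp le_max lexx orbT]; move: (posp _) => a; lra.
Qed.

Lemma gcut_lip v w : `|gcut v - gcut w| <= D%:R * `|v - w|.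
Proof.
apply: le_trans (len_lip v w); rewrite !gcutE.
have -> : len v - len w = (len v - 2) - (len w - 2) by ring.
apply: le_trans (posp_lip _ _).
move: (posp_ge0 (len v - 2)) (posp_ge0 (len w - 2)).
move: (posp (len v - 2)) (posp (len w - 2)) => x y x0 y0.
case: (leP y x) => [|/ltW] h.
  by rewrite ger0_norm ?subr_ge0; [rewrite ger0_norm ?subr_ge0//; exact: psi_lip_le|exact: psi_mono].
rewrite distrC [leRHS]distrC.
by rewrite ger0_norm ?subr_ge0; [rewrite ger0_norm ?subr_ge0//; exact: psi_lip_le|exact: psi_mono].
Qed.

Lemma gcut_Ck : Ck 2 setT gcut.
Proof.
have o : open [set: 'rV[R]_D] by exact: openT.
apply: CkM => //.
  have h : Ck 2 [set: R] (fun x => posp x ^+ 3) := Ck_pospX 2 0.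
  have hl : Ck 2 setT (fun v => len v - 2) by apply: CkB => //; [exact: len_Ck|exact: (Ck_cst 2 setT (2 : R))].
  exact: (Ck_comp findim_R o openT (fun _ _ => I) (vCk_R o hl) h).
apply: CkV => //; last by apply: CkX => //; exact: len_Ck.
by move=> v _; rewrite expf_neq0// gt_eqF// len_gt0.
Qed.

Definition dgcut v : R := 3 * posp (len v - 2) ^+ 2 / len v ^+ 2 - 2 * posp (len v - 2) ^+ 3 / len v ^+ 3.

Lemma derive_gcut v w : 'D_w gcut v = dgcut v * 'D_w len v.
Proof.
have h0 : is_derive (0 : R) 1 (fun t : R => len (v + t *: w)) ('D_w len v).
  by have := is_derive_line (f := len) (z := v) (v := w) (s := 0); rewrite scale0r addr0; apply; exact: len_diff.
have hg : is_derive (0 : R) 1 (fun t : R => gcut (v + t *: w)) ('D_w gcut v).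
  have := is_derive_line (f := gcut) (z := v) (v := w) (s := 0); rewrite scale0r addr0; apply.
  exact: gcut_Ck.1.
have hp : is_derive (0 : R) 1 (fun t : R => posp (len (v + t *: w) - 2) ^+ 3) (3 * posp (len v - 2) ^+ 2 * 'D_w len v).
  have h1 : is_derive (0 : R) 1 (fun t : R => len (v + t *: w) - 2) ('D_w len v).
    by apply: is_derive_eq; rewrite subr0.
  have h2 := pospX_diff 1 (len (v + 0 *: w) - 2).
  have := @is_derive1_comp _ (fun x => posp x ^+ 3) (fun t : R => len (v + t *: w) - 2) 0 _ _ h2 h1.
  by rewrite scale0r addr0.
have hn : len (v + 0 *: w) ^+ 2 != 0 by rewrite expf_neq0// gt_eqF// len_gt0.
have h2 : is_derive (0 : R) 1 (fun t : R => gcut (v + t *: w)) (dgcut v * 'D_w len v).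
  have hi : is_derive (0 : R) 1 (fun t : R => len (v + t *: w) ^- 2) (- 2 * len v ^- 3 * 'D_w len v).
    have hs : is_derive (0 : R) 1 (fun t : R => len (v + t *: w) ^+ 2) (2 * len v * 'D_w len v).
      by have := is_derive_sq h0; rewrite scale0r addr0.
    have h' := @is_deriveV _ (fun t : R => len (v + t *: w) ^+ 2) _ _ _ hn hs.
    apply: (is_derive_eq h'); rewrite scale0r addr0 /GRing.scale /=.
    by field; rewrite gt_eqF// len_gt0.
  have h' := is_deriveM hp hi; rewrite /gcut; apply: (is_derive_eq h').
  rewrite scale0r addr0 /GRing.scale /= /dgcut; field; by rewrite gt_eqF// len_gt0.
by rewrite -(@derive_val _ _ _ _ _ _ _ hg) -(@derive_val _ _ _ _ _ _ _ h2).
Qed.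

Lemma gcut_legendre v : 'D_v gcut v - gcut v <= 6.
Proof.
rewrite derive_gcut derive_len; apply: psi_legendre; [exact: posp_ge0|exact: len_ge1|].
case: (leP (len v) 2) => h; [left; apply: posp_eq0|right; rewrite posp_id ?subrK// subr_ge0 ltW//].
by rewrite subr_le0.
Qed.

Lemma len_legendre v : 'D_v len v - (len v - 1) <= 1.
Proof.
rewrite derive_len; have h := len_ge1 v; have h0 := len_gt0 v.
have -> : (len v ^+ 2 - 1) / len v = len v - (len v)^-1 by field; rewrite gt_eqF.
by have : 0 < (len v)^-1 by [rewrite invr_gt0]; lra.
Qed.

End Kinetic.

(** * The domain W and the regularity of functions on it *)

Section DiscBundle.
Context {R : realType} {n : nat} {M : smoothManifold R n} (F : frame M).
Notation D := (fdim F).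
Notation e := (emb F).
Local Notation V := ('rV[R]_n * 'rV[R]_n)%type.

Definition height (z : cotangent M) : R := len (frame_comp F z).
Definition disc_bundle : set (cotangent M) := [set z | height z < 2].

Lemma height_cts : continuous height.
Proof.
move=> z; have h : {for frame_comp F z, continuous (@len R D)} by exact: (Ck_cont (len_Ck 0)).
exact: (cvg_comp _ _ (@frame_comp_cts _ _ _ F z) h).
Qed.

Lemma height_covec x (p : 'rV[R]_D) : height (covec x p) = len (Q x p).
Proof. by rewrite /height frame_comp_covec. Qed.

Lemma height_zero x : height (zero_section x) = 1.
Proof. by rewrite -(covec0 F) height_covec Q0 len0. Qed.

Lemma len_shrink (s : R) (v : 'rV[R]_D) : 0 <= s <= 1 -> len (s *: v) <= len v.
Proof.
move=> /andP[s0 s1]; rewrite -ler_sqr ?nnegrE ?len_ge0// !len_sq lerD2l pairingZl pairingZr mulrA.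
by rewrite ler_piMl ?pairing_ge0// mulr_ile1.
Qed.

(** The bundle is fibrewise star-shaped: it is the union of the connected sets formed by the zero
    section and one radial segment. *)
Lemma disc_bundle_domain (x0 : M) : connected [set: M] -> domain_containing_zero_section disc_bundle.
Proof.
move=> cnM; split; first exact: open_preim_lt height_cts.
- pose Z : set (cotangent M) := [set zero_section x | x in [set: M]].
  pose ray (z : cotangent M) (s : R) := covec (base z) (s *: frame_comp F z).
  have cZ : connected Z.
    apply: connected_continuous_connected cnM _; apply: continuous_subspaceT.
    exact: (zero_section_cts F).
  pose A z : set (cotangent M) := Z `|` [set ray z s | s in `[0, 1]%classic].
  have cA z : connected (A z).
    apply: connectedU => //.
      exists (zero_section (base z)); split; first by exists (base z).
      by exists 0; [rewrite /= in_itv /= lexx ler01|rewrite /ray scale0r covec0].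
    apply: connected_continuous_connected; first exact: segment_connected.
    apply: continuous_subspaceT => s; apply: covec_cvg; first exact: cvg_cst.
    by apply: cvgZr_tmp; exact: cvg_id.
  rewrite (_ : disc_bundle = \bigcup_(z in disc_bundle) A z).
    apply: bigcup_connected => //; exists (zero_section x0) => z _; left; by exists x0.
  apply/seteqP; split=> [z hz|z [z' hz' [[x _ <-]|[s /= s01 <-]]]].
  + exists z => //; right; exists 1; first by rewrite /= in_itv /= lexx ler01.
    by rewrite /ray scale1r covec_frame_comp.
  + by rewrite /disc_bundle /= height_zero ltr1n.
  + rewrite /disc_bundle /= /ray; apply: le_lt_trans hz'.
    rewrite /height frame_comp_covec QZ.
    have -> : Q (base z') (frame_comp F z') = frame_comp F z' by rewrite -frame_comp_covec covec_frame_comp.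
    by apply: len_shrink; move: s01; rewrite in_itv.
- by move=> _ [x _ <-]; rewrite /disc_bundle /= height_zero ltr1n.
Qed.

(** On the compact support 2 - [height] is bounded below. The gap between [tau] and 2 separates the
    support from the region where [gcut] acts. *)
Lemma support_margin (H : R -> cotangent M -> R) : compactly_supported_hamiltonian disc_bundle H ->
  exists tau : R, [/\ 1 <= tau, tau < 2 & forall t z, tau < height z -> H t z = 0].
Proof.
move=> [_ _ [S [cS SW S0]]].
have [|x Sx|C C0 hC] := @compact_bound _ _ S (fun C z => 0 <= 2 - height z /\ 1 <= C * (2 - height z)) cS.
- move=> C C' z CC' [h1 h2]; split=> //; apply: le_trans h2 _; exact: ler_wpM2r.
- have d0 : 0 < 2 - height x by rewrite subr_gt0; exact: SW.
  exists (2 / (2 - height x)).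
  have d2 : 0 < (2 - height x) / 2 by rewrite divr_gt0.
  have /cvgrPdist_lt/(_ _ d2) : height @ x --> height x by exact: height_cts.
  apply: filterS => y; rewrite ltr_norml => /andP[h1 _] _.
  have h3 : (2 - height x) / 2 <= 2 - height y by lra.
  split; first exact: le_trans (ltW d2) h3.
  apply: (@le_trans _ _ (2 / (2 - height x) * ((2 - height x) / 2))).
    by rewrite le_eqVlt; apply/orP; left; apply/eqP; field; rewrite gt_eqF.
  by rewrite ler_wpM2l// divr_ge0// ltW.
exists (Num.max 1 (2 - C^-1)); split; first by rewrite le_max lexx.
  by rewrite gt_max ltr1n /= gtrDl oppr_lt0 invr_gt0.
move=> t z; rewrite gt_max => /andP[_ hz]; apply: S0 => Sz.
have [_] := hC z Sz; rewrite -ler_pdivrMl// mulr1.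
by move: hz; move: (C^-1) => a; lra.
Qed.

Definition HCk k (f : R -> cotangent M -> R) := forall c : chart M,
  Ck k [set s : R * V | cimg c s.2.1] (fun s => f s.1 (coparam c s.2)).

Lemma hdom_open (c : chart M) : open [set s : R * V | cimg c s.2.1].
Proof.
apply: (@open_comp _ _ (fun s : R * V => s.2.1) (cimg c)); last exact: cimg_open.
by move=> s _; apply: (cvg_comp snd fst); [exact: cvg_snd|exact: cvg_fst].
Qed.

Lemma vCk_base k (c : chart M) : vCk k [set s : R * V | cimg c s.2.1] (fun s : R * V => s.2).
Proof. exact: (@vCk_snd R R V k). Qed.

Lemma wdom_open (c : chart M) : open [set w : V | cimg c w.1].
Proof. by apply: (@open_comp _ _ fst (cimg c)); [move=> w _; exact: cvg_fst|exact: cimg_open]. Qed.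

Lemma HCk_fibre (phi : 'rV[R]_D -> R) : Ck 2 setT phi -> HCk 2 (fun _ z => phi (frame_comp F z)).
Proof.
move=> hphi c; have o := @hdom_open c.
have h : Ck 2 [set w : V | cimg c w.1] (phi \o frame_loc F c).
  apply: (Ck_comp (findim_rV D) (@wdom_open c) openT (fun _ _ => I) _ hphi).
  by apply: vCk_rV; [exact: wdom_open|move=> j; exact: frame_loc_C2].
apply: (Ck_eq o (f := (phi \o frame_loc F c) \o snd)).
  by move=> s cs; rewrite /= frame_comp_coparam.
exact: (Ck_comp (findim_pair (findim_rV n) (findim_rV n)) o (@wdom_open c) (fun _ h => h) (@vCk_base 2 c) h).
Qed.

Lemma HCkD k f g : HCk k f -> HCk k g -> HCk k (fun t z => f t z + g t z).
Proof. by move=> hf hg c; apply: CkD; [exact: hdom_open|exact: hf|exact: hg]. Qed.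

Lemma HCkZ k a f : HCk k f -> HCk k (fun t z => a * f t z).
Proof. by move=> hf c; apply: CkZ; [exact: hdom_open|exact: hf]. Qed.

(** The open sets where the height is less than 2 and greater than [tau] cover the bundle; H is
    smooth on the first and 0 on the second. *)
Lemma HCk_supported H tau k : compactly_supported_hamiltonian disc_bundle H -> tau < 2 ->
  (forall t z, tau < height z -> H t z = 0) -> HCk k H.
Proof.
move=> [_ sH _] tau2 Hout c; apply: Ck_local => s cs.
have o := @hdom_open c.
have hc : continuous (fun s : R * V => s.2) by move=> ?; exact: cvg_snd.
have hs : {in [set s : R * V | cimg c s.2.1], continuous (fun s : R * V => height (coparam c s.2))}.
  move=> s' /set_mem cs'; have h0 := HCk_fibre (len_Ck 2) c.
  exact: (Ck_cont h0 cs').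
have oB (B : set R) : open B -> open [set s : R * V | cimg c s.2.1 /\ B (height (coparam c s.2))].
  move=> oB; rewrite openE => s' [cs' Bs']; rewrite /interior.
  have h1 : \forall y \near s', cimg c y.2.1 by exact: (near_in_open o).
  have h2 : \forall y \near s', B (height (coparam c y.2)).
    by apply: (hs s' (mem_set cs')); apply: open_nbhs_nbhs.
  exact: filterS2 h1 h2.
case: (ltP (height (coparam c s.2)) 2) => hs2.
  exists [set p : R * V | (cocoord c @` (disc_bundle `&` [set z | cdom c (base z)])) p.2].
    by have [h1 h2] := coparamP (w := s.2) cs; exists (coparam c s.2).
  exact: smooth_on_Ck (sH c).
exists [set s : R * V | cimg c s.2.1 /\ [set r : R | tau < r] (height (coparam c s.2))].
  by split=> //; exact: lt_le_trans tau2 hs2.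
apply: (Ck_eq (oB _ (@open_gt _ tau)) (f := cst (0 : R))); last exact: Ck_cst.
by move=> s' [_ /= h]; rewrite Hout.
Qed.

(** In charts (x, p) |-> [covec x p] reads (q, y) with y_i = p.(d_i e), a C^2 map linear in p. Time
    is made a part of the parameter to keep joint regularity. *)
Lemma HCk_JCk f : HCk 2 f -> JCk 2 (fun x (s : R * 'rV[R]_D) => f s.1 (covec x s.2)).
Proof.
move=> hf c; pose U : set ('rV[R]_n * (R * 'rV[R]_D)) := [set z | cimg c z.1].
have oU : open U by exact: jdom_open.
pose Y (z : 'rV[R]_n * (R * 'rV[R]_D)) : 'rV[R]_n := pull c (param c z.1) z.2.2.
apply: (Ck_eq oU (f := (fun s : R * V => f s.1 (coparam c s.2)) \o (fun z => (z.2.1, (z.1, Y z))))).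
  by move=> z cz /=; rewrite (covec_coparam z.2.2 (cdom_param cz)) paramK.
have f2 : findim V by exact: findim_pair (findim_rV n) (findim_rV n).
have fz : findim (R * 'rV[R]_D)%type by exact: findim_pair findim_R (findim_rV D).
have v1 : vCk 2 U (fst : _ -> 'rV[R]_n) by exact: vCk_fst.
have v2 : vCk 2 U (snd : _ -> R * 'rV[R]_D) by exact: vCk_snd.
have v3 : vCk 2 U (fun z => z.2.1).
  exact: (vCk_comp fz oU openT (fun _ _ => I) v2 (@vCk_fst R R 'rV[R]_D 2 setT)).
have v4 : vCk 2 U (fun z => z.2.2).
  exact: (vCk_comp fz oU openT (fun _ _ => I) v2 (@vCk_snd R R 'rV[R]_D 2 setT)).
have vY : vCk 2 U Y.
  apply: vCk_rV => // i.
  have h : Ck 2 U (fun z => \sum_j z.2.2 0 j * dE F c (param c z.1) (delta_mx 0 i) 0 j).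
    apply: Ck_sum => // j; apply: CkM => //; first exact: (v4 _ (clinear_coord j)).
    by have := Ck_comp (findim_rV n) oU (@cimg_open _ _ M c) _ v1 (pull_C2 c i j); apply.
  by apply: (Ck_eq oU _ h) => z _; rewrite mxE.
have vP : vCk 2 U (fun z => (z.2.1, (z.1, Y z))) := vCk_pair oU v3 (vCk_pair oU v1 vY).
have hg : Ck 2 [set s : R * V | cimg c s.2.1] (fun s : R * V => f s.1 (coparam c s.2)) := hf c.
have := Ck_comp (findim_pair findim_R f2) oU (@hdom_open c) _ vP hg.
by apply.
Qed.

Lemma JCk_lift (f : M -> 'rV[R]_D -> R) : JCk 2 f -> JCk 2 (fun x (s : R * 'rV[R]_D) => f x s.2).
Proof.
move=> hf c; have oU := @jdom_open _ _ M (R * 'rV[R]_D)%type c.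
pose Phi (z : 'rV[R]_n * (R * 'rV[R]_D)) : 'rV[R]_n * 'rV[R]_D := (z.1, z.2.2).
have fz : findim (R * 'rV[R]_D)%type by exact: findim_pair findim_R (findim_rV D).
have v1 : vCk 2 [set z : 'rV[R]_n * (R * 'rV[R]_D) | cimg c z.1] fst by exact: vCk_fst.
have v2 : vCk 2 [set z : 'rV[R]_n * (R * 'rV[R]_D) | cimg c z.1] snd by exact: vCk_snd.
have v4 := vCk_comp fz oU openT (fun _ _ => I) v2 (@vCk_snd R R 'rV[R]_D 2 setT).
have hg : Ck 2 [set z : 'rV[R]_n * 'rV[R]_D | cimg c z.1] (fun z => f (param c z.1) z.2) := hf c.
have hp : vCk 2 [set z : 'rV[R]_n * (R * 'rV[R]_D) | cimg c z.1] Phi := vCk_pair oU v1 v4.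
have := Ck_comp (findim_pair (findim_rV n) (findim_rV D)) oU (@jdom_open _ _ M 'rV[R]_D c) _ hp hg.
by apply.
Qed.

Lemma JCk_at (f : M -> R * 'rV[R]_D -> R) (t : R) : JCk 2 f -> JCk 2 (fun x p => f x (t, p)).
Proof.
move=> hf c; have oU := @jdom_open _ _ M 'rV[R]_D c.
have v1 : vCk 2 [set z : 'rV[R]_n * 'rV[R]_D | cimg c z.1] fst by exact: vCk_fst.
have v2 : vCk 2 [set z : 'rV[R]_n * 'rV[R]_D | cimg c z.1] snd by exact: vCk_snd.
have v0 : vCk 2 [set z : 'rV[R]_n * 'rV[R]_D | cimg c z.1] (fun=> t) by exact: vCk_cst.
have hg : Ck 2 [set z : 'rV[R]_n * (R * 'rV[R]_D) | cimg c z.1] (fun z => f (param c z.1) z.2) := hf c.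
have hp : vCk 2 [set z : 'rV[R]_n * 'rV[R]_D | cimg c z.1] (fun z => (z.1, (t, z.2))) := vCk_pair oU v1 (vCk_pair oU v0 v2).
have := Ck_comp (findim_pair (findim_rV n) (findim_pair findim_R (findim_rV D))) oU (@jdom_open _ _ M (R * 'rV[R]_D)%type c) _ hp hg.
by apply.
Qed.

Lemma JCk_Q j : JCk 2 (fun x (p : 'rV[R]_D) => Q x p 0 j).
Proof.
have h : JCk 2 (fun x (p : 'rV[R]_D) => \sum_i p 0 i * Qm i j x).
  apply: JCk_sum => i; apply: (JCkM (f := fun _ (p : 'rV[R]_D) => p 0 i) (g := fun x _ => Qm i j x)).
    by apply: JCk_snd; [exact: findim_rV|apply: Ck_lin; exact: clinear_coord].
  by apply: JCk_fst; exact: Qm_C2.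
by move=> c; apply: (Ck_eq (@jdom_open _ _ M 'rV[R]_D c) _ (h c)) => z _; rewrite QE.
Qed.

Lemma JCk_normal (phi : 'rV[R]_D -> R) : Ck 2 setT phi -> JCk 2 (fun x (p : 'rV[R]_D) => phi (p - Q x p)).
Proof.
move=> hphi c; have oU := @jdom_open _ _ M 'rV[R]_D c.
apply: (Ck_comp (f := fun z : 'rV[R]_n * 'rV[R]_D => z.2 - Q (param c z.1) z.2) (findim_rV D) oU openT (fun _ _ => I) _ hphi).
apply: vCk_rV => // j.
have h : Ck 2 [set z : 'rV[R]_n * 'rV[R]_D | cimg c z.1] (fun z => z.2 0 j - Q (param c z.1) z.2 0 j).
  apply: CkB => //; last exact: (JCk_Q j c).
  exact: (@vCk_snd R 'rV[R]_n 'rV[R]_D 2 _ _ (clinear_coord j)).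
by apply: (Ck_eq oU _ h) => z _; rewrite !mxE.
Qed.

End DiscBundle.

Lemma cts_bound_on (R : realType) (X : topologicalType) (A : set X) (f : X -> R) : compact A -> continuous f ->
  exists2 C, 0 < C & forall x, A x -> `|f x| <= C.
Proof.
move=> cA cf; have [||C C0 hC] := @compact_bound _ _ A (fun C x => `|f x| <= C) cA.
- by move=> C C' x CC' /le_trans; exact.
- move=> x _; exists (`|f x| + 1).
  have /cvgrPdist_lt/(_ _ ltr01) : f @ x --> f x by exact: cf.
  apply: filterS => y hy _; have -> : f y = f x - (f x - f y) by ring.
  by apply: le_trans (ler_normB _ _) _; rewrite lerD2l ltW.
by exists C.
Qed.

Lemma sub_swap (V : zmodType) (a b c d : V) : (a - b) - (c - d) = (a - c) - (b - d).
Proof. by rewrite !opprB [d - c]addrC addrACA [- b + d]addrC. Qed.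

Lemma derive_linear_comp (R : realType) (V W : normedModType R) (A : V -> W) (phi : W -> R) p v :
  linear A -> 'D_v (phi \o A) p = 'D_(A v) phi (A p).
Proof.
move=> lA; rewrite /derive.
have -> : (fun h : R => h^-1 *: ((phi \o A \o shift p) (h *: v) - (phi \o A) p)) =
  (fun h : R => h^-1 *: ((phi \o shift (A p)) (h *: A v) - phi (A p))); last by [].
by apply/funext => h; rewrite /= lA.
Qed.

Lemma derive_dir0 (R : realType) (V : normedModType R) (f : V -> R) p : differentiable f p -> 'D_0 f p = 0.
Proof. by move=> df; rewrite deriveE// linear0. Qed.

(** * Growth, Lipschitz and Legendre bounds of the modified Hamiltonian *)

Section HamiltonianBounds.
Context {R : realType} {n : nat} {M : smoothManifold R n} (F : frame M).
Hypothesis cM : compact [set: M].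
Notation D := (fdim F).
Notation e := (emb F).

Lemma jet_lip (f : M -> R * 'rV[R]_D -> R) (r : R) : JCk 2 f -> exists2 L, 0 < L & forall t x x' p p',
  0 <= t <= 1 -> `|p| <= r -> `|p'| <= r -> `|f x' (t, p') - f x (t, p)| <= L * (`|e x' - e x| + `|p' - p|).
Proof.
move=> hf.
have fV : findim (R * 'rV[R]_D)%type by exact: findim_pair findim_R (findim_rV D).
pose B : set (R * 'rV[R]_D) := `[0, 1]%classic `*` [set p | `|p| <= r].
have cB : compact B by apply: compact_setX; [exact: segment_compact|exact: box_compact].
have [C1 C10 h1] := jet_bound F cM cB fV hf.
have hf1 : JCk 1 f by move=> c; exact: CkW (hf c).
have [Ce Ce0 he] := emb_bound F cM.
have cMB : compact ([set: M] `*` B) by exact: compact_setX.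
have [C2 C20 h2] : exists2 C, 0 < C & forall z : M * (R * 'rV[R]_D), ([set: M] `*` B) z -> `|(`|grad F (f^~ z.2) z.1| : R)| <= C.
  by apply: cts_bound_on => // z; apply: cvg_norm; exact: (grad_cts fV hf1).
have [C3 C30 h3] : exists2 C, 0 < C & forall z : M * (R * 'rV[R]_D), ([set: M] `*` B) z ->
    `|(\sum_j `|'D_((0 : R), (delta_mx 0 j : 'rV[R]_D)) (f z.1) z.2| : R)| <= C.
  apply: cts_bound_on => // z; apply: cvg_big => [|j _]; first exact: add_continuous.
  by apply: cvg_norm; exact: (fib_derive_cts hf1).
exists (C1 * (2 * Ce + `|2 * r|) + D%:R * C2 + C3).
  by rewrite ltr_wpDl// addr_ge0// !mulr_ge0// ?(ltW C10) ?(ltW C20)// addr_ge0// mulr_ge0// ltW.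
move=> t x x' p p' t01 pr pr'.
have Bp : B (t, p) by split=> //=; rewrite in_itv.
have Bp' : B (t, p') by split=> //=; rewrite in_itv.
have j1 := h1 x (t, p) x' (t, p') Bp Bp'; rewrite /jet_err in j1.
have Es : (t, p') - (t, p) = ((0 : R), p' - p) by rewrite -[LHS]/(t - t, p' - p) subrr.
have := h2 (x, (t, p)) (conj I Bp); rewrite /= normr_id => j2.
have := h3 (x, (t, p)) (conj I Bp); rewrite /= ger0_norm ?sumr_ge0// => j3.
rewrite Es in j1.
have n1 : `|((0 : R), p' - p)| <= `|p' - p| by apply: le_trans (norm_pair_le _ _) _; rewrite normr0 add0r.
set de := e x' - e x in j1 *; set dp := p' - p in j1 n1 *.
have dp2 : `|dp| <= `|2 * r|.
  apply: le_trans (ler_normB _ _) _; apply: (@le_trans _ _ (2 * r)); last exact: ler_norm.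
  by rewrite mulr_natl mulr2n lerD.
have de2 : `|de| <= 2 * Ce by apply: le_trans (ler_normB _ _) _; rewrite mulr_natl mulr2n lerD.
have k1 : `|pairing (grad F (f^~ (t, p)) x) de| <= D%:R * C2 * `|de|.
  by apply: le_trans (pairing_bnd _ _) _; rewrite -mulrA ler_wpM2l// ler_wpM2r.
have k2 : `|'D_((0 : R), dp) (f x) (t, p)| <= C3 * `|dp|.
  rewrite derive_pair2 derive_rV; last by apply: (JCk_fib x (findim_rV D) (JCk_at t hf)).1.
  apply: le_trans (ler_norm_sum _ _ _) _.
  apply: (@le_trans _ _ (\sum_j `|'D_((0 : R), (delta_mx 0 j : 'rV[R]_D)) (f x) (t, p)| * `|dp|)).
    by apply: ler_sum => j _; rewrite normrM derive_pair2 mulrC ler_wpM2l// coord_le_norm.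
  by rewrite -mulr_suml ler_wpM2r.
set a := f x' _ - f x _ in j1 *; set b := pairing _ de in j1 k1; set d := 'D_(0, dp) _ _ in j1 k2.
have -> : a = (a - b - d) + (b + d) by ring.
apply: le_trans (ler_normD _ _) _; apply: le_trans (lerD j1 (ler_normD _ _)) _.
apply: le_trans (lerD (lexx _) (lerD k1 k2)) _.
have m1 : `|de| ^+ 2 <= 2 * Ce * `|de| by rewrite expr2 ler_wpM2r.
have m2 : `|((0 : R), dp)| ^+ 2 <= `|2 * r| * `|dp|.
  by rewrite expr2; apply: ler_pM => //; exact: le_trans dp2.
have m3 : C1 * (`|de| ^+ 2 + `|((0 : R), dp)| ^+ 2) <= C1 * ((2 * Ce + `|2 * r|) * (`|de| + `|dp|)).
  rewrite ler_wpM2l ?(ltW C10)//; apply: le_trans (lerD m1 m2) _; rewrite [leRHS]mulrDl; apply: lerD.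
    by rewrite ler_wpM2l ?lerDl// mulr_ge0// ltW.
  by rewrite ler_wpM2l ?lerDr.
apply: le_trans (lerD m3 (lexx _)) _.
have -> : (C1 * (2 * Ce + `|2 * r|) + D%:R * C2 + C3) * (`|de| + `|dp|) =
  C1 * ((2 * Ce + `|2 * r|) * (`|de| + `|dp|)) + (D%:R * C2 * `|de| + C3 * `|dp|) + (D%:R * C2 * `|dp| + C3 * `|de|) by ring.
rewrite lerDl; apply: addr_ge0; apply: mulr_ge0 => //; last exact: ltW.
by apply: mulr_ge0 => //; exact: ltW.
Qed.

Variables (H : R -> cotangent M -> R) (tau a : R).
Hypothesis Hper : forall t z, H (t + 1) z = H t z.
Hypothesis HC2 : HCk 2 H.
Hypothesis tau2 : tau < 2.
Hypothesis Hout : forall t z, tau < height F z -> H t z = 0.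
Hypothesis a0 : 0 < a.

Let h t x (p : 'rV[R]_D) := H t (covec x p).

Lemma h_Q t x p : h t x p = h t x (Q x p).
Proof. by rewrite /h covec_Q. Qed.

Lemma h_out t x p : tau < len (Q x p) -> h t x p = 0.
Proof. by move=> hp; apply: Hout; rewrite height_covec. Qed.

Let hJ : JCk 2 (fun x (s : R * 'rV[R]_D) => h s.1 x s.2). Proof. exact: HCk_JCk. Qed.

Lemma h_unit t : exists2 t', 0 <= t' <= 1 & forall x p, h t x p = h t' x p.
Proof.
exists (t + (- Num.floor t)%:~R); last first.
  by move=> x p; rewrite /h; symmetry; exact: (@periodic_int _ _ (H^~ (covec x p)) _ _ (Hper^~ _)).
rewrite rmorphN /= subr_ge0 lerBlDl floor_le_tmp /=.
by have := lt_succ_floor t; rewrite intrD => /ltW.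
Qed.

Lemma h_bound : exists2 B, 0 < B & forall t x p, `|h t x p| <= B.
Proof.
pose A : set (M * (R * 'rV[R]_D)) := [set: M] `*` (`[0, 1]%classic `*` [set p | `|p| <= 2]).
have cA : compact A.
  by apply: compact_setX => //; apply: compact_setX; [exact: segment_compact|exact: box_compact].
have [B B0 hB] := cts_bound_on cA (JCk_cts hJ).
exists B => // t x p; have [t' t01 ->] := h_unit t; rewrite h_Q.
case: (ltP tau (len (Q x p))) => hp; first by rewrite h_out ?normr0 ?(ltW B0)// Q_idem.
apply: (hB (x, (t', Q x p))); split; [by []|split; [by rewrite /= in_itv|rewrite /=]].
exact: le_trans (norm_le_len _) (le_trans hp (ltW tau2)).
Qed.

(** The momenta range over a noncompact space, but [h] sees p only through [Q x p] and vanishes when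
    this is large, so the compact estimate [jet_lip] is enough. *)
Lemma h_lip : exists2 L, 0 < L & forall t x x' p p',
  `|h t x' p' - h t x p| <= L * (`|e x' - e x| + `|Q x' p' - Q x p|).
Proof.
have [B B0 hB] := h_bound.
have [L L0 hL] := jet_lip 4 hJ.
(* If the other point is in the region where [h] may be nonzero, its tangential momentum has norm at
   most 2, so the two differ by more than 1 and the bound on [h] suffices. *)
have far t x x' p p' : 4 < `|Q x p| -> `|h t x' p' - h t x p| <= B * `|Q x' p' - Q x p|.
  move=> hp; rewrite (h_out t (p := p)); last first.
    by apply: lt_le_trans (norm_le_len _); apply: lt_trans tau2 (lt_trans _ hp); rewrite ltr_nat.
  rewrite subr0; case: (ltP tau (len (Q x' p'))) => hp'.
    by rewrite h_out// normr0 mulr_ge0// ltW.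
  apply: le_trans (hB t x' p') _; rewrite ler_peMr ?(ltW B0)//.
  have h2 : `|Q x' p'| <= 2 by apply: le_trans (norm_le_len _) (le_trans hp' (ltW tau2)).
  have := ler_normB (Q x' p') (Q x' p' - Q x p); rewrite subKr.
  by move: hp h2; move: (`|Q x p|) (`|Q x' p'|) (`|_ - _|) => u v w; lra.
exists (L + B); first exact: addr_gt0.
move=> t x x' p p'.
have le1 : B * `|Q x' p' - Q x p| <= (L + B) * (`|e x' - e x| + `|Q x' p' - Q x p|).
  by apply: ler_pM => //; rewrite ?(ltW B0) ?lerDr ?(ltW L0).
case: (ltP 4 `|Q x p|) => hp; first exact: le_trans (far _ _ _ _ _ hp) le1.
case: (ltP 4 `|Q x' p'|) => hp'.
  by rewrite distrC; apply: le_trans (far t x' x p' p hp') _; rewrite distrC.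
have [t' t01 ht] := h_unit t; rewrite !ht h_Q [X in _ - X]h_Q.
apply: le_trans (hL t' x x' _ _ t01 hp hp') _.
by rewrite ler_wpM2r ?addr_ge0// lerDl ltW.
Qed.

Lemma h_derive_Q t x p v : 'D_v (h t x) p = 'D_(Q x v) (h t x) (Q x p).
Proof.
rewrite -[LHS](_ : 'D_v (h t x \o Q x) p = _); first exact: (derive_linear_comp _ _ _ (@Q_linear _ _ _ F x)).
by congr ('D_v _ p); apply/funext => q; rewrite /= -h_Q.
Qed.

Lemma h_derive_out t x p v : tau < len (Q x p) -> 'D_v (h t x) p = 0.
Proof.
move=> hp; rewrite (_ : 'D_v (h t x) p = 'D_v (cst (0 : R)) p); first by rewrite derive_cst.
apply: near_eq_derive.
have hc : height F (covec x q) @[q --> p] --> height F (covec x p).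
  have hv : covec x q @[q --> p] --> covec x p by apply: (@covec_cvg _ _ _ F _ (nbhs p) (nbhs_filter p) (fun=> x) (fun q => q) x p); [exact: cvg_cst|exact: cvg_id].
  exact: (cvg_comp _ _ hv (@height_cts _ _ _ F _)).
have hn : nbhs (height F (covec x p)) [set r : R | tau < r].
  by rewrite height_covec; apply: (near_in_open (@open_gt _ tau)).
have hn' : \forall q \near p, tau < height F (covec x q) := hc _ hn.
by move: hn'; apply: filterS => q hq; exact: Hout.
Qed.

(* The first two terms are a Hamiltonian on the cotangent bundle pulled back by (x, p) |-> p.de; the third one
   confines p to the range of Q, where its derivatives vanish. *)
Definition tamed t x (p : 'rV[R]_D) : R := h t x p + a * gcut (Q x p) + a * (len (p - Q x p) - 1).

Lemma tamed_per t : tamed (t + 1) = tamed t.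
Proof. by apply/funext => x; apply/funext => p; rewrite /tamed /h Hper. Qed.

Lemma tamed_JCk : JCk 2 (fun x (s : R * 'rV[R]_D) => tamed s.1 x s.2).
Proof.
have h1 := hJ.
have h2 : JCk 2 (fun x (s : R * 'rV[R]_D) => gcut (Q x s.2)).
  have h4 := HCk_JCk F (@HCk_fibre _ _ _ F _ gcut_Ck).
  by move=> c; apply: (Ck_eq (@jdom_open _ _ M _ c) _ (h4 c)) => z _ /=; rewrite frame_comp_covec.
have h3 : JCk 2 (fun x (s : R * 'rV[R]_D) => len (s.2 - Q x s.2) - 1).
  apply: (JCkD (f := fun x s => len (s.2 - Q x s.2)) (g := fun _ _ => -1)).
    exact: (JCk_lift (JCk_normal (len_Ck 2))).
  by move=> c; exact: Ck_cst.
exact: (JCkD (JCkD h1 (JCkZ a h2)) (JCkZ a h3)).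
Qed.

Lemma tamed_C2 t : JCk 2 (tamed t).
Proof. exact: (JCk_at t tamed_JCk). Qed.

Lemma h_diff t x p : differentiable (h t x) p.
Proof. exact: (JCk_fib x (findim_rV D) (JCk_at t hJ)).1. Qed.

Lemma tamed_derive t x p v : 'D_v (tamed t x) p =
  'D_v (h t x) p + a * 'D_(Q x v) gcut (Q x p) + a * 'D_(v - Q x v) len (p - Q x p).
Proof.
have dG : differentiable (gcut \o Q x) p.
  have h1 := HCk_JCk F (@HCk_fibre _ _ _ F _ gcut_Ck).
  have := (JCk_fib x (findim_rV D) (JCk_at t h1)).1 p I.
  by apply: differentiable_near; near=> q => /=; rewrite frame_comp_covec.
have lN : linear (fun p : 'rV[R]_D => p - Q x p).
  by move=> s u w; rewrite QD QZ scalerBr opprD addrACA.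
have dN : differentiable (len \o (fun p : 'rV[R]_D => p - Q x p)) p.
  exact: (JCk_fib x (findim_rV D) (JCk_normal (len_Ck 2))).1.
have E : tamed t x = (h t x + (a *: (gcut \o Q x))) + (a *: ((len \o (fun p : 'rV[R]_D => p - Q x p)) - cst 1)).
  by apply/funext => q.
have dh := h_diff t x p.
have dNc : derivable ((len \o (fun p : 'rV[R]_D => p - Q x p)) - cst 1) p v.
  by apply: derivableB; [exact: diff_derivable|exact: derivable_cst].
rewrite E deriveD; last first.
- exact: derivableZ.
- by apply: derivableD; [exact: diff_derivable|apply: derivableZ; exact: diff_derivable].
rewrite deriveD; [|exact: diff_derivable|by apply: derivableZ; exact: diff_derivable].
rewrite !deriveZ//; last exact: diff_derivable.
rewrite deriveB; [|exact: diff_derivable|exact: derivable_cst].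
rewrite derive_cst subr0 (derive_linear_comp _ _ _ (@Q_linear _ _ _ F x)).
by rewrite (derive_linear_comp _ _ _ lN).
Unshelve. all: by end_near. Qed.

(** The contributions are 6 from [gcut_legendre] and 1 from [len_legendre], each multiplied by [a];
    neither depends on H. *)
Lemma tamed_legendre t x p : pairing p (dgrad (tamed t x) p) - tamed t x p <= 'D_p (h t x) p - h t x p + 7 * a.
Proof.
rewrite pairingC -dgradP; last by apply: (JCk_fib x (findim_rV D) (tamed_C2 t)).1.
rewrite tamed_derive /tamed.
have h1 := gcut_legendre (Q x p); have h2 := len_legendre (p - Q x p).
have h3 : a * ('D_(Q x p) gcut (Q x p) - gcut (Q x p)) <= a * 6 by rewrite ler_pM2l.
have h4 : a * ('D_(p - Q x p) len (p - Q x p) - (len (p - Q x p) - 1)) <= a * 1 by rewrite ler_pM2l.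
by move: h3 h4; move: ('D_p _ _) (h t x p) ('D_(Q x p) _ _) (gcut _) ('D_(_ - _) _ _) (len _) => *; lra.
Qed.

Lemma tamed_growth : exists b, forall t x p, a * `|p| - b <= tamed t x p.
Proof.
have [B B0 hB] := h_bound; exists (B + 7 * a) => t x p; rewrite /tamed.
have h1 : a * (len (Q x p) - 6) <= a * gcut (Q x p) by rewrite ler_pM2l// gcut_ge.
have h2 : - B <= h t x p by have := hB t x p; rewrite ler_norml => /andP[].
have h3 : a * `|p| <= a * (len (Q x p) + len (p - Q x p)).
  rewrite ler_pM2l//; apply: (@le_trans _ _ (`|Q x p| + `|p - Q x p|)).
    by rewrite -[in leLHS](subrKC (Q x p) p) ler_normD.
  by apply: lerD; exact: norm_le_len.
by move: h1 h2 h3; move: (h t x p) (gcut _) (len (Q x p)) (len (p - _)) (`|p|) => *; lra.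
Qed.

Lemma tamed_legendre_bound : exists B, forall t x p, pairing p (dgrad (tamed t x) p) - tamed t x p <= B.
Proof.
have [B B0 hB] := h_bound; have [L L0 hL] := h_lip; have [Cq Cq0 hq] := Q_bnd F cM.
exists (D%:R * (2 * (L * Cq)) + B + 7 * a) => t x p; apply: le_trans (tamed_legendre t x p) _.
rewrite lerD2r; apply: lerD; last by have := hB t x p; rewrite ler_norml => /andP[h1 _]; rewrite lerNl.
have L1 : 0 <= L * Cq by rewrite mulr_ge0// ltW.
case: (ltP tau (len (Q x p))) => hp.
  by rewrite h_derive_out// mulr_ge0// mulr_ge0.
rewrite h_derive_Q dgradP; last exact: h_diff.
apply: le_trans (ler_norm _) _; apply: le_trans (pairing_bnd _ _) _; rewrite ler_wpM2l// mulrC.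
apply: ler_pM => //; first exact: le_trans (norm_le_len _) (le_trans hp (ltW tau2)).
apply: dgrad_lip => //; first exact: h_diff.
move=> p'; apply: le_trans (hL t x x _ _) _; rewrite subrr normr0 add0r -mulrA ler_pM2l// -QB.
exact: hq.
Qed.

Lemma tamed_small t x p : 7 * a + 1 <= pairing p (dgrad (tamed t x) p) - tamed t x p -> len (Q x p) <= tau.
Proof.
move=> hp; rewrite leNgt; apply/negP => hlt.
have := tamed_legendre t x p; rewrite h_derive_out// h_out// subr0 add0r => h1.
by move: hp h1; move: (pairing _ _ - _) => u; lra.
Qed.

Lemma tamed_zero t x : tamed t x 0 = H t (zero_section x).
Proof. by rewrite /tamed /h covec0 Q0 subr0 len0 subrr gcut_eq0 ?len0 ?ler1n// !mulr0 !addr0. Qed.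

(** Along the normal direction v = p - Q p only the confining term varies; its derivative is a |v|^2
    / [len v] with the Euclidean norm, and [len v] is at most 1 + D|v|. *)
Lemma tamed_normal t x p : a * `|p - Q x p| ^+ 2 <=
  (1 + D%:R * `|p - Q x p|) * pairing (p - Q x p) (dgrad (tamed t x) p).
Proof.
set v := p - Q x p; have Qv : Q x v = 0 by rewrite QB Q_idem subrr.
rewrite pairingC -dgradP; last by apply: (JCk_fib x (findim_rV D) (tamed_C2 t)).1.
rewrite tamed_derive h_derive_Q Qv derive_dir0; last exact: h_diff.
rewrite derive_dir0; last by apply: gcut_Ck.1.
have El : len v ^+ 2 - 1 = pairing v v by rewrite len_sq addrC addKr.
rewrite mulr0 !add0r subr0 -/v derive_len El.
have h1 := len_le v; have h2 := norm_le_pairing v; have l0 := len_gt0 v.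
rewrite [leRHS]mulrCA ler_pM2l// mulrA ler_pdivlMr// mulrC.
by apply: ler_pM => //; exact: ltW.
Qed.

Lemma tamed_master : exists2 L, 0 < L & forall t x x' p p', `|tamed t x' p' - tamed t x p| <=
  L * (`|e x' - e x| + `|Q x' p' - Q x p| + `|(p' - Q x' p') - (p - Q x p)|).
Proof.
have [L L0 hL] := h_lip; exists (L + a * D%:R); first by rewrite ltr_pwDl// mulr_ge0// ltW.
move=> t x x' p p'; rewrite /tamed.
have h1 := hL t x x' p p'.
have h2 : `|a * gcut (Q x' p') - a * gcut (Q x p)| <= a * D%:R * `|Q x' p' - Q x p|.
  by rewrite -mulrBr normrM (gtr0_norm a0) -mulrA ler_pM2l// gcut_lip.
have h3 : `|a * len (p' - Q x' p') - a * len (p - Q x p)| <= a * D%:R * `|(p' - Q x' p') - (p - Q x p)|.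
  by rewrite -mulrBr normrM (gtr0_norm a0) -mulrA ler_pM2l// len_lip.
have aD : 0 <= a * D%:R by rewrite mulr_ge0// ltW.
have -> : h t x' p' + a * gcut (Q x' p') + a * (len (p' - Q x' p') - 1) - (h t x p + a * gcut (Q x p) + a * (len (p - Q x p) - 1)) =
  (h t x' p' - h t x p) + ((a * gcut (Q x' p') - a * gcut (Q x p)) + (a * len (p' - Q x' p') - a * len (p - Q x p))) by ring.
apply: le_trans (ler_normD _ _) _; apply: le_trans (lerD h1 (ler_normD _ _)) _.
apply: le_trans (lerD (lexx _) (lerD h2 h3)) _.
set u := `|e x' - e x|; set v := `|Q x' p' - Q x p|; set w := `|_ - (p - Q x p)|.
have -> : (L + a * D%:R) * (u + v + w) = L * (u + v) + (a * D%:R * v + a * D%:R * w) + (L * w + a * D%:R * u) by ring.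
by rewrite lerDl; apply: addr_ge0; apply: mulr_ge0; rewrite ?(ltW L0) ?normr_ge0.
Qed.

Lemma tamed_lip : exists2 L, 0 <= L & forall t x p p', `|tamed t x p' - tamed t x p| <= L * `|p' - p|.
Proof.
have [L L0 hL] := tamed_master; have [Cq Cq0 hq] := Q_bnd F cM.
exists (L * (1 + 2 * Cq)); first by rewrite mulr_ge0 ?addr_ge0 ?mulr_ge0// ltW.
move=> t x p p'; apply: le_trans (hL t x x p p') _; rewrite subrr normr0 add0r -mulrA ler_pM2l//.
have -> : (p' - Q x p') - (p - Q x p) = (p' - p) - Q x (p' - p) by rewrite QB sub_swap.
rewrite -QB; have h1 := hq x (p' - p); have h2 := ler_normB (p' - p) (Q x (p' - p)).
by move: h1 h2; move: (`|Q _ _|) (`|_ - Q _ _|) (`|_ - _|) => u v w; lra.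
Qed.

Lemma tamed_lipx : exists2 L, 0 <= L & forall t x x' p, `|tamed t x' p - tamed t x p| <= L * (1 + `|p|) * `|e x' - e x|.
Proof.
have [L L0 hL] := tamed_master; have [Cq Cq0 hq] := Q_lip F cM.
exists (L * (1 + 2 * Cq)); first by rewrite mulr_ge0 ?addr_ge0 ?mulr_ge0// ltW.
move=> t x x' p; apply: le_trans (hL t x x' p p) _; rewrite -!mulrA ler_pM2l//.
have -> : (p - Q x' p) - (p - Q x p) = - (Q x' p - Q x p) by rewrite sub_swap subrr sub0r.
rewrite normrN; have h1 := hq x x' p; set u := `|e x' - e x| in h1 *; set v := `|_ - _| in h1 *.
have -> : (1 + 2 * Cq) * ((1 + `|p|) * u) = u + Cq * `|p| * u + Cq * `|p| * u + (`|p| * u + 2 * (Cq * u)) by ring.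
have u0 : 0 <= u by exact: normr_ge0.
have g1 : 0 <= `|p| * u by apply: mulr_ge0.
have g2 : 0 <= Cq * u by apply: mulr_ge0 => //; exact: ltW.
rewrite -[leLHS]addr0; apply: lerD; last by apply: addr_ge0 => //; apply: mulr_ge0.
by apply: lerD => //; apply: lerD.
Qed.

End HamiltonianBounds.

Lemma derive_len0 (R : realType) d (w : 'rV[R]_d) : 'D_w (@len R d) 0 = 0.
Proof.
have h0 : is_derive (0 : R) 1 (fun t : R => len (0 + t *: w)) ('D_w (@len R d) 0).
  by have := is_derive_line (f := @len R d) (z := 0) (v := w) (s := 0); rewrite scale0r addr0; apply; exact: len_diff.
have h1 := is_derive_sq h0; rewrite scale0r addr0 len0 mulr1 in h1.
have h2 : is_derive (0 : R) 1 (fun t : R => len (0 + t *: w) ^+ 2) 0.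
  rewrite (_ : (fun t : R => _) = fun t : R => 1 + t ^+ 2 * pairing w w); last first.
    by apply/funext => t; rewrite len_sq add0r pairingZl pairingZr mulrA expr2.
  by apply: is_derive_eq; rewrite /GRing.scale /=; ring.
have E : 2 * 'D_w (@len R d) 0 = 0 := etrans (esym (@derive_val _ _ _ _ _ _ _ h1)) (@derive_val _ _ _ _ _ _ _ h2).
by move: E => /eqP; rewrite mulf_eq0 pnatr_eq0 /= => /eqP.
Qed.

Lemma rV_id_diff (R : realType) d (v : 'rV[R]_d) : differentiable (fun v' : 'rV[R]_d => v') v.
Proof. exact: (vCk_diff (findim_rV d) (@vCk_id _ _ 1 setT) I). Qed.

Lemma sum_mul_delta (R : realType) d (f : 'I_d -> R) i : \sum_k f k * (delta_mx 0 k : 'rV[R]_d) 0 i = f i.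
Proof.
rewrite (bigD1 i)//= mxE !eqxx mulr1 big1 ?addr0// => k ki.
by rewrite mxE eqxx eq_sym (negPf ki) mulr0.
Qed.

(** * From the equations in R^D to Hamilton's equations in canonical charts *)

Section HamiltonEquations.
Context {R : realType} {n : nat} {M : smoothManifold R n} (F : frame M).
Notation D := (fdim F).
Notation e := (emb F).
Local Notation V := ('rV[R]_n * 'rV[R]_n)%type.
Variables (H : R -> cotangent M -> R) (a : R).
Hypothesis HC2 : HCk 2 H.

Definition tamed_ham t (z : cotangent M) : R := H t z + a * gcut (frame_comp F z).

Lemma tamed_ham_C2 : HCk 2 tamed_ham.
Proof. exact: (HCkD HC2 (HCkZ a (@HCk_fibre _ _ _ F _ gcut_Ck))). Qed.

Lemma tamedE t x (p : 'rV[R]_D) : tamed H a t x p = tamed_ham t (covec x p) + a * (len (p - Q x p) - 1).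
Proof. by rewrite /tamed /tamed_ham frame_comp_covec. Qed.

Definition hchart t (c : chart M) (w : V) : R := tamed_ham t (coparam c w).

Lemma hchart_C2 t c : Ck 2 [set w : V | cimg c w.1] (hchart t c).
Proof.
have o := @wdom_open _ _ M c.
have f2 : findim V by exact: findim_pair (findim_rV n) (findim_rV n).
have hp : vCk 2 [set w : V | cimg c w.1] (fun w => (t, w)).
  by exact: (vCk_pair o (@vCk_cst _ _ _ _ _ _) (@vCk_id _ _ _ _)).
have := Ck_comp (findim_pair findim_R f2) o (@hdom_open _ _ M c) _ hp (tamed_ham_C2 c).
by apply.
Qed.

Variables (t : R) (c : chart M) (x : M) (p : 'rV[R]_D).
Hypotheses (cx : cdom c x) (Qp : Q x p = p).
Let q := coord c x.
Let y := pull c x p.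

Lemma hchart_diff : differentiable (hchart t c) (q, y).
Proof. by case: (hchart_C2 t c) => h _; apply: h; exact: cimg_coord. Qed.

Lemma pull_linear : linear (pull c x : 'rV[R]_D -> 'rV[R]_n).
Proof. by move=> s u v; apply/rowP => i; rewrite !mxE pairingDl pairingZl. Qed.

Lemma covec_diff : differentiable (fun p' => tamed_ham t (covec x p')) p.
Proof. exact: (JCk_fib x (findim_rV D) (JCk_at t (HCk_JCk F tamed_ham_C2))).1. Qed.

Lemma tamed_derive_fibre v : 'D_v (tamed H a t x) p = 'D_(pull c x v) (fun y => hchart t c (q, y)) y.
Proof.
have lN : linear (fun p : 'rV[R]_D => p - Q x p).
  by move=> s u w; rewrite QD QZ scalerBr opprD addrACA.
have dN : differentiable (len \o (fun p : 'rV[R]_D => p - Q x p)) p.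
  exact: (JCk_fib x (findim_rV D) (JCk_normal (len_Ck 2))).1.
have E : tamed H a t x = (fun p => tamed_ham t (covec x p)) + (a *: ((len \o (fun p : 'rV[R]_D => p - Q x p)) - cst 1)).
  by apply/funext => p'; rewrite tamedE.
have dNc : derivable ((len \o (fun p : 'rV[R]_D => p - Q x p)) - cst 1) p v.
  by apply: derivableB; [exact: diff_derivable|exact: derivable_cst].
rewrite E deriveD; [|apply: diff_derivable; exact: covec_diff|exact: derivableZ].
rewrite deriveZ// deriveB; [|exact: diff_derivable|exact: derivable_cst].
rewrite derive_cst subr0 (derive_linear_comp _ _ _ lN) Qp subrr derive_len0 scaler0 addr0.
rewrite -(derive_linear_comp _ _ _ pull_linear).
by congr ('D_v _ p); apply/funext => p'; rewrite /= /hchart -covec_coparam.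
Qed.

Let dy (i : 'I_n) := 'D_(delta_mx 0 i) (fun y => hchart t c (q, y)) y.

Lemma fibre_derive (v : 'rV[R]_n) : 'D_v (fun y => hchart t c (q, y)) y = \sum_i v 0 i * dy i.
Proof.
apply: derive_rV; have h : differentiable (fun y : 'rV[R]_n => (q, y)) y.
  by apply: differentiable_pair; [exact: differentiable_cst|exact: rV_id_diff].
exact: (differentiable_comp h hchart_diff).
Qed.

(** As y_k = p.(d_k e), the p_j-derivative is the sum over k of (d_k e_j) dH/dy_k, and contraction
    with w_j is undone by [fld_dual]. *)
Lemma Vf_hamilton i : Vf (tamed H a) c (t, (x, p)) 0 i = dy i.
Proof.
rewrite VfE /=.
transitivity (\sum_j \sum_k dE F c x (delta_mx 0 k) 0 j * dy k * fld F c x j 0 i).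
  apply: eq_bigr => j _; rewrite mxE tamed_derive_fibre fibre_derive mulr_suml.
  by apply: eq_bigr => k _; rewrite mxE pairingC pairing_delta.
rewrite exchange_big /=.
transitivity (\sum_k dy k * (delta_mx 0 k : 'rV[R]_n) 0 i).
  apply: eq_bigr => k _.
  have E : (delta_mx 0 k : 'rV[R]_n) 0 i = \sum_j dE F c x (delta_mx 0 k) 0 j * fld F c x j 0 i.
    have := congr1 (fun v : 'rV[R]_n => v 0 i) (fld_dual F (delta_mx 0 k) cx).
    by rewrite /= summxE => <-; apply: eq_bigr => j _; rewrite !mxE.
  by rewrite E mulr_sumr; apply: eq_bigr => j _; ring.
exact: (sum_mul_delta dy).
Qed.

(** The fibre coordinates of [covec] for a fixed p and a varying base point: fixing p is not the
    same as fixing y. *)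
Definition ploc (q' : 'rV[R]_n) : 'rV[R]_n := \row_i \sum_j p 0 j * dbase c i j q'.

Lemma ploc_C2 i : Ck 2 (cimg c) (fun q' => ploc q' 0 i).
Proof.
have h : Ck 2 (cimg c) (fun q' => \sum_j p 0 j * dbase c i j q').
  apply: Ck_sum => [|j]; first exact: cimg_open.
  by apply: CkZ; [exact: cimg_open|exact: dbase_C2].
by apply: (Ck_eq (@cimg_open _ _ M c) _ h) => q' _; rewrite mxE.
Qed.

Lemma pull_ploc q' : cimg c q' -> pull c (param c q') p = ploc q'.
Proof.
move=> cq; apply/rowP => i; rewrite !mxE; apply: eq_bigr => j _.
by rewrite dE_dbase paramK.
Qed.

(** Since Q x p = p, the length is taken at 0, which is its critical point; the confining term
    exerts no force on the limit orbit. *)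
Lemma normal_diff : differentiable ((fun x' => len (p - Q x' p)) \o param c) q /\
  forall v, 'D_v ((fun x' => len (p - Q x' p)) \o param c) q = 0.
Proof.
pose N (q' : 'rV[R]_n) : 'rV[R]_D := p - Q (param c q') p.
have hN : vCk 2 (cimg c) N.
  apply: vCk_rV => [|j]; first exact: cimg_open.
  have h : Ck 2 (cimg c) (fun q' => p 0 j - \sum_i p 0 i * Qm i j (param c q')).
    apply: CkB; [exact: cimg_open|exact: (Ck_cst 2 _ (p 0 j))|].
    apply: Ck_sum => [|i]; first exact: cimg_open.
    by apply: CkZ; [exact: cimg_open|exact: (@Qm_C2 _ _ _ F i j c)].
  apply: (Ck_eq (@cimg_open _ _ M c) _ h) => q' _; rewrite -QE /N [RHS]mxE; congr (_ + _).
  by rewrite [RHS]mxE.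
have dN : differentiable N q by exact: (vCk_diff (findim_rV D) hN (cimg_coord cx)).
have dl : differentiable (@len R D) (N q) by exact: len_diff.
have N0 : N q = 0 by rewrite /N coordK// Qp subrr.
split; first exact: (differentiable_comp dN dl).
by move=> v; rewrite (derive_comp v dN dl) N0 derive_len0.
Qed.

Lemma tamed_derive_base v : 'D_v ((fun x' => tamed H a t x' p) \o param c) q =
  'D_v (fun q' => hchart t c (q', y)) q + \sum_i 'D_v (fun q' => ploc q' 0 i) q * dy i.
Proof.
have [dN DN] := normal_diff.
have cq : cimg c q by exact: cimg_coord.
have dP : differentiable ploc q.
  by apply: (vCk_diff (findim_rV n) (vCk_rV (@cimg_open _ _ M c) ploc_C2) cq).
have Ep : ploc q = y by rewrite /y -pull_ploc// coordK.
have dPhi : differentiable (fun q' : 'rV[R]_n => (q', ploc q')) q.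
  by apply: differentiable_pair => //; exact: rV_id_diff.
have dh : differentiable (hchart t c) ((fun q' : 'rV[R]_n => (q', ploc q')) q) by rewrite /= Ep; exact: hchart_diff.
pose A : 'rV[R]_n -> R := hchart t c \o (fun q' : 'rV[R]_n => (q', ploc q')).
pose B : 'rV[R]_n -> R := (fun x' => len (p - Q x' p)) \o param c.
have dA : differentiable A q by exact: differentiable_comp.
rewrite (near_eq_derive (g := A + a *: (B - cst 1))); last first.
  apply: (near_in_open (@cimg_open _ _ M c) cq) => q' cq'.
  rewrite /= tamedE -[in RHS]/(A q' + a * (B q' - 1)); congr (_ + _).
  by rewrite /A /= /hchart -pull_ploc// (covec_coparam p (cdom_param cq')) paramK.
have dBc : derivable (B - cst 1) q v.
  by apply: derivableB; [exact: diff_derivable|exact: derivable_cst].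
rewrite deriveD; [|exact: diff_derivable|exact: derivableZ].
rewrite deriveZ// deriveB; [|exact: diff_derivable|exact: derivable_cst].
rewrite derive_cst subr0 /B DN scaler0 addr0 /A (derive_comp v dPhi dh).
have -> : 'D_v (fun q' : 'rV[R]_n => (q', ploc q')) q = (v, 'D_v ploc q).
  have hid := rV_id_diff q.
  rewrite deriveE// diff_pair//; congr pair; first by rewrite -deriveE ?derive_id//; exact: rV_id_diff.
  by rewrite deriveE.
rewrite /= Ep derive_pair; last exact: hchart_diff.
congr (_ + _); rewrite fibre_derive; apply: eq_bigr => i _; congr (_ * _).
by rewrite -(derive_coord v (clinear_coord i) dP).
Qed.

(** The base derivative at fixed p contains the second derivatives of [e] through [ploc]. They
    cancel against [Psi2] by the symmetry of second derivatives, since [Vf] is dH/dy. *)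
Lemma Psi_hamilton i : Psi1 (tamed H a) c i (t, (x, p)) + Psi2 (tamed H a) c i (t, (x, p)) =
  - 'D_(delta_mx 0 i) (fun q' => hchart t c (q', y)) q.
Proof.
have cq : cimg c q by exact: cimg_coord.
have dt : differentiable ((fun x' => tamed H a t x' p) \o param c) q.
  have h := JCk_slice p (findim_rV D) (tamed_C2 F a HC2 t).
  exact: ((h c).1 _ cq).
rewrite /Psi1 /= gradP// tamed_derive_base.
suff -> : Psi2 (tamed H a) c i (t, (x, p)) = \sum_l 'D_(delta_mx 0 i) (fun q' => ploc q' 0 l) q * dy l.
  by move: (\sum_(l < _) _) => S; ring.
rewrite /Psi2 /=.
transitivity (\sum_l \sum_j p 0 j * (dy l * 'D_(delta_mx 0 i) (dbase c l j) q)).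
  rewrite exchange_big /=; apply: eq_bigr => j _; rewrite mulr_sumr; apply: eq_bigr => l _.
  have h3 : Ck 2 (cimg c) (ecoord (F := F) j \o param c) by exact: CkW (emb_C3 F j c).
  have E2 : 'D_(delta_mx 0 l) (dbase c i j) (coord c x) = 'D_(delta_mx 0 i) (dbase c l j) q.
    exact: (Schwarz _ _ (@cimg_open _ _ M c) h3 cq).
  by rewrite E2 (Vf_hamilton l).
apply: eq_bigr => l _; rewrite mulrC.
have dd j : differentiable (dbase c l j) q by exact: (dbase_C2 c l j).1.
have -> : 'D_(delta_mx 0 i) (fun q' => ploc q' 0 l) q = \sum_j p 0 j * 'D_(delta_mx 0 i) (dbase c l j) q.
  rewrite (_ : (fun q' => ploc q' 0 l) = \sum_j (p 0 j *: dbase c l j)); last first.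
    by apply/funext => q'; rewrite mxE fct_sumE.
  rewrite derive_sum; last by move=> j; apply: derivableZ; exact: diff_derivable.
  by apply: eq_bigr => j _; rewrite deriveZ//; exact: diff_derivable.
by rewrite mulr_sumr; apply: eq_bigr => j _; rewrite mulrCA.
Qed.

End HamiltonEquations.

Lemma is_derive_near (R : realType) (f g : R -> R) (t d : R) : (\forall s \near t, g s = f s) ->
  is_derive t (1 : R) g d -> is_derive t (1 : R) f d.
Proof.
move=> gf h; have dg : differentiable g t by apply/derivable1_diffP; exact: ex_derive.
apply: DeriveDef; first by apply/derivable1_diffP; exact: differentiable_near gf dg.
by rewrite -(near_eq_derive _ gf) derive_val.
Qed.

(** * Periodic orbits *)

Section SmoothODE.
Context {R : realType} {n : nat}.
Local Notation V := ('rV[R]_n * 'rV[R]_n)%type.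

Lemma Ck_primitive (O : set R) (f g : R -> R) k : open O -> (forall t, O t -> is_derive t (1 : R) f (g t)) ->
  Ck k O g -> Ck k.+1 O f.
Proof.
move=> oO fg hg.
have df t : O t -> differentiable f t.
  by move=> Ot; apply/derivable1_diffP; have h := fg t Ot; exact: ex_derive.
split=> // v; apply: (Ck_eq oO (f := fun t => v * g t)); last exact: CkZ.
move=> t Ot; rewrite derive_dirR; last exact: df.
by have h := fg t Ot; rewrite (@derive_val _ _ _ _ _ _ _ h).
Qed.

(** Bootstrap: a C^j curve makes the right-hand side C^j along the curve, hence the curve is
    C^(j+1). *)
Lemma ode_vCk (O : set R) (U : set (R * V)) (w : R -> V) (X1 X2 : 'I_n -> R * V -> R) k :
  open O -> open U -> (forall t, O t -> U (t, w t)) -> (forall i, Ck k U (X1 i)) -> (forall i, Ck k U (X2 i)) ->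
  (forall t i, O t -> is_derive t (1 : R) (fun s => (w s).1 0 i) (X1 i (t, w t))) ->
  (forall t i, O t -> is_derive t (1 : R) (fun s => (w s).2 0 i) (X2 i (t, w t))) ->
  vCk k.+1 O w.
Proof.
move=> oO oU wU c1 c2 d1 d2.
have pk j : (forall i, Ck j O (fun s => (w s).1 0 i)) -> (forall i, Ck j O (fun s => (w s).2 0 i)) -> vCk j O w.
  move=> h1 h2; have hp := vCk_pair oO (vCk_rV (f := fun s => (w s).1) oO h1) (vCk_rV (f := fun s => (w s).2) oO h2).
  have -> : w = fun s => ((w s).1, (w s).2) by apply/funext => s; case: (w s).
  exact: hp.
suff h j : (j <= k.+1)%N -> (forall i, Ck j O (fun s => (w s).1 0 i)) /\ (forall i, Ck j O (fun s => (w s).2 0 i)).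
  by have [h1 h2] := h k.+1 (leqnn _); exact: pk.
elim: j => [_|j IH jk].
  split=> i t Ot; apply: differentiable_continuous; apply/derivable1_diffP.
    by have h := d1 t i Ot; exact: ex_derive.
  by have h := d2 t i Ot; exact: ex_derive.
have [h1 h2] := IH (ltnW jk); have hw := pk _ h1 h2.
have f2 : findim (R * V)%type by exact: findim_pair findim_R (findim_pair (findim_rV n) (findim_rV n)).
have hp : vCk j O (fun s => (s, w s)) := vCk_pair oO (@vCk_id _ _ j O) hw.
split=> i.
  have hc := Ck_comp f2 oO oU wU hp (Ck_le (jk : (j <= k)%N) (c1 i)).
  exact: (Ck_primitive oO (fun t Ot => d1 t i Ot) hc).
have hc := Ck_comp f2 oO oU wU hp (Ck_le (jk : (j <= k)%N) (c2 i)).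
exact: (Ck_primitive oO (fun t Ot => d2 t i Ot) hc).
Qed.

Lemma derive_pair_coords (f : V -> R) w v : differentiable f w ->
  'D_v f w = \sum_i v.1 0 i * 'D_(delta_mx 0 i, 0) f w + \sum_i v.2 0 i * 'D_(0, delta_mx 0 i) f w.
Proof.
case: w v => q y [v1 v2] df /=; rewrite derive_pair//.
have e1 : differentiable (fun q' : 'rV[R]_n => (q', y)) q.
  by apply: differentiable_pair; [exact: rV_id_diff|exact: differentiable_cst].
have e2 : differentiable (fun y' : 'rV[R]_n => (q, y')) y.
  by apply: differentiable_pair; [exact: differentiable_cst|exact: rV_id_diff].
have d1 : differentiable (fun q => f (q, y)) q := differentiable_comp e1 df.
have d2 : differentiable (fun y => f (q, y)) y := differentiable_comp e2 df.
rewrite !derive_rV//; congr (_ + _); apply: eq_bigr => i _; first by rewrite derive_pair1.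
by rewrite derive_pair2.
Qed.

End SmoothODE.

(** * Conservation of the height and return to the original Hamiltonian *)

Section Orbit.
Context {R : realType} {n : nat} {M : smoothManifold R n} (F : frame M).
Notation D := (fdim F).
Local Notation V := ('rV[R]_n * 'rV[R]_n)%type.
Variables (x : R -> M) (p : R -> 'rV[R]_D).
Hypotheses (xc : continuous x) (pc : continuous p).

Definition chart_curve (c : chart M) (t : R) : V := (coord c (x t), pull c (x t) (p t)).

Definition solves (f : R -> cotangent M -> R) := forall (t : R) (c : chart M) (i : 'I_n), cdom c (x t) ->
  is_derive t (1 : R) (fun s => coord c (x s) 0 i)
    ('D_((0 : 'rV[R]_n), (delta_mx 0 i : 'rV[R]_n)) (fun w => f t (coparam c w)) (chart_curve c t)) /\
  is_derive t (1 : R) (fun s => pull c (x s) (p s) 0 i)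
    (- 'D_((delta_mx 0 i : 'rV[R]_n), (0 : 'rV[R]_n)) (fun w => f t (coparam c w)) (chart_curve c t)).

Lemma time_open (c : chart M) : open [set t | cdom c (x t)].
Proof. by apply: (@open_comp _ _ x (cdom c)); [move=> t _; exact: xc|exact: cdom_open]. Qed.

Lemma curve_cimg c t : cdom c (x t) -> cimg c (chart_curve c t).1.
Proof. exact: cimg_coord. Qed.

Lemma solves_vCk f c k : HCk k.+1 f -> solves f -> vCk k.+1 [set t | cdom c (x t)] (chart_curve c).
Proof.
move=> hf sf; pose U : set (R * V) := [set s | cimg c s.2.1].
pose hh (s : R * V) := f s.1 (coparam c s.2).
pose X1 (i : 'I_n) := 'D_((0 : R), ((0 : 'rV[R]_n), (delta_mx 0 i : 'rV[R]_n))) hh.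
pose X2 (i : 'I_n) := fun s => - 'D_((0 : R), ((delta_mx 0 i : 'rV[R]_n), (0 : 'rV[R]_n))) hh s.
have oU : open U by exact: hdom_open.
apply: (@ode_vCk _ _ _ U (chart_curve c) X1 X2) => //.
- exact: time_open.
- by move=> t ct; exact: curve_cimg.
- by move=> i; exact: (hf c).2.
- by move=> i; apply: CkN => //; exact: (hf c).2.
- by move=> t i ct; rewrite /X1 derive_pair2; exact: (sf t c i ct).1.
- by move=> t i ct; rewrite /X2 derive_pair2; exact: (sf t c i ct).2.
Qed.

Lemma curve_derive f c t : HCk 1 f -> solves f -> cdom c (x t) ->
  differentiable (chart_curve c) t /\ 'D_1 (chart_curve c) t =
  (\row_i 'D_((0 : 'rV[R]_n), (delta_mx 0 i : 'rV[R]_n)) (fun w => f t (coparam c w)) (chart_curve c t),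
   \row_i - 'D_((delta_mx 0 i : 'rV[R]_n), (0 : 'rV[R]_n)) (fun w => f t (coparam c w)) (chart_curve c t)).
Proof.
move=> hf sf ct.
have f2 : findim V by exact: findim_pair (findim_rV n) (findim_rV n).
have dw : differentiable (chart_curve c) t := vCk_diff f2 (@solves_vCk f c 0 hf sf) ct.
have cl1 (i : 'I_n) : clinear (fun w : V => w.1 0 i).
  exact: (clinear_comp (L := fst) (fun _ _ _ => erefl) (@differentiable_fst _ _ _) (clinear_coord i)).
have cl2 (i : 'I_n) : clinear (fun w : V => w.2 0 i).
  exact: (clinear_comp (L := snd) (fun _ _ _ => erefl) (@differentiable_snd _ _ _) (clinear_coord i)).
split=> //; rewrite [LHS]surjective_pairing; congr pair; apply/rowP => i; rewrite [RHS]mxE.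
  have := derive_coord (1 : R) (cl1 i) dw => /= <-.
  by have [h _] := sf t c i ct; exact: (@derive_val _ _ _ _ _ _ _ h).
have := derive_coord (1 : R) (cl2 i) dw => /= <-.
by have [_ h] := sf t c i ct; exact: (@derive_val _ _ _ _ _ _ _ h).
Qed.

Lemma curve_covec c t : cdom c (x t) -> covec (x t) (p t) = coparam c (chart_curve c t).
Proof. exact: covec_coparam. Qed.

Lemma fibre_C2 (phi : 'rV[R]_D -> R) c : Ck 2 setT phi ->
  Ck 2 [set w : V | cimg c w.1] (fun w => phi (frame_comp F (coparam c w))).
Proof.
move=> hphi.
have h : Ck 2 [set w : V | cimg c w.1] (phi \o frame_loc F c).
  apply: (Ck_comp (findim_rV D) (@wdom_open _ _ _ c) openT (fun _ _ => I) _ hphi).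
  by apply: vCk_rV; [exact: wdom_open|move=> j; exact: frame_loc_C2].
by apply: (Ck_eq (@wdom_open _ _ _ c) _ h) => w cw; rewrite frame_comp_coparam.
Qed.

Lemma derive_gcut_height c (w v : V) : cimg c w.1 ->
  'D_v (fun w => gcut (frame_comp F (coparam c w))) w =
  dgcut (frame_comp F (coparam c w)) * 'D_v (fun w => height F (coparam c w)) w.
Proof.
move=> cw; have o := @wdom_open _ _ _ c.
have dl : differentiable (frame_loc F c) w.
  apply: (vCk_diff (findim_rV D) (k := 1) (vCk_rV o (@frame_loc_C2 _ _ _ F c)) cw).
have E (phi : 'rV[R]_D -> R) : 'D_v (fun w => phi (frame_comp F (coparam c w))) w = 'D_v (phi \o frame_loc F c) w.
  by apply: near_eq_derive; apply: (near_in_open o) => // w' cw'; rewrite /= frame_comp_coparam.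
rewrite (E gcut) /height (E len) (derive_comp v dl); last exact: gcut_Ck.1.
rewrite (derive_comp v dl); last exact: len_diff.
by rewrite derive_gcut frame_comp_coparam.
Qed.

Variables (H : R -> cotangent M -> R) (a tau : R).
Hypothesis HC : forall k, HCk k H.
Hypothesis tau2 : tau < 2.
Hypothesis Hout : forall t z, tau < height F z -> H t z = 0.
Hypothesis sol : solves (tamed_ham F H a).
Hypothesis low : exists t, height F (covec (x t) (p t)) <= tau.

Lemma height_near c (w : V) (A : set R) : cimg c w.1 -> open A -> A (height F (coparam c w)) ->
  \forall w' \near w, A (height F (coparam c w')).
Proof.
move=> cw oA Aw; have h := Ck_cont (fibre_C2 c (len_Ck 2)) cw.
by apply: h; apply: open_nbhs_nbhs.
Qed.

(* The height Poisson-commutes with functions of the height, and [tamed_ham] is one wherever the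
   height exceeds [tau]; the square of the positive part avoids any discussion of exit times. *)
Lemma energy_derive t : is_derive t (1 : R) (fun s => posp (height F (covec (x s) (p s)) - tau) ^+ 2) 0.
Proof.
have [c ct] : exists c, cdom c (x t) by exact: cdom_cover.
have cw := curve_cimg ct.
pose T (w : V) := height F (coparam c w).
have tamed1 : HCk 1 (tamed_ham F H a) by move=> c'; apply: CkW; exact: (tamed_ham_C2 F a (HC 2) c').
have [dw Dw] := curve_derive tamed1 sol ct.
have dT : differentiable T (chart_curve c t) by exact: (fibre_C2 c (len_Ck 2)).1.
have dTw : is_derive t (1 : R) (T \o chart_curve c) ('D_('D_1 (chart_curve c) t) T (chart_curve c t)).
  rewrite -derive_comp//; apply: DeriveDef => //.
  by apply/derivable1_diffP; exact: differentiable_comp.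
have near_t : \forall s \near t, height F (covec (x s) (p s)) = (T \o chart_curve c) s.
  by apply: (near_in_open (@time_open c) ct) => s cs; rewrite /T /= -curve_covec.
have hh : is_derive t (1 : R) (fun s => height F (covec (x s) (p s)) - tau) ('D_('D_1 (chart_curve c) t) T (chart_curve c t)).
  have h1 : is_derive t (1 : R) (fun s => height F (covec (x s) (p s))) ('D_('D_1 (chart_curve c) t) T (chart_curve c t)).
    by apply: is_derive_near dTw; move: near_t; apply: filterS => s ->.
  by apply: (is_derive_eq (is_deriveB h1 (is_derive_cst tau t 1))); rewrite subr0.
have hp := pospX_diff 0 (height F (covec (x t) (p t)) - tau).
have h3 := @is_derive1_comp _ (fun s => posp s ^+ 2) (fun s => height F (covec (x s) (p s)) - tau) t _ _ hp hh.
apply: (is_derive_eq h3); rewrite expr1.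
case: (leP (height F (covec (x t) (p t))) tau) => ht.
  by rewrite posp_eq0 ?subr_le0// mulr0 mul0r.
suff -> : 'D_('D_1 (chart_curve c) t) T (chart_curve c t) = 0 by rewrite mulr0.
have ht' : tau < T (chart_curve c t) by rewrite /T -curve_covec.
pose g := a * dgcut (frame_comp F (coparam c (chart_curve c t))).
have Dv v : 'D_v (fun w => tamed_ham F H a t (coparam c w)) (chart_curve c t) = g * 'D_v T (chart_curve c t).
  rewrite /g -mulrA -derive_gcut_height//.
  rewrite (near_eq_derive (g := a *: (fun w => gcut (frame_comp F (coparam c w))))).
    by rewrite deriveZ//; apply: diff_derivable; exact: (fibre_C2 c gcut_Ck).1.
  have := height_near cw (@open_gt _ tau) ht'; apply: filterS => w hw.
  by rewrite /tamed_ham (Hout _ hw) add0r.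
(* The bracket of the height with a function of which all derivatives are [g] times those of the
   height: the terms cancel for each i. *)
rewrite derive_pair_coords// Dw /= -big_split /=; apply: big1 => i _.
by rewrite mxE [X in _ + X * _]mxE !Dv mulNr [X in X - _]mulrAC subrr.
Qed.

Lemma height_low t : height F (covec (x t) (p t)) <= tau.
Proof.
have [t0 ht0] := low.
have E := @is_derive_0_is_cst R _ t t0 energy_derive.
rewrite leNgt; apply/negP => ht; move: E.
rewrite [in RHS]posp_eq0 ?subr_le0// expr0n /= => /eqP; rewrite expf_eq0 /= posp_id ?subr_ge0 ?(ltW ht)//.
by rewrite subr_eq0 gt_eqF.
Qed.

(** The orbit stays at heights at most [tau] < 2, and near such points [gcut] vanishes
    identically. *)
Lemma solves_original : solves H.
Proof.
move=> t c i ct; have cw := curve_cimg ct.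
have Dv v : 'D_v (fun w => tamed_ham F H a t (coparam c w)) (chart_curve c t) =
    'D_v (fun w => H t (coparam c w)) (chart_curve c t).
  apply: near_eq_derive; have h2 : height F (coparam c (chart_curve c t)) < 2.
    by rewrite -curve_covec//; exact: le_lt_trans (height_low t) tau2.
  have := height_near cw (@open_lt _ 2) h2; apply: filterS => w hw.
  by rewrite /tamed_ham gcut_eq0 ?mulr0 ?addr0//; exact: ltW.
by rewrite -!Dv; exact: sol.
Qed.

Lemma orbit_cocoord c t : cdom c (x t) -> cocoord c (covec (x t) (p t)) = chart_curve c t.
Proof. by move=> ct; rewrite /cocoord /= covec_compE. Qed.

(** The bootstrap is run with [H], which is smooth, and not with the modified Hamiltonian, which is
    only known to be C^2. *)
Lemma orbit_smooth : (forall t, x (t + 1) = x t /\ p (t + 1) = p t) -> smooth_loop (fun t => covec (x t) (p t)).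
Proof.
move=> per; split.
- move=> t; apply: (@covec_cvg _ _ _ F _ (nbhs t) (nbhs_filter t) x p) ; [exact: xc|exact: pc].
- by move=> t; have [-> ->] := per t.
move=> c; have oO := @time_open c.
apply: Ck_smooth_on; [exact: oO|exact: findim_pair (findim_rV n) (findim_rV n)|].
move=> k l cl; apply: CkW; have h := @solves_vCk H c k (HC k.+1) solves_original l cl.
by apply: (Ck_eq oO _ h) => t ct; rewrite /= orbit_cocoord.
Qed.

Lemma orbit_hamiltonian t c : cdom c (x t) ->
  is_hamiltonian_vector (H t) c (covec (x t) (p t)) ('D_1 (fun s => cocoord c (covec (x s) (p s))) t).
Proof.
move=> ct v; have oO := @time_open c.
have -> : 'D_1 (fun s => cocoord c (covec (x s) (p s))) t = 'D_1 (chart_curve c) t.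
  by apply: near_eq_derive; apply: (near_in_open oO ct) => s cs; exact: orbit_cocoord.
have [dw Dw] := curve_derive (HC 1) solves_original ct.
set X := 'D_(1 : R) _ _ in Dw *; rewrite orbit_cocoord//.
have dl (u w u' : V) : 'D_u (fun q : V => pairing q.2 u'.1) w = pairing u.2 u'.1.
  have cl : clinear (fun y : 'rV[R]_n => pairing y u'.1).
    split=> [r u1 u2|v0]; first by rewrite pairingDl pairingZl.
    have h : Ck 1 setT (fun y : 'rV[R]_n => pairing y u'.1).
      apply: Ck_sum => [|i]; first exact: openT.
      by apply: CkM; [exact: openT|apply: Ck_lin; exact: clinear_coord|exact: (Ck_cst 1 _ (u'.1 0 i))].
    exact: h.1.
  have cl2 := clinear_comp (L := @snd 'rV[R]_n 'rV[R]_n) (fun _ _ _ => erefl) (@differentiable_snd _ _ _) cl.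
  exact: (derive_clinear w u cl2).
rewrite /Omega_can /exterior_derivative /liouville_form !dl.
have dh : differentiable (H t \o coparam c) (chart_curve c t).
  have hp : differentiable (fun w : V => (t, w)) (chart_curve c t).
    by apply: differentiable_pair; [exact: differentiable_cst|exact: (vCk_diff (findim_pair (findim_rV n) (findim_rV n)) (@vCk_id _ _ 1 setT) I)].
  have hH := (HC 1 c).1 (t, chart_curve c t) (curve_cimg ct).
  exact: (differentiable_comp hp hH).
rewrite derive_pair_coords// Dw opprB /pairing /= addrC; congr (_ + _).
  by apply: eq_bigr => i _; rewrite mxE.
by rewrite -sumrN; apply: eq_bigr => i _; rewrite mxE mulNr opprK mulrC.
Qed.

End Orbit.

(** * Assembly of the periodic orbit *)

Section Existence.
Context {R : realType} {n : nat} {M : smoothManifold R n} (F : frame M).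
Hypothesis cM : compact [set: M].
Notation D := (fdim F).
Notation e := (emb F).

Lemma tamed_solves (H : R -> cotangent M -> R) (a : R) (x : R -> M) (p : R -> 'rV[R]_D) :
  HCk 2 H -> (forall t, Q (x t) (p t) = p t) ->
  (forall t c i, cdom c (x t) -> is_derive t (1 : R) (fun s => coord c (x s) 0 i) (Vf (tamed H a) c (t, (x t, p t)) 0 i)) ->
  (forall t c i, cdom c (x t) -> is_derive t (1 : R) (fun s => pairing (p s) (dE F c (x s) (delta_mx 0 i)))
     (Psi1 (tamed H a) c i (t, (x t, p t)) + Psi2 (tamed H a) c i (t, (x t, p t)))) ->
  solves x p (tamed_ham F H a).
Proof.
move=> HC2 Qp dq dy t c i ct; split.
  apply: (is_derive_eq (dq t c i ct)).
  by rewrite (Vf_hamilton a HC2 t ct (Qp t) i) derive_pair2.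
have E : (fun s => pull c (x s) (p s) 0 i) = (fun s => pairing (p s) (dE F c (x s) (delta_mx 0 i))).
  by apply/funext => s; rewrite mxE.
rewrite E; apply: (is_derive_eq (dy t c i ct)).
by rewrite (Psi_hamilton a HC2 t ct (Qp t) i) derive_pair1.
Qed.

(** The homotopy multiplies the momentum by s in [0, 1], which does not increase the height. *)
Lemma covec_homotopic (x : R -> M) (p : R -> 'rV[R]_D) : continuous x -> continuous p ->
  (forall t, x (t + 1) = x t /\ p (t + 1) = p t) -> (forall t, height F (covec (x t) (p t)) < 2) ->
  free_homotopic (disc_bundle F) (@zero_section R n M \o x) (fun t => covec (x t) (p t)).
Proof.
move=> xc pc per low; exists (fun z : R * R => covec (x z.2) (z.1 *: p z.2)); split.
- apply: continuous_subspaceT => z.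
  have h2 : snd z' @[z' --> z] --> z.2 by exact: cvg_snd.
  have hx : x z'.2 @[z' --> z] --> x z.2 := cvg_comp _ _ h2 (xc z.2).
  have hp : p z'.2 @[z' --> z] --> p z.2 := cvg_comp _ _ h2 (pc z.2).
  apply: (@covec_cvg _ _ _ F _ (nbhs z) (nbhs_filter z) (fun z => x z.2) (fun z => z.1 *: p z.2)) => //.
  by apply: cvgZ => //; exact: cvg_fst.
- by move=> s t _ /=; have [-> ->] := per t.
- move=> s t s01; rewrite /disc_bundle /= height_covec QZ; apply: le_lt_trans (low t).
  by rewrite height_covec; apply: len_shrink; move: s01; rewrite in_itv.
- by move=> t /=; rewrite scale0r covec0.
- by move=> t /=; rewrite scale1r.
Qed.

Lemma periodic_orbit_exists (g0 : R -> M) : loop_in setT g0 -> exists2 c0 : R, 0 < c0 &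
  forall H, compactly_supported_hamiltonian (disc_bundle F) H -> (forall t x, H t (zero_section x) <= - c0) ->
  exists x (p : R -> 'rV[R]_D), free_homotopic setT g0 x /\
    periodic_orbits (disc_bundle F) H [set z | free_homotopic (disc_bundle F) (@zero_section R n M \o x) z]
      (fun t => covec (x t) (p t)).
Proof.
move=> lg; pose x0 := g0 0.
have [l [l0 hl]] := lipschitz_polygons F cM x0 lg.
pose a : R := D%:R * l + 1; have a0 : 0 < a by rewrite ltr_pwDr// mulr_ge0// ltW.
(* After the loss of 2 in [discrete_orbits] this leaves 7a + 1, the threshold of [tamed_small]. It
   is fixed before H is introduced. *)
exists (7 * a + 3); first by rewrite addr_gt0// mulr_gt0.
move=> H cH Hz; have [tau [tau1 tau2 Hout]] := support_margin cH.
have HC k : HCk k H := HCk_supported k cH tau2 Hout.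
have [Hper _ _] := cH.
have HC2 := HC 2.
have [Lp Lp0 hLp] := tamed_lip cM Hper HC2 tau2 Hout a0.
have [Lx Lx0 hLx] := tamed_lipx cM Hper HC2 tau2 Hout a0.
have [b hb] := tamed_growth cM Hper HC2 tau2 Hout a0.
have [B hB] := tamed_legendre_bound cM Hper HC2 tau2 Hout a0.
pose S x p := @len R D (Q x p) <= tau.
have hS t x p : 7 * a + 3 - 2 <= pairing p (dgrad (tamed H a t x) p) - tamed H a t x p -> S x p.
  move=> h; apply: (tamed_small HC2 Hout a0 (t := t)); apply: le_trans h.
  by rewrite -addrA lerD2l; lra.
have hK0 t x : tamed (F := F) H a t x 0 <= - (7 * a + 3) by rewrite tamed_zero.
have KC2 t := tamed_C2 F a HC2 t.
have [d d0 [hom1 hom2]] := polygon_homotopic F cM x0.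
have [N0 hN0] := discrete_orbits cM (tamed_per F a Hper) KC2 Lp0 l0 hLp hK0 hb hB hS hl d0 hom1.
have SQ x p : S x p -> `|Q x p| <= 2.
  by move=> h; apply: le_trans (norm_le_len _) (le_trans h (ltW tau2)).
have [C C0 [N1 hN1]] := orbit_estimates cM KC2 Lp0 Lx0 a0 hLp hLx (tamed_normal HC2 a0) SQ.
pose good N (XP : (int -> M) * (int -> 'rV[R]_D)) : Prop :=
  [/\ (forall k, XP.1 (k + N%:Z) = XP.1 k) /\ (forall k, XP.2 (k + N%:Z) = XP.2 k),
      forall k, `|e (XP.1 (k + 1)) - e (XP.1 k) - N%:R^-1 *: dgrad (tamed H a (k%:~R / N%:R) (XP.1 k)) (XP.2 k)| <= N%:R^-1 ^+ 2,
      forall k, `|Q (XP.1 k) (XP.2 (k - 1) - XP.2 k - N%:R^-1 *: grad F (fun x => tamed H a (k%:~R / N%:R) x (XP.2 k)) (XP.1 k))| <= N%:R^-1 ^+ 2,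
      exists k, S (XP.1 k) (XP.2 k) &
      (forall k, `|e (XP.1 (k + 1)) - e (XP.1 k)| <= d) /\ free_homotopic setT g0 (polygon F x0 N XP.1)].
(* For N below N0 constant sequences serve as default values; the ultrafilter ignores these N. *)
have /choice[XP hXP] : forall N, exists XP, (N0 <= N)%N -> good N XP.
  move=> N; case: (leqP N0 N) => hN; last by exists (fun=> x0, fun=> 0).
  by have [X [P h]] := hN0 N hN; exists (X, P).
pose X N := (XP N).1; pose P N := (XP N).2.
(* Any ultrafilter finer than the filter of large integers will do. *)
have [U [uU Uoo]] := ultraFilterLemma (F := \oo).
have hU m : \forall N \near U, (m <= N)%N by apply: Uoo; exact: nbhs_infty_ge.
have pU : ProperFilter U by exact: ultra_proper.
have hper : \forall N \near U, (forall k, X N (k + N%:Z) = X N k) /\ (forall k, P N (k + N%:Z) = P N k).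
  by apply: filterS (hU N0) => N hN; have [h _ _ _ _] := hXP N hN.
have hE1 : \forall N \near U, forall k,
  `|e (X N (k + 1)) - e (X N k) - N%:R^-1 *: dgrad (tamed H a (k%:~R / N%:R) (X N k)) (P N k)| <= N%:R^-1 ^+ 2.
  by apply: filterS (hU N0) => N hN; have [_ h _ _ _] := hXP N hN.
have hE2 : \forall N \near U, forall k,
  `|Q (X N k) (P N (k - 1) - P N k - N%:R^-1 *: grad F (fun x => tamed H a (k%:~R / N%:R) x (P N k)) (X N k))| <= N%:R^-1 ^+ 2.
  by apply: filterS (hU N0) => N hN; have [_ _ h _ _] := hXP N hN.
have hest : \forall N \near U, forall k, [/\ `|e (X N (k + 1)) - e (X N k)| <= C / N%:R, `|P N k| <= C,
  `|P N (k + 1) - P N k| <= C / N%:R & `|P N k - Q (X N k) (P N k)| <= C / N%:R].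
  apply: filterS2 (hU N0) (hU N1) => N hN hN'; have [[h1 h2] h3 h4 h5 _] := hXP N hN.
  exact: (hN1 N hN' (X N) (P N) h1 h2 h3 h4 h5).
have [x [p hxp]] := limit_exists cM uU hest.
have hx t : X N (Num.floor (N%:R * t)) @[N --> U] --> x t by case: (hxp t).
have hp t : P N (Num.floor (N%:R * t)) @[N --> U] --> p t by case: (hxp t).
have [xc pc] := limit_cts cM uU hU C0 hest hx hp.
have Qp t : Q (x t) (p t) = p t := limit_normal uU hU hest hx hp t.
have per t : x (t + 1) = x t /\ p (t + 1) = p t := limit_periodic uU hper hx hp t.
have KJ := tamed_JCk F a HC2.
have sol : solves x p (tamed_ham F H a).
  apply: tamed_solves => // t c i ct; first exact: (q_derive cM uU hU C0 hest hx hp KJ hE1 ct i).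
  exact: (y_derive cM uU hU C0 hest hx hp KJ hE1 hE2 ct i).
have low : exists t, height F (covec (x t) (p t)) <= tau.
  have [t ht] : exists t, height F (covec (x t) (p t)) <= tau; last by exists t.
  apply: (limit_small cM uU hU C0 hper hest hx hp (f := fun x p => height F (covec x p))).
    move=> z; have h : covec z'.1 z'.2 @[z' --> z] --> covec z.1 z.2.
      by apply: (@covec_cvg _ _ _ F _ (nbhs z) (nbhs_filter z) fst snd); [exact: cvg_fst|exact: cvg_snd].
    exact: (cvg_comp _ _ h (@height_cts _ _ _ F _)).
  apply: filterS (hU N0) => N hN; have [_ _ _ [k hk] _] := hXP N hN.
  by exists k; rewrite height_covec.
have lowt t : height F (covec (x t) (p t)) < 2.
  exact: le_lt_trans (height_low xc HC Hout sol low t) tau2.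
exists x, p; split.
  have lx : loop_in setT x by split=> // t; case: (per t).
  (* One good N suffices for the class: its polygon lies in the class of [g0] by the minimax, and
     the limit loop is close to its vertices. *)
  have [N [hN hcl]] : exists N, (N0 <= N)%N /\ forall t, `|e (x t) - e (X N (Num.floor (N%:R * t)))| <= d.
    have h1 := hU N0; have h2 := limit_class uU hU C0 hper hest hx hp d0.
    have h : \forall N \near U, (N0 <= N)%N /\ forall t, `|e (x t) - e (X N (Num.floor (N%:R * t)))| <= d by exact: filterI.
    by have [N hN] := @filter_ex _ U pU _ h; exists N.
  have [[h1 _] _ _ _ [h2 h3]] := hXP N hN.
  by apply: free_homotopic_trans h3 _; have [] := hom2 N (X N) x h1 h2 lx hcl.
split.
- exact: (orbit_smooth xc pc HC tau2 Hout sol low per).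
- exact: lowt.
- by move=> t c ct; exact: (orbit_hamiltonian xc HC tau2 Hout sol low ct).
- exact: covec_homotopic.
Qed.

End Existence.

Lemma c_BPS_finite (R : realType) (n : nat) (M : smoothManifold R n) (W : set (cotangent M))
  (beta : set (R -> cotangent M)) (c0 : R) : 0 < c0 ->
  (forall H, compactly_supported_hamiltonian W H -> (forall t x, H t (zero_section x) <= - c0) ->
     periodic_orbits W H beta !=set0) ->
  c_BPS W beta \is a fin_num.
Proof.
move=> c00 h; rewrite /c_BPS ge0_fin_numE.
  apply: (@le_lt_trans _ _ (c0%:E)); last exact: ltry.
  apply: ereal_inf_lbound; exists c0 => //; split=> // H cH hsup; apply: h => // t x.
  rewrite -lee_fin; apply: le_trans hsup; apply: ereal_sup_ubound.
  by exists (t, x).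
by apply: le_ereal_inf_tmp => _ [c [c_gt0 _] <-]; rewrite lee_fin ltW.
Qed.

Theorem corollary4p5 (R : realType) (n : nat) (M : smoothManifold R n)
  (g : riemannianMetric M)
  (M_compact : compact [set: M]) (M_connected : connected [set: M])
  (alpha : set (R -> M))
  (alpha_class : is_free_class [set: M] alpha)
  (alpha_nontrivial : nontrivial_class [set: M] alpha) :
  symplectically_essential alpha.
Proof.
have [F] := frame_exists M_compact.
have [g0 lg ->] := alpha_class.
exists (disc_bundle F); split; first exact: disc_bundle_domain (g0 0) M_connected.
have [c0 c00 h] := periodic_orbit_exists F M_compact lg.
apply: (c_BPS_finite c00) => H cH Hz; have [x [p [hgx [h1 h2 h3 h4]]]] := h H cH Hz.
by exists (fun t => covec (x t) (p t)); split=> //; exists x.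
Qed.
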